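(* Let $F\subseteq\mathbb{C}$ be a number field and $E/F$ an elliptic curve with $\mathrm{End}_F(E)\cong\mathcal{O}$ for an order $\mathcal{O}$ in an imaginary quadratic field $K\subseteq F$, and suppose $F(E_{\mathrm{tors}})\subseteq K^{\mathrm{ab}}$. Let $\alpha\colon\mathbb{A}_K^\times\to K^\times\subseteq\mathbb{C}^\times$ be a group homomorphism such that (i) $\varphi(s) := \alpha(s)\cdot s_\infty^{-1}$ defines a Hecke character $\varphi\colon\mathbb{A}_K^\times\to\mathbb{C}^\times$, and (ii) for every lattice $\Lambda\subseteq K$, every analytic isomorphism $\xi\colon\mathbb{C}/\Lambda\to E(\mathbb{C})$ and every $s\in K^\times\cdot\mathrm{N}_{F/K}(\mathbb{A}_F^\times)$, one has $(\alpha(s)s^{-1})\cdot\Lambda=\Lambda$ and $\xi((\alpha(s)s^{-1})\cdot z) = \tau(\xi(z))$ for all $z\in K/\Lambda$, where $\tau\in\mathrm{Gal}(K^{\mathrm{ab}}/F)$ is the unique automorphism with $\tau|_{K^{\mathrm{ab}}} = [s,K]$. Then $F(E[I]) = F\cdot H_{I,\mathcal{O}}$ for every invertible ideal $I\subseteq\mathcal{O}$ with $I\subseteq\mathfrak{f}_\varphi\cap\mathcal{O}$, where $\mathfrak{f}_\varphi\subseteq\mathcal{O}_K$ is the conductor of $\varphi$.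
   Context: $[\cdot,K]\colon\mathbb{A}_K^\times\to\mathrm{Gal}(K^{\mathrm{ab}}/K)$ is the global Artin map; $s_\infty\in(K\otimes\mathbb{R})^\times=\mathbb{C}^\times$ is the infinite component; $\mathrm{N}_{F/K}$ is the idelic norm; a Hecke character is a continuous homomorphism $\mathbb{A}_K^\times\to\mathbb{C}^\times$ trivial on $K^\times$, and its conductor is $\prod_w w^{n_w}$ with $n_w$ minimal such that $\varphi$ is trivial on $1+w^{n_w}\mathcal{O}_{K_w}$ (on $\mathcal{O}_{K_w}^\times$ if $n_w=0$). A lattice is a subgroup $\Lambda\subseteq K$ free of rank $2$. For a rational prime $p$ put $\Lambda_p := \Lambda\otimes\mathbb{Z}_p\subseteq K_p := K\otimes\mathbb{Q}_p$. For an idele $t$ with $p$-components $t_p$, $t\cdot\Lambda$ is the unique lattice with $(t\cdot\Lambda)_p = t_p\Lambda_p$ for all $p$, and the map $t\cdot\colon K/\Lambda\to K/(t\cdot\Lambda)$ corresponds under $K/\Lambda\cong\bigoplus_p K_p/\Lambda_p$ to componentwise multiplication by $t_p$; here $\alpha(s)\in K^\times$ is embedded diagonally into the ideles. $E[I]\subseteq E(\mathbb{C})$ is the $I$-torsion for the normalised isomorphism $\mathcal{O}\cong\mathrm{End}(E)$ and $F(E[I])$ is generated over $F$ by its points' coordinates. $H_{I,\mathcal{O}} := (K^{\mathrm{ab}})^{[U_{I,\mathcal{O}},K]}$ with $U_{I,\mathcal{O}} := \{s\in\mathbb{A}_K^\times : s_p\in(\mathcal{O}\otimes\mathbb{Z}_p)^\times\cap(1+I(\mathcal{O}\otimes\mathbb{Z}_p))\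 \forall p\}$. *)

(* Defs.v *)
From HB Require Import structures.
From mathcomp Require Import all_boot all_order all_algebra.
From mathcomp Require Import complex ring_quotient ring.
From mathcomp Require cyclic.
From mathcomp Require Import all_classical all_reals all_analysis.
Set Implicit Arguments.
Unset Strict Implicit.
Unset Printing Implicit Defensive.
Import Order.TTheory GRing.Theory Num.Theory numFieldNormedType.Exports.
Local Open Scope classical_set_scope.
Local Open Scope ring_scope.

(* The ambient field is meant to be the field of complex numbers R[i]; number
   fields, infinite extensions, ideals and lattices are subsets of it. *)

Section NumberFields.
Context {C : numClosedFieldType}.

Definition ZZ : set C := range intr.
Definition QQ : set C := range ratr.

Record is_subfield (S : set C) : Prop := IsSubfield {
  subfield1 : S 1;
  subfieldB : forall x y, S x -> S y -> S (x - y);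
  subfieldM : forall x y, S x -> S y -> S (x * y);
  subfieldV : forall x, S x -> S x^-1 }.

Definition basis_over (k V : set C) (n : nat) (b : 'I_n -> C) : Prop :=
  (forall x, V x <->
     exists c : 'I_n -> C, (forall i, k (c i)) /\ x = \sum_i c i * b i) /\
  (forall c : 'I_n -> C, (forall i, k (c i)) ->
     \sum_i c i * b i = 0 -> forall i, c i = 0).

Record numField := NumField {
  nf_set :> set C;
  nf_subfield : is_subfield nf_set;
  nf_finite : exists n (b : 'I_n -> C), basis_over QQ nf_set b }.

Definition adjoin (F S : set C) : set C :=
  [set x | forall M, is_subfield M -> F `<=` M -> S `<=` M -> M x].

Definition embedding (L : set C) (s : C -> C) : Prop :=
  [/\ s 1 = 1,
      forall x y, L x -> L y -> s (x - y) = s x - s y &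
      forall x y, L x -> L y -> s (x * y) = s x * s y].

(* Only the values of [s] on [M] matter. *)
Definition gal (M k : set C) (s : C -> C) : Prop :=
  [/\ embedding M s, s @` M = M & forall x, k x -> s x = x].

(* Galois over [K] means here stable under all [K]-embeddings into [C]
   (characteristic 0). *)
Definition abelian_ext (K L : numField) : Prop :=
  [/\ K `<=` L,
      forall s, embedding L s -> (forall x, nf_set K x -> s x = x) ->
        s @` L `<=` L &
      forall s t, gal L K s -> gal L K t ->
        forall x, nf_set L x -> s (t x) = t (s x)].

Definition max_abelian (K : numField) : set C :=
  [set x | exists L : numField, abelian_ext K L /\ nf_set L x].

Definition ints (L : set C) : set C :=
  [set x | L x /\ integralOver (intr : int -> C) x].

Definition is_ideal (A I : set C) : Prop :=
  [/\ I `<=` A, I 0, forall x y, I x -> I y -> I (x - y) &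
      forall a x, A a -> I x -> I (a * x)].

Definition ideal_mul (I J : set C) : set C :=
  [set x | exists n (a b : 'I_n -> C),
     [/\ forall i, I (a i), forall i, J (b i) & x = \sum_i a i * b i]].

Definition ideal_exp (A I : set C) (n : nat) : set C := iter n (ideal_mul I) A.

Definition nonzero_prime (L : numField) (w : set C) : Prop :=
  [/\ is_ideal (ints L) w, exists2 x, w x & x != 0, ~ w 1 &
      forall x y, ints L x -> ints L y -> w (x * y) -> w x \/ w y].

Definition invertible_ideal (K O I : set C) : Prop :=
  is_ideal O I /\
  exists J, [/\ J `<=` K, forall x y, J x -> J y -> J (x - y),
                forall a x, O a -> J x -> J (a * x) & ideal_mul I J = O].

Definition is_lattice (K : numField) (La : set C) : Prop :=
  La `<=` K /\ exists b : 'I_2 -> C, basis_over ZZ La b.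

Definition is_order (K : numField) (O : set C) : Prop :=
  [/\ is_lattice K O, O 1 & forall x y, O x -> O y -> O (x * y)].

Definition imag_quadratic (K : numField) : Prop :=
  (exists b : 'I_2 -> C, basis_over QQ K b) /\
  (exists2 x, nf_set K x & x \isn't Num.real).

End NumberFields.
Arguments numField C : clear implicits.

Section NumberFieldFacts.
Context {C : numClosedFieldType}.
Implicit Types L : numField C.

Section Subfield.
Variables (S : set C) (hS : is_subfield S).

Lemma subfield0 : S 0.
Proof. by rewrite -(subrr 1); apply: (subfieldB hS _ _); apply: (subfield1 hS). Qed.

Lemma subfieldN x : S x -> S (- x).
Proof. by move=> Sx; rewrite -sub0r; apply: (subfieldB hS _ Sx); apply: subfield0. Qed.

Lemma subfieldD x y : S x -> S y -> S (x + y).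
Proof. by move=> Sx /subfieldN Sy; rewrite -[y]opprK; apply: (subfieldB hS _ _). Qed.

Lemma subfield_nat n : S n%:R.
Proof.
elim: n => [|n IH]; first exact: subfield0.
by rewrite -natr1; apply: subfieldD => //; apply: subfield1.
Qed.

End Subfield.

Lemma integral_multiple L x : nf_set L x -> exists2 d : nat, (0 < d)%N & ints L (d%:R * x).
Proof.
move=> Lx; have [n [b [span _]]] := nf_finite L.
have Lb i : nf_set L (b i).
  apply/span; exists (fun j => (i == j)%:R); split=> [j|].
    by exists (i == j)%:R => //; rewrite rmorph_nat.
  rewrite (bigD1 i) //= eqxx mul1r big1 ?addr0 // => j ji.
  by rewrite eq_sym (negPf ji) mul0r.
have xb i : {c : 'I_n -> rat | x * b i = \sum_j ratr (c j) * b j}.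
  apply: cid; have /span [c [cQ ->]] : nf_set L (x * b i) by apply: (subfieldM (nf_subfield L) _ _).
  have cQ' j : {q : rat | ratr q = c j} by apply: cid; have [q _ <-] := cQ j; exists q.
  by exists (fun j => sval (cQ' j)); apply: eq_bigr => j _; rewrite (svalP (cQ' j)).
pose q i j : rat := sval (xb i) j.
pose d := (\prod_i \prod_j `|denq (q i j)|)%N.
have d0 : (0 < d)%N.
  by apply: prodn_gt0 => i; apply: prodn_gt0 => j; rewrite absz_gt0 denq_neq0.
have dq i j : exists z : int, d%:R * q i j = z%:~R.
  have dv : (`|denq (q i j)| %| d)%N.
    by rewrite /d (bigD1 i) //= (bigD1 j) //= -mulnA dvdn_mulr.
  have /dvdnP [e ->] := dv.
  exists (e%:Z * numq (q i j)); rewrite natrM -mulrA.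
  have -> : (`|denq (q i j)|%N)%:R = (denq (q i j))%:~R :> rat.
    by rewrite -[in RHS](gez0_abs (denq_ge0 _)).
  by rewrite [X in _ * X]mulrC -[X in _ * (X * _)]divq_num_den divfK ?intq_eq0 ?denq_neq0 ?rmorphM.
pose z i j := sval (cid (dq i j)).
have zE i j : ratr (d%:R * q i j) = (z i j)%:~R :> C.
  by rewrite (svalP (cid (dq i j))) ratr_int.
pose M : 'M[int]_n := \matrix_(i, j) z j i.
exists d => //; split.
  by apply: (subfieldM (nf_subfield L) _ Lx); apply: (subfield_nat (nf_subfield L) _).
exists (char_poly M); first exact: char_poly_monic.
have /span [c [_ c1]] : nf_set L 1 by apply: (subfield1 (nf_subfield L)).
rewrite map_char_poly -eigenvalue_root_char.
apply/eigenvalueP; exists (\row_j b j).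
  apply/rowP => i; rewrite !mxE -mulrA (svalP (xb i)) mulr_sumr.
  apply: eq_bigr => j _; rewrite !mxE /= -zE rmorphM /= ratr_nat -/(q i j).
  by rewrite mulrCA [b j * _]mulrC.
apply/eqP => /rowP b0; move/eqP: (oner_neq0 C); apply.
by rewrite c1 big1 // => i _; have := b0 i; rewrite !mxE => ->; rewrite mulr0.
Qed.

Lemma ints0 L : ints L 0.
Proof.
split; first exact: (subfield0 (nf_subfield L)).
exact: mxpoly.integral0.
Qed.

Lemma ints_nat L n : ints L n%:R.
Proof.
split; first exact: (subfield_nat (nf_subfield L) n).
exact: (@mxpoly.integral_id int C (intr : {rmorphism int -> C}) n%:Z).
Qed.

Lemma intsN L x : ints L x -> ints L (- x).
Proof. by move=> [Lx Ix]; split; [exact: (subfieldN (nf_subfield L) Lx) | exact: (@mxpoly.integral_opp _ _ (intr : {rmorphism int -> C}))]. Qed.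

Lemma intsD L x y : ints L x -> ints L y -> ints L (x + y).
Proof.
move=> [Lx Ix] [Ly Iy]; split; first exact: (subfieldD (nf_subfield L) Lx Ly).
exact: (@mxpoly.integral_add _ _ (intr : {rmorphism int -> C})).
Qed.

Lemma intsM L x y : ints L x -> ints L y -> ints L (x * y).
Proof.
move=> [Lx Ix] [Ly Iy]; split; first exact: (subfieldM (nf_subfield L) Lx Ly).
exact: (@mxpoly.integral_mul _ _ (intr : {rmorphism int -> C})).
Qed.

Lemma integral_frac (p m : nat) : prime p ->
  integralOver (intr : int -> C) (m%:R / p%:R) -> (p %| m)%N.
Proof.
move=> pp [P Pmon /rootP]; have p0 : p%:R != 0 :> C by rewrite pnatr_eq0 -lt0n prime_gt0.
rewrite horner_coef size_map_inj_poly ?rmorph0 //; last exact: intr_inj.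
have P0 : (0 < size P)%N by rewrite size_poly_gt0 monic_neq0.
set n := (size P).-1; have Pn : size P = n.+1 by rewrite prednK.
have lc : P`_n = 1 by have := monicP Pmon; rewrite /lead_coef -/n.
move/(congr1 (fun t => t * p%:R ^+ n)); rewrite mul0r mulr_suml.
have key : \sum_(i < size P)
     (map_poly intr P)`_i * (m%:R / p%:R) ^+ i * p%:R ^+ n
   = (\sum_(i < n.+1) P`_i * m%:Z ^+ i * p%:Z ^+ (n - i))%:~R :> C.
  rewrite Pn rmorph_sum; apply: eq_bigr => i _.
  rewrite coef_map_id0 ?rmorph0 // !rmorphM !rmorphXn /= -!mulrA; congr (_ * _).
  have le_in : (i <= n)%N by rewrite -ltnS.
  have -> : p%:R ^+ n = p%:R ^+ i * p%:R ^+ (n - i) :> C by rewrite -exprD subnKC.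
  by rewrite exprMn exprVn -!mulrA mulKf ?expf_neq0.
rewrite key => /eqP; rewrite intr_eq0 big_ord_recr /= lc subnn expr0 mulr1 mul1r => /eqP S0.
have : (p%:Z %| m%:Z ^+ n)%Z.
  rewrite -[m%:Z ^+ n](addKr (\sum_(i < n) P`_i * m%:Z ^+ i * p%:Z ^+ (n - i))) S0 addr0.
  rewrite rpredN; apply: rpred_sum => i _; apply: dvdz_mull.
  by rewrite -(subnSK (ltn_ord i)) exprS dvdz_mulr.
by rewrite dvdzE abszX /= Euclid_dvdX // => /andP[].
Qed.

Lemma embedding_nat L s n : embedding L s -> s n%:R = n%:R.
Proof.
move=> [s1 sB _]; have L1 := subfield1 (nf_subfield L).
have s0 : s 0 = 0 by rewrite -(subrr 1) sB // s1 subrr.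
have L0 := subfield0 (nf_subfield L).
elim: n => [//|n IH]; have Ln := subfield_nat (nf_subfield L) n.
have e : n.+1%:R = n%:R - (0 - 1) :> C by rewrite sub0r opprK natr1.
have L01 := subfieldB (nf_subfield L) L0 L1.
by rewrite e sB // IH sB // s0 s1.
Qed.

End NumberFieldFacts.

Definition rprime := {p : nat | prime p}.
Inductive place := Infty | Fin of rprime.

Section Completion.
Context {C : numClosedFieldType}.
Implicit Types (L : numField C) (v : place).

(* [nb_fin L p n] is p^n (O_L localised at p), [nb_inf L n] the set of elements
   all of whose conjugates are smaller than 1/(n+1). *)
Definition nb_fin L (p n : nat) : set C :=
  [set x | nf_set L x /\ exists m : nat, ~~ (p %| m)%N /\
     exists2 y, ints L y & m%:R * x = p%:R ^+ n * y].

Definition nb_inf L (n : nat) : set C :=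
  [set x | nf_set L x /\
     forall s, embedding L s -> `|s x| < (n.+1)%:R^-1].

Definition nb L v (n : nat) : set C :=
  match v with Infty => nb_inf L n | Fin p => nb_fin L (val p) n end.

Lemma nbL L v n x : nb L v n x -> nf_set L x.
Proof. by case: v => [|p] []. Qed.

Lemma nb_mono L v m n : (m <= n)%N -> nb L v n `<=` nb L v m.
Proof.
move=> mn x; case: v => [|p] [Lx] /=.
  move=> h; split=> // s es; apply: lt_le_trans (h s es) _.
  by rewrite lef_pV2 ?posrE ?ltr0n // ler_nat ltnS.
move=> [k [pk [y Iy e]]]; split=> //; exists k; split=> //.
exists ((val p)%:R ^+ (n - m) * y); last by rewrite mulrA -exprD subnKC.
by apply: intsM => //; rewrite -natrX; apply: ints_nat.
Qed.

Lemma nb0 L v n : nb L v n 0.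
Proof.
case: v => [|p]; split; try exact: (subfield0 (nf_subfield L)).
  move=> s es; have := embedding_nat 0 es; rewrite /= => ->.
  by rewrite normr0 invr_gt0 ltr0n.
exists 1%N; split; first by rewrite dvdn1 neq_ltn prime_gt1 ?orbT //; exact: valP p.
by exists 0; [exact: ints0 | rewrite !mulr0].
Qed.

Lemma nbN L v n x : nb L v n x -> nb L v n (- x).
Proof.
case: v => [|p] [Lx h]; split; try exact: (subfieldN (nf_subfield L) Lx).
  move=> s es; have [_ sB _] := es.
  rewrite -sub0r sB //; last exact: (subfield0 (nf_subfield L)).
  by have := embedding_nat 0 es; rewrite /= => ->; rewrite sub0r normrN; apply: h.
have [k [pk [y Iy e]]] := h; exists k; split=> //.
by exists (- y); [exact: intsN | rewrite !mulrN e].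
Qed.

Lemma nbD L v n : exists m, forall x y, nb L v m x -> nb L v m y -> nb L v n (x + y).
Proof.
case: v => [|p].
  exists (n.*2.+1) => x y [Lx hx] [Ly hy].
  split; first exact: (subfieldD (nf_subfield L) Lx Ly).
  move=> s es; have [_ sB _] := es.
  have LNy : nf_set L (- y) by exact: (subfieldN (nf_subfield L) Ly).
  rewrite -[y]opprK sB //; apply: le_lt_trans (ler_normB _ _) _.
  have -> : (n.+1%:R^-1 : C) = (n.*2.+2)%:R^-1 + (n.*2.+2)%:R^-1.
    rewrite -doubleS -muln2 natrM invfM -mulrDr -[2%:R^-1]mul1r -mulrDl.
    by rewrite -[1 + 1]/2%:R divff ?mulr1 // pnatr_eq0.
  apply: ltrD; first exact: hx.
  rewrite -sub0r sB //; last exact: (subfield0 (nf_subfield L)).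
  by have := embedding_nat 0 es; rewrite /= => ->; rewrite sub0r normrN; apply: hy.
exists n => x y [Lx [k [pk [a Ia e]]]] [Ly [l [pl [b Ib f]]]].
split; first exact: (subfieldD (nf_subfield L) Lx Ly).
exists (k * l)%N; split; first by rewrite Euclid_dvdM ?negb_or ?pk //; exact: valP p.
exists (l%:R * a + k%:R * b).
  by apply: intsD; apply: intsM => //; apply: ints_nat.
rewrite natrM mulrDr mulrDr [k%:R * l%:R in X in X + _ = _]mulrC -!mulrA e f.
by congr (_ + _); rewrite mulrCA.
Qed.

Lemma nbM L v n x y : nb L v n x -> nb L v n y -> nb L v n (x * y).
Proof.
case: v => [|p] [Lx hx] [Ly hy]; split;
  try exact: (subfieldM (nf_subfield L) Lx Ly).
  move=> s es; have [_ _ sM] := es.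
  rewrite sM // normrM -[X in _ < X]mulr1.
  have le1 : (n.+1)%:R^-1 <= 1 :> C by rewrite invf_le1 ?ler1n ?ltr0n.
  by apply: ltr_pM => //; [exact: hx | apply: lt_le_trans le1; exact: hy].
have [k [pk [a Ia e]]] := hx; have [l [pl [b Ib f]]] := hy.
exists (k * l)%N; split; first by rewrite Euclid_dvdM ?negb_or ?pk //; exact: valP p.
exists ((val p)%:R ^+ n * (a * b)).
  by apply: intsM; [rewrite -natrX; exact: ints_nat | exact: intsM].
by rewrite natrM mulrACA e f -!mulrA; congr (_ * _); rewrite mulrCA.
Qed.

Lemma root_bound (P : {poly int}) : P \is monic ->
  exists B : nat, forall r : C, root (map_poly intr P) r -> `|r| <= B%:R.
Proof.
move=> Pmon; set n := (size P).-1.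
have P0 : (0 < size P)%N by rewrite size_poly_gt0 monic_neq0.
have Pn : size P = n.+1 by rewrite prednK.
have lc : P`_n = 1 by have := monicP Pmon; rewrite /lead_coef -/n.
pose c (i : nat) : int := P`_i.
exists (1 + \sum_(i < n) `|c i|)%N => r /rootP.
rewrite horner_coef size_map_inj_poly ?rmorph0 //; last exact: intr_inj.
rewrite Pn big_ord_recr /= !coef_map_id0 ?rmorph0 // lc mul1r.
have [r1 _|r1] := real_leP (normr_real r) (@real1 C).
  by apply: le_trans r1 _; rewrite ler1n.
move/eqP; rewrite addrC addr_eq0 => /eqP rn.
have r0 : 0 < `|r| by apply: lt_trans r1; exact: ltr01.
case En : n rn => [|k] rn.
  by move/eqP: rn; rewrite big_ord0 oppr0 expr0 oner_eq0.
rewrite -(ler_pM2r (exprn_gt0 k r0)) -exprS -normrX rn normrN.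
apply: le_trans (ler_norm_sum _ _ _) _.
rewrite natrD mulrDl natr_sum mulr_suml.
apply: ler_wpDl; first by rewrite mulr_ge0 // exprn_ge0.
apply: ler_sum => i _; rewrite normrM normrX coef_map_id0 ?rmorph0 //= -/(c i).
have -> : `|(c i)%:~R| = (`|c i|%N)%:R :> C by rewrite -intr_norm natr_absz.
apply: ler_wpM2l; first exact: ler0n.
by apply: ler_weXn2l; [exact: ltW | rewrite -ltnS].
Qed.

Lemma embedding_bound L x : nf_set L x ->
  exists B : nat, forall s, embedding L s -> `|s x| <= B%:R.
Proof.
move=> Lx; have [d d0 [Ldx [P Pmon rP]]] := integral_multiple Lx.
have [B Br] := root_bound Pmon; exists B.
move=> s es; have [s1 sB sM] := es.
have hL := nf_subfield L.
have s0 : s 0 = 0 by have := embedding_nat 0 es.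
have sN y : nf_set L y -> s (- y) = - s y.
  by move=> Ly; rewrite -sub0r sB ?s0 ?sub0r //; exact: (subfield0 hL).
have sD y z : nf_set L y -> nf_set L z -> s (y + z) = s y + s z.
  by move=> Ly Lz; rewrite -[z]opprK sB ?sN ?opprK //; apply: (subfieldN hL _) => //; apply: (subfieldN hL _).
have Lint (z : int) : nf_set L z%:~R.
  by case: z => m; [exact: (subfield_nat hL m) | rewrite NegzE rmorphN; apply: (subfieldN hL _); exact: (subfield_nat hL _)].
have sint (z : int) : s z%:~R = z%:~R.
  case: z => m; first exact: embedding_nat m es.
  rewrite NegzE rmorphN /= sN; first by congr (- _); exact: embedding_nat m.+1 es.
  exact: (subfield_nat hL m.+1).
have sroot y (Q : {poly int}) : nf_set L y ->
    nf_set L (map_poly intr Q).[y] /\ s (map_poly intr Q).[y] = (map_poly intr Q).[s y].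
  move=> Ly; elim/poly_ind: Q => [|Q c [LQ sQ]].
    by rewrite rmorph0 !horner0; split=> //; exact: (subfield0 hL).
  rewrite rmorphD rmorphM /= map_polyX map_polyC /= !hornerMXaddC -sQ.
  have LQy : nf_set L ((map_poly intr Q).[y] * y) by exact: (subfieldM hL LQ Ly).
  split; first exact: (subfieldD hL LQy (Lint c)).
  by rewrite sD // sM // sint.
have Pdx : (map_poly (intr : int -> C) P).[s (d%:R * x)] = 0.
  by rewrite -(sroot _ P Ldx).2 (rootP rP) s0.
have Bd : `|s (d%:R * x)| <= B%:R by apply: Br; apply/rootP.
have Ld : nf_set L d%:R by exact: (subfield_nat hL d).
have -> : s x = s (d%:R * x) / d%:R.
  by rewrite sM // (embedding_nat d es) mulrAC divff ?mul1r // pnatr_eq0 -lt0n.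
rewrite normrM normfV normr_nat.
apply: le_trans Bd; rewrite ler_pdivrMr ?ltr0n //.
by apply: ler_peMr => //; rewrite ler1n.
Qed.

Lemma nbZ L v n x : nf_set L x -> exists m, forall y, nb L v m y -> nb L v n (x * y).
Proof.
move=> Lx; case: v => [|p].
  have [B bB] := embedding_bound Lx.
  exists (B.+1 * n.+1)%N => y [Ly hy]; split; first exact: (subfieldM (nf_subfield L) Lx Ly).
  move=> s es; have [_ _ sM] := es; rewrite sM // normrM.
  apply: le_lt_trans (_ : B%:R * `|s y| < _).
    by apply: ler_wpM2r => //; exact: bB.
  apply: le_lt_trans (_ : B.+1%:R * `|s y| < _).
    by apply: ler_wpM2r => //; rewrite ler_nat.
  rewrite -ltr_pdivlMl ?ltr0n // -invfM -natrM.
  by apply: lt_trans (hy s es) _; rewrite ltf_pV2 ?posrE ?ltr0n ?muln_gt0 // ltr_nat.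
have [d d0 Idx] := integral_multiple Lx; have pp := valP p.
have [k pk dk] := pfactor_coprime pp d0.
have pk' : ~~ (val p %| k)%N by rewrite -prime_coprime.
exists (n + logn (val p) d)%N => y [Ly [l [pl [b Ib e]]]].
split; first exact: (subfieldM (nf_subfield L) Lx Ly).
exists (k * l)%N; split; first by rewrite Euclid_dvdM ?negb_or ?pk'.
exists ((d%:R * x) * b); first exact: intsM.
have pq0 : (val p)%:R ^+ logn (val p) d != 0 :> C.
  by rewrite expf_neq0 // pnatr_eq0 -lt0n prime_gt0.
apply: (mulfI pq0).
have dE : d%:R = k%:R * (val p)%:R ^+ logn (val p) d :> C.
  by rewrite -natrX -natrM -dk.
rewrite natrM.
set q := _ ^+ logn _ _ in dE *.
transitivity ((k%:R * q) * x * (l%:R * y)); first by ring.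
by rewrite -dE e exprD -/q; ring.
Qed.

Lemma nb_no1 L v : exists n, ~ nb L v n 1.
Proof.
case: v => [|p].
  exists 0%N => -[L1 h]; have := h id; rewrite normr1 invr1 ltxx.
  by move=> F; suff: false by []; apply: F; split.
exists 1%N => -[_ [m [pm [y [_ Iy] e]]]].
have pp := valP p; move/negP: pm; apply; apply: (integral_frac (C := C) pp).
rewrite -[m%:R]mulr1 e expr1 mulrAC divff ?mul1r //.
by rewrite pnatr_eq0 -lt0n prime_gt0.
Qed.

(* Cauchy sequences of elements of [L] for the [v]-adic topology, modulo null
   sequences. For [v = Fin p] this is K (x) Q_p, for [v = Infty] it is
   K (x) R. *)
Definition cauchy L v (u : nat -> C) : Prop :=
  (forall n, nf_set L (u n)) /\
  forall k, exists N, forall m n, (N <= m)%N -> (N <= n)%N ->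
    nb L v k (u m - u n).

Definition cauchy_pred L v : {pred nat -> C} := fun u => `[< cauchy L v u >].

Lemma cauchyB L v u w : cauchy L v u -> cauchy L v w -> cauchy L v (u - w).
Proof.
move=> [Lu cu] [Lw cw]; split=> [n|k].
  exact: (subfieldB (nf_subfield L) (Lu n) (Lw n)).
have [j jD] := nbD L v k; have [N hN] := cu j; have [M hM] := cw j.
exists (maxn N M) => m n; rewrite !geq_max => /andP[Nm Mm] /andP[Nn Mn].
have -> : (u - w) m - (u - w) n = (u m - u n) + - (w m - w n).
  by rewrite !fctE; ring.
by apply: jD; [exact: hN | apply: nbN; exact: hM].
Qed.

Lemma cauchy_bounded L v u k : cauchy L v u ->
  exists N j, forall n y, (N <= n)%N -> nb L v j y -> nb L v k (u n * y).
Proof.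
move=> [Lu cu]; have [j jD] := nbD L v k; have [N hN] := cu j.
have [l hl] := @nbZ L v j (u N) (Lu N).
exists N, (maxn j l) => n y Nn hy.
have -> : u n * y = (u n - u N) * y + u N * y by ring.
apply: jD; last by apply: hl; apply: nb_mono hy; exact: leq_maxr.
by apply: nbM; [exact: hN | apply: nb_mono hy; exact: leq_maxl].
Qed.

Lemma cauchyM L v u w : cauchy L v u -> cauchy L v w -> cauchy L v (u * w).
Proof.
move=> cu cw; have [Lu hu] := cu; have [Lw hw] := cw; split=> [n|k].
  exact: (subfieldM (nf_subfield L) (Lu n) (Lw n)).
have [j jD] := nbD L v k.
have [N1 [j1 h1]] := cauchy_bounded j cu; have [N2 [j2 h2]] := cauchy_bounded j cw.
have [N3 h3] := hu j2; have [N4 h4] := hw j1.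
exists (maxn (maxn N1 N2) (maxn N3 N4)) => m n.
rewrite !geq_max => /andP[/andP[? ?] /andP[? ?]] /andP[/andP[? ?] /andP[? ?]].
have -> : (u * w) m - (u * w) n = w n * (u m - u n) + u m * (w m - w n).
  by rewrite !fctE; ring.
by apply: jD; [apply: h2 => //; exact: h3 | apply: h1 => //; exact: h4].
Qed.

Lemma cauchy_cst L v x : nf_set L x -> cauchy L v (fun=> x).
Proof. by move=> Lx; split=> // k; exists 0%N => m n _ _; rewrite subrr; exact: nb0. Qed.

Lemma cauchy_subring L v : subring_closed (cauchy_pred L v).
Proof.
split; first by apply/asboolP; apply: cauchy_cst; exact: (subfield1 (nf_subfield L)).
  by move=> u w /asboolP cu /asboolP cw; apply/asboolP; exact: cauchyB.
by move=> u w /asboolP cu /asboolP cw; apply/asboolP; exact: cauchyM.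
Qed.

HB.instance Definition _ L v :=
  GRing.isSubringClosed.Build (nat -> C) (cauchy_pred L v) (cauchy_subring L v).

Record cseq L v := CSeq { cseq_val : nat -> C; _ : cseq_val \in cauchy_pred L v }.
HB.instance Definition _ L v := [isSub for @cseq_val L v].
HB.instance Definition _ L v := [Choice of cseq L v by <:].
HB.instance Definition _ L v := [SubChoice_isSubComNzRing of cseq L v by <:].

Definition null_seq L v : {pred cseq L v} := fun u =>
  `[< forall k, exists N, forall n, (N <= n)%N -> nb L v k (val u n) >].

Lemma null_seq_ideal L v : idealr_closed (@null_seq L v).
Proof.
split.
- by apply/asboolP => k; exists 0%N => n _; exact: nb0.
- have [n h1] := nb_no1 L v; apply/negP => /asboolP /(_ n) [N hN].
  exact: h1 (hN N (leqnn N)).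
- move=> a u w /asboolP hu /asboolP hw; apply/asboolP => k.
  have [j jD] := nbD L v k.
  have /asboolP ca : val a \in cauchy_pred L v := valP a.
  have [N1 [i h1]] := cauchy_bounded j ca.
  have [N2 h2] := hu i; have [N3 h3] := hw j.
  exists (maxn N1 (maxn N2 N3)) => n; rewrite !geq_max => /and3P[? ? ?].
  by rewrite rmorphD rmorphM /=; apply: jD; [apply: h1 => //; exact: h2 | exact: h3].
Qed.

HB.instance Definition _ L v :=
  isIdealr.Build (cseq L v) (@null_seq L v) (null_seq_ideal L v).

Definition completion L v := {ideal_quot (@null_seq L v)}.

End Completion.

Section Adeles.
Context {C : numClosedFieldType}.
Implicit Types (L K F : numField C) (v : place).

Definition class_of L v (u : nat -> C) : completion L v :=
  \pi_({ideal_quot (@null_seq C L v)})%qT (insubd (0 : cseq L v) u).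

Definition rep L v (x : completion L v) : nat -> C :=
  val (repr (x : {ideal_quot (@null_seq C L v)})).

(* The canonical map L -> L_v; only meaningful on elements of [L]. *)
Definition emb L v (x : C) : completion L v := class_of L v (fun=> x).

(* The canonical map K_v -> F_v, for [K `<=` F]. *)
Definition base_change K F v (x : completion K v) : completion F v :=
  class_of F v (rep x).

(* The closure in L_v of a subset [S] of [L]; for instance
   [clos (ints L)] is O_L (x) Z_p for [v = Fin p]. *)
Definition clos L v (S : set C) : set (completion L v) :=
  [set x | exists u, [/\ cauchy L v u, forall n, S (u n) & x = class_of L v u]].
Arguments clos L v S : clear implicits.

Lemma insubd_cauchy L v u : cauchy L v u -> val (insubd (0 : cseq L v) u) = u.
Proof. by move=> cu; rewrite insubdK //; apply/asboolP. Qed.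

Lemma class_ofM L v u w : cauchy L v u -> cauchy L v w ->
  class_of L v (u * w) = class_of L v u * class_of L v w.
Proof.
move=> cu cw; rewrite /class_of.
rewrite [RHS](_ : _ = \pi_({ideal_quot (@null_seq C L v)})%qT
   (insubd (0 : cseq L v) u * insubd (0 : cseq L v) w)); last first.
  by rewrite rmorphM.
congr (\pi_(_)%qT _); apply: val_inj; rewrite rmorphM /= !insubd_cauchy //.
exact: cauchyM.
Qed.

Lemma class_of1 L v : class_of L v 1 = 1.
Proof.
rewrite /class_of; have -> : insubd (0 : cseq L v) 1 = 1.
  apply: val_inj; rewrite insubd_cauchy ?rmorph1 //.
  by apply: cauchy_cst; exact: (subfield1 (nf_subfield L)).
by rewrite rmorph1.
Qed.

Lemma class_of_eq L v u w : cauchy L v u -> cauchy L v w ->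
  (forall k, exists N, forall n, (N <= n)%N -> nb L v k (u n - w n)) ->
  class_of L v u = class_of L v w.
Proof.
move=> cu cw h; apply/eqP; rewrite /class_of -Quotient.idealrBE; apply/asboolP => k.
by have [N hN] := h k; exists N => n Nn; rewrite rmorphB /= !insubd_cauchy //; exact: hN.
Qed.

Lemma embM L v x y : nf_set L x -> nf_set L y -> emb L v (x * y) = emb L v x * emb L v y.
Proof. by move=> Lx Ly; rewrite /emb -class_ofM //; exact: cauchy_cst. Qed.

Lemma clos_intsM L v x y : clos L v (ints L) x -> clos L v (ints L) y ->
  clos L v (ints L) (x * y).
Proof.
move=> [u [cu Iu ->]] [w [cw Iw ->]]; exists (u * w).
split; [exact: cauchyM | by move=> n; exact: intsM | by rewrite class_ofM].
Qed.

Lemma clos_ints1 L v : clos L v (ints L) 1.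
Proof.
exists 1; split; last by rewrite class_of1.
  by apply: cauchy_cst; exact: (subfield1 (nf_subfield L)).
by move=> n; exact: (ints_nat L 1).
Qed.

Lemma emb_integral L x : nf_set L x ->
  finite_set [set p : rprime | ~ clos L (Fin p) (ints L) (emb L (Fin p) x)].
Proof.
move=> Lx; have [d d0 Idx] := integral_multiple Lx.
apply: (@sub_finite_set _ _ (val @^-1` [set k : nat | (k < d.+1)%N])); last first.
  by apply: finite_preimage; [move=> ? ? _ _; exact: val_inj | exact: finite_II].
move=> p; apply: contra_notP => /= /negP; rewrite -leqNgt => dp.
have pp := valP p.
have dcp : coprime d (val p).
  rewrite coprime_sym prime_coprime //; apply/negP => /(dvdn_leq d0).
  by rewrite leqNgt dp.
pose u n : C := (d ^ totient (val p ^ n))%:R * x.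
have Iu n : ints L (u n).
  have t0 : (0 < totient (val p ^ n))%N by rewrite totient_gt0 expn_gt0 prime_gt0.
  rewrite /u -(prednK t0) expnSr natrM -mulrA.
  by apply: intsM => //; exact: ints_nat.
have ux k n : (k <= n)%N -> nb L (Fin p) k (u n - x).
  move=> kn; apply: (nb_mono kn); split.
    exact: (subfieldB (nf_subfield L) (Iu n).1 Lx).
  exists d; split; first by rewrite -prime_coprime // coprime_sym.
  have : d ^ totient (val p ^ n) == 1 %[mod val p ^ n].
    by apply/eqP/cyclic.Euler_exp_totient; rewrite coprimeXr.
  rewrite eqn_mod_dvd ?expn_gt0 ?d0 // => /dvdnP[e eE].
  exists (e%:R * (d%:R * x)); first by apply: intsM => //; exact: ints_nat.
  have -> : u n - x = (e * val p ^ n)%:R * x.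
    by rewrite -eE natrB ?expn_gt0 ?d0 // mulrBl mul1r.
  by rewrite natrM natrX; ring.
have cu : cauchy L (Fin p) u.
  split=> [n|k]; first exact: (Iu n).1.
  have [j jD] := nbD L (Fin p) k; exists j => m n jm jn.
  have -> : u m - u n = (u m - x) + - (u n - x) by ring.
  by apply: jD; [exact: ux | apply: nbN; exact: ux].
exists u; split=> //; apply: class_of_eq => //; first exact: cauchy_cst.
by move=> k; exists k => n kn; rewrite -opprB; apply: nbN; exact: ux.
Qed.

(* Ideles: units of the restricted product of the L_v with respect to the
   O_L (x) Z_p, the inverse being part of the data. *)
Record idele L := Idele {
  icomp :> forall v, completion L v;
  iinv : forall v, completion L v;
  icompK : forall v, icomp v * iinv v = 1;
  icomp_int : finite_set [set p | ~ clos L (Fin p) (ints L) (icomp (Fin p))];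
  iinv_int : finite_set [set p | ~ clos L (Fin p) (ints L) (iinv (Fin p))] }.

Lemma finite_nonintM L (a b : forall v, completion L v) :
  finite_set [set p | ~ clos L (Fin p) (ints L) (a (Fin p))] ->
  finite_set [set p | ~ clos L (Fin p) (ints L) (b (Fin p))] ->
  finite_set [set p | ~ clos L (Fin p) (ints L) (a (Fin p) * b (Fin p))].
Proof.
move=> fa fb; apply: sub_finite_set (_ : _ `<=` _ `|` _) _; last first.
  by rewrite finite_setU; split; [exact: fa | exact: fb].
move=> p /=; apply: contra_notP => /not_orP[/contrapT ha /contrapT hb].
exact: clos_intsM.
Qed.

Definition ideleM L (s t : idele L) : idele L.
Proof.
apply: (@Idele L (fun v => s v * t v) (fun v => iinv s v * iinv t v)).
- by move=> v; rewrite mulrACA !icompK mulr1.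
- exact: (finite_nonintM (icomp_int s) (icomp_int t)).
- exact: (finite_nonintM (iinv_int s) (iinv_int t)).
Defined.

Definition ideleV L (s : idele L) : idele L.
Proof.
apply: (@Idele L (iinv s) s); last exact: icomp_int.
- by move=> v; rewrite mulrC icompK.
- exact: iinv_int.
Defined.

Definition idele1 L : idele L.
Proof.
have f : finite_set [set p | ~ clos L (Fin p) (ints L) 1].
  apply: sub_finite_set (@finite_set0 _) => p /=; apply; exact: clos_ints1.
apply: (@Idele L (fun=> 1) (fun=> 1)) => //.
by move=> v; rewrite mulr1.
Defined.

Definition principal_idele L x (Lx : nf_set L x) (x0 : x != 0) : idele L.
Proof.
have LVx := subfieldV (nf_subfield L) Lx.
apply: (@Idele L (fun v => emb L v x) (fun v => emb L v x^-1)).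
- by move=> v; rewrite -embM // divff // -class_of1.
- exact: emb_integral.
- exact: emb_integral.
Defined.

(* The diagonal embedding L^* -> A_L^* (junk value 1 outside L^* ). *)
Definition principal L (x : C) : idele L :=
  match pselect (nf_set L x), boolP (x != 0) with
  | left Lx, AltTrue x0 => principal_idele Lx x0
  | _, _ => idele1 L
  end.

End Adeles.
Arguments clos {C} L v S _.

Section RationalField.
Context {C : numClosedFieldType}.

Lemma QQ_subfield : is_subfield (@QQ C).
Proof.
split.
- by exists 1 => //; rewrite rmorph1.
- by move=> _ _ [p _ <-] [q _ <-]; exists (p - q) => //; rewrite rmorphB.
- by move=> _ _ [p _ <-] [q _ <-]; exists (p * q) => //; rewrite rmorphM.
- by move=> _ [p _ <-]; exists p^-1 => //; rewrite fmorphV.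
Qed.

Lemma QQ_finite : exists n (b : 'I_n -> C), basis_over QQ QQ b.
Proof.
exists 1%N, (fun=> 1); split=> [x|c cQ].
  split=> [Qx|[c [Qc ->]]]; last by rewrite big_ord1 mulr1.
  by exists (fun=> x); rewrite big_ord1 mulr1.
by rewrite big_ord1 mulr1 => c0 i; rewrite ord1.
Qed.

Definition rat_field : numField C := NumField QQ_subfield QQ_finite.

End RationalField.

Section ClassFieldTheory.
Context {C : numClosedFieldType}.
Implicit Types (K L F : numField C) (p : rprime).

(* A basis of neighbourhoods of 1 in A_L^*: the u which are close to 1 at
   infinity and lie in (1 + N O_p) \cap O_p^* for every p, O_p = O_L (x) Z_p. *)
Definition idele_ball L (N : nat) : set (idele L) :=
  [set u : idele L | clos L Infty (nb_inf L N) (u Infty - 1) /\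
    forall p,
      [/\ clos L (Fin p) (ints L) (u (Fin p)),
          clos L (Fin p) (ints L) (iinv u (Fin p)) &
          exists2 y, clos L (Fin p) (ints L) y &
            u (Fin p) - 1 = emb L (Fin p) N%:R * y]].

Definition idele_nbhs L (s : idele L) : set_system (idele L) :=
  filter_from [set N | (0 < N)%N]
    (fun N => [set t : idele L | idele_ball N (ideleM t (ideleV s))]).

(* [idele_norm t s] : N_{F/K} t = s, where N_{F/K} : A_F^* -> A_K^* is the norm of
   the free A_K-algebra A_F = F (x)_K A_K, computed place by place. *)
Definition idele_norm K F (t : idele F) (s : idele K) : Prop :=
  exists n (b : 'I_n -> C), basis_over K F b /\
    forall v, exists M : 'M[completion K v]_n,
      (forall j, t v * emb F v (b j) =
         \sum_i base_change F (M i j) * emb F v (b i)) /\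
      s v = \det M.

(* The subgroup K^* N_{F/K}(A_F^* ) of A_K^*. *)
Definition norm_group K F : set (idele K) :=
  [set s : idele K | exists k (t : idele F) (n : idele K),
     [/\ nf_set K k, k != 0, idele_norm t n & s = ideleM (principal K k) n]].
Arguments norm_group K F _ : clear implicits.

(* [loc K w n] is w^n localised at w, so that for p in w the set
   [clos K (Fin p) (loc K w n)] consists of the elements of
   K_p = \prod_(w' | p) K_w' whose w-component is in w^n O_(K_w). *)
Definition loc K (w : set C) (n : nat) : set C :=
  [set x | nf_set K x /\ exists b,
     [/\ ints K b, ~ w b & ideal_exp (ints K) w n (b * x)]].

(* The image of K_w^* in A_K^*. *)
Definition supported_at K (w : set C) : set (idele K) :=
  [set s : idele K | s Infty = 1 /\
     forall w' p, nonzero_prime K w' -> w' (val p)%:R -> w' <> w ->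
       forall n, clos K (Fin p) (loc K w' n) (s (Fin p) - 1)].

(* The image in A_K^* of 1 + w^n O_(K_w), of O_(K_w)^* if n = 0. *)
Definition local_units K (w : set C) (n : nat) : set (idele K) :=
  [set s : idele K | supported_at w s /\
     forall p, w (val p)%:R ->
       if n == 0%N then
         clos K (Fin p) (loc K w 0) (s (Fin p)) /\
         clos K (Fin p) (loc K w 0) (iinv s (Fin p))
       else clos K (Fin p) (loc K w n) (s (Fin p) - 1)].

Definition uniformizer K (w : set C) : set (idele K) :=
  [set s : idele K | supported_at w s /\
     forall p, w (val p)%:R ->
       clos K (Fin p) (loc K w 1) (s (Fin p)) /\
       ~ clos K (Fin p) (loc K w 2) (s (Fin p))].

Definition residue_card K (w : set C) (q : nat) : Prop :=
  exists r : 'I_q -> C, (forall i, ints K (r i)) /\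
    forall x, ints K x -> exists! i, w (x - r i).

Definition unramified L (w : set C) : Prop :=
  forall P, nonzero_prime L P -> w `<=` P -> ~ (w `<=` ideal_mul P P).

(* The global Artin map [., K] : A_K^* -> Gal(K^ab / K) (arithmetic Frobenius
   normalisation), as provided by the reciprocity law; [art s] is only
   meaningful on [max_abelian K]. *)
Record is_artin_map K (art : idele K -> C -> C) : Prop := IsArtinMap {
  artin_gal : forall s, gal (max_abelian K) K (art s);
  artin_mul : forall s t x, max_abelian K x ->
    art (ideleM s t) x = art s (art t x);
  artin_principal : forall k x, nf_set K k -> k != 0 -> max_abelian K x ->
    art (principal K k) x = x;
  artin_continuous : forall s x, max_abelian K x ->
    \forall t \near idele_nbhs s, art t x = art s x;
  artin_frobenius : forall (L : numField C) w q s P x,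
    abelian_ext K L -> nonzero_prime K w -> unramified L w -> residue_card K w q ->
    uniformizer w s -> nonzero_prime L P -> w `<=` P -> ints L x ->
    P (art s x - x ^+ q);
  artin_surjective : forall (L : numField C) g, abelian_ext K L -> gal L K g ->
    exists s, forall x, nf_set L x -> art s x = g x;
  artin_kernel : forall (L : numField C) s, abelian_ext K L ->
    ((forall x, nf_set L x -> art s x = x) <-> norm_group K L s) }.

Record is_hecke_char K (phi : idele K -> C) : Prop := IsHeckeChar {
  hecke_neq0 : forall s, phi s != 0;
  hecke_mul : forall s t, phi (ideleM s t) = phi s * phi t;
  hecke_principal : forall k, nf_set K k -> k != 0 -> phi (principal K k) = 1;
  hecke_continuous : forall s, phi @ idele_nbhs s --> phi s }.

Definition conductor_exp K (phi : idele K -> C) (w : set C) (n : nat) : Prop :=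
  (forall s, local_units w n s -> phi s = 1) /\
  forall m, (forall s, local_units (K := K) w m s -> phi s = 1) -> (n <= m)%N.

(* [f] is the product of the w^(e w); [ws] lists all primes with [e w != 0]. *)
Definition is_conductor K (phi : idele K -> C) (f : set C) : Prop :=
  exists (ws : seq (set C)) (e : set C -> nat),
    [/\ uniq ws,
        forall w, w \in ws -> nonzero_prime K w,
        forall w, nonzero_prime K w -> conductor_exp phi w (e w),
        forall w, nonzero_prime K w -> w \notin ws -> e w = 0%N &
        f = \big[ideal_mul/ints K]_(w <- ws) ideal_exp (ints K) w (e w)].

(* The archimedean component in (K (x) R)^* = C^*, for K imaginary quadratic. *)
Definition arch_comp K (s : idele K) : C := lim (rep (s Infty) @ \oo).

Definition span_over L v (A : set (completion L v)) (S : set C) :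
    set (completion L v) :=
  [set x | exists n (a : 'I_n -> completion L v) (l : 'I_n -> C),
     [/\ forall i, A (a i), forall i, S (l i) &
         x = \sum_i a i * emb L v (l i)]].

Definition Zp p : set (completion (@rat_field C) (Fin p)) :=
  clos rat_field (Fin p) ZZ.
Arguments Zp p _ : clear implicits.

(* S (x) Z_p, as a subset of K_p = K (x) Q_p *)
Definition tensorZp K p (S : set C) : set (completion K (Fin p)) :=
  span_over (@base_change C rat_field K (Fin p) @` Zp p) S.
Arguments tensorZp K p S _ : clear implicits.

(* [idele_lattice t La La'] : t . La = La' *)
Definition idele_lattice K (t : idele K) (La La' : set C) : Prop :=
  is_lattice K La' /\
  forall p, tensorZp K p La' =
    [set t (Fin p) * x | x in tensorZp K p La].

(* [idele_point t La z z'] : t . maps the class of z in K / La to the class of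
   z' in K / t . La *)
Definition idele_point K (t : idele K) (La : set C) (z z' : C) : Prop :=
  forall p, [set t (Fin p) * x | x in tensorZp K p La]
    (emb K (Fin p) z' - t (Fin p) * emb K (Fin p) z).

Definition ray_units K (O I : set C) : set (idele K) :=
  [set s : idele K | forall p,
    [/\ tensorZp K p O (s (Fin p)), tensorZp K p O (iinv s (Fin p)) &
        span_over (tensorZp K p O) I (s (Fin p) - 1)]].

Definition ray_class_field K (art : idele K -> C -> C) (O I : set C) : set C :=
  [set x | max_abelian K x /\ forall s, ray_units O I s -> art s x = x].

End ClassFieldTheory.
Arguments tensorZp {C} K p S _.
Arguments Zp {C} p _.
Arguments norm_group {C} K F _.

Section EllipticCurves.
Context {C : numClosedFieldType}.

Record weierstrass := Weierstrass { a1 : C; a2 : C; a3 : C; a4 : C; a6 : C }.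
Implicit Type E : weierstrass.

Definition discriminant E : C :=
  let b2 := a1 E ^+ 2 + 4 * a2 E in
  let b4 := 2 * a4 E + a1 E * a3 E in
  let b6 := a3 E ^+ 2 + 4 * a6 E in
  let b8 := a1 E ^+ 2 * a6 E + 4 * a2 E * a6 E - a1 E * a3 E * a4 E
            + a2 E * a3 E ^+ 2 - a4 E ^+ 2 in
  - b2 ^+ 2 * b8 - 8 * b4 ^+ 3 - 27 * b6 ^+ 2 + 9 * b2 * b4 * b6.

Definition elliptic_curve_over (F : set C) E : Prop :=
  [/\ F (a1 E), F (a2 E), F (a3 E), F (a4 E) & F (a6 E)] /\ discriminant E != 0.

Inductive ecpoint := Origin | Affine of C & C.

Definition on_curve E (P : ecpoint) : Prop :=
  match P with
  | Origin => True
  | Affine x y => y ^+ 2 + a1 E * x * y + a3 E * y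
                  = x ^+ 3 + a2 E * x ^+ 2 + a4 E * x + a6 E
  end.

Definition add E (P Q : ecpoint) : ecpoint :=
  match P, Q with
  | Origin, _ => Q
  | _, Origin => P
  | Affine x1 y1, Affine x2 y2 =>
    if (x1 == x2) && (y1 + y2 + a1 E * x2 + a3 E == 0) then Origin else
    let l := if x1 == x2
             then (3 * x1 ^+ 2 + 2 * a2 E * x1 + a4 E - a1 E * y1)
                  / (2 * y1 + a1 E * x1 + a3 E)
             else (y2 - y1) / (x2 - x1) in
    let x3 := l ^+ 2 + a1 E * l - a2 E - x1 - x2 in
    Affine x3 (- (l + a1 E) * x3 - (y1 - l * x1) - a3 E)
  end.

Definition torsion E : set ecpoint :=
  [set P | on_curve E P /\ exists2 n : nat, (0 < n)%N & iter n (add E P) Origin = Origin].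

Definition coordinates (S : set ecpoint) : set C :=
  [set c | exists x y, S (Affine x y) /\ (c = x \/ c = y)].

Definition map_point (s : C -> C) (P : ecpoint) : ecpoint :=
  match P with Origin => Origin | Affine x y => Affine (s x) (s y) end.

(* [projective X Y Z P] : (X, Y, Z) <> 0 and P = [X : Y : Z] *)
Definition projective (X Y Z : C) (P : ecpoint) : Prop :=
  match P with
  | Origin => [/\ X = 0, Y != 0 & Z = 0]
  | Affine x y => [/\ X = x * Z, Y = y * Z & Z != 0]
  end.

Definition eval_form (d : nat) (c : nat -> nat -> C) (X Y Z : C) : C :=
  \sum_(i < d.+1) \sum_(j < (d - i).+1)
     c i j * X ^+ i * Y ^+ j * Z ^+ (d - i - j).

Definition eval_point (d : nat) (c : nat -> nat -> C) (P : ecpoint) : C :=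
  match P with
  | Origin => eval_form d c 0 1 0
  | Affine x y => eval_form d c x y 1
  end.

(* Morphisms of curves over F, i.e. given Zariski-locally by forms over F, fixing
   the origin. Only the values of [f] on the curve matter. *)
Definition endomorphism_over (F : set C) E (f : ecpoint -> ecpoint) : Prop :=
  [/\ f Origin = Origin,
      forall P, on_curve E P -> on_curve E (f P) &
      forall P, on_curve E P -> exists d (cX cY cZ : nat -> nat -> C),
        [/\ forall i j, [/\ F (cX i j), F (cY i j) & F (cZ i j)],
            projective (eval_point d cX P) (eval_point d cY P) (eval_point d cZ P)
              (f P) &
            forall Q, on_curve E Q ->
              [\/ eval_point d cX Q != 0, eval_point d cY Q != 0
                | eval_point d cZ Q != 0] ->
              projective (eval_point d cX Q) (eval_point d cY Q)
                (eval_point d cZ Q) (f Q)]].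

Definition ring_iso_End (F : set C) E (O : set C) (theta : C -> ecpoint -> ecpoint) :
    Prop :=
  [/\ forall a, O a -> endomorphism_over F E (theta a),
      forall f, endomorphism_over F E f ->
        exists2 a, O a & forall P, on_curve E P -> f P = theta a P,
      forall a b, O a -> O b ->
        (forall P, on_curve E P -> theta a P = theta b P) -> a = b,
      forall P, on_curve E P -> theta 1 P = P &
      forall a b P, O a -> O b -> on_curve E P ->
        theta (a + b) P = add E (theta a P) (theta b P) /\
        theta (a * b) P = theta a (theta b P)].

(* xi : C -> E(C) is holomorphic as a map to the projective plane. *)
Definition holomorphic_to_curve (xi : C -> ecpoint) : Prop :=
  forall z0 : C, exists X Y Z : C -> C, \forall z \near z0,
    [/\ derivable (X : C^o -> C^o) z 1, derivable (Y : C^o -> C^o) z 1,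
        derivable (Z : C^o -> C^o) z 1 & projective (X z) (Y z) (Z z) (xi z)].

(* An isomorphism C / La -> E(C) of complex Lie groups, seen as a map on C.
   The inverse of a bijective holomorphic map is holomorphic. *)
Definition analytic_iso E (La : set C) (xi : C -> ecpoint) : Prop :=
  [/\ [set P | on_curve E P] = range xi,
      forall z z', xi z = xi z' <-> La (z - z'),
      forall z z', xi (z + z') = add E (xi z) (xi z') &
      holomorphic_to_curve xi].

Definition complex_lattice (La : set C) : Prop :=
  exists b : 'I_2 -> C,
    basis_over ZZ La b /\ basis_over [set x | x \is Num.real] setT b.

(* [theta a] is induced by multiplication by [a] on C, for a uniformisation
   C / La = E(C). *)
Definition normalised E (O : set C) (theta : C -> ecpoint -> ecpoint) : Prop :=
  exists La xi, [/\ complex_lattice La, analytic_iso E La xi &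
    forall a z, O a -> theta a (xi z) = xi (a * z)].

Definition ideal_torsion E (theta : C -> ecpoint -> ecpoint) (I : set C) : set ecpoint :=
  [set P | on_curve E P /\ forall a, I a -> theta a P = Origin].

End EllipticCurves.
Arguments weierstrass C : clear implicits.
Arguments ecpoint C : clear implicits.

(* Main.v *)
(* Write z in K / La, where La is a lattice in K with E(C) = C / La, and let s be an
   idele in K^* N(A_F^* ). By hypothesis (ii) the Artin symbol of s acts on the torsion
   points xi(z) as multiplication by t = alpha(s) s^-1, and t stabilises La.

   If an element x of H_I were not in F(E[I]), some automorphism g of an abelian
   extension of K would fix F(E[I]) and move x. Writing g as the Artin symbol of s, the
   idele t acts trivially on I^-1 La / La. Since the multipliers of La are exactly O, t
   lies in U_I, so that the Artin symbols of t, hence of s, fix x.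

   Conversely let u be in U_I with trivial Artin symbol on F. The Hecke character is
   trivial on the part of u away from infinity, because I is contained in the conductor,
   and alpha is trivial on the ideles of C^*: if d alpha(v) is integral and w is a root of
   v close to 1, then d (alpha(w) - 1) is an algebraic integer of K of absolute value
   less than 1. Hence alpha(u) = 1, and u^-1 acts trivially on E[I].

   That the multipliers of La are exactly O uses End_F(E) = O: an endomorphism of C / La
   which becomes rational over F after multiplication by an integer m is itself given by
   forms over F. Indeed its x-coordinate is a rational function of x by a fibre argument,
   and descends to F because it is the quotient of [m a] by [m]. *)
Require Import Defs.
From HB Require Import structures.
From mathcomp Require Import all_boot all_order all_algebra.
From mathcomp Require Import separable closed_field complex ring lra zify.
From mathcomp Require Import all_classical all_reals all_analysis.
Set Implicit Arguments.
Unset Strict Implicit.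
Unset Printing Implicit Defensive.
Import Order.TTheory GRing.Theory Num.Theory numFieldNormedType.Exports.
Local Open Scope classical_set_scope.
Local Open Scope ring_scope.

(** * Polynomials *)

(** Multiplication by a on the torus is not known to be algebraic, and the proof uses no Weierstrass
    functions, only the discreteness of the periods and the continuity of local homogeneous
    coordinates. Hence the detour through f o [m] = [m a], where [m] and [m a] are over F. The
    definition of an endomorphism asks for forms near every point, and the origin and the 2-torsion
    need forms of their own.

    The completions are indexed by rational primes p, while the conductor is local at primes w of K,
    so K_p is cut into the fields K_w by idempotents. Membership in a completed lattice is tested on
    Cauchy representatives. In place of the factorisation of ideals, integral linear relations
    between three elements of K describe the primes above p.

    Galois theory is reduced to two facts: an element outside a subfield is moved by some embedding,
    and a finite orbit is the root set of a polynomial with fixed coefficients. Since F lies in the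
    maximal abelian extension it is abelian over K, and the kernel of the Artin map on F is the norm
    group to which hypothesis (ii) applies. *)

Lemma poly_nonroot (R : numDomainType) (p : {poly R}) : p != 0 -> exists n : nat, p.[n%:R] != 0.
Proof.
move=> p0; apply: contrapT => h.
have := @max_poly_roots _ p [seq n%:R | n <- iota 0 (size p)] p0.
rewrite map_inj_uniq; last by move=> i j /eqP; rewrite eqr_nat => /eqP.
rewrite iota_uniq size_map size_iota ltnn => F; suff: false by []; apply: F => //.
apply/allP => _ /mapP[n _ ->]; rewrite rootE; apply/negP => /negP pn; apply: h; by exists n.
Qed.

(** * Rational functions constant on the fibres of A/B *)

Section FibreConstant.
Variables (k : fieldType) (C : numClosedFieldType) (iota : {rmorphism k -> C}).
Local Notation "p ^@" := (map_poly iota p) (at level 2, format "p ^@").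

Lemma deriv_eq0_num (p : {poly C}) : p^`() = 0 -> (size p <= 1)%N.
Proof.
move=> p0; apply/leq_sizeP => -[//|j] _.
have /eqP : p^`()`_j = 0 by rewrite p0 coef0.
by rewrite coef_deriv mulrn_eq0 /= => /eqP.
Qed.

(** If A'B = AB', coprimality makes B divide B', which has smaller degree, so B' = 0; then A'B = 0
    as well, and in characteristic zero both A and B are constant. *)
Lemma wronskian_neq0 (A B : {poly C}) : coprimep A B ->
  ~~ ((size A <= 1)%N && (size B <= 1)%N) -> A^`() * B - A * B^`() != 0.
Proof.
move=> cAB; apply: contraNneq => /eqP; rewrite subr_eq0 => /eqP e.
have B'0 : B^`() = 0.
  have : B %| B^`() by rewrite -(@Gauss_dvdpr _ B^`() A B) 1?coprimep_sym // -e dvdp_mull.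
  move=> dB; apply/eqP; apply: contraTT dB => B'0; apply/negP => dB.
  have B0 : B != 0 by apply: contraNneq B'0 => ->; rewrite deriv0.
  by have := dvdp_leq B'0 dB; rewrite leqNgt lt_size_deriv.
rewrite (deriv_eq0_num B'0) andbT.
move: e; rewrite B'0 mulr0 => /eqP; rewrite mulf_eq0 => /orP[/eqP/deriv_eq0_num//|/eqP B0].
by move: cAB; rewrite B0 coprimep0 => /eqp_size ->; rewrite size_poly1.
Qed.

Lemma simple_roots_list (p : {poly C}) : p != 0 ->
  (forall x, root p x -> p^`().[x] != 0) ->
  exists rs : seq C, [/\ uniq rs, (size rs).+1 = size p & forall x, x \in rs = root p x].
Proof.
move=> p0 sp; have [rs E] := closed_field_poly_normal p.
have lc0 : lead_coef p != 0 by rewrite lead_coef_eq0.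
have rE x : root p x = (x \in rs) by rewrite E rootZ ?root_prod_XsubC.
exists rs; split=> [||x]; last by rewrite rE.
  rewrite -separable_prod_XsubC.
  have : coprimep p p^`() by apply/Pdiv.ClosedField.coprimepP.
  by rewrite separable_poly.unlock {1 2}E derivZ coprimepZl // coprimepZr.
by rewrite E size_scale // size_prod_XsubC.
Qed.

(** Over a value t, the fibre of A/B is the root set of P = A - tB, a polynomial in x over k[t].
    Reduce N and D modulo P: the remainders have degree in x below that of P, and for generic t the
    remainder of N minus rho t times that of D vanishes on a full set of distinct roots, so it is
    zero. Comparing one coefficient writes rho as a quotient of polynomials in t over [k]. *)
Lemma fibre_constant_rational (A B N D : {poly k}) (rho : C -> C) (W : {poly C}) :
  coprimep A B -> ~~ ((size A <= 1)%N && (size B <= 1)%N) -> D != 0 -> W != 0 ->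
  (forall x, W.[x] != 0 -> B^@.[x] != 0 ->
     N^@.[x] = rho (A^@.[x] / B^@.[x]) * D^@.[x]) ->
  exists (h1 h2 : {poly k}) (V : {poly C}),
    [/\ h2 != 0, V != 0 & forall t, V.[t] != 0 ->
          [/\ h2^@.[t] != 0, h1^@.[t] = rho t * h2^@.[t] &
              exists x, [/\ W.[x] != 0, B^@.[x] != 0 & A^@.[x] / B^@.[x] = t]]].
Proof.
move=> cAB nc D0 W0 hW.
have cAB' : coprimep A^@ B^@ by rewrite coprimep_map.
have nc' : ~~ ((size A^@ <= 1)%N && (size B^@ <= 1)%N) by rewrite !size_map_poly.
(* The outer variable is x; ['X%:P] is the parameter t. *)
pose P : {poly {poly k}} := map_poly polyC A - 'X%:P * map_poly polyC B.
pose U := A^@^`() * B^@ - A^@ * B^@^`().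
have U0 : U != 0 by exact: wronskian_neq0.
have hor (x t : C) : A^@.[x] = t * B^@.[x] -> B^@.[x] != 0.
  move=> e; apply/eqP => B0; move/(Pdiv.ClosedField.coprimepP): cAB' => /(_ x).
  by rewrite rootE e B0 mulr0 eqxx => /(_ isT).
pose spec (t : C) : {poly {poly k}} -> {poly C} :=
  map_poly (fun q : {poly k} => q^@.[t]).
have specP t : spec t P = A^@ - t *: B^@.
  apply/polyP => i; rewrite /spec coef_map_id0; last by rewrite rmorph0 horner0.
  rewrite !coefB coefZ !coef_map /= coefCM coef_map /= rmorphB rmorphM /= map_polyX !map_polyC.
  by rewrite !hornerE.
have P0 : P != 0.
  apply/eqP => P0; have := specP 0; rewrite P0 /spec map_poly0 scale0r subr0 => A0.
  have := specP 1; rewrite P0 /spec map_poly0 scale1r -A0 sub0r => /eqP.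
  by rewrite eq_sym oppr_eq0 => /eqP B0; move: nc'; rewrite -A0 B0 size_poly0.
have specM t q r : spec t (q * r) = spec t q * spec t r.
  pose f : {rmorphism {poly k} -> C} := horner_eval t \o map_poly iota.
  exact: (rmorphM (map_poly f)).
have specD t q r : spec t (q + r) = spec t q + spec t r.
  pose f : {rmorphism {poly k} -> C} := horner_eval t \o map_poly iota.
  exact: (rmorphD (map_poly f)).
have specZ t q r : spec t (q *: r) = q^@.[t] *: spec t r.
  apply/polyP => i; rewrite coefZ /spec !coef_map_id0 ?rmorph0 ?horner0 //=.
  by rewrite coefZ rmorphM hornerM.
have specC t (q : {poly k}) : spec t (map_poly polyC q) = q^@.
  by apply/polyP => i; rewrite /spec !coef_map_id0 ?rmorph0 ?horner0 //= map_polyC hornerC.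
pose l := lead_coef P; have l0 : l != 0 by rewrite lead_coef_eq0.
pose n := (size P).-1.
have nP : size P = n.+1 by rewrite prednK // size_poly_gt0.
have lt0 t : l^@.[t] != 0 -> size (spec t P) = n.+1.
  by move=> lt; rewrite -nP /spec size_map_poly_id0.
have [rW rWE] := closed_field_poly_normal (W * U).
(* [V0] discards the t at which P drops in degree, and the images under A/B of the roots of W and of
   the Wronskian U, which detects multiple points of a fibre. *)
pose V0 : {poly C} := l^@ * \prod_(x <- rW) (B^@.[x] *: 'X - A^@.[x]%:P).
have V00 : V0 != 0.
  rewrite mulf_neq0 ?map_poly_eq0 //; rewrite prodf_seq_neq0; apply/allP => x _ /=; apply/eqP => /polyP e.
  have B0 : B^@.[x] = 0 by have := e 1%N; rewrite coefB coefZ coefX coefC mulr1 subr0 coef0.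
  have A0 : A^@.[x] = 0.
    by have := e 0%N; rewrite coefB coefZ coefX coefC mulr0 sub0r coef0 => /eqP; rewrite oppr_eq0 => /eqP.
  by move/Pdiv.ClosedField.coprimepP: cAB' => /(_ x); rewrite rootE A0 B0 eqxx => /(_ isT).
have gen t : V0.[t] != 0 -> [/\ l^@.[t] != 0, size (spec t P) = n.+1 &
    forall x, root (spec t P) x ->
     [/\ B^@.[x] != 0, W.[x] != 0, U.[x] != 0 & A^@.[x] / B^@.[x] = t]].
  rewrite hornerM mulf_eq0 negb_or => /andP[lt vt]; split=> // [|x]; first exact: lt0.
  move=> rx; have e : A^@.[x] = t * B^@.[x].
    by move: rx; rewrite specP rootE !hornerE subr_eq0 => /eqP.
  have B0 : B^@.[x] != 0 by exact: hor e.
  have : ~~ root (W * U) x.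
    apply: contra vt; rewrite rWE rootZ ?lead_coef_eq0 ?mulf_neq0 // root_prod_XsubC => xr.
    by rewrite horner_prod (big_rem x) //= !hornerE e [t * _]mulrC subrr mul0r.
  rewrite rootE hornerM mulf_eq0 negb_or => /andP[-> ->]; split=> //.
  by rewrite e mulfK.
have roots t : V0.[t] != 0 -> exists rs : seq C, [/\ uniq rs, size rs = n & forall x, x \in rs = root (spec t P) x].
  move=> /gen[lt sz h].
  have p0 : spec t P != 0 by rewrite -size_poly_gt0 sz.
  have [|rs [u e1 e2]] := simple_roots_list p0.
    move=> x rx; have [B0 _ Ux tE] := h x rx.
    apply: contraNneq Ux; rewrite specP derivB derivZ !hornerE => /eqP.
    rewrite subr_eq0 => /eqP e.
    rewrite e; have -> : A^@.[x] = t * B^@.[x] by rewrite -tE divfK.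
    by apply/eqP; ring.
  by exists rs; split=> //; move: e1; rewrite sz => -[].
pose NN := map_poly polyC N; pose DD := map_poly polyC D.
pose kN := scalp NN P; pose kD := scalp DD P.
(* Pseudo-division scales N by l^kN and D by l^kD; the exponents are exchanged so that both
   remainders carry the same factor l^(kN + kD). *)
pose al := l ^+ kD *: (NN %% P)%R; pose be := l ^+ kN *: (DD %% P).
have alE : l ^+ (kN + kD) *: NN = (l ^+ kD *: (NN %/ P)) * P + al.
  by rewrite addnC exprD -scalerA Pdiv.Idomain.divp_eq scalerDr scalerAl.
have beE : l ^+ (kN + kD) *: DD = (l ^+ kN *: (DD %/ P)) * P + be.
  by rewrite exprD -scalerA Pdiv.Idomain.divp_eq scalerDr scalerAl.
have sal : (size al < n.+1)%N.
  by rewrite -nP (leq_ltn_trans (size_scale_leq _ _)) // Pdiv.Idomain.ltn_modp.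
have sbe : (size be < n.+1)%N.
  by rewrite -nP (leq_ltn_trans (size_scale_leq _ _)) // Pdiv.Idomain.ltn_modp.
have valN t x : root (spec t P) x -> (l ^+ (kN + kD))^@.[t] * N^@.[x] = (spec t al).[x].
  move=> /rootP rx; have := congr1 (fun q => (spec t q).[x]) alE.
  by rewrite /= specD specM specZ specC !hornerE rx mulr0 add0r.
have valD t x : root (spec t P) x -> (l ^+ (kN + kD))^@.[t] * D^@.[x] = (spec t be).[x].
  move=> /rootP rx; have := congr1 (fun q => (spec t q).[x]) beE.
  by rewrite /= specD specM specZ specC !hornerE rx mulr0 add0r.
(* If D reduced to zero modulo P, it would vanish on all generic fibres; Z collects the conditions
   that make an x generic with D nonzero. *)
have be0 : be != 0.
  apply/eqP => be0; have [rV rVE] := closed_field_poly_normal V0.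
  pose Z := D^@ * B^@ * \prod_(t <- rV) (A^@ - t *: B^@).
  have Bn0 : B^@ != 0.
    apply/eqP => b0; move: cAB' nc'; rewrite b0 coprimep0 => /eqp_size ->.
    by rewrite size_poly1 size_poly0.
  have Z0 : Z != 0.
    rewrite !mulf_neq0 ?map_poly_eq0 //; first by rewrite -(map_poly_eq0 iota).
    rewrite prodf_seq_neq0; apply/allP => t _ /=; apply/eqP => /eqP.
    rewrite subr_eq0 => /eqP e; have := cAB'; rewrite e.
    have [t0|t0] := eqVneq t 0.
      rewrite t0 scale0r coprime0p => /eqp_size sB; move: nc'.
      by rewrite sB size_poly1 e t0 scale0r size_poly0.
    rewrite coprimepZl // coprimepp => /eqP sB; move: nc'.
    by rewrite sB e size_scale // sB.
  have [x Zx] : exists x, Z.[x] != 0.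
    by have [n0] := poly_nonroot Z0; exists n0%:R.
  move: Zx; rewrite !hornerM !mulf_eq0 !negb_or -andbA => /and3P[Dx Bx px].
  pose t := A^@.[x] / B^@.[x].
  have tE : A^@.[x] = t * B^@.[x] by rewrite divfK.
  have vt : V0.[t] != 0.
    apply: contraNneq px => vt.
    have tr : t \in rV by rewrite -root_prod_XsubC -(@rootZ _ _ (lead_coef V0)) ?lead_coef_eq0 // -rVE; apply/rootP.
    by rewrite horner_prod (big_rem t) //= !hornerE tE subrr mul0r.
  have [lt _ _] := gen t vt.
  have rx : root (spec t P) x by rewrite rootE specP !hornerE tE subrr.
  have /eqP := valD t x rx; rewrite be0 /spec map_poly0 horner0 mulf_eq0 (negPf Dx) orbF.
  by rewrite rmorphXn /= horner_exp expf_eq0 (negPf lt) andbF.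
have [j bj] : exists j, be`_j != 0.
  exists (size be).-1; by rewrite -/(lead_coef be) lead_coef_eq0.
exists al`_j, be`_j, (V0 * (be`_j)^@); split=> //.
  by rewrite mulf_neq0 // map_poly_eq0.
move=> t; rewrite hornerM mulf_eq0 negb_or => /andP[vt bt].
have [rs [u srs rsE]] := roots t vt; have [lt sz h] := gen t vt.
split=> //; last first.
  have n0 : (0 < n)%N.
    rewrite lt0n; apply: contra bj => /eqP n0; move: sbe; rewrite n0 ltnS leqn0 size_poly_eq0.
    by move/eqP => ->; rewrite coef0.
  case: rs srs rsE {u} => [e|x rs _ rsE]; first by rewrite -e in n0.
  have /h[Bx Wx _ tE] : root (spec t P) x by rewrite -rsE mem_head.
  by exists x.
(* The left side has degree below n and vanishes at the n distinct points of the fibre. *)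
have /eqP : spec t al - rho t *: spec t be == 0.
  apply: contraTT (leqnn n) => d0; rewrite -ltnNge -{1}srs.
  apply: leq_trans (max_poly_roots d0 _ u) _; last first.
    apply: leq_trans (size_polyD _ _) _; rewrite size_polyN geq_max.
    apply/andP; split; first by apply: leq_trans (size_poly _ _) _; rewrite -ltnS.
    apply: leq_trans (size_scale_leq _ _) _.
    by apply: leq_trans (size_poly _ _) _; rewrite -ltnS.
  apply/allP => x; rewrite rsE => rx; have [B0 Wx _ tE] := h x rx.
  by rewrite rootE !hornerE -valN // -valD // hW // tE; apply/eqP; ring.
move=> /polyP /(_ j); rewrite coefB coefZ coef0 /spec !coef_map_id0 ?rmorph0 ?horner0 //.
by move/eqP; rewrite subr_eq0 => /eqP.
Qed.
End FibreConstant.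

(** * Rational maps of Weierstrass curves *)

Definition cubic_poly (k : nzRingType) (u3 u2 u1 u0 : k) : {poly k} :=
  u3%:P * 'X^3 + u2%:P * 'X^2 + u1%:P * 'X + u0%:P.

Section Cubic.
Variables (k : fieldType) (C : fieldType) (iota : {rmorphism k -> C}) (u3 u2 u1 u0 : k).

Lemma map_cubic : map_poly iota (cubic_poly u3 u2 u1 u0) =
  cubic_poly (iota u3) (iota u2) (iota u1) (iota u0).
Proof.
by rewrite /cubic_poly !rmorphD !rmorphM /= !map_polyC !map_polyX.
Qed.

Lemma cubic_horner x : (map_poly iota (cubic_poly u3 u2 u1 u0)).[x] =
  iota u3 * x ^+ 3 + iota u2 * x ^+ 2 + iota u1 * x + iota u0.
Proof. by rewrite map_cubic /cubic_poly !hornerE. Qed.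

Lemma cubic_deriv_horner x : (map_poly iota (cubic_poly u3 u2 u1 u0))^`().[x] =
  3 * iota u3 * x ^+ 2 + 2 * iota u2 * x + iota u1.
Proof. by rewrite map_cubic /cubic_poly !mul_polyC 3!derivD 3!derivZ 2!derivXn derivX derivC !hornerE /=; ring. Qed.

End Cubic.

Lemma size_cubic (k : fieldType) (u3 u2 u1 u0 : k) : u3 != 0 ->
  size (cubic_poly u3 u2 u1 u0) = 4%N.
Proof.
move=> u30; rewrite /cubic_poly -!addrA mul_polyC size_polyDl ?size_scale ?size_polyXn //.
rewrite ltnS (leq_trans (size_polyD _ _)) // geq_max mul_polyC.
rewrite (leq_trans (size_scale_leq _ _)) ?size_polyXn //=.
rewrite (leq_trans (size_polyD _ _)) // geq_max mul_polyC.
rewrite (leq_trans (size_scale_leq _ _)) ?size_polyX //=.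
by rewrite (leq_trans (size_polyC_leq1 _)).
Qed.

Section CurveFunctions.
Variables (k : fieldType) (C : numClosedFieldType) (iota : {rmorphism k -> C}).
Local Notation "p ^@" := (map_poly iota p) (at level 2, format "p ^@").

Variable E : weierstrass C.

(** Completes the square: eta^2 is a cubic in x on the curve, eta changes sign under negation, and
    it vanishes at the points of order two. *)
Definition curve_eta (x y : C) : C := 2 * y + a1 E * x + a3 E.

Definition negp (P : ecpoint C) : ecpoint C :=
  match P with Origin => Origin | Affine x y => Affine x (- y - a1 E * x - a3 E) end.

(** The cubic 4x^3 + b2 x^2 + 2 b4 x + b6, which equals eta^2 on the curve. It is locked so that
    simplification treats it as an atom. *)
Definition two_division (al1 al2 al3 al4 al6 : k) : {poly k} :=
  let b2 := al1 ^+ 2 + 4 * al2 in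
  let b4 := 2 * al4 + al1 * al3 in
  let b6 := al3 ^+ 2 + 4 * al6 in
  locked (cubic_poly 4 b2 (2 * b4) b6).

Variables (al1 al2 al3 al4 al6 : k).
Hypotheses (e1 : a1 E = iota al1) (e2 : a2 E = iota al2) (e3 : a3 E = iota al3)
  (e4 : a4 E = iota al4) (e6 : a6 E = iota al6).
Hypothesis (dE : discriminant E != 0).
Local Notation c := (two_division al1 al2 al3 al4 al6).

Lemma two_division_horner x : c^@.[x] =
  4 * x ^+ 3 + (a1 E ^+ 2 + 4 * a2 E) * x ^+ 2 + 2 * (2 * a4 E + a1 E * a3 E) * x
  + (a3 E ^+ 2 + 4 * a6 E).
Proof.
by rewrite /two_division -lock cubic_horner e1 e2 e3 e4 e6 !(rmorph_nat, rmorphXn, rmorphD, rmorphM); ring.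
Qed.

Lemma on_curveE x y : on_curve E (Affine x y) <-> curve_eta x y ^+ 2 = c^@.[x].
Proof.
rewrite two_division_horner /curve_eta /=; split=> h.
  transitivity (4 * (y ^+ 2 + a1 E * x * y + a3 E * y) + (a1 E * x + a3 E) ^+ 2); first by ring.
  by rewrite h; ring.
have n4 : 4%:R != 0 :> C by rewrite pnatr_eq0.
apply: (mulfI n4); transitivity (curve_eta x y ^+ 2 - (a1 E * x + a3 E) ^+ 2); first by rewrite /curve_eta; ring.
by rewrite /curve_eta h; ring.
Qed.

Lemma eta_neg x y : curve_eta x (- y - a1 E * x - a3 E) = - curve_eta x y.
Proof. by rewrite /curve_eta; ring. Qed.

Lemma on_curve_neg P : on_curve E P -> on_curve E (negp P).
Proof. by case: P => // x y /on_curveE h; apply/on_curveE; rewrite eta_neg sqrrN. Qed.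

Lemma curve_point x : exists y, on_curve E (Affine x y).
Proof.
exists ((sqrtC c^@.[x] - a1 E * x - a3 E) / 2); apply/on_curveE.
rewrite /curve_eta [2 * _]mulrC divfK ?pnatr_eq0 // -[RHS]sqrtCK; ring.
Qed.

Lemma eta_inj x y y' : curve_eta x y = curve_eta x y' -> y = y'.
Proof.
have n2 : 2%:R != 0 :> C by rewrite pnatr_eq0.
by rewrite /curve_eta => /addIr/addIr/(mulfI n2).
Qed.

Lemma same_abscissa x y y' : on_curve E (Affine x y) -> on_curve E (Affine x y') ->
  Affine x y' = Affine x y \/ Affine x y' = negp (Affine x y).
Proof.
move=> /on_curveE h /on_curveE h'; have /eqP : curve_eta x y' ^+ 2 == curve_eta x y ^+ 2 by rewrite h h'.
move/eqP; rewrite eqf_sqr => /orP[/eqP e|/eqP e]; [left|right].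
  by congr Affine; exact: eta_inj e.
by congr Affine; apply: (@eta_inj x); rewrite eta_neg.
Qed.

(** At a double root the two equations can be solved for b4 and b6. Substituted into 4 times the
    discriminant, with 4 b8 = b2 b6 - b4^2, they give zero identically. *)
Lemma two_division_simple x : c^@.[x] = 0 -> c^@^`().[x] != 0.
Proof.
move=> c0; apply: contraNneq dE.
have -> : c^@^`().[x] = 12 * x ^+ 2 + 2 * (a1 E ^+ 2 + 4 * a2 E) * x + 2 * (2 * a4 E + a1 E * a3 E).
  by rewrite /two_division -lock cubic_deriv_horner e1 e2 e3 e4 !(rmorph_nat, rmorphXn, rmorphD, rmorphM); ring.
move: c0; rewrite two_division_horner /discriminant.
set b2 := a1 E ^+ 2 + 4 * a2 E; set b4 := 2 * a4 E + a1 E * a3 E; set b6 := a3 E ^+ 2 + 4 * a6 E.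
set b8 := _ - a4 E ^+ 2; have b8E : 4 * b8 = b2 * b6 - b4 ^+ 2 by rewrite /b8 /b2 /b4 /b6; ring.
move=> c0 c1; have n2 : 2%:R != 0 :> C by rewrite pnatr_eq0.
have n4 : 4%:R != 0 :> C by rewrite pnatr_eq0.
have b4E : b4 = - 6 * x ^+ 2 - b2 * x.
  by apply: (mulfI n2); apply/eqP; rewrite -subr_eq0 -[X in _ == X]c1; apply/eqP; ring.
have b6E : b6 = 8 * x ^+ 3 + b2 * x ^+ 2.
  by apply/eqP; rewrite -subr_eq0 -[X in _ == X]c0 b4E; apply/eqP; ring.
apply/eqP/(mulfI n4); rewrite mulr0.
transitivity (- b2 ^+ 2 * (4 * b8) - 4 * 8 * b4 ^+ 3 - 4 * 27 * b6 ^+ 2 + 4 * 9 * b2 * b4 * b6); first by ring.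
by rewrite b8E b4E b6E; ring.
Qed.

Lemma size_two_division : size c = 4%N.
Proof.
by rewrite /two_division -lock size_cubic // -(fmorph_eq0 iota) rmorph_nat pnatr_eq0.
Qed.

(** This is the norm of q0 + q1 eta down to k[x]. The first square has even degree and the second
    term odd degree, so they cannot cancel. *)
Lemma norm_neq0 (q0 q1 : {poly k}) : (q0 != 0) || (q1 != 0) -> q0 ^+ 2 - q1 ^+ 2 * c != 0.
Proof.
have c0 : c != 0 by rewrite -size_poly_gt0 size_two_division.
rewrite subr_eq0; have [->|q1n] := eqVneq q1 0.
  by rewrite orbF expr0n mul0r expf_eq0.
move=> _; apply/eqP => /(congr1 (fun p : {poly k} => size p)).
have [->|q0n] := eqVneq q0 0.
  by rewrite expr0n /= size_poly0 => /esym/eqP; rewrite size_poly_eq0 mulf_eq0 expf_eq0 (negPf q1n) (negPf c0).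
rewrite !expr2 !size_mul ?mulf_neq0 // size_two_division.
have : (0 < size q0)%N by rewrite size_poly_gt0.
have : (0 < size q1)%N by rewrite size_poly_gt0.
by move: (size q0) (size q1) => [|a] [|b] // _ _; clear; lia.
Qed.

(** The coordinate ring of the affine curve as k[x] + k[x] eta; the two summands are the even and
    the odd functions under negation. *)
Definition regular_fun (phi : C -> C -> C) := exists q0 q1 : {poly k},
  forall x y, on_curve E (Affine x y) -> phi x y = q0^@.[x] + q1^@.[x] * curve_eta x y.

Lemma regularD phi psi : regular_fun phi -> regular_fun psi ->
  regular_fun (fun x y => phi x y + psi x y).
Proof.
move=> [p0 [p1 hp]] [q0 [q1 hq]]; exists (p0 + q0), (p1 + q1) => x y xy.
by rewrite hp // hq // !rmorphD /= !hornerD; ring.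
Qed.

Lemma regularM phi psi : regular_fun phi -> regular_fun psi ->
  regular_fun (fun x y => phi x y * psi x y).
Proof.
move=> [p0 [p1 hp]] [q0 [q1 hq]]; exists (p0 * q0 + p1 * q1 * c), (p0 * q1 + p1 * q0) => x y xy.
rewrite hp // hq // !(rmorphD, rmorphM) /= !(hornerD, hornerM).
by move/on_curveE: xy => <-; ring.
Qed.

Lemma regularC (a : k) : regular_fun (fun _ _ => iota a).
Proof. by exists a%:P, 0 => x y _; rewrite map_polyC rmorph0 hornerC horner0 mul0r addr0. Qed.

Lemma regularX : regular_fun (fun x _ => x).
Proof. by exists 'X, 0 => x y _; rewrite map_polyX rmorph0 hornerX horner0 mul0r addr0. Qed.

Lemma regularY : regular_fun (fun _ y => y).
Proof.
have n2 : 2%:R != 0 :> C by rewrite pnatr_eq0.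
exists (- (al1 / 2) *: 'X - (al3 / 2)%:P), (1 / 2)%:P => x y _.
rewrite rmorphB /= linearZ /= map_polyX !map_polyC !hornerE /curve_eta e1 e3 /=.
rewrite !(rmorphN, fmorph_div, rmorph_nat, rmorph1).
by field.
Qed.

Lemma regular_sum n (phi : 'I_n -> C -> C -> C) : (forall i, regular_fun (phi i)) ->
  regular_fun (fun x y => \sum_i phi i x y).
Proof.
elim: n phi => [|n IH] phi h.
  have [q0 [q1 h0]] := regularC 0; exists q0, q1 => x y xy.
  by rewrite big_ord0 -h0 // rmorph0.
have [q0 [q1 hq]] := regularD (h ord0) (IH _ (fun i => h (lift ord0 i))).
by exists q0, q1 => x y xy; rewrite big_ord_recl hq.
Qed.

Lemma regularXn phi n : regular_fun phi -> regular_fun (fun x y => phi x y ^+ n).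
Proof.
move=> h; elim: n => [|n IH].
  by have [q0 [q1 hq]] := regularC 1; exists q0, q1 => x y xy; rewrite -hq // rmorph1 expr0.
by have [q0 [q1 hq]] := regularM h IH; exists q0, q1 => x y xy; rewrite exprS hq.
Qed.

Lemma regular_form d (cc : nat -> nat -> C) : (forall i j, range iota (cc i j)) ->
  regular_fun (fun x y => eval_form d cc x y 1).
Proof.
move=> hc; apply: regular_sum => i; apply: regular_sum => j.
have [a _ ea] := hc i j; rewrite -ea.
do 3! [apply: regularM; last by apply: regularXn; first [exact: regularX | exact: regularY |
   have [q0 [q1 hq]] := regularC 1; exists q0, q1 => x y xy; rewrite -hq // rmorph1]].
exact: regularC.
Qed.

End CurveFunctions.

(** * Rational representation of maps commuting with negation *)

Section RationalRepresentation.
Variables (k : fieldType) (C : numClosedFieldType) (iota : {rmorphism k -> C}).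
Local Notation "p ^@" := (map_poly iota p) (at level 2, format "p ^@").
Variable E : weierstrass C.
Local Notation eta := (curve_eta E).
Local Notation negp := (negp E).

(* f (x, y) = (A/B (x), y') with eta (f (x, y)) = eta (x, y) S/T (x), for all
   but finitely many x *)
Definition ratrep (f : ecpoint C -> ecpoint C) (A B S T : {poly k}) : Prop :=
  [/\ B != 0, T != 0 & exists2 W : {poly C}, W != 0 &
    forall x y, on_curve E (Affine x y) -> W.[x] != 0 ->
      exists x' y', [/\ f (Affine x y) = Affine x' y',
        x' * B^@.[x] = A^@.[x] & eta x' y' * T^@.[x] = eta x y * S^@.[x]]].

Lemma ratrep_neq0 f A B S T : ratrep f A B S T -> exists2 W : {poly C}, W != 0 &
    forall x y, on_curve E (Affine x y) -> W.[x] != 0 ->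
      exists x' y', [/\ f (Affine x y) = Affine x' y', B^@.[x] != 0, T^@.[x] != 0,
        x' * B^@.[x] = A^@.[x] & eta x' y' * T^@.[x] = eta x y * S^@.[x]].
Proof.
move=> [B0 T0 [W W0 hW]]; exists (W * B^@ * T^@).
  by rewrite !mulf_neq0 ?map_poly_eq0.
move=> x y xy; rewrite !hornerM !mulf_eq0 !negb_or -andbA => /and3P[Wx Bx Tx].
by have [x' [y' [h1 h2 h3]]] := hW x y xy Wx; exists x', y'.
Qed.

Lemma ratrep_coprime f A B S T : ratrep f A B S T ->
  exists A' B' S' T', [/\ coprimep A' B', coprimep S' T' & ratrep f A' B' S' T'].
Proof.
move=> r; have [B0 T0 _] := r; have [W W0 hW] := ratrep_neq0 r.
pose g := gcdp A B; pose g' := gcdp S T.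
have g0 : g != 0 by rewrite gcdp_eq0 negb_and B0 orbT.
have g0' : g' != 0 by rewrite gcdp_eq0 negb_and T0 orbT.
have AE : A = A %/ g * g by rewrite divpK ?dvdp_gcdl.
have BE : B = B %/ g * g by rewrite divpK ?dvdp_gcdr.
have SE : S = S %/ g' * g' by rewrite divpK ?dvdp_gcdl.
have TE : T = T %/ g' * g' by rewrite divpK ?dvdp_gcdr.
exists (A %/ g), (B %/ g), (S %/ g'), (T %/ g'); split.
- by apply: coprimep_div_gcd; rewrite B0 orbT.
- by apply: coprimep_div_gcd; rewrite T0 orbT.
split; [by move: B0; rewrite {1}BE mulf_eq0 negb_or => /andP[] |
        by move: T0; rewrite {1}TE mulf_eq0 negb_or => /andP[] |].
exists W => // x y xy Wx; have [x' [y' [h1 Bx Tx h2 h3]]] := hW x y xy Wx.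
exists x', y'; split=> //.
  have gx : g^@.[x] != 0 by move: Bx; rewrite {1}BE rmorphM hornerM mulf_eq0 negb_or => /andP[].
  by apply: (mulIf gx); rewrite -mulrA -!hornerM -!rmorphM -BE -AE.
have gx : g'^@.[x] != 0 by move: Tx; rewrite {1}TE rmorphM hornerM mulf_eq0 negb_or => /andP[].
by apply: (mulIf gx); rewrite -!mulrA -!hornerM -!rmorphM -TE -SE.
Qed.

Lemma norm_horner (q0 q1 r : {poly k}) x :
  (q0 ^+ 2 - q1 ^+ 2 * r)^@.[x] = q0^@.[x] ^+ 2 - q1^@.[x] ^+ 2 * r^@.[x].
Proof. by rewrite !expr2 !(rmorphB, rmorphM) /= !(hornerD, hornerN, hornerM). Qed.

Variables (al1 al2 al3 al4 al6 : k).
Hypotheses (e1 : a1 E = iota al1) (e2 : a2 E = iota al2) (e3 : a3 E = iota al3)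
  (e4 : a4 E = iota al4) (e6 : a6 E = iota al6).
Hypothesis (dE : discriminant E != 0).
Local Notation c := (two_division al1 al2 al3 al4 al6).

Let onE := @on_curveE _ _ iota E _ _ _ _ _ e1 e2 e3 e4 e6.

Lemma on_curve_negp P : on_curve E P -> on_curve E (negp P).
Proof. exact: (on_curve_neg e1 e2 e3 e4 e6). Qed.

(** Near a point, forms give the coordinates X, Y, Z as elements p0 + p1 eta. Multiplying by the
    conjugate z0 - z1 eta of Z makes the denominator the norm of Z, a polynomial in x. Since h
    commutes with negation, averaging the formulas at P and at -P kills the odd part of the abscissa
    and the even part of eta. *)
Lemma endomorphism_ratrep (h : ecpoint C -> ecpoint C) :
  endomorphism_over (range iota) E h ->
  (forall P, on_curve E P -> h (negp P) = negp (h P)) ->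
  (forall W : {poly C}, W != 0 -> exists x y,
     [/\ on_curve E (Affine x y), W.[x] != 0 & h (Affine x y) <> Origin]) ->
  exists A B S T, ratrep h A B S T.
Proof.
move=> [_ hE forms] hneg hO.
have [x0 [y0 [xy0 _ _]]] := hO 1 (oner_neq0 _).
have [d [cX [cY [cZ [cF pr0 pr]]]]] := forms _ xy0.
have rX := regular_form e1 e2 e3 e4 e6 d (fun i j => let: And3 a _ _ := cF i j in a).
have rY := regular_form e1 e2 e3 e4 e6 d (fun i j => let: And3 _ a _ := cF i j in a).
have rZ := regular_form e1 e2 e3 e4 e6 d (fun i j => let: And3 _ _ a := cF i j in a).
pose eX := eval_form d cX; pose eY := eval_form d cY; pose eZ := eval_form d cZ.
have rH : regular_fun iota E (fun x y => 2 * eY x y 1 + a1 E * eX x y 1 + a3 E * eZ x y 1).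
  have r2 : regular_fun iota E (fun _ _ => 2).
    by have [q0 [q1 hq]] := regularC iota E 2; exists q0, q1 => x y xy; rewrite -hq // rmorph_nat.
  rewrite e1 e3; apply: (regularD _ (regularM e1 e2 e3 e4 e6 (regularC _ _ _) rZ)).
  exact: (regularD (regularM e1 e2 e3 e4 e6 r2 rY) (regularM e1 e2 e3 e4 e6 (regularC _ _ _) rX)).
have [x0' [x1 hX]] := rX; have [yy0 [yy1 hY]] := rY; have [z0 [z1 hZ]] := rZ; have [t0 [t1 hH]] := rH.
rewrite -/eX in hX; rewrite -/eY in hY; rewrite -/eZ in hZ.
have norm0 (q0 q1 : {poly k}) x y : on_curve E (Affine x y) ->
    (q0 ^+ 2 - q1 ^+ 2 * c)^@.[x] != 0 -> q0^@.[x] + q1^@.[x] * eta x y != 0.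
  move=> /onE xy; apply: contraNneq => e0.
  rewrite norm_horner -xy.
  by rewrite -exprMn subr_sqr e0 mulr0.
have nzpair (q0 q1 : {poly k}) (phi : C -> C -> C) :
    (forall x y, on_curve E (Affine x y) -> phi x y = q0^@.[x] + q1^@.[x] * eta x y) ->
    phi x0 y0 != 0 -> (q0 != 0) || (q1 != 0).
  move=> hq; apply: contraNT; rewrite negb_or !negbK => /andP[/eqP q0E /eqP q1E].
  by rewrite hq // q0E q1E rmorph0 !horner0 mul0r addr0.
(* One of the three coordinates is nonzero at the base point; off the roots of its norm the forms
   represent h. *)
have [N N0 hN] : exists2 N : {poly C}, N != 0 & forall x y, on_curve E (Affine x y) -> N.[x] != 0 ->
   projective (eX x y 1) (eY x y 1) (eZ x y 1) (h (Affine x y)).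
  have nn := norm_neq0 iota al1 al2 al3 al4 al6.
  have : [\/ eX x0 y0 1 != 0, eY x0 y0 1 != 0 | eZ x0 y0 1 != 0].
    move: pr0; rewrite /projective; case: (h _) => [[_ ? _]|u v [_ _ ?]]; first by constructor 2.
    by constructor 3.
  case=> nz.
  - exists (x0' ^+ 2 - x1 ^+ 2 * c)^@ => [|x y xy Nx]; first by rewrite map_poly_eq0 nn // (nzpair _ _ _ hX nz).
    by apply: (pr _ xy); constructor 1; rewrite /= -/eX hX // norm0.
  - exists (yy0 ^+ 2 - yy1 ^+ 2 * c)^@ => [|x y xy Nx]; first by rewrite map_poly_eq0 nn // (nzpair _ _ _ hY nz).
    by apply: (pr _ xy); constructor 2; rewrite /= -/eY hY // norm0.
  - exists (z0 ^+ 2 - z1 ^+ 2 * c)^@ => [|x y xy Nx]; first by rewrite map_poly_eq0 nn // (nzpair _ _ _ hZ nz).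
    by apply: (pr _ xy); constructor 3; rewrite /= -/eZ hZ // norm0.
pose Nz := z0 ^+ 2 - z1 ^+ 2 * c.
have Nz0 : Nz != 0.
  apply: (norm_neq0 iota).
  rewrite -negb_and; apply/negP => /andP[/eqP z00 /eqP z10].
  have [x [y [xy Nx nO]]] := hO N N0; have := hN x y xy Nx.
  have ez : eZ x y 1 = 0 by rewrite hZ // z00 z10 rmorph0 !horner0 mul0r addr0.
  by rewrite ez; case: (h _) nO => // u v _ [_ _]; rewrite eqxx.
have c0 : c != 0 by rewrite -size_poly_gt0 (size_two_division iota).
exists (x0' * z0 - x1 * z1 * c), Nz, (t1 * z0 - t0 * z1), Nz; split=> //.
exists (Nz^@ * c^@ * N); first by rewrite !mulf_neq0 ?map_poly_eq0.
have key x y : on_curve E (Affine x y) -> Nz^@.[x] != 0 -> N.[x] != 0 ->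
   exists x' y', [/\ h (Affine x y) = Affine x' y',
     x' * Nz^@.[x] = (x0' * z0 - x1 * z1 * c)^@.[x] + (x1 * z0 - x0' * z1)^@.[x] * eta x y &
     eta x' y' * Nz^@.[x] = (t0 * z0 - t1 * z1 * c)^@.[x] + (t1 * z0 - t0 * z1)^@.[x] * eta x y].
  move=> xy Nzx Nx; have := hN x y xy Nx.
  have ez : eZ x y 1 != 0 by rewrite hZ // norm0.
  have eN : Nz^@.[x] = eZ x y 1 * (z0^@.[x] - z1^@.[x] * eta x y).
    rewrite hZ // /Nz norm_horner.
    by move/onE: xy => <-; ring.
  case: (h _) => [[_ _ z]|x' y' [hx hy _]]; first by rewrite z eqxx in ez.
  have et : eta x' y' * eZ x y 1 = 2 * eY x y 1 + a1 E * eX x y 1 + a3 E * eZ x y 1.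
    by rewrite hx hy /curve_eta; ring.
  exists x', y'; split=> //.
    rewrite eN mulrA -hx hX // !(rmorphB, rmorphM) /= !(hornerD, hornerN, hornerM).
    by move/onE: xy => <-; ring.
  rewrite eN mulrA et hH // !(rmorphB, rmorphM) /= !(hornerD, hornerN, hornerM).
  by move/onE: xy => <-; ring.
move=> x y xy; rewrite !hornerM !mulf_eq0 !negb_or -andbA => /and3P[Nzx cx Nx].
have [x' [y' [h1 h2 h3]]] := key x y xy Nzx Nx.
have xyn := on_curve_negp xy.
have [x'' [y'' [h1n h2n h3n]]] := key _ _ xyn Nzx Nx.
move: (hneg _ xy); rewrite h1 /= [LHS]h1n => -[ex ey].
move: h2n h3n; rewrite eta_neg ex ey eta_neg => h2n h3n.
have n2 : 2%:R != 0 :> C by rewrite pnatr_eq0.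
exists x', y'; split=> //; apply: (mulfI n2).
  by rewrite mulr_natl mulr2n {1}h2 h2n; ring.
transitivity (eta x' y' * Nz^@.[x] - (- eta x' y' * Nz^@.[x])); first by ring.
by rewrite h3 h3n; ring.
Qed.

End RationalRepresentation.

(** * Division of one map by another *)

Section Quotient.
Variables (k : fieldType) (C : numClosedFieldType) (iota : {rmorphism k -> C}).
Local Notation "p ^@" := (map_poly iota p) (at level 2, format "p ^@").
Variable E : weierstrass C.
Local Notation eta := (curve_eta E).
Local Notation negp := (negp E).
Variables (al1 al2 al3 al4 al6 : k).
Hypotheses (e1 : a1 E = iota al1) (e2 : a2 E = iota al2) (e3 : a3 E = iota al3)
  (e4 : a4 E = iota al4) (e6 : a6 E = iota al6).
Hypothesis (dE : discriminant E != 0).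
Local Notation c := (two_division al1 al2 al3 al4 al6).

Let onE := @on_curveE _ _ iota E _ _ _ _ _ e1 e2 e3 e4 e6.

(** For a point of abscissa t, the abscissa of f and the ratio eta(f)/eta depend on t alone, because
    f commutes with negation. Pulled back by h they become A2/B2 and (S2 T)/(T2 S) in x, so
    [fibre_constant_rational] applied to A/B makes them rational functions of t. *)
Lemma ratrep_quotient (h g f : ecpoint C -> ecpoint C) A B S T A2 B2 S2 T2 :
  ratrep iota E h A B S T -> ratrep iota E g A2 B2 S2 T2 ->
  (forall P, on_curve E P -> on_curve E (h P)) ->
  (forall P, on_curve E P -> f (h P) = g P) ->
  (forall P, on_curve E P -> f (negp P) = negp (f P)) ->
  (forall W V : {poly C}, W != 0 -> V != 0 -> exists x y x' y',
     [/\ on_curve E (Affine x y), W.[x] != 0, h (Affine x y) = Affine x' y' & V.[x'] != 0]) ->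
  exists A3 B3 S3 T3, ratrep iota E f A3 B3 S3 T3.
Proof.
move=> /ratrep_coprime [{}A [{}B [{}S [{}T [cAB _ rh]]]]] rg hE fh fneg dom.
have [B0 T0 _] := rh; have [B20 T20 _] := rg.
have [W1 W10 hW1] := ratrep_neq0 rh; have [W2 W20 hW2] := ratrep_neq0 rg.
have c0 : c != 0 by rewrite -size_poly_gt0 (size_two_division iota).
have c0' : c^@ != 0 by rewrite map_poly_eq0.
(* A constant abscissa of h would make V vanish at all of its generic values, against the last
   hypothesis. *)
have nc : ~~ ((size A <= 1)%N && (size B <= 1)%N).
  apply/negP => /andP[/size1_polyC eA /size1_polyC eB].
  have b0 : iota B`_0 != 0 by rewrite fmorph_eq0; move: B0; rewrite {1}eB polyC_eq0.
  pose V := (iota B`_0) *: 'X - (iota A`_0)%:P.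
  have V0 : V != 0.
    apply: contraNneq b0 => /polyP/(_ 1%N); rewrite coefB coefZ coefX coefC coef0 subr0 mulr1.
    by move->.
  have [x [y [x' [y' [xy Wx hx]]]]] := dom W1 V W10 V0.
  have [x'' [y'' [hx' _ _ e _]]] := hW1 x y xy Wx.
  move: hx'; rewrite hx => -[ex _]; rewrite -ex in e.
  have e' : iota B`_0 * x' = iota A`_0.
    by move: e; rewrite {1}eA {1}eB !map_polyC /= !hornerC mulrC.
  by rewrite /V !hornerE e' subrr eqxx.
have S0 : S != 0.
  apply/eqP => S0; have [x [y [x' [y' [xy Wx hx cx]]]]] := dom W1 c^@ W10 c0'.
  have [x'' [y'' [hx' _ Tx _]]] := hW1 x y xy Wx; move: hx'; rewrite hx => -[<- <-].
  rewrite S0 rmorph0 horner0 mulr0 => /eqP; rewrite mulf_eq0 (negPf Tx) orbF => /eqP et.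
  have /onE : on_curve E (Affine x' y') by rewrite -hx; exact: hE.
  by rewrite et expr0n => /esym/eqP; rewrite (negPf cx).
pose W := W1 * W2.
have W0 : W != 0 by rewrite mulf_neq0.
have /choice [yof yofE] := curve_point e1 e2 e3 e4 e6.
pose px (P : ecpoint C) := if P is Affine x _ then x else 0.
pose pe (P : ecpoint C) := if P is Affine x y then eta x y else 0.
pose rho1 t := px (f (Affine t (yof t))).
pose rho2 t := pe (f (Affine t (yof t))) / eta t (yof t).
have fneg' t y : on_curve E (Affine t y) ->
   px (f (Affine t y)) = rho1 t /\ pe (f (Affine t y)) / eta t y = rho2 t.
  move=> ty; have := same_abscissa e1 e2 e3 e4 e6 (yofE t) ty.
  case=> [[->]//|e].
  have ey : eta t y = - eta t (yof t) by case: e => ->; rewrite eta_neg.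
  rewrite e fneg // /rho1 /rho2 ey; case: (f _) => //=.
    by rewrite !mul0r.
  by move=> u v; rewrite eta_neg invrN mulrNN.
have main x y : on_curve E (Affine x y) -> W.[x] != 0 ->
  exists x' y' x2 y2, [/\ h (Affine x y) = Affine x' y', g (Affine x y) = Affine x2 y2 &
    [/\ B^@.[x] != 0, x' = A^@.[x] / B^@.[x], T^@.[x] != 0 & eta x' y' = eta x y * S^@.[x] / T^@.[x]]
    /\ [/\ B2^@.[x] != 0, x2 = A2^@.[x] / B2^@.[x], T2^@.[x] != 0 & eta x2 y2 = eta x y * S2^@.[x] / T2^@.[x]]].
  move=> xy; rewrite hornerM mulf_eq0 negb_or => /andP[Wx1 Wx2].
  have [x' [y' [h1 h2 h3 h4 h5]]] := hW1 x y xy Wx1.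
  have [x2 [y2 [g1 g2 g3 g4 g5]]] := hW2 x y xy Wx2.
  exists x', y', x2, y2; rewrite -h4 -h5 -g4 -g5 !mulfK //; split=> //.
have [h1 [h2 [V [h20 V0 hV]]]] : exists (h1 h2 : {poly k}) (V : {poly C}),
    [/\ h2 != 0, V != 0 & forall t, V.[t] != 0 ->
          [/\ h2^@.[t] != 0, h1^@.[t] = rho1 t * h2^@.[t] &
              exists x, [/\ W.[x] != 0, B^@.[x] != 0 & A^@.[x] / B^@.[x] = t]]].
  apply: (fibre_constant_rational cAB nc B20 W0) => x Wx Bx.
  have [y xy] := curve_point e1 e2 e3 e4 e6 x.
  have [x' [y' [x2 [y2 [hx gx [[_ ex _ _] [B2x ex2 _ _]]]]]]] := main x y xy Wx.
  have xy' : on_curve E (Affine x' y') by rewrite -hx; exact: hE.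
  have [er _] := fneg' _ _ xy'; move: er; rewrite -hx fh // gx /= -ex => <-.
  by rewrite ex2 divfK.
(* The ratio divides by eta and by S, so their zeros are excluded too. *)
pose W' := W * c^@ * S^@.
have W'0 : W' != 0 by rewrite !mulf_neq0 // map_poly_eq0.
have TS0 : T2 * S != 0 by rewrite mulf_neq0.
have [|k1 [k2 [V' [k20 V'0 hV']]]] :=
    @fibre_constant_rational _ _ iota A B (S2 * T) (T2 * S) rho2 W' cAB nc TS0 W'0.
  move=> x; rewrite hornerM [X in X * _]hornerM [_ * _ == 0]mulf_eq0 [_ * _ == 0]mulf_eq0 !negb_or -andbA => /and3P[Wx cx Sx] Bx.
  have [y xy] := curve_point e1 e2 e3 e4 e6 x.
  have [x' [y' [x2 [y2 [hx gx [[_ ex Tx ey] [_ _ T2x ey2]]]]]]] := main x y xy Wx.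
  have xy' : on_curve E (Affine x' y') by rewrite -hx; exact: hE.
  have et : eta x y != 0.
    by apply: contraNneq cx => et; move/onE: xy; rewrite et expr0n => <-.
  have [_ er] := fneg' _ _ xy'; move: er; rewrite -hx fh // gx /= -ex => <-.
  by rewrite ey ey2 !rmorphM !hornerM; field; rewrite T2x et Sx Tx.
exists h1, h2, k1, k2; split=> //; exists (V * V' * c^@); first by rewrite !mulf_neq0.
move=> t y ty; rewrite !hornerM !mulf_eq0 !negb_or -andbA => /and3P[Vt V't ct].
have [h2t eh [x [Wx Bx tE]]] := hV t Vt.
have [k2t ek _] := hV' _ V't.
have [y0 xy] := curve_point e1 e2 e3 e4 e6 x.
have [x' [y' [x2 [y2 [hx gx [[_ ex _ _] _]]]]]] := main x y0 xy Wx.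
rewrite tE in ex; rewrite ex in hx.
have xy' : on_curve E (Affine t y') by rewrite -hx; exact: hE.
have [u [v fuv]] : exists u v, f (Affine t y) = Affine u v.
  case: (same_abscissa e1 e2 e3 e4 e6 xy' ty) => ->; last rewrite fneg //.
    by rewrite -hx fh // gx; exists x2, y2.
  by rewrite -hx fh // gx /=; eexists; eexists.
have [] := fneg' _ _ ty; rewrite fuv /= => ru re; exists u, v; split=> //.
  by rewrite ru.
have et : eta t y != 0.
  by apply: contraNneq ct => et; move/onE: ty; rewrite et expr0n => <-.
by rewrite ek -re; field.
Qed.

End Quotient.

(** * Forms on Weierstrass curves *)

Section Forms.
Variables (k : fieldType) (C : numClosedFieldType) (iota : {rmorphism k -> C}).
Local Notation "p ^@" := (map_poly iota p) (at level 2, format "p ^@").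

(** Forms over [k] are handled through the functions they define, so that sums and products can be
    formed without displaying coefficients. *)
Definition kform (d : nat) (phi : C -> C -> C -> C) : Prop :=
  exists cc : nat -> nat -> C, (forall i j, range iota (cc i j)) /\
    forall X Y Z, eval_form d cc X Y Z = phi X Y Z.

Lemma kformD d phi psi : kform d phi -> kform d psi ->
  kform d (fun X Y Z => phi X Y Z + psi X Y Z).
Proof.
move=> [c1 [h1 e1]] [c2 [h2 e2]]; exists (fun i j => c1 i j + c2 i j); split.
  move=> i j; have [a _ <-] := h1 i j; have [b _ <-] := h2 i j.
  by exists (a + b) => //; rewrite rmorphD.
move=> X Y Z; rewrite -e1 -e2 /eval_form -big_split; apply: eq_bigr => i _.
by rewrite -big_split; apply: eq_bigr => j _; rewrite !mulrDl.
Qed.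

Lemma kformZ d (a : k) phi : kform d phi -> kform d (fun X Y Z => iota a * phi X Y Z).
Proof.
move=> [c1 [h1 e1]]; exists (fun i j => iota a * c1 i j); split.
  by move=> i j; have [b _ <-] := h1 i j; exists (a * b) => //; rewrite rmorphM.
move=> X Y Z; rewrite -e1 /eval_form mulr_sumr; apply: eq_bigr => i _.
by rewrite mulr_sumr; apply: eq_bigr => j _; rewrite !mulrA.
Qed.

Lemma range0 : range iota 0. Proof. by exists 0 => //; rewrite rmorph0. Qed.

Lemma kform0 d : kform d (fun _ _ _ => 0).
Proof.
exists (fun _ _ => 0); split=> [i j|X Y Z]; first exact: range0.
by rewrite /eval_form big1 // => i _; rewrite big1 // => j _; rewrite !mul0r.
Qed.

Lemma kform1 : kform 0 (fun _ _ _ => 1).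
Proof.
exists (fun _ _ => 1); split=> [i j|X Y Z]; first by exists 1 => //; rewrite rmorph1.
by rewrite /eval_form !big_ord1 /= !expr0 !mulr1.
Qed.

Lemma kform_mulX d phi : kform d phi -> kform d.+1 (fun X Y Z => X * phi X Y Z).
Proof.
move=> [cc [hc e]]; exists (fun i j => if i is i'.+1 then cc i' j else 0); split.
  by move=> [|i] j; [exact: range0 | exact: hc].
move=> X Y Z; rewrite -e /eval_form big_ord_recl big1 ?add0r => [|j _]; last by rewrite !mul0r.
rewrite mulr_sumr; apply: eq_bigr => i _ /=; rewrite mulr_sumr; apply: eq_bigr => j _ /=.
case: j => j /= _; have -> : (d.+1 - bump 0 i - j = d - i - j)%N by rewrite /bump leq0n add1n subSS.
by rewrite /bump leq0n add1n add0n exprS; ring.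
Qed.

Lemma kform_mulY d phi : kform d phi -> kform d.+1 (fun X Y Z => Y * phi X Y Z).
Proof.
move=> [cc [hc e]]; exists (fun i j => if j is j'.+1 then cc i j' else 0); split.
  by move=> i [|j]; [exact: range0 | exact: hc].
move=> X Y Z; rewrite -e /eval_form big_ord_recr /= subnn big_ord1 /= !mul0r addr0.
rewrite mulr_sumr; apply: eq_bigr => i _ /=; rewrite mulr_sumr subSn; last by rewrite -ltnS.
rewrite big_ord_recl /= !mul0r add0r; apply: eq_bigr => j _ /=.
have -> : ((d - i).+1 - bump 0 j = d - i - j)%N by rewrite /bump leq0n add1n subSS.
by rewrite /bump leq0n add1n exprS; ring.
Qed.

Lemma kform_mulZ d phi : kform d phi -> kform d.+1 (fun X Y Z => Z * phi X Y Z).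
Proof.
(* [eval_form] in degree d ignores the coefficients with i + j > d, but in degree d + 1 it reads
   those with i + j = d + 1. *)
move=> [cc [hc e]]; exists (fun i j => if (i + j <= d)%N then cc i j else 0); split.
  by move=> i j; case: ifP => _; [exact: hc | exact: range0].
move=> X Y Z; rewrite -e /eval_form big_ord_recr /= subnn big_ord1 /= addn0 ltnn !mul0r addr0.
rewrite mulr_sumr; apply: eq_bigr => i _ /=.
have le_id : (i <= d)%N by rewrite -ltnS.
rewrite mulr_sumr subSn // big_ord_recr /= addnS subnKC // ltnn !mul0r addr0.
apply: eq_bigr => j _ /=.
have le_j : (j <= d - i)%N by rewrite -ltnS.
have -> : (i + j <= d)%N by lia.
by rewrite subSn // exprS; ring.
Qed.

Lemma kform_ext d phi psi : (forall X Y Z, phi X Y Z = psi X Y Z) -> kform d phi -> kform d psi.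
Proof. by move=> e [cc [h1 h2]]; exists cc; split=> // X Y Z; rewrite h2 e. Qed.

Lemma kform_Zn d n phi : kform d phi -> kform (n + d) (fun X Y Z => Z ^+ n * phi X Y Z).
Proof.
move=> h; elim: n => [|n IH]; first by apply: kform_ext h => X Y Z; rewrite mul1r.
by apply: kform_ext (kform_mulZ IH) => X Y Z; rewrite exprS mulrA.
Qed.

Lemma kform_Xn d n phi : kform d phi -> kform (n + d) (fun X Y Z => X ^+ n * phi X Y Z).
Proof.
move=> h; elim: n => [|n IH]; first by apply: kform_ext h => X Y Z; rewrite mul1r.
by apply: kform_ext (kform_mulX IH) => X Y Z; rewrite exprS mulrA.
Qed.

Variable E : weierstrass C.
Local Notation eta := (curve_eta E).
Variables (al1 al2 al3 al4 al6 : k).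
Hypotheses (e1 : a1 E = iota al1) (e2 : a2 E = iota al2) (e3 : a3 E = iota al3)
  (e4 : a4 E = iota al4) (e6 : a6 E = iota al6).
Local Notation c := (two_division al1 al2 al3 al4 al6).
Let onE := @on_curveE _ _ iota E _ _ _ _ _ e1 e2 e3 e4 e6.

Let etaf X Y Z := 2 * Y + a1 E * X + a3 E * Z.

Lemma kform_eta d phi : kform d phi -> kform d.+1 (fun X Y Z => etaf X Y Z * phi X Y Z).
Proof.
move=> h; have := kformD (kformD (kformZ 2 (kform_mulY h)) (kformZ al1 (kform_mulX h)))
  (kformZ al3 (kform_mulZ h)).
by apply: kform_ext => X Y Z; rewrite /etaf e1 e3 rmorph_nat; ring.
Qed.

(* By the equation of the curve, this quadratic form is x^3 where Z = 1. *)
Let cube X Y Z := (etaf X Y Z ^+ 2 - (a1 E ^+ 2 + 4 * a2 E) * X ^+ 2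
   - 2 * (2 * a4 E + a1 E * a3 E) * X * Z - (a3 E ^+ 2 + 4 * a6 E) * Z ^+ 2) / 4.

Lemma kform_cube d phi : kform d phi -> kform d.+2 (fun X Y Z => cube X Y Z * phi X Y Z).
Proof.
move=> h; have := kformZ (4^-1) (kformD (kformD (kformD (kform_eta (kform_eta h))
  (kformZ (- (al1 ^+ 2 + 4 * al2)) (kform_mulX (kform_mulX h))))
  (kformZ (- (2 * (2 * al4 + al1 * al3))) (kform_mulX (kform_mulZ h))))
  (kformZ (- (al3 ^+ 2 + 4 * al6)) (kform_mulZ (kform_mulZ h)))).
apply: kform_ext => X Y Z; rewrite /cube e1 e2 e3 e4 e6.
rewrite fmorphV !(rmorphN, rmorph_nat, rmorphXn, rmorphD, rmorphM).
by ring.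
Qed.

Lemma cube_curve x y : on_curve E (Affine x y) -> cube x y 1 = x ^+ 3.
Proof.
have n4 : 4%:R != 0 :> C by rewrite pnatr_eq0.
move/onE; rewrite (two_division_horner e1 e2 e3 e4 e6) /cube /etaf => h.
apply: (mulIf n4); rewrite divfK //.
have -> : 2 * y + a1 E * x + a3 E * 1 = eta x y by rewrite /curve_eta; ring.
by rewrite h; ring.
Qed.

(** A form of degree D, divided by Z^D, has a pole of order at most 3D at the origin, and x^i has
    one of order 2i. With i = 3q + r the form is Z^m X^r times the q-th power of [cube], which has
    degree 2 and equals x^3 on the curve; it survives at the origin exactly when the bound is
    attained. *)
Lemma monomial_form D i : (2 * i <= 3 * D)%N -> exists phi, [/\ kform D phi,
  forall x y, on_curve E (Affine x y) -> phi x y 1 = x ^+ i &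
  phi 0 1 0 = (2 * i == 3 * D)%N%:R].
Proof.
move=> iD; pose q := (i %/ 3)%N; pose r := (i %% 3)%N; pose m := (D - r - 2 * q)%N.
have iE : i = (q * 3 + r)%N by exact: divn_eq.
have r3 : (r < 3)%N by rewrite ltn_mod.
have DE : D = (m + (r + (2 * q)))%N by rewrite /m; lia.
have hq : kform (2 * q) (fun X Y Z => cube X Y Z ^+ q).
  elim: (q) => [|n IH]; first exact: kform1.
  by rewrite mulnS; apply: kform_ext (kform_cube IH) => X Y Z; rewrite exprS.
exists (fun X Y Z => Z ^+ m * (X ^+ r * cube X Y Z ^+ q)); split.
- by rewrite DE; apply: kform_Zn; apply: kform_Xn.
- by move=> x y xy; rewrite expr1n mul1r cube_curve // -exprM -exprD; congr (_ ^+ _); lia.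
have c1 : cube 0 1 0 = 1.
  by rewrite /cube /etaf; field.
rewrite c1 expr1n mulr1 !expr0n -natrM mulnb; congr (_%:R); congr nat_of_bool.
by apply/andP/eqP; lia.
Qed.

(** Sums the monomial forms; at the origin only a top monomial that attains the bound
    contributes. *)
Lemma poly_form D (p : {poly k}) : (2 * (size p).-1 <= 3 * D)%N -> exists phi, [/\ kform D phi,
  forall x y, on_curve E (Affine x y) -> phi x y 1 = p^@.[x],
  (2 * (size p).-1 < 3 * D)%N || (p == 0) -> phi 0 1 0 = 0 &
  (2 * (size p).-1 = 3 * D)%N -> phi 0 1 0 = iota (lead_coef p)].
Proof.
move=> hD.
suff H n : (n <= size p)%N -> exists phi, [/\ kform D phi,
    forall x y, on_curve E (Affine x y) -> phi x y 1 = \sum_(i < n) iota p`_i * x ^+ i &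
    phi 0 1 0 = \sum_(i < n) iota p`_i * (2 * i == 3 * D)%N%:R].
  have [phi [h1 h2 h3]] := H _ (leqnn _); exists phi; split=> //.
  - by move=> x y xy; rewrite h2 // horner_coef size_map_poly; apply: eq_bigr => i _; rewrite coef_map.
  - move=> /orP[lt|/eqP p0]; last by rewrite h3 p0 size_poly0 big_ord0.
    rewrite h3 big1 // => i _; rewrite (_ : _ == _ = false) ?mulr0 //.
    by apply/negP => /eqP; have := ltn_ord i; lia.
  - move=> eq; rewrite h3 /lead_coef; have [->|p0] := eqVneq p 0.
      by rewrite size_poly0 big_ord0 coef0 rmorph0.
    move: eq; rewrite -size_poly_gt0 in p0; case: (size p) p0 => [//|m] _ eq.
    rewrite big_ord_recr /= eq eqxx mulr1 big1 ?add0r // => i _.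
    rewrite (_ : _ == _ = false) ?mulr0 //.
    by apply/negP => /eqP; have := ltn_ord i; move: eq => /=; lia.
elim: n => [|n IH] hn.
  exists (fun _ _ _ => 0); split; [exact: kform0 | by move=> x y _; rewrite big_ord0 | by rewrite big_ord0].
have [phi [h1 h2 h3]] := IH (ltnW hn).
have [|psi [g1 g2 g3]] := @monomial_form D n; first by lia.
exists (fun X Y Z => phi X Y Z + iota p`_n * psi X Y Z); split.
- exact: kformD h1 (kformZ _ g1).
- by move=> x y xy; rewrite big_ord_recr h2 // g2.
- by rewrite big_ord_recr h3 g3.
Qed.

(* Numerators u, v, w for x, eta, 1, each of the form p0 + p1 eta. *)
Lemma triple_forms D (u0 u1 v0 v1 w0 w1 : {poly k}) :
  (forall p, p \in [:: u0; v0; w0] -> (2 * (size p).-1 <= 3 * D.+1)%N) ->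
  (forall p, p \in [:: u1; v1; w1] -> (2 * (size p).-1 <= 3 * D)%N) ->
  exists cX cY cZ : nat -> nat -> C,
  [/\ forall i j, [/\ range iota (cX i j), range iota (cY i j) & range iota (cZ i j)],
   forall x y, on_curve E (Affine x y) ->
     [/\ eval_form D.+1 cX x y 1 = u0^@.[x] + u1^@.[x] * eta x y,
         2 * eval_form D.+1 cY x y 1 + a1 E * eval_form D.+1 cX x y 1
           + a3 E * eval_form D.+1 cZ x y 1 = v0^@.[x] + v1^@.[x] * eta x y &
         eval_form D.+1 cZ x y 1 = w0^@.[x] + w1^@.[x] * eta x y] &
   u1 = 0 -> v0 = 0 -> w1 = 0 -> (2 * (size v1).-1 = 3 * D)%N -> v1 != 0 ->
     (2 * (size u0).-1 < 3 * D.+1)%N -> (2 * (size w0).-1 < 3 * D.+1)%N ->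
     eval_form D.+1 cY 0 1 0 != 0].
Proof.
move=> h0 h1.
have n2 : 2%:R != 0 :> C by rewrite pnatr_eq0.
have [U0 [fU0 cU0 oU0 _]] := poly_form (h0 u0 (mem_head _ _)).
have [|V0 [fV0 cV0 oV0 _]] := @poly_form D.+1 v0; first by apply: h0; rewrite !inE eqxx orbT.
have [|W0 [fW0 cW0 oW0 _]] := @poly_form D.+1 w0; first by apply: h0; rewrite !inE eqxx !orbT.
have [|U1 [fU1 cU1 oU1 _]] := @poly_form D u1; first by apply: h1; rewrite !inE eqxx.
have [|V1 [fV1 cV1 oV1 tV1]] := @poly_form D v1; first by apply: h1; rewrite !inE eqxx orbT.
have [|W1 [fW1 cW1 oW1 _]] := @poly_form D w1; first by apply: h1; rewrite !inE eqxx !orbT.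
pose U X Y Z := U0 X Y Z + etaf X Y Z * U1 X Y Z.
pose V X Y Z := V0 X Y Z + etaf X Y Z * V1 X Y Z.
pose W X Y Z := W0 X Y Z + etaf X Y Z * W1 X Y Z.
have fU : kform D.+1 U by exact: kformD fU0 (kform_eta fU1).
have fV : kform D.+1 V by exact: kformD fV0 (kform_eta fV1).
have fW : kform D.+1 W by exact: kformD fW0 (kform_eta fW1).
have [cX [hX eX]] := fU; have [cZ [hZ eZ]] := fW.
have [cY [hY eY]] := kformZ (2^-1) (kformD fV (kformD (kformZ (- al1) fU) (kformZ (- al3) fW))).
exists cX, cY, cZ; split=> [i j|x y xy|u10 v00 w10 sv v1n su sw] //.
  have ee : etaf x y 1 = eta x y by rewrite /etaf /curve_eta mulr1.
  rewrite eX eY eZ; split.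
  - by rewrite /U ee cU0 // cU1 //; ring.
  - rewrite fmorphV rmorph_nat mulVKf // !rmorphN -e1 -e3 /V ee cV0 // cV1 //; ring.
  - by rewrite /W ee cW0 // cW1 //; ring.
have U010 : U 0 1 0 = 0.
  by rewrite /U oU0 ?su // oU1 ?u10 ?eqxx ?orbT // mulr0 addr0.
have W010 : W 0 1 0 = 0.
  by rewrite /W oW0 ?sw // oW1 ?w10 ?eqxx ?orbT // mulr0 addr0.
rewrite eY U010 W010 /V oV0 ?v00 ?eqxx ?orbT // tV1 // /etaf !mulr0 !addr0 add0r mulr1.
by rewrite fmorphV rmorph_nat mulKf // fmorph_eq0 lead_coef_eq0.
Qed.

End Forms.

(** * From rational representations to forms at every point *)

Section Regularity.
Variables (k : fieldType) (C : numClosedFieldType) (iota : {rmorphism k -> C}).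
Local Notation "p ^@" := (map_poly iota p) (at level 2, format "p ^@").
Variable E : weierstrass C.
Local Notation eta := (curve_eta E).
Variables (al1 al2 al3 al4 al6 : k).
Hypotheses (e1 : a1 E = iota al1) (e2 : a2 E = iota al2) (e3 : a3 E = iota al3)
  (e4 : a4 E = iota al4) (e6 : a6 E = iota al6).
Hypothesis (dE : discriminant E != 0).
Local Notation c := (two_division al1 al2 al3 al4 al6).
Let onE := @on_curveE _ _ iota E _ _ _ _ _ e1 e2 e3 e4 e6.

(** A density property: forms that give f at generic points give it wherever they do not vanish
    simultaneously. For maps induced by multiplication on C it is proved by continuity in
    [analytic_generic_forms]. *)
Definition generic_forms (f : ecpoint C -> ecpoint C) : Prop :=
  forall d (cX cY cZ : nat -> nat -> C) (W : {poly C}), W != 0 ->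
  (forall x y, on_curve E (Affine x y) -> W.[x] != 0 -> exists x' y',
     [/\ f (Affine x y) = Affine x' y',
         eval_form d cX x y 1 = x' * eval_form d cZ x y 1 &
         eval_form d cY x y 1 = y' * eval_form d cZ x y 1]) ->
  forall Q, on_curve E Q ->
    [\/ eval_point d cX Q != 0, eval_point d cY Q != 0 | eval_point d cZ Q != 0] ->
    projective (eval_point d cX Q) (eval_point d cY Q) (eval_point d cZ Q) (f Q).

Lemma poly_eq_generic (p q W : {poly C}) : W != 0 ->
  (forall x, W.[x] != 0 -> p.[x] = q.[x]) -> p = q.
Proof.
move=> W0 h; apply/eqP; rewrite -subr_eq0; apply: contraTT isT => pq.
have [n] := poly_nonroot (mulf_neq0 pq W0); rewrite hornerM mulf_eq0 negb_or => /andP[+ Wn].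
by rewrite hornerD hornerN h // subrr eqxx.
Qed.

Lemma dvdp_cube_square (p q : {poly k}) : p != 0 -> p ^+ 3 %| q ^+ 2 -> p %| q.
Proof.
move=> p0 pq; rewrite -(dvdp_pexp2r _ _ (isT : 0 < 2)%N).
by apply: dvdp_trans pq; rewrite dvdp_exp2l.
Qed.

Lemma size_polyX_succ (p : {poly k}) n m : size p = m.+1 -> size (p ^+ n) = (n * m).+1.
Proof.
move=> sp; have p0 : p != 0 by rewrite -size_poly_gt0 sp.
have : (0 < size (p ^+ n))%N by rewrite size_poly_gt0 expf_neq0.
by move/prednK <-; rewrite size_exp sp mulnC.
Qed.

Variables (f : ecpoint C -> ecpoint C) (A B S T : {poly k}).
Hypotheses (rf : ratrep iota E f A B S T) (cAB : coprimep A B) (cST : coprimep S T).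
Hypothesis fE : forall P, on_curve E P -> on_curve E (f P).
Hypothesis fO : f Origin = Origin.
Hypothesis gf : generic_forms f.
Hypothesis sAB : (size B < size A)%N.

Let b2 := al1 ^+ 2 + 4 * al2.
Let b4 := 2 * al4 + al1 * al3.
Let b6 := al3 ^+ 2 + 4 * al6.
Let H := 4 *: A ^+ 3 + b2 *: (A ^+ 2 * B) + (2 * b4) *: (A * B ^+ 2) + b6 *: B ^+ 3.

(** The image point satisfies eta^2 = c; substituting A/B for its abscissa and eta S/T for its eta
    and clearing denominators gives the identity, H being B^3 c(A/B). *)
Lemma ratrep_identity : c * S ^+ 2 * B ^+ 3 = T ^+ 2 * H.
Proof.
have [W W0 hW] := ratrep_neq0 rf.
apply: (map_poly_inj iota); apply: (poly_eq_generic W0) => x Wx.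
have [y xy] := curve_point e1 e2 e3 e4 e6 x.
have [x' [y' [h1 Bx Tx h2 h3]]] := hW x y xy Wx.
have xy' : on_curve E (Affine x' y') by rewrite -h1; exact: fE.
move/onE: xy => xy; move/onE: xy'; rewrite (two_division_horner e1 e2 e3 e4 e6) => xy'.
have HE : H^@.[x] = (eta x' y') ^+ 2 * B^@.[x] ^+ 3.
  rewrite /H !rmorphD /= !linearZ /= !(rmorphXn, rmorphM) /= !(hornerD, hornerZ, horner_exp, hornerM) -h2 xy' /b2 /b4 /b6.
  by rewrite e1 e2 e3 e4 e6 !(rmorph_nat, rmorphXn, rmorphD, rmorphM); ring.
rewrite !(rmorphXn, rmorphM) /= !(hornerD, hornerZ, horner_exp, hornerM) HE -xy -exprMn -h3; ring.
Qed.

Let local_forms P := exists d (cX cY cZ : nat -> nat -> C),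
  [/\ forall i j, [/\ range iota (cX i j), range iota (cY i j) & range iota (cZ i j)],
      projective (eval_point d cX P) (eval_point d cY P) (eval_point d cZ P) (f P) &
      forall Q, on_curve E Q ->
        [\/ eval_point d cX Q != 0, eval_point d cY Q != 0 | eval_point d cZ Q != 0] ->
        projective (eval_point d cX Q) (eval_point d cY Q) (eval_point d cZ Q) (f Q)].

Section LocalForms.
Variables (u0 u1 v0 v1 w0 w1 : {poly k}) (W : {poly C}).
Hypothesis W0 : W != 0.
Hypothesis hW : forall x y, on_curve E (Affine x y) -> W.[x] != 0 ->
  exists x' y', [/\ f (Affine x y) = Affine x' y',
    u0^@.[x] + u1^@.[x] * eta x y = x' * (w0^@.[x] + w1^@.[x] * eta x y) &
    v0^@.[x] + v1^@.[x] * eta x y = eta x' y' * (w0^@.[x] + w1^@.[x] * eta x y)].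

Lemma generic_triple d (cX cY cZ : nat -> nat -> C) :
  (forall x y, on_curve E (Affine x y) ->
     [/\ eval_form d cX x y 1 = u0^@.[x] + u1^@.[x] * eta x y,
         2 * eval_form d cY x y 1 + a1 E * eval_form d cX x y 1
           + a3 E * eval_form d cZ x y 1 = v0^@.[x] + v1^@.[x] * eta x y &
         eval_form d cZ x y 1 = w0^@.[x] + w1^@.[x] * eta x y]) ->
  forall Q, on_curve E Q ->
    [\/ eval_point d cX Q != 0, eval_point d cY Q != 0 | eval_point d cZ Q != 0] ->
    projective (eval_point d cX Q) (eval_point d cY Q) (eval_point d cZ Q) (f Q).
Proof.
move=> hc; apply: (gf W0) => x y xy Wx.
have [x' [y' [h1 h2 h3]]] := hW xy Wx; have [c1 c2 c3] := hc x y xy.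
have n2 : 2%:R != 0 :> C by rewrite pnatr_eq0.
exists x', y'; rewrite -c1 -c3 in h2; split=> //; apply: (mulfI n2).
rewrite -c2 -c3 h2 /curve_eta in h3.
apply: (addIr (a1 E * (x' * eval_form d cZ x y 1) + a3 E * eval_form d cZ x y 1)).
by rewrite addrA h3; ring.
Qed.

Lemma local_forms_affine x y : on_curve E (Affine x y) ->
  (v0^@.[x] + v1^@.[x] * eta x y != 0) || (w0^@.[x] + w1^@.[x] * eta x y != 0) ->
  local_forms (Affine x y).
Proof.
(* A generous degree, in which the pole orders of all six numerators fit. *)
move=> xy nz; pose D := (2 * (size u0 + size v0 + size w0 + size u1 + size v1 + size w1))%N.
have [||cX [cY [cZ [hr hc _]]]] := triple_forms e1 e2 e3 e4 e6 (D := D) (u0 := u0) (u1 := u1)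
  (v0 := v0) (v1 := v1) (w0 := w0) (w1 := w1).
- by move=> p; rewrite !inE => /or3P[] /eqP ->; rewrite /D; clear; lia.
- by move=> p; rewrite !inE => /or3P[] /eqP ->; rewrite /D; clear; lia.
exists D.+1, cX, cY, cZ; have gt := generic_triple hc; split=> //; apply: gt => //.
have [c1 c2 c3] := hc x y xy; rewrite /= -c2 -c3 in nz *.
have [cX0|? ] := eqVneq (eval_form D.+1 cX x y 1) 0; last by constructor 1.
have [cZ0|? ] := eqVneq (eval_form D.+1 cZ x y 1) 0; last by constructor 3.
constructor 2; move: nz; rewrite cX0 cZ0 eqxx orbF !mulr0 !addr0 mulf_eq0 negb_or.
by case/andP.
Qed.

(** At the origin the numerator v1 eta has exactly the largest pole order allowed in its degree, and
    the other numerators have smaller ones; hence the Y-form survives at [0 : 1 : 0]. *)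
Lemma local_forms_origin D : u1 = 0 -> v0 = 0 -> w1 = 0 -> v1 != 0 ->
  (2 * (size v1).-1 = 3 * D)%N -> (2 * (size u0).-1 < 3 * D.+1)%N ->
  (2 * (size w0).-1 < 3 * D.+1)%N -> local_forms Origin.
Proof.
move=> u10 v00 w10 v1n sv su sw.
have [||cX [cY [cZ [hr hc hO]]]] := triple_forms e1 e2 e3 e4 e6 (D := D) (u0 := u0) (u1 := u1)
  (v0 := v0) (v1 := v1) (w0 := w0) (w1 := w1).
- by move=> p; rewrite !inE => /or3P[] /eqP ->; rewrite ?v00 ?size_poly0; move: sv su sw; clear; lia.
- by move=> p; rewrite !inE => /or3P[] /eqP ->; rewrite ?u10 ?w10 ?size_poly0; move: sv su sw; clear; lia.
exists D.+1, cX, cY, cZ; have gt := generic_triple hc; split=> //; apply: gt => //.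
by constructor 2; apply: hO.
Qed.

End LocalForms.

(** There are three kinds of points. The forms (A T' : eta S : T), with T = T' B, serve where eta S
    or T is nonzero, and at the origin after padding the degree. The remaining points have eta = 0
    and T = 0; there the common factor of c and T' is removed with the help of eta^2 = c. *)
Lemma ratrep_endomorphism : endomorphism_over (range iota) E f.
Proof.
have [B0 T0 _] := rf; have [W W0 hW] := ratrep_neq0 rf.
have c0 : c != 0 by rewrite -size_poly_gt0 (size_two_division iota).
have A0 : A != 0 by rewrite -size_poly_gt0 (leq_trans _ sAB).
have root_AB x : B^@.[x] = 0 -> A^@.[x] != 0.
  move=> bx; have : coprimep B^@ A^@ by rewrite coprimep_map coprimep_sym.
  by move=> /Pdiv.ClosedField.coprimepP; apply; apply/rootP.
have root_ST x : T^@.[x] = 0 -> S^@.[x] != 0.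
  move=> bx; have : coprimep T^@ S^@ by rewrite coprimep_map coprimep_sym.
  by move=> /Pdiv.ClosedField.coprimepP; apply; apply/rootP.
have n4 : 4%:R != 0 :> k by rewrite -(fmorph_eq0 iota) rmorph_nat pnatr_eq0.
have BH : coprimep B H.
  have -> : H = 4 *: A ^+ 3 + (b2 *: A ^+ 2 + (2 * b4) *: (A * B) + b6 *: B ^+ 2) * B.
    by rewrite /H -!mul_polyC; ring.
  by rewrite addrC coprimep_addl_mul coprimepZr // coprimep_expr // coprimep_sym.
(* H is 4 A^3 modulo B, so it is prime to B and the identity forces B^3 to divide T^2. *)
have BT : B %| T.
  apply: dvdp_cube_square => //; rewrite -(@Gauss_dvdpl _ _ H); last by rewrite coprimep_expl.
  by rewrite -ratrep_identity dvdp_mull.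
pose T' := T %/ B; have TE : T = T' * B by rewrite divpK.
have T'0 : T' != 0 by apply: contraNneq T0 => T'0; rewrite TE T'0 mul0r.
have ident : c * S ^+ 2 * B = T' ^+ 2 * H.
  apply: (mulIf (expf_neq0 2 B0)); have := ratrep_identity; rewrite TE => h.
  by transitivity (c * S ^+ 2 * B ^+ 3); [ring | rewrite h; ring].
split=> // P PE; case: P PE => [_|x0 y0 xy0].
  have szX (p : {poly k}) : p != 0 -> exists n, size p = n.+1.
    by rewrite -size_poly_gt0 => /prednK <-; eexists.
  have [a szA] := szX _ A0; have [b szB] := szX _ B0; have [t szT] := szX _ T'0.
  have ab : (b < a)%N by rewrite -ltnS -szA -szB.
  have szA2 : size (A ^+ 2) = (2 * a).+1 by exact: size_polyX_succ _ szA.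
  have szA3 : size (A ^+ 3) = (3 * a).+1 by exact: size_polyX_succ _ szA.
  have szB2 : size (B ^+ 2) = (2 * b).+1 by exact: size_polyX_succ _ szB.
  have szB3 : size (B ^+ 3) = (3 * b).+1 by exact: size_polyX_succ _ szB.
  have szH : size H = (3 * a).+1.
    rewrite /H -!addrA size_polyDl size_scale // szA3 ltnS.
    rewrite (leq_trans (size_polyD _ _)) // geq_max; apply/andP; split.
      rewrite (leq_trans (size_scale_leq _ _)) // size_mul ?expf_neq0 // szA2 szB; move: ab; clear; lia.
    rewrite (leq_trans (size_polyD _ _)) // geq_max; apply/andP; split.
      rewrite (leq_trans (size_scale_leq _ _)) // size_mul ?expf_neq0 // szA szB2; move: ab; clear; lia.
    rewrite (leq_trans (size_scale_leq _ _)) // szB3; move: ab; clear; lia.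
  have H0 : H != 0 by rewrite -size_poly_gt0 szH.
  have S0 : S != 0.
    apply/eqP => S0; move/eqP: ident; rewrite S0 expr0n mulr0 mul0r eq_sym mulf_eq0.
    by rewrite expf_eq0 (negPf T'0) (negPf H0).
  have [s szS] := szX _ S0.
  (* Degrees in the identity; they compare the pole orders of the three coordinates at the
     origin. *)
  have deg : (3 + 2 * s + b = 2 * t + 3 * a)%N.
    have := congr1 (fun p : {poly k} => size p) ident.
    rewrite /= !size_mul ?mulf_neq0 ?expf_neq0 // (size_two_division iota).
    by rewrite szS szT szH szB; clear; lia.
  (* Multiplying by X^r raises the degree of S to a multiple 3m of 3, so that twice it is 3 (2m) and
     the bound is attained in form degree 2m. *)
  pose r := ((3 - s %% 3) %% 3)%N; pose m := ((s + r) %/ 3)%N.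
  have rE : (s + r = 3 * m)%N by rewrite /m /r; clear; lia.
  have Xr0 : 'X^r != 0 :> {poly k} by rewrite expf_neq0 // polyX_eq0.
  apply: (@local_forms_origin (A * T' * 'X^r) 0 0 (S * 'X^r) (T * 'X^r) 0 W _ _ (2 * m)) => //.
  - move=> x y xy Wx; have [x' [y' [h1 Bx Tx h2 h3]]] := hW x y xy Wx.
    exists x', y'; rewrite !rmorph0 !horner0 !mul0r !addr0 add0r; split=> //.
      by rewrite TE !rmorphM !hornerM -h2; ring.
    by rewrite !rmorphM !hornerM !mulrA h3; ring.
  - by rewrite mulf_neq0.
  - by rewrite size_mul // size_polyXn szS; move: rE; move: (m) (r); clear; lia.
  - by rewrite !size_mul ?mulf_neq0 // size_polyXn szA szT; move: rE deg ab; move: (m) (r); clear; lia.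
  - by rewrite TE !size_mul ?mulf_neq0 // size_polyXn szB szT; move: rE deg ab; move: (m) (r); clear; lia.
have [nz|] := boolP ((eta x0 y0 * S^@.[x0] != 0) || (T^@.[x0] != 0)).
  apply: (@local_forms_affine (A * T') 0 0 S T 0 W) => //.
    move=> x y xy Wx; have [x' [y' [h1 Bx Tx h2 h3]]] := hW x y xy Wx.
    exists x', y'; rewrite !rmorph0 !horner0 !mul0r !addr0 add0r; split=> //.
      by rewrite TE !rmorphM !hornerM -h2; ring.
    by rewrite h3 mulrC.
  by rewrite !rmorph0 !horner0 !mul0r add0r addr0 mulrC.
rewrite negb_or !negbK => /andP[/eqP Sx0 /eqP Tx0].
have Sn := root_ST _ Tx0.
have et0 : eta x0 y0 = 0 by move/eqP: Sx0; rewrite mulf_eq0 (negPf Sn) orbF => /eqP.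
have cx0 : c^@.[x0] = 0 by move/onE: xy0 => <-; rewrite et0 expr0n.
have T'x0 : T'^@.[x0] = 0.
  have /eqP := Tx0; rewrite TE rmorphM hornerM mulf_eq0 => /orP[/eqP//|/eqP Bx0].
  have := congr1 (fun p : {poly k} => p^@.[x0]) ident.
  rewrite /= rmorphM hornerM Bx0 mulr0 rmorphM hornerM => /esym/eqP; rewrite mulf_eq0.
  rewrite rmorphXn /= horner_exp expf_eq0 /= => /orP[/eqP//|/eqP Hx0].
  have : coprimep B^@ H^@ by rewrite coprimep_map.
  by move/Pdiv.ClosedField.coprimepP => /(_ x0); rewrite rootE Bx0 Hx0 eqxx => /(_ isT).
(* Multiply the coordinates by eta/e and use eta^2 = c: the middle one becomes (c/e) S, nonzero at
   x0 because the roots of c are simple. *)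
pose e := gcdp c T'.
have e0 : e != 0 by rewrite gcdp_eq0 negb_and T'0 orbT.
have cE : c = c %/ e * e by rewrite divpK ?dvdp_gcdl.
have T'E : T' = T' %/ e * e by rewrite divpK ?dvdp_gcdr.
have ex0 : e^@.[x0] = 0.
  apply/rootP; rewrite gcdp_map root_gcd; apply/andP; split; exact/rootP.
have cex0 : (c %/ e)^@.[x0] != 0.
  have := two_division_simple e1 e2 e3 e4 e6 dE cx0.
  rewrite {1}cE rmorphM derivM hornerD !hornerM ex0 mulr0 add0r mulf_eq0 negb_or.
  by case/andP.
apply: (@local_forms_affine 0 (A * (T' %/ e)) (c %/ e * S) 0 0 (T' %/ e * B) (W * e^@)) => //.
- by rewrite mulf_neq0 // map_poly_eq0.
- move=> x y xy; rewrite hornerM mulf_eq0 negb_or => /andP[Wx ex].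
  have [x' [y' [h1 Bx Tx h2 h3]]] := hW x y xy Wx.
  exists x', y'; rewrite !rmorph0 !horner0 !mul0r !addr0 !add0r; split=> //.
    by rewrite !rmorphM !hornerM -h2; ring.
  apply: (mulIf ex); rewrite !rmorphM !hornerM.
  transitivity (c^@.[x] * S^@.[x]); first by rewrite [in RHS]cE rmorphM hornerM; ring.
  move/onE: (xy) => <-; rewrite expr2 -mulrA -h3 {1}TE {1}T'E !rmorphM !hornerM; ring.
- by rewrite rmorphM hornerM !rmorph0 !horner0 !mul0r addr0 mulf_neq0.
Qed.

End Regularity.

(** * Endomorphisms of the complex torus *)

Section Uniformisation.
Variables (C : numClosedFieldType) (E : weierstrass C) (La : set C) (xi : C -> ecpoint C).
Hypothesis ai : analytic_iso E La xi.
Local Notation negp := (negp E).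

Lemma xi_on z : on_curve E (xi z).
Proof.
have [h _ _ _] := ai; suff : [set P | on_curve E P] (xi z) by [].
by rewrite h; exists z.
Qed.

Lemma xi_surj P : on_curve E P -> exists z, xi z = P.
Proof.
have [h _ _ _] := ai => PE; have : [set P | on_curve E P] P by [].
by rewrite h => -[z _ <-]; exists z.
Qed.

Lemma xi0 : xi 0 = Origin.
Proof.
have [_ _ hD _] := ai; have [w hw] := @xi_surj Origin I.
by have := hD w 0; rewrite addr0 hw.
Qed.

Lemma xi_Origin z : xi z = Origin <-> La z.
Proof. by have [_ h _ _] := ai; rewrite -xi0 h subr0. Qed.

Lemma latticeN z : La z -> La (- z).
Proof.
have [_ h _ _] := ai => /xi_Origin hz; rewrite -sub0r; apply/h.
by rewrite hz xi0.
Qed.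

Lemma add_negp P : Defs.add E P (negp P) = Origin.
Proof.
case: P => // x y /=; rewrite eqxx /= ifT //; apply/eqP; ring.
Qed.

Lemma on_curveN P : on_curve E P -> on_curve E (negp P).
Proof.
case: P => //= x y e; apply/eqP; rewrite -subr_eq0; move/eqP: e; rewrite -subr_eq0 => /eqP e.
by apply/eqP; rewrite -[RHS]e; ring.
Qed.

Lemma xiN z : xi (- z) = negp (xi z).
Proof.
have [_ h hD _] := ai.
have [w hw] := xi_surj (on_curveN (xi_on z)).
rewrite -hw; apply/h; rewrite -opprD; apply: latticeN; apply/xi_Origin.
by rewrite hD hw add_negp.
Qed.

Variable r : C.
Hypotheses (r0 : 0 < r) (disc : forall l, La l -> l != 0 -> r <= `|l|).

(** Points become options of pairs, on which membership in a sequence is decidable. *)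
Let code (P : ecpoint C) : option (C * C) := if P is Affine x y then Some (x, y) else None.

Lemma bad_points_finite (W : {poly C}) : W != 0 -> exists bp : seq (option (C * C)),
  forall P, on_curve E P -> code P \notin bp -> exists x y, P = Affine x y /\ W.[x] != 0.
Proof.
move=> W0; have [rs rsE] := closed_field_poly_normal W.
have pt x : exists y, on_curve E (Affine x y).
  have [|y yE] := @solve_monicpoly C 2 (nth 0 [:: x ^+ 3 + a2 E * x ^+ 2 + a4 E * x + a6 E; - (a1 E * x + a3 E)]) => //.
  exists y => /=; rewrite yE !big_ord_recl big_ord0 /=; ring.
have /choice [yo yoE] := pt.
exists (None :: flatten [seq [:: Some (x, yo x); Some (x, - yo x - a1 E * x - a3 E)] | x <- rs]).
case=> [|x y] xy; first by rewrite inE eqxx.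
rewrite inE negb_or => /andP[_ h]; exists x, y; split=> //; apply: contra h => Wx.
have xr : x \in rs by rewrite -root_prod_XsubC -(@rootZ _ _ (lead_coef W)) ?lead_coef_eq0 // -rsE.
apply/flattenP; exists [:: Some (x, yo x); Some (x, - yo x - a1 E * x - a3 E)].
  by apply/mapP; exists x.
have : (y - yo x) * (y - (- yo x - a1 E * x - a3 E)) = 0.
  transitivity ((y ^+ 2 + a1 E * x * y + a3 E * y) - (yo x ^+ 2 + a1 E * x * yo x + a3 E * yo x)); first by ring.
  by move: (xy) (yoE x) => /= -> ->; rewrite subrr.
move=> /eqP; rewrite mulf_eq0 !subr_eq0 !inE => /orP[/eqP->|/eqP->]; first by rewrite eqxx.
by rewrite eqxx orbT.
Qed.

(** Nonzero periods have absolute value at least r, so xi is injective on a disc of radius r/2 and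
    each of the finitely many bad points has at most one preimage there. *)
Lemma bad_arguments_finite (W : {poly C}) z0 : W != 0 -> exists s : seq C, forall z,
  `|z - z0| < r / 2 -> z \notin s -> exists x y, xi z = Affine x y /\ W.[x] != 0.
Proof.
move=> W0; have [bp bpE] := bad_points_finite W0; have [_ h _ _] := ai.
have [g gE] : exists g : option (C * C) -> C, forall z, `|z - z0| < r / 2 ->
    xi (g (code (xi z))) = xi z /\ `|g (code (xi z)) - z0| < r / 2.
  have /choice [g gE] : forall o, exists w, forall z, `|z - z0| < r / 2 -> code (xi z) = o ->
     xi w = xi z /\ `|w - z0| < r / 2.
    move=> o; have [[z [zd zo]]|no] := pselect (exists z, `|z - z0| < r / 2 /\ code (xi z) = o).
      exists z => z' _ e; split=> //; move: zo; rewrite -e.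
      by case: (xi z) (xi z') => [|x y] [|x' y'] //= [-> ->].
    by exists 0 => z zd zo; case: no; exists z.
  by exists g => z zd; apply: gE.
exists [seq g o | o <- bp] => z zd zs; apply: bpE; first exact: xi_on.
apply: contra zs => ob; apply/mapP; exists (code (xi z)) => //.
have [e1 e2] := gE z zd; apply/eqP; rewrite -subr_eq0; apply/negPn/negP => nz.
have /h Lz : xi z = xi (g (code (xi z))) by rewrite e1.
suff : r < r by rewrite ltxx.
apply: le_lt_trans (disc Lz nz) _.
have -> : z - g (code (xi z)) = (z - z0) - (g (code (xi z)) - z0) by ring.
apply: le_lt_trans (ler_normB _ _) _.
by rewrite (splitr r); apply: ltrD.
Qed.

Lemma avoid_finite (z0 d : C) (s : seq C) : 0 < d -> exists z, [/\ `|z - z0| < d, z != z0 & z \notin s].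
Proof.
move=> d0; apply: contrapT => no.
pose w (n : nat) := z0 + d / n.+2%:R.
have winj : injective w.
  move=> m n /addrI/(mulfI (lt0r_neq0 d0))/invr_inj/eqP; rewrite eqr_nat => /eqP.
  by case.
have dn n : 0 < d / n.+2%:R by rewrite divr_gt0 // ltr0n.
have ws n : w n \in s.
  apply/negPn/negP => wn; apply: no; exists (w n); split=> //.
    rewrite /w addrC addKr ger0_norm ?ltW // ltr_pdivrMr ?ltr0n //.
    by rewrite -{1}[d]mulr1 ltr_pM2l // ltr1n.
  by rewrite /w -subr_eq0 addrC addKr lt0r_neq0.
have := @uniq_leq_size _ [seq w n | n <- iota 0 (size s).+1] s.
rewrite map_inj_uniq // iota_uniq size_map size_iota ltnn => F.
by suff: false by []; apply: F => // _ /mapP[n _ ->].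
Qed.

Lemma generic_arguments (b : C) (W V : {poly C}) z0 d : b != 0 -> W != 0 -> V != 0 -> 0 < d ->
  exists z x y x' y', [/\ `|z - z0| < d, z != z0,
    xi z = Affine x y /\ W.[x] != 0 & xi (b * z) = Affine x' y' /\ V.[x'] != 0].
Proof.
move=> b0 W0 V0 d0.
have [s1 h1] := bad_arguments_finite z0 W0; have [s2 h2] := bad_arguments_finite (b * z0) V0.
have r2 : 0 < r / 2 by rewrite divr_gt0 ?ltr0n.
have nb : 0 < `|b| by rewrite normr_gt0.
pose u := d / (r / 2); pose v := d * `|b| / (r / 2).
have u0 : 0 < u by rewrite divr_gt0.
have v0 : 0 < v by rewrite divr_gt0 ?mulr_gt0.
have uE : u * (r / 2) = d by rewrite divfK ?lt0r_neq0.
have vE : v * (r / 2) = d * `|b| by rewrite divfK ?lt0r_neq0.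
(* Dividing d by 1 + u + v puts d' below d, r/2 and (r/2)/|b| at once. *)
pose d' := d / (1 + u + v).
have D0 : 0 < 1 + u + v by rewrite !addr_gt0.
have d'0 : 0 < d' by rewrite divr_gt0.
have [z [zd zz0]] := avoid_finite z0 (s1 ++ [seq b^-1 * w | w <- s2]) d'0.
rewrite mem_cat negb_or => /andP[zs1 zs2].
have d'1 : d' <= d.
  by rewrite ler_pdivrMr // ler_peMr ?(ltW d0) // -addrA lerDl addr_ge0 ?(ltW u0) ?(ltW v0).
have d'2 : d' <= r / 2.
  rewrite ler_pdivrMr // mulrC -uE ler_pM2r // [X in _ <= X]addrAC lerDr.
  by rewrite addr_ge0 ?ler01 ?(ltW v0).
have d'3 : `|b| * d' <= r / 2.
  rewrite mulrA ler_pdivrMr // [`|b| * d]mulrC [X in _ <= X]mulrC -vE ler_pM2r // lerDr.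
  by rewrite addr_ge0 ?ler01 ?(ltW u0).
have [|//|x [y xy]] := h1 z; first exact: lt_le_trans d'2.
have [||x' [y' xy']] := h2 (b * z).
- by rewrite -mulrBr normrM; apply: lt_le_trans d'3; rewrite ltr_pM2l.
- by apply: contra zs2 => bs; apply/mapP; exists (b * z) => //; rewrite mulKf.
by exists z, x, y, x', y'; split=> //; exact: lt_le_trans d'1.
Qed.

End Uniformisation.

(** * Number fields and their embeddings *)

(** Turns a subset closed under the field operations into a field type, over which polynomials can
    be divided. *)
Record subfield_of (C : numClosedFieldType) := SubfieldOf {
  subfield_set : set C; subfield_ofP : is_subfield subfield_set }.

Definition subfield_pred (C : numClosedFieldType) (F : subfield_of C) : {pred C} :=
  fun x => `[< subfield_set F x >].

Lemma subfield_divring_closed (C : numClosedFieldType) (F : subfield_of C) :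
  divring_closed (subfield_pred F).
Proof.
have hF := subfield_ofP F; split; first by apply/asboolP; exact: subfield1.
  by move=> x y /asboolP Fx /asboolP Fy; apply/asboolP; exact: subfieldB.
move=> x y /asboolP Fx /asboolP Fy; apply/asboolP.
by apply: (subfieldM hF) => //; exact: subfieldV.
Qed.

HB.instance Definition _ (C : numClosedFieldType) (F : subfield_of C) :=
  GRing.isDivringClosed.Build C (subfield_pred F) (subfield_divring_closed F).

Record subfield_type (C : numClosedFieldType) (F : subfield_of C) := SubfieldElement {
  subfield_val : C; _ : subfield_val \in subfield_pred F }.

HB.instance Definition _ (C : numClosedFieldType) (F : subfield_of C) :=
  [isSub for @subfield_val C F].
HB.instance Definition _ (C : numClosedFieldType) (F : subfield_of C) :=
  [Choice of subfield_type F by <:].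
HB.instance Definition _ (C : numClosedFieldType) (F : subfield_of C) :=
  [SubChoice_isSubIntegralDomain of subfield_type F by <:].
HB.instance Definition _ (C : numClosedFieldType) (F : subfield_of C) :=
  [SubIntegralDomain_isSubField of subfield_type F by <:].

Lemma subfield_valP (C : numClosedFieldType) (F : subfield_of C) x :
  subfield_set F x <-> exists y : subfield_type F, val y = x.
Proof.
split=> [Fx|[y <-]]; last by have /asboolP := valP y.
by have Fx' : x \in subfield_pred F by [apply/asboolP]; exists (SubfieldElement Fx').
Qed.

Lemma subfield_range (C : numClosedFieldType) (S : set C) : is_subfield S ->
  exists (k : fieldType) (iota : {rmorphism k -> C}), S = range iota.
Proof.
move=> hS; pose F := SubfieldOf hS; exists (subfield_type F), val.
apply/seteqP; split=> x; first by move=> /(@subfield_valP _ F) [y <-]; exists y.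
by move=> [y _ <-]; apply/(@subfield_valP _ F); exists y.
Qed.

(** * Continuity in one complex variable *)

Section Continuity.
Variable C : numClosedFieldType.
Implicit Types f g : C -> C.

Lemma derivable_cts f (z : C) : derivable (f : C^o -> C^o) z 1 -> {for z, continuous f}.
Proof. by move=> /derivable1_diffP/differentiable_continuous. Qed.

Lemma ctsD f g (z : C) : {for z, continuous f} -> {for z, continuous g} ->
  {for z, continuous (fun x => f x + g x)}.
Proof. by move=> hf hg; exact: (@cvgD _ C^o _ _ _ f g _ _ hf hg). Qed.

Lemma ctsM f g (z : C) : {for z, continuous f} -> {for z, continuous g} ->
  {for z, continuous (fun x => f x * g x)}.
Proof. by move=> hf hg; exact: (@cvgM _ _ _ _ f g _ _ hf hg). Qed.

Lemma cts_cst (a z : C) : {for z, continuous (fun _ : C => a)}.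
Proof. exact: (@cst_continuous _ _ a z). Qed.

Lemma cts_id (z : C) : {for z, continuous (fun x : C => x)}.
Proof. exact: (@cvg_id _ _). Qed.

Lemma ctsV f (z : C) : {for z, continuous f} -> f z != 0 ->
  {for z, continuous (fun x => (f x)^-1)}.
Proof. by move=> hf f0; exact: (@cvgV _ _ _ _ f _ f0 hf). Qed.

Lemma ctsB f g (z : C) : {for z, continuous f} -> {for z, continuous g} ->
  {for z, continuous (fun x => f x - g x)}.
Proof.
move=> hf hg; apply: ctsD => //; suff -> : (fun x => - g x) = (fun x => -1 * g x).
  by apply: ctsM => //; exact: cts_cst.
by apply/funext => x; rewrite mulN1r.
Qed.

Lemma ctsX f n (z : C) : {for z, continuous f} -> {for z, continuous (fun x => f x ^+ n)}.
Proof.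
move=> hf; elim: n => [|n IH]; first exact: cts_cst.
have -> : (fun x => f x ^+ n.+1) = (fun x => f x * f x ^+ n) by apply/funext => x; rewrite exprS.
exact: ctsM.
Qed.

Lemma cts_sum n (F : 'I_n -> C -> C) (z : C) : (forall i, {for z, continuous (F i)}) ->
  {for z, continuous (fun x => \sum_i F i x)}.
Proof.
elim: n F => [|n IH] F hF.
  have -> : (fun x => \sum_(i < 0) F i x) = (fun=> 0) by apply/funext => x; rewrite big_ord0.
  exact: cts_cst.
have -> : (fun x => \sum_(i < n.+1) F i x) = (fun x => F ord0 x + \sum_(i < n) F (lift ord0 i) x).
  by apply/funext => x; rewrite big_ord_recl.
by apply: ctsD => //; apply: IH.
Qed.

Lemma cts_horner (p : {poly C}) f (z : C) : {for z, continuous f} ->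
  {for z, continuous (fun x => p.[f x])}.
Proof.
move=> hf; have -> : (fun x => p.[f x]) = (fun x => \sum_(i < size p) p`_i * f x ^+ i).
  by apply/funext => x; rewrite horner_coef.
by apply: cts_sum => i; apply: ctsM; [exact: cts_cst | exact: ctsX].
Qed.

Lemma cts_scale f (a z : C) : {for a * z, continuous f} -> {for z, continuous (fun x => f (a * x))}.
Proof.
move=> hf; apply: (@continuous_comp _ _ _ (fun x => a * x) f) => //.
by apply: ctsM; [exact: cts_cst | exact: cts_id].
Qed.

Lemma cts_neq0 f (z : C) : {for z, continuous f} -> f z != 0 ->
  exists2 d, 0 < d & forall w, `|w - z| < d -> f w != 0.
Proof.
move=> hf f0; have := cvgr_neq0 _ hf f0; move=> /(_ (nbhs_filter z)) /nbhs_ballP [d /= d0 hd].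
by exists d => // w wd; apply: hd => /=; rewrite /ball /= distrC.
Qed.

Lemma cts_eval_form d (c : nat -> nat -> C) X Y Z (z : C) :
  {for z, continuous X} -> {for z, continuous Y} -> {for z, continuous Z} ->
  {for z, continuous (fun x => eval_form d c (X x) (Y x) (Z x))}.
Proof.
move=> hX hY hZ; apply: cts_sum => i; apply: cts_sum => j.
apply: ctsM; last exact: ctsX; apply: ctsM; last exact: ctsX.
by apply: ctsM; [exact: cts_cst | exact: ctsX].
Qed.

Lemma eval_form_homogeneous d c (l X Y Z : C) :
  eval_form d c (l * X) (l * Y) (l * Z) = l ^+ d * eval_form d c X Y Z.
Proof.
rewrite /eval_form mulr_sumr; apply: eq_bigr => i _; rewrite mulr_sumr; apply: eq_bigr => j _.
have -> : l ^+ d = l ^+ i * l ^+ j * l ^+ (d - i - j).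
  rewrite -!exprD; congr (_ ^+ _).
  by have := ltn_ord i; have := ltn_ord j; move: (nat_of_ord i) (nat_of_ord j); clear; lia.
by rewrite !exprMn; ring.
Qed.

Lemma projective_eval X Y Z (P : ecpoint C) : projective X Y Z P ->
  exists2 l, l != 0 & forall d c, eval_form d c X Y Z = l ^+ d * eval_point d c P.
Proof.
case: P => [[-> Y0 ->]|x y [-> -> Z0]].
  by exists Y => // d c; rewrite -eval_form_homogeneous !mulr0 mulr1.
by exists Z => // d c; rewrite -eval_form_homogeneous mulr1 ![Z * _]mulrC.
Qed.

Lemma projective_parallel X Y Z X' Y' Z' (P : ecpoint C) : projective X' Y' Z' P ->
  X * Z' = X' * Z -> Y * Z' = Y' * Z -> X * Y' = X' * Y ->
  [\/ X != 0, Y != 0 | Z != 0] -> projective X Y Z P.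
Proof.
case: P => [[-> Y0 ->]|x y [-> -> Z0]] e1 e2 e3 nz.
  have X0 : X = 0 by apply: (mulIf Y0); rewrite e3 !mul0r.
  have Z0 : Z = 0 by apply: (mulfI Y0); rewrite -e2 !mulr0.
  by split=> //; case: nz; rewrite ?X0 ?Z0 ?eqxx.
have X0 : X = x * Z by apply: (mulIf Z0); rewrite e1; ring.
have Y0 : Y = y * Z by apply: (mulIf Z0); rewrite e2; ring.
split=> //; apply: contraTN isT => /eqP Ze.
by case: nz; rewrite ?X0 ?Y0 Ze ?mulr0 eqxx.
Qed.

End Continuity.

(** * Endomorphisms given by multiplication on C *)

Section AnalyticEndomorphism.
Variables (C : numClosedFieldType) (E : weierstrass C) (La : set C) (xi : C -> ecpoint C).
Hypothesis ai : analytic_iso E La xi.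
Variable r : C.
Hypotheses (r0 : 0 < r) (disc : forall l, La l -> l != 0 -> r <= `|l|).
Variables (a : C) (f : ecpoint C -> ecpoint C).
Hypotheses (a0 : a != 0) (fxi : forall z, f (xi z) = xi (a * z)).

(** Holomorphy enters the argument here, as continuity at z0 of homogeneous coordinates of xi that
    are valid on a disc. *)
Lemma local_coordinates z0 : exists X Y Z d,
  [/\ 0 < d, [/\ {for z0, continuous X}, {for z0, continuous Y} & {for z0, continuous Z}] &
      forall z, `|z - z0| < d -> projective (X z) (Y z) (Z z) (xi z)].
Proof.
have [_ _ _ /(_ z0) [X [Y [Z nr]]]] := ai.
have [dX dY dZ _] := nbhs_singleton nr.
move: nr => /nbhs_ballP [d /= d0 hd]; exists X, Y, Z, d; split=> //.
  by split; apply: derivable_cts.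
move=> z zd; have zb : ball z0 d z by rewrite /ball /= distrC.
by have [] := hd z zb.
Qed.

(** Compare the forms along xi near z0 with local coordinates of xi near a z0: the 2 by 2 minors are
    continuous in z and vanish at generic z, which accumulate at z0, so they vanish at z0. *)
Lemma analytic_generic_forms : generic_forms E f.
Proof.
move=> d cX cY cZ W W0 hW Q QE nz; have [z0 z0E] := xi_surj ai QE.
have [X [Y [Z [d1 [d10 [hX hY hZ] pr]]]]] := local_coordinates z0.
have [X' [Y' [Z' [d2 [d20 [hX' hY' hZ'] pr']]]]] := local_coordinates (a * z0).
have pr0 : projective (X z0) (Y z0) (Z z0) Q by rewrite -z0E; apply: pr; rewrite subrr normr0.
have pr0' : projective (X' (a * z0)) (Y' (a * z0)) (Z' (a * z0)) (f Q).
  by rewrite -z0E fxi; apply: pr'; rewrite subrr normr0.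
have [l l0 lE] := projective_eval pr0.
have ld : l ^+ d != 0 by rewrite expf_neq0.
pose FX z := eval_form d cX (X z) (Y z) (Z z).
pose FY z := eval_form d cY (X z) (Y z) (Z z).
pose FZ z := eval_form d cZ (X z) (Y z) (Z z).
have cFX : {for z0, continuous FX} by exact: cts_eval_form.
have cFY : {for z0, continuous FY} by exact: cts_eval_form.
have cFZ : {for z0, continuous FZ} by exact: cts_eval_form.
have cX' := cts_scale hX'; have cY' := cts_scale hY'; have cZ' := cts_scale hZ'.
have key (G : C -> C) : {for z0, continuous G} -> (forall z x y x' y', xi z = Affine x y -> W.[x] != 0 ->
     `|z - z0| < d1 -> `|a * z - a * z0| < d2 -> f (Affine x y) = Affine x' y' ->
     FX z = x' * FZ z -> FY z = y' * FZ z ->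
     X' (a * z) = x' * Z' (a * z) -> Y' (a * z) = y' * Z' (a * z) -> G z = 0) -> G z0 = 0.
  move=> cG hG; apply/eqP/negPn/negP => G0; have [d3 d30 hd3] := cts_neq0 cG G0.
  (* The inverse of a sum of inverses lies below d1, d2/|a| and d3. *)
  pose d4 := (d1^-1 + d2^-1 * `|a| + d3^-1)^-1.
  have na : 0 < `|a| by rewrite normr_gt0.
  have i1 : 0 < d1^-1 by rewrite invr_gt0. have i2 : 0 < d2^-1 * `|a| by rewrite mulr_gt0 ?invr_gt0.
  have i3 : 0 < d3^-1 by rewrite invr_gt0.
  have d40 : 0 < d4 by rewrite invr_gt0 !addr_gt0.
  have d41 : d4 <= d1.
    by rewrite -[d1]invrK lef_pV2 ?posrE ?addr_gt0 // -addrA lerDl addr_ge0 ?ltW.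
  have d43 : d4 <= d3.
    by rewrite -[d3]invrK lef_pV2 ?posrE ?addr_gt0 // lerDr addr_ge0 ?ltW.
  have d42 : `|a| * d4 <= d2.
    rewrite mulrC -ler_pdivlMr // -[d2 / _]invrK lef_pV2 ?posrE ?addr_gt0 ?invr_gt0 ?divr_gt0 //.
    by rewrite invfM invrK [d1^-1 + _]addrC -addrA lerDl addr_ge0 ?ltW.
  have [z [x [y [_ [_ [zd _ [xz Wx] _]]]]]] := generic_arguments ai r0 disc z0 (oner_neq0 C) W0 (oner_neq0 _) d40.
  have := hd3 z (lt_le_trans zd d43); rewrite (_ : G z = 0) ?eqxx //.
  have xy : on_curve E (Affine x y) by rewrite -xz; exact: (xi_on ai).
  have [x' [y' [h1 h2 h3]]] := hW x y xy Wx.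
  have zd1 := lt_le_trans zd d41.
  have zd2 : `|a * z - a * z0| < d2.
    by rewrite -mulrBr normrM; apply: lt_le_trans d42; rewrite ltr_pM2l.
  have [l' l'0 l'E] := projective_eval (pr z zd1).
  have := pr' _ zd2; rewrite -fxi xz h1 => -[e1 e2 _].
  by apply: (hG z x y x' y') => //; rewrite /FX /FY /FZ !l'E xz /= ?h2 ?h3; ring.
have G1 : FX z0 * Z' (a * z0) - X' (a * z0) * FZ z0 = 0.
  apply: (key (fun z => FX z * Z' (a * z) - X' (a * z) * FZ z)).
    by apply: ctsB; apply: ctsM.
  by move=> z x y x' y' _ _ _ _ _ -> _ -> _; ring.
have G2 : FY z0 * Z' (a * z0) - Y' (a * z0) * FZ z0 = 0.
  apply: (key (fun z => FY z * Z' (a * z) - Y' (a * z) * FZ z)).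
    by apply: ctsB; apply: ctsM.
  by move=> z x y x' y' _ _ _ _ _ _ -> _ ->; ring.
have G3 : FX z0 * Y' (a * z0) - X' (a * z0) * FY z0 = 0.
  apply: (key (fun z => FX z * Y' (a * z) - X' (a * z) * FY z)).
    by apply: ctsB; apply: ctsM.
  by move=> z x y x' y' _ _ _ _ _ -> -> -> ->; ring.
move/eqP: G1; rewrite subr_eq0 => /eqP; move/eqP: G2; rewrite subr_eq0 => /eqP.
move/eqP: G3; rewrite subr_eq0 => /eqP; rewrite /FX /FY /FZ !lE => g3 g2 g1.
apply: (projective_parallel pr0' _ _ _ nz); apply: (mulfI ld).
- by rewrite mulrA g1; ring.
- by rewrite mulrA g2; ring.
- by rewrite mulrA g3; ring.
Qed.

Lemma horner_reverse (p : {poly C}) n v x : (size p <= n.+1)%N -> v * x = 1 ->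
  (\poly_(i < n.+1) p`_(n - i)).[v] = v ^+ n * p.[x].
Proof.
move=> sp vx; rewrite horner_poly (horner_coef_wide _ sp) mulr_sumr (reindex_inj rev_ord_inj) /=.
apply: eq_bigr => i _; have le_in : (i <= n)%N by rewrite -ltnS.
rewrite subSS subKn // mulrCA; congr (_ * _).
have -> : v ^+ n = v ^+ (n - i) * v ^+ i by rewrite -exprD subnK.
by rewrite -mulrA -exprMn vx expr1n mulr1.
Qed.

(** The origin maps to the origin, so the abscissa of f has a pole there, like x. In terms of a
    continuous V = 1/x, a numerator A of degree at most n = deg B would give Br(V(z)) = Ar(V(z)) V(a
    z) at generic z near 0, with reversed polynomials Br and Ar. By continuity this would hold at 0,
    where the left side is the leading coefficient of B and the right side is 0. *)
Lemma analytic_degree (k : fieldType) (iota : {rmorphism k -> C}) A B S T :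
  ratrep iota E f A B S T -> (size B < size A)%N.
Proof.
move=> rf; have [B0 _ _] := rf; have [W W0 hW] := ratrep_neq0 rf.
rewrite ltnNge; apply/negP => sAB; pose n := (size B).-1.
have sB : size B = n.+1 by rewrite prednK // size_poly_gt0.
have [X [Y [Z [d [d0 [hX hY hZ] pr]]]]] := local_coordinates 0.
have [X0 Y0 Z0] : projective (X 0) (Y 0) (Z 0) Origin.
  by rewrite -(xi0 ai); apply: pr; rewrite subrr normr0.
(* By the equation of the curve U = X^3/Z where Z is nonzero, so X^2/U extends Z/X = 1/x across the
   origin, where U = Y^2. *)
pose U z := Y z ^+ 2 + a1 E * (X z * Y z) + a3 E * (Y z * Z z) - a2 E * X z ^+ 2
  - a4 E * (X z * Z z) - a6 E * Z z ^+ 2.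
have cU : {for 0, continuous U}.
  have cc w (h : C -> C) : {for 0, continuous h} -> {for 0, continuous (fun z => w * h z)}.
    by move=> ch; apply: ctsM => //; exact: cts_cst.
  rewrite /U; do 3 (apply: ctsB; last by apply: cc; first [apply: ctsX | apply: ctsM]).
  do 2 (apply: ctsD; last by apply: cc; apply: ctsM).
  exact: ctsX.
have U0 : U 0 != 0 by rewrite /U X0 Z0 !(mulr0, mul0r, expr0n, addr0, subr0) /= ?subr0 expf_neq0.
pose V z := X z ^+ 2 * (U z)^-1.
have cV : {for 0, continuous V} by apply: ctsM; [exact: ctsX | exact: ctsV].
have V0 : V 0 = 0 by rewrite /V X0 expr0n mul0r.
have cVa : {for 0, continuous (fun z => V (a * z))} by apply: cts_scale; rewrite mulr0.
have [dU dU0 hU] := cts_neq0 cU U0.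
have VE z x y : `|z| < d -> `|z| < dU -> xi z = Affine x y -> V z * x = 1.
  move=> zd zdU xz; have := pr z; rewrite subr0 xz => /(_ zd) [eX eY nZ].
  have Uz : U z != 0 by apply: hU; rewrite subr0.
  have : on_curve E (Affine x y) by rewrite -xz; exact: (xi_on ai).
  move=> /= /eqP; rewrite -subr_eq0 => /eqP xy.
  apply: (mulIf Uz); rewrite mul1r /V mulrAC divfK //.
  apply: (mulfI nZ); apply/eqP; rewrite -subr_eq0 /U eX eY; apply/eqP.
  transitivity (- Z z ^+ 3 * (y ^+ 2 + a1 E * x * y + a3 E * y - (x ^+ 3 + a2 E * x ^+ 2 + a4 E * x + a6 E))).
    by ring.
  by rewrite xy mulr0.
pose Br := \poly_(i < n.+1) (map_poly iota B)`_(n - i).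
pose Ar := \poly_(i < n.+1) (map_poly iota A)`_(n - i).
pose G z := Br.[V z] - Ar.[V z] * V (a * z).
have cG : {for 0, continuous G}.
  by apply: ctsB; [exact: cts_horner | apply: ctsM => //; exact: cts_horner].
have G0 : G 0 != 0.
  rewrite /G mulr0 V0 mulr0 subr0 horner_coef0 coef_poly ltn0Sn subn0 coef_map fmorph_eq0.
  by rewrite -/(lead_coef B) lead_coef_eq0.
have [dG dG0 hG] := cts_neq0 cG G0.
pose m := `|a| + 1.
have m0 : 0 < m by rewrite ltr_wpDl ?ltr01.
pose d4 := (d^-1 * m + dU^-1 * m + dG^-1)^-1.
have i1 : 0 < d^-1 * m by rewrite mulr_gt0 ?invr_gt0.
have i2 : 0 < dU^-1 * m by rewrite mulr_gt0 ?invr_gt0.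
have i3 : 0 < dG^-1 by rewrite invr_gt0.
have d40 : 0 < d4 by rewrite invr_gt0 !addr_gt0.
have h1 : m * d4 <= d.
  rewrite mulrC -ler_pdivlMr // -[d / _]invrK lef_pV2 ?posrE ?addr_gt0 ?invr_gt0 ?divr_gt0 //.
  by rewrite invfM invrK -addrA lerDl addr_ge0 ?ltW.
have h2 : m * d4 <= dU.
  rewrite mulrC -ler_pdivlMr // -[dU / _]invrK lef_pV2 ?posrE ?addr_gt0 ?invr_gt0 ?divr_gt0 //.
  by rewrite invfM invrK addrAC lerDr addr_ge0 ?ltW.
have h3 : d4 <= dG.
  by rewrite -[dG]invrK lef_pV2 ?posrE ?addr_gt0 // lerDr addr_ge0 ?ltW.
have am : `|a| <= m by rewrite lerDl ler01.
have m1 : 1 <= m by rewrite lerDr.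
have [z [x [y [x' [y' [zd _ [xz Wx] [xz' _]]]]]]] :=
  generic_arguments ai r0 disc 0 a0 W0 (oner_neq0 _) d40.
rewrite subr0 in zd.
have mz : m * `|z| < m * d4 by rewrite ltr_pM2l.
have z1 : `|z| < m * d4 by apply: le_lt_trans mz; rewrite ler_peMl.
have z2 : `|a * z| < m * d4 by rewrite normrM; apply: le_lt_trans mz; rewrite ler_wpM2r.
have v1 := VE z x y (lt_le_trans z1 h1) (lt_le_trans z1 h2) xz.
have v2 := VE _ x' y' (lt_le_trans z2 h1) (lt_le_trans z2 h2) xz'.
have := hG z; rewrite subr0 => /(_ (lt_le_trans zd h3)).
have xy : on_curve E (Affine x y) by rewrite -xz; exact: (xi_on ai).
have [x1 [y1 [e1 _ _ e2 _]]] := hW x y xy Wx.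
move: e1; rewrite -xz fxi xz' => -[ex _]; rewrite -ex in e2.
rewrite /G !(@horner_reverse _ n _ x) ?size_map_poly -?sB // -e2.
rewrite (_ : _ - _ = (V z ^+ n * (map_poly iota B).[x]) * (1 - V (a * z) * x')); last by ring.
by rewrite v2 subrr mulr0 eqxx.
Qed.

End AnalyticEndomorphism.

(** With a section s of xi, f is xi(a s(P)); stability of La under a makes it independent of s. Then
    f o h = g exhibits f as a quotient of two maps over F: this makes it rational over F, and then
    given by forms over F. *)
Lemma analytic_endomorphism_over (C : numClosedFieldType) (F : set C) (E : weierstrass C)
    (La : set C) (xi : C -> ecpoint C) (r a m : C) (g h : ecpoint C -> ecpoint C) :
  is_subfield F -> elliptic_curve_over F E -> analytic_iso E La xi ->
  0 < r -> (forall l, La l -> l != 0 -> r <= `|l|) ->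
  (forall l, La l -> La (a * l)) -> a != 0 -> m != 0 ->
  endomorphism_over F E h -> (forall z, h (xi z) = xi (m * z)) ->
  endomorphism_over F E g -> (forall z, g (xi z) = xi (m * a * z)) ->
  exists2 f, endomorphism_over F E f & forall z, f (xi z) = xi (a * z).
Proof.
move=> hF [[F1 F2 F3 F4 F6] dE] ai r0 disc aLa a0 m0 eh hxi eg gxi.
have [k [iota FE]] := subfield_range hF.
have co x : F x -> exists y, x = iota y by rewrite FE => -[y _ <-]; exists y.
have [al1 e1] := co _ F1; have [al2 e2] := co _ F2; have [al3 e3] := co _ F3.
have [al4 e4] := co _ F4; have [al6 e6] := co _ F6.
rewrite FE in eh eg *.
have [_ hx _ _] := ai.
have [s sE] : exists s : ecpoint C -> C, forall P, on_curve E P -> xi (s P) = P.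
  have /choice [s sE] : forall P, exists z, on_curve E P -> xi z = P.
    move=> P; have [PE|nP] := pselect (on_curve E P); last by exists 0.
    by have [z <-] := xi_surj ai PE; exists z.
  by exists s.
pose f P := xi (a * s P).
have fxi z : f (xi z) = xi (a * z).
  apply/hx; rewrite -mulrBr; apply: aLa; apply/hx; apply: sE; exact: (xi_on ai).
have on P : on_curve E P -> exists z, P = xi z by move=> /(xi_surj ai)[z <-]; exists z.
have neg b (q : ecpoint C -> ecpoint C) : (forall z, q (xi z) = xi (b * z)) ->
    forall P, on_curve E P -> q (negp E P) = negp E (q P).
  by move=> qxi P /on[z ->]; rewrite -(xiN ai) !qxi mulrN (xiN ai).
have dom b (q : ecpoint C -> ecpoint C) : b != 0 -> (forall z, q (xi z) = xi (b * z)) ->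
    forall W V : {poly C}, W != 0 -> V != 0 -> exists x y x' y',
     [/\ on_curve E (Affine x y), W.[x] != 0, q (Affine x y) = Affine x' y' & V.[x'] != 0].
  move=> b0 qxi W V W0 V0.
  have [z [x [y [x' [y' [_ _ [xz Wx] [xz' Vx]]]]]]] := generic_arguments ai r0 disc 0 b0 W0 V0 ltr01.
  exists x, y, x', y'; split=> //; last by rewrite -xz qxi.
  by rewrite -xz; exact: (xi_on ai).
have rep b q : b != 0 -> (forall z, q (xi z) = xi (b * z)) -> endomorphism_over (range iota) E q ->
    exists A B S T, ratrep iota E q A B S T.
  move=> b0 qxi eq; apply: (endomorphism_ratrep e1 e2 e3 e4 e6 eq (neg _ _ qxi)) => W W0.
  have [x [y [x' [y' [xy Wx qx _]]]]] := dom b q b0 qxi W 1 W0 (oner_neq0 _).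
  by exists x, y; rewrite qx.
have [A [B [Sh [T rh]]]] := rep _ _ m0 hxi eh.
have [A2 [B2 [S2 [T2 rg]]]] := rep _ _ (mulf_neq0 m0 a0) gxi eg.
have [||A3 [B3 [S3 [T3 rf]]]] := ratrep_quotient e1 e2 e3 e4 e6 rh rg _ _ (neg _ _ fxi) (dom _ _ m0 hxi).
- by move=> P /on[z ->]; rewrite hxi; exact: (xi_on ai).
- by move=> P /on[z ->]; rewrite hxi fxi gxi mulrCA mulrA.
have [A4 [B4 [S4 [T4 [c1 c2 rf']]]]] := ratrep_coprime rf.
exists f => //; apply: (ratrep_endomorphism e1 e2 e3 e4 e6 dE rf' c1 c2).
- by move=> P _; exact: (xi_on ai).
- by rewrite -(xi0 ai) fxi mulr0.
- exact: (analytic_generic_forms ai r0 disc a0 fxi).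
- exact: (analytic_degree ai r0 disc a0 fxi rf').
Qed.

Section Embeddings.
Variable C : numClosedFieldType.
Implicit Types (L F K : numField C).
Local Notation ratp := (map_poly (ratr : rat -> C)).

Section Morphism.
Variables (L : numField C) (s : C -> C).
Hypothesis es : embedding L s.
Let hL := nf_subfield L.

Lemma embedding0 : s 0 = 0. Proof. exact: (embedding_nat 0 es). Qed.
Lemma embedding1 : s 1 = 1. Proof. by case: es. Qed.
Lemma embeddingB x y : nf_set L x -> nf_set L y -> s (x - y) = s x - s y. Proof. by case: es => _ + _; exact. Qed.
Lemma embeddingM x y : nf_set L x -> nf_set L y -> s (x * y) = s x * s y. Proof. by case: es => _ _; exact. Qed.

Lemma embeddingN x : nf_set L x -> s (- x) = - s x.
Proof. by move=> Lx; rewrite -sub0r embeddingB // ?embedding0 ?sub0r //; exact: subfield0. Qed.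

Lemma embeddingD x y : nf_set L x -> nf_set L y -> s (x + y) = s x + s y.
Proof.
by move=> Lx Ly; rewrite -[y]opprK embeddingB ?embeddingN ?opprK //; exact: subfieldN.
Qed.

Lemma embeddingX x n : nf_set L x -> nf_set L (x ^+ n) /\ s (x ^+ n) = s x ^+ n.
Proof.
move=> Lx; elim: n => [|n [IH1 IH2]]; first by rewrite !expr0 embedding1; split=> //; exact: (subfield1 hL).
by rewrite !exprS embeddingM // IH2; split=> //; exact: (subfieldM hL).
Qed.

Lemma embedding_neq0 x : nf_set L x -> x != 0 -> s x != 0.
Proof.
move=> Lx x0; apply: contra_neq (oner_neq0 C) => sx.
rewrite -embedding1 -(divff x0) embeddingM ?sx ?mul0r //; exact: (subfieldV hL).
Qed.

Lemma embedding_inj x y : nf_set L x -> nf_set L y -> s x = s y -> x = y.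
Proof.
move=> Lx Ly e; apply/eqP; rewrite -subr_eq0; apply: contraTT isT => xy.
have := embedding_neq0 (subfieldB hL Lx Ly) xy.
by rewrite embeddingB // e subrr eqxx.
Qed.

Lemma embedding_sum n (f : 'I_n -> C) : (forall i, nf_set L (f i)) ->
  nf_set L (\sum_i f i) /\ s (\sum_i f i) = \sum_i s (f i).
Proof.
elim: n f => [|n IH] f Lf.
  by rewrite !big_ord0 embedding0; split=> //; exact: (subfield0 hL).
rewrite !big_ord_recr /=; have [h1 h2] := IH (fun i => f (widen_ord (leqnSn n) i)) (fun i => Lf _).
by rewrite embeddingD // h2; split=> //; exact: (subfieldD hL).
Qed.

Lemma embedding_horner (p : {poly C}) x : (forall i, nf_set L p`_i) -> nf_set L x ->
  nf_set L p.[x] /\ s p.[x] = \sum_(i < size p) s p`_i * s x ^+ i.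
Proof.
move=> Lp Lx; rewrite horner_coef.
have LX i : nf_set L (p`_i * x ^+ i) by apply: (subfieldM hL) => //; case: (embeddingX i Lx).
have [h1 ->] := embedding_sum (fun i : 'I_(size p) => LX i); split=> //.
by apply: eq_bigr => i _; have [h2 h3] := embeddingX i Lx; rewrite embeddingM // h3.
Qed.

Lemma embedding_fixed_horner (p : {poly C}) x :
  (forall i, nf_set L p`_i /\ s p`_i = p`_i) -> nf_set L x -> s p.[x] = p.[s x].
Proof.
move=> hp Lx; have [_ ->] := embedding_horner (fun i => (hp i).1) Lx.
by rewrite [RHS]horner_coef; apply: eq_bigr => i _; rewrite (hp i).2.
Qed.

End Morphism.

Lemma rat_in L (q : rat) : nf_set L (ratr q).
Proof.
have hL := nf_subfield L.
have Lint (z : int) : nf_set L z%:~R.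
  case: z => m; [exact: (subfield_nat hL m) | rewrite NegzE rmorphN; apply: (subfieldN hL _); exact: (subfield_nat hL _)].
by rewrite /ratr; apply: (subfieldM hL) => //; apply: (subfieldV hL).
Qed.

Lemma embedding_rat L s (q : rat) : embedding L s -> s (ratr q) = ratr q.
Proof.
move=> es; have hL := nf_subfield L.
have Lint (z : int) : nf_set L z%:~R by rewrite -ratr_int; exact: rat_in.
have sint (z : int) : s z%:~R = z%:~R.
  case: z => m; first exact: embedding_nat m es.
  rewrite NegzE rmorphN /= (embeddingN es); first by congr (- _); exact: embedding_nat m.+1 es.
  exact: (subfield_nat hL m.+1).
have d0 : (denq q)%:~R != 0 :> C by rewrite intr_eq0 denq_neq0.
apply: (mulIf d0); rewrite {2}/ratr divfK // -(sint (denq q)) -(embeddingM es) //; last exact: rat_in.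
by rewrite /ratr divfK.
Qed.

Lemma ratp_in L (p : {poly rat}) x : nf_set L x -> nf_set L (ratp p).[x].
Proof.
move=> Lx; have eid : embedding L id by split.
apply: (embedding_horner eid _ Lx).1 => i; rewrite coef_map; exact: rat_in.
Qed.

Lemma embedding_ratp L s (p : {poly rat}) x : embedding L s -> nf_set L x ->
  s (ratp p).[x] = (ratp p).[s x].
Proof.
move=> es Lx; apply: (embedding_fixed_horner es) => // i; rewrite coef_map.
by split; [exact: rat_in | exact: (embedding_rat _ es)].
Qed.

Lemma numfield_algebraic L x : nf_set L x -> exists2 p : {poly rat}, p != 0 & root (ratp p) x.
Proof.
move=> Lx; have [d d0 [_ [P Pm rP]]] := integral_multiple Lx.
have d0' : d%:R != 0 :> rat by rewrite pnatr_eq0 -lt0n.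
exists (map_poly intr P \Po (d%:R *: 'X)).
  rewrite comp_poly2_eq0 ?size_scale ?size_polyX // map_poly_eq0_id0; first exact: monic_neq0.
  by rewrite intr_eq0 (monicP Pm).
rewrite rootE map_comp_poly horner_comp linearZ /= map_polyX hornerZ hornerX rmorph_nat.
rewrite -map_poly_comp (@eq_map_poly _ _ _ (intr : int -> C)) //; last by move=> z /=; exact: ratr_int.
Qed.

Lemma primitive_list L n (b : 'I_n -> C) : (forall i, nf_set L (b i)) ->
  exists2 g, nf_set L g & forall i, exists q, b i = (ratp q).[g].
Proof.
have hL := nf_subfield L.
elim: n b => [|n IH] b Lb; first by exists 0; [exact: (subfield0 hL) | case].
have [g Lg hg] := IH (fun i => b (lift ord0 i)) (fun i => Lb _).
have [p p0 rp] := numfield_algebraic Lg; have [q q0 rq] := numfield_algebraic (Lb ord0).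
have char0 : has_pchar0 rat by apply: pchar_num.
have [m [[u hu] [v hv]]] := pchar0_PET p0 rp q0 rq char0.
have Lz : nf_set L (b ord0 *+ m - g).
  by apply: (subfieldB hL) => //; rewrite -mulr_natr; apply: (subfieldM hL) => //; exact: subfield_nat.
exists (b ord0 *+ m - g) => // i; case: (unliftP ord0 i) => [j ->|->]; last by exists v; exact: esym hv.
have [w ->] := hg j; exists (w \Po u).
by rewrite map_comp_poly horner_comp; congr (_.[_]); exact: esym hu.
Qed.

Lemma primitive_element L : exists2 g, nf_set L g &
  forall x, nf_set L x -> exists q, x = (ratp q).[g].
Proof.
have [n [b [span _]]] := nf_finite L.
have Lb i : nf_set L (b i).
  apply/span; exists (fun j => (i == j)%:R); split=> [j|].
    by exists (i == j)%:R => //; rewrite rmorph_nat.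
  rewrite (bigD1 i) //= eqxx mul1r big1 ?addr0 // => j ji.
  by rewrite eq_sym (negPf ji) mul0r.
have [g Lg hg] := primitive_list Lb; exists g => // x /span [c [cQ ->]].
have /choice [q qE] := hg.
have /choice [r rE] : forall i, exists r : rat, ratr r = c i by move=> i; have [r _ <-] := cQ i; exists r.
exists (\sum_i r i *: q i); rewrite rmorph_sum /= horner_sum; apply: eq_bigr => i _.
by rewrite linearZ /= hornerZ -qE rE.
Qed.

End Embeddings.

Section MinimalPolynomial.
Variables (k : fieldType) (C : numClosedFieldType) (iota : {rmorphism k -> C}).

Lemma minimal_poly_exists x (P : {poly k}) : P != 0 -> root (map_poly iota P) x ->
  exists p : {poly k}, [/\ p != 0, root (map_poly iota p) x,
    forall Q, root (map_poly iota Q) x -> p %| Q &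
    forall y, root (map_poly iota p) y -> (map_poly iota p)^`().[y] != 0].
Proof.
move=> P0 rP.
pose A n := `[< exists p : {poly k}, [/\ p != 0, root (map_poly iota p) x & size p = n] >].
have exA : exists n, A n by exists (size P); apply/asboolP; exists P.
case: (ex_minnP exA) => n /asboolP [p [p0 rp sp]] min.
have div Q : root (map_poly iota Q) x -> p %| Q.
  move=> rQ; apply/modp_eq0P/eqP/negPn/negP => r0.
  have : root (map_poly iota (Q %% p)) x.
    have /rootP := rQ; rewrite {1}(divp_eq Q p) rmorphD rmorphM hornerD hornerM (rootP rp) mulr0 add0r.
    by move=> e; apply/rootP.
  move=> rr; have := min (size (Q %% p)); rewrite leqNgt -sp ltn_modp p0 => F.
  by suff: false by []; apply: F; apply/asboolP; exists (Q %% p).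
exists p; split=> // y ry.
have sp1 : (1 < size p)%N.
  rewrite ltnNge; apply/negP => /size1_polyC pE; move: rp p0; rewrite pE map_polyC rootC fmorph_eq0.
  by rewrite polyC_eq0 => /eqP ->; rewrite eqxx.
have p'0 : p^`() != 0.
  apply/eqP => p'0; have := congr1 (map_poly iota) p'0; rewrite -deriv_map rmorph0 => /deriv_eq0_num.
  by rewrite size_map_poly leqNgt sp1.
have cop : coprimep p p^`().
  pose d := gcdp p p^`(); have d0 : d != 0 by rewrite gcdp_eq0 negb_and p0.
  have pE : p = p %/ d * d by rewrite divpK ?dvdp_gcdl.
  rewrite /coprimep -/d; apply/negPn/negP => sd.
  have : root (map_poly iota (p %/ d)) x || root (map_poly iota d) x.
    by rewrite -rootM -rmorphM -pE.
  case/orP => /div pd.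
    have q0 : p %/ d != 0 by apply: contraNneq p0 => q0; rewrite pE q0 mul0r.
    have := dvdp_leq q0 pd; rewrite {1}pE size_mul //.
    by have : (0 < size d)%N; [rewrite size_poly_gt0 | move: sd; case: (size d) => [|[|m]] // _ _; rewrite addnS /= addnS ltnNge leq_addr].
  have := dvdp_leq p'0 (dvdp_trans pd (dvdp_gcdr p p^`())).
  by rewrite leqNgt lt_size_deriv.
have : coprimep (map_poly iota p) (map_poly iota p^`()) by rewrite coprimep_map.
by move=> /Pdiv.ClosedField.coprimepP /(_ y ry); rewrite deriv_map.
Qed.

End MinimalPolynomial.

Lemma map_prod_XsubC (k : fieldType) (C : numClosedFieldType) (f : {rmorphism k -> C}) (t : seq k) :
  map_poly f (\prod_(z <- t) ('X - z%:P)) = \prod_(z <- map f t) ('X - z%:P).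
Proof.
elim: t => [|z t IH]; first by rewrite !big_nil rmorph1.
by rewrite /= !big_cons rmorphM /= IH map_polyXsubC.
Qed.

Lemma prod_XsubC_perm (R : comNzRingType) (t u : seq R) : perm_eq t u ->
  \prod_(z <- t) ('X - z%:P) = \prod_(z <- u) ('X - z%:P).
Proof. exact: perm_big. Qed.

(** * Galois theory inside the complex numbers *)

Section Galois.
Variable C : numClosedFieldType.
Implicit Types (L F K : numField C).
Local Notation ratp := (map_poly (ratr : rat -> C)).

Lemma subfield_rat (S : set C) (q : rat) : is_subfield S -> S (ratr q).
Proof.
move=> hS; have Sint (z : int) : S z%:~R.
  by case: z => m; [exact: subfield_nat | rewrite NegzE rmorphN; apply: subfieldN => //; exact: subfield_nat].
by rewrite /ratr; apply: (subfieldM hS) => //; apply: (subfieldV hS).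
Qed.

(** Let p be the minimal polynomial over M of a primitive element g0 of L, and y = q(g0). Each root
    g1 of p gives an embedding over M. If all of them fixed y, then (q mod p) - y would have as many
    roots as p has degree, hence vanish, and y would be a coefficient in M. *)
Lemma separating_embedding L (M : set C) y : is_subfield M -> M `<=` L ->
  nf_set L y -> ~ M y -> exists g, [/\ embedding L g, forall x, M x -> g x = x & g y <> y].
Proof.
move=> hM ML Ly My; have hL := nf_subfield L.
have [k [iota ME]] := subfield_range hM.
have inM x : M x <-> exists u, iota u = x.
  by rewrite ME; split=> [[u _ <-]|[u <-]]; exists u.
have [g0 Lg0 prim] := primitive_element L.
have /choice [qq qqE] : forall x, exists q, nf_set L x -> x = (ratp q).[g0].
  by move=> x; have [/prim[q ->]|nL] := pselect (nf_set L x); [exists q | exists 0].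
have /choice [lf kq] : forall q : {poly rat}, exists Q : {poly k}, map_poly iota Q = ratp q.
  move=> q; have /choice [l lE] : forall i, exists u : k, iota u = (ratp q)`_i.
    by move=> i; apply/inM; rewrite coef_map; exact: subfield_rat.
  exists (\poly_(i < size (ratp q)) l i); apply/polyP => i; rewrite coef_map coef_poly.
  by case: ltnP => h; [exact: lE | rewrite [RHS]nth_default //; exact: rmorph0].
have mapB q (c : k) t : (map_poly iota (lf q - c%:P)).[t] = (ratp q).[t] - iota c.
  by rewrite rmorphB /= hornerD hornerN map_polyC hornerC kq.
have [P P0 rP] := numfield_algebraic Lg0.
have [p [p0 rp div simp]] : exists p : {poly k}, [/\ p != 0, root (map_poly iota p) g0,
    forall Q, root (map_poly iota Q) g0 -> p %| Q &
    forall y, root (map_poly iota p) y -> (map_poly iota p)^`().[y] != 0].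
  apply: (@minimal_poly_exists _ _ _ _ (lf P)); first by rewrite -(map_poly_eq0 iota) kq map_poly_eq0.
  by rewrite kq.
have pC0 : map_poly iota p != 0 by rewrite map_poly_eq0.
have [rs [u srs rsE]] := simple_roots_list pC0 simp.
have transfer (Q : {poly k}) g1 : g1 \in rs -> (map_poly iota Q).[g0] = 0 -> (map_poly iota Q).[g1] = 0.
  rewrite rsE => /rootP r1 /rootP /div /dvdpP [Q' ->].
  by rewrite rmorphM hornerM r1 mulr0.
have [g1 g1r g1y] : exists2 g1, g1 \in rs & (ratp (qq y)).[g1] <> y.
  apply: contrapT => no.
  have all g1 : g1 \in rs -> (ratp (qq y)).[g1] = y.
    by move=> g1r; apply: contrapT => ne; apply: no; exists g1.
  pose Q : {poly k} := lf (qq y) %% p.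
  have QE g1 : g1 \in rs -> (map_poly iota Q).[g1] = y.
    move=> g1r; have := all g1 g1r; rewrite -kq {1}(divp_eq (lf (qq y)) p).
    rewrite rmorphD rmorphM hornerD hornerM; move: g1r; rewrite rsE => /rootP ->.
    by rewrite mulr0 add0r.
  have sQ : (size (map_poly iota Q) <= size rs)%N.
    by rewrite -ltnS srs !size_map_poly ltn_modp.
  have rs0 : (0 < size rs)%N.
    have : g0 \in rs by rewrite rsE.
    by case: (rs).
  have /eqP : map_poly iota Q - y%:P == 0.
    apply: contraTT (leqnn (size rs)) => d0; rewrite -ltnNge.
    apply: leq_trans (max_poly_roots d0 _ u) _; last first.
      apply: leq_trans (size_polyD _ _) _; rewrite size_polyN geq_max sQ.
      by apply: leq_trans (size_polyC_leq1 _) _.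
    by apply/allP => g1 /QE e; rewrite rootE !hornerE e subrr.
  move=> /polyP /(_ 0%N); rewrite coefB coefC coef_map coef0 /= => /eqP; rewrite subr_eq0 => /eqP e.
  by apply: My; apply/inM; exists Q`_0.
pose g x := (ratp (qq x)).[g1].
have gE x (q : {poly rat}) : nf_set L x -> x = (ratp q).[g0] -> g x = (ratp q).[g1].
  move=> Lx e; suff : (map_poly iota (lf (qq x) - lf q)).[g1] = 0.
    by rewrite rmorphB hornerD hornerN /= !kq => /eqP; rewrite subr_eq0 => /eqP.
  by apply: transfer => //; rewrite rmorphB hornerD hornerN /= !kq -(qqE x Lx) -e subrr.
exists g; split=> //; last first.
  move=> x Mx; have Lx := ML _ Mx; have [c ce] := (inM x).1 Mx.
  have : (map_poly iota (lf (qq x) - c%:P)).[g1] = 0.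
    by apply: transfer => //; rewrite mapB -(qqE x Lx) ce subrr.
  by rewrite mapB ce => /eqP; rewrite subr_eq0 => /eqP.
split.
- by have := gE 1 1 (subfield1 hL); rewrite rmorph1 !hornerC; apply.
- move=> a b La Lb; have := gE (a - b) (qq a - qq b) (subfieldB hL La Lb).
  by rewrite rmorphB /= !hornerD !hornerN -(qqE a La) -(qqE b Lb); apply.
- move=> a b La Lb; have := gE (a * b) (qq a * qq b) (subfieldM hL La Lb).
  by rewrite rmorphM /= !hornerM -(qqE a La) -(qqE b Lb); apply.
Qed.

(** An injective map permutes any finite set which it maps to itself, here the roots in L of a
    rational polynomial that kills y. *)
Lemma embedding_surj L s : embedding L s -> (forall x, nf_set L x -> nf_set L (s x)) -> s @` L = L.
Proof.
move=> es sL; apply/seteqP; split=> [_ [x Lx <-]|y Ly]; first exact: sL.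
have [p p0 rp] := numfield_algebraic Ly.
have pC0 : ratp p != 0 by rewrite map_poly_eq0.
have [rs rsE] := closed_field_poly_normal (ratp p).
have rE z : root (ratp p) z = (z \in rs) by rewrite {1}rsE rootZ ?lead_coef_eq0 // root_prod_XsubC.
pose t := undup [seq z <- rs | `[< nf_set L z >]].
have tE z : (z \in t) = root (ratp p) z && `[< nf_set L z >] by rewrite mem_undup mem_filter andbC rE.
have st : {subset map s t <= t}.
  move=> _ /mapP[z + ->]; rewrite !tE => /andP[rz /asboolP Lz]; apply/andP; split; last by apply/asboolP; exact: sL.
  by rewrite rootE -(embedding_ratp p es Lz) (rootP rz) (embedding0 es).
have ut : uniq (map s t).
  rewrite map_inj_in_uniq ?undup_uniq // => a b; rewrite !tE => /andP[_ /asboolP La] /andP[_ /asboolP Lb].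
  exact: (embedding_inj es).
have [_ e] := uniq_min_size ut st (eq_leq (esym (size_map s t))).
have : y \in map s t by rewrite e tE rp; apply/asboolP.
by move=> /mapP[x]; rewrite tE => /andP[_ /asboolP Lx] ->; exists x.
Qed.

Lemma abelian_gal K L s : abelian_ext K L -> embedding L s -> (forall x, nf_set K x -> s x = x) ->
  gal L K s.
Proof.
move=> [KL nor _] es sK; split=> //; apply: embedding_surj => // x Lx.
by apply: (nor s es sK); exists x.
Qed.

Lemma embedding_restrict L L' s : L' `<=` L -> embedding L s -> embedding L' s.
Proof. by move=> sub [h1 h2 h3]; split=> // x y /sub Lx /sub Ly; [exact: h2 | exact: h3]. Qed.

Lemma gal_restrict K L L' s : L' `<=` L -> abelian_ext K L' -> gal L K s -> gal L' K s.
Proof. by move=> sub ab [es _ sK]; apply: abelian_gal => //; exact: embedding_restrict es. Qed.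

(** The orbit of x lies among the roots of a rational polynomial, so it is finite and each s
    permutes it, which fixes the coefficients of the product of the X - z over the orbit. It serves
    both for Gal(L/K) and for the Artin symbols of the ray units. *)
Lemma orbit_poly L (Gam : set (C -> C)) x : nf_set L x ->
  (forall s, Gam s -> embedding L s /\ (forall y, nf_set L y -> nf_set L (s y))) ->
  (exists2 s, Gam s & s x = x) ->
  (forall s t, Gam s -> Gam t -> exists2 u, Gam u & u x = s (t x)) ->
  exists P : {poly C}, [/\ P.[x] = 0, forall i, nf_set L P`_i,
    forall s i, Gam s -> s P`_i = P`_i &
    forall y, P.[y] = 0 -> exists2 s, Gam s & s x = y].
Proof.
move=> Lx hG [s1 Gs1 s1x] comp.
have [k [iota LE]] := subfield_range (nf_subfield L).
have inL u : nf_set L (iota u) by rewrite LE; exists u.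
have [p p0 rp] := numfield_algebraic Lx.
have pC0 : ratp p != 0 by rewrite map_poly_eq0.
have [rs rsE] := closed_field_poly_normal (ratp p).
have rE z : root (ratp p) z = (z \in rs) by rewrite {1}rsE rootZ ?lead_coef_eq0 // root_prod_XsubC.
pose t := undup [seq z <- rs | `[< exists2 s, Gam s & s x = z >]].
have tE z : z \in t <-> exists2 s, Gam s & s x = z.
  rewrite mem_undup mem_filter; split=> [/andP[/asboolP]//|h]; apply/andP; split; first by apply/asboolP.
  have [s Gs <-] := h; have [es _] := hG s Gs.
  by rewrite -rE rootE -(embedding_ratp p es Lx) (rootP rp) (embedding0 es).
have tL z : z \in t -> nf_set L z by move/tE => -[s Gs <-]; apply: (hG s Gs).2.
have [t' t'E] : exists t' : seq k, map iota t' = t.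
  elim: (t) tL => [|z l IH] lL; first by exists [::].
  have [|l' <-] := IH; first by move=> w wl; apply: lL; rewrite inE wl orbT.
  have : nf_set L z by apply: lL; rewrite mem_head.
  rewrite LE => -[z' _ <-].
  by exists (z' :: l').
pose P' := \prod_(z <- t') ('X - z%:P).
exists (map_poly iota P'); split.
- have : x \in t by apply/tE; exists s1.
  by rewrite map_prod_XsubC t'E -root_prod_XsubC => /rootP.
- by move=> i; rewrite coef_map; exact: inL.
- move=> s i Gs; have [[es1 esB esM] sL] := hG s Gs.
  pose f0 u := s (iota u).
  have f0B : zmod_morphism f0 by move=> u v; rewrite /f0 rmorphB; exact: esB.
  have f0M : monoid_morphism f0.
    by split=> [|u v]; rewrite /f0 ?rmorph1 // rmorphM; exact: esM.
  (* s is known to respect the operations only on L, so it is turned into a ring morphism on the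
     abstract field [k]. *)
  pose f : {rmorphism k -> C} :=
    HB.pack f0 (GRing.isZmodMorphism.Build _ _ f0 f0B) (GRing.isMonoidMorphism.Build _ _ f0 f0M).
  have -> : s (map_poly iota P')`_i = (map_poly f P')`_i by rewrite !coef_map.
  congr (_`_ _); congr polyseq; rewrite !map_prod_XsubC t'E.
  have -> : [seq f u | u <- t'] = map s t by rewrite -t'E -map_comp.
  apply: prod_XsubC_perm; apply: uniq_perm; rewrite ?undup_uniq //.
      rewrite map_inj_in_uniq ?undup_uniq // => a b /tL La /tL Lb.
      exact: (embedding_inj (And3 es1 esB esM)).
    have st : {subset map s t <= t}.
      by move=> _ /mapP[z /tE[u Gu <-] ->]; have [w Gw e] := comp s u Gs Gu; apply/tE; exists w.
    have ut : uniq (map s t).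
      rewrite map_inj_in_uniq ?undup_uniq // => a b /tL La /tL Lb.
      exact: (embedding_inj (And3 es1 esB esM)).
    by have [_ e] := uniq_min_size ut st (eq_leq (esym (size_map s t))).
- by move=> y; rewrite map_prod_XsubC t'E => /rootP; rewrite root_prod_XsubC => /tE.
Qed.

End Galois.

(** * Abelian extensions: composita and subextensions *)

Section AbelianExtensions.
Variable C : numClosedFieldType.
Implicit Types (L F K : numField C).
Local Notation ratp := (map_poly (ratr : rat -> C)).

(** Q[z] is already a field: if q(z) is nonzero, q is prime to the minimal polynomial of z, and
    Bezout gives the inverse. *)
Lemma simple_numfield (z : C) (P : {poly rat}) : P != 0 -> root (ratp P) z ->
  exists L : numField C, forall x, nf_set L x <-> exists q, x = (ratp q).[z].
Proof.
move=> P0 rP; have [p [p0 rp div simp]] := minimal_poly_exists P0 rP.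
pose S : set C := [set x | exists q, x = (ratp q).[z]].
have modp q : (ratp q).[z] = (ratp (q %% p)).[z].
  by rewrite {1}(divp_eq q p) rmorphD rmorphM hornerD hornerM (rootP rp) mulr0 add0r.
have hS : is_subfield S.
  split.
  - by exists 1; rewrite rmorph1 hornerC.
  - by move=> _ _ [q ->] [u ->]; exists (q - u); rewrite rmorphB hornerD hornerN.
  - by move=> _ _ [q ->] [u ->]; exists (q * u); rewrite rmorphM hornerM.
  - move=> _ [q ->]; have [e|nz] := eqVneq (ratp q).[z] 0.
      by exists 0; rewrite e invr0 rmorph0 horner0.
    have cop : coprimep p q.
      pose d := gcdp p q; have d0 : d != 0 by rewrite gcdp_eq0 negb_and p0.
      have pE : p = p %/ d * d by rewrite divpK ?dvdp_gcdl.
      have : root (ratp (p %/ d)) z || root (ratp d) z by rewrite -rootM -rmorphM -pE.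
      case/orP => [/div pd|rd].
        have q0 : p %/ d != 0 by apply: contraNneq p0 => q0; rewrite pE q0 mul0r.
        have := dvdp_leq q0 pd; rewrite {1}pE size_mul // /coprimep -/d.
        have : (0 < size d)%N by rewrite size_poly_gt0.
        have : (0 < size (p %/ d)%R)%N by rewrite size_poly_gt0.
        move: (size (p %/ d)) (size d); clear; move=> a b; lia.
      have /dvdpP [u uE] := dvdp_gcdr p q.
      by case/eqP: nz; rewrite uE rmorphM hornerM (rootP rd) mulr0.
    have [[u v] /= uv] := Bezout_eq1_coprimepP _ _ cop.
    exists v; have := congr1 (fun w => (ratp w).[z]) uv.
    rewrite /= rmorphD !rmorphM rmorph1 hornerD !hornerM hornerC (rootP rp) mulr0 add0r => e.
    by apply: (mulIf nz); rewrite mulVf // e.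
pose d := (size p).-1.
have sp : size p = d.+1 by rewrite prednK // size_poly_gt0.
have fin : exists n (b : 'I_n -> C), basis_over QQ S b.
  exists d, (fun i => z ^+ i); split=> [x|c cQ c0].
    split=> [[q ->]|[c [cQ ->]]].
      rewrite modp; exists (fun i => ratr (q %% p)`_i); split=> [i|]; first by exists (q %% p)`_i.
      rewrite (@horner_coef_wide _ d) ?size_map_poly; last by rewrite -ltnS -sp ltn_modp.
      by apply: eq_bigr => i _; rewrite coef_map.
    have /choice [r rE] : forall i, exists r : rat, ratr r = c i by move=> i; have [r _ <-] := cQ i; exists r.
    exists (\sum_i r i *: 'X^i); rewrite rmorph_sum /= horner_sum; apply: eq_bigr => i _.
    by rewrite linearZ /= map_polyXn hornerZ hornerXn rE.
  have /choice [r rE] : forall i, exists r : rat, ratr r = c i by move=> i; have [r _ <-] := cQ i; exists r.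
  pose q := \poly_(i < d) (if insub i is Some j then r j else 0).
  have : root (ratp q) z.
    apply/rootP; rewrite (@horner_coef_wide _ d) ?size_map_poly ?size_poly // -[RHS]c0; apply: eq_bigr => i _.
    by rewrite coef_map coef_poly ltn_ord valK /= rE.
  move=> /div pq; have q0 : q = 0.
    by apply/eqP; apply: contraTT pq => q0; rewrite gtNdvdp // sp ltnS size_poly.
  move=> i; have := congr1 (fun u : {poly rat} => u`_i) q0.
  by rewrite /= coef_poly ltn_ord valK coef0 -rE => ->; rewrite rmorph0.
by exists (NumField hS fin).
Qed.

(** The compositum is Q(z) with z = m g2 - g1 as in the primitive element theorem. An embedding is
    determined by its value at z, so normality and commutation follow from those of L1 and L2 at g1
    and g2. *)
Lemma compositum K L1 L2 : abelian_ext K L1 -> abelian_ext K L2 ->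
  exists L, [/\ abelian_ext K L, L1 `<=` L & L2 `<=` L].
Proof.
move=> a1 a2; have [g1 Lg1 h1] := primitive_element L1; have [g2 Lg2 h2] := primitive_element L2.
have [p p0 rp] := numfield_algebraic Lg1; have [q q0 rq] := numfield_algebraic Lg2.
have char0 : has_pchar0 rat by apply: pchar_num.
have [m [[u hu] [v hv]]] := pchar0_PET p0 rp q0 rq char0.
set z := g2 *+ m - g1 in hu hv.
have [P P0 rP] : exists2 P : {poly rat}, P != 0 & root (ratp P) z.
  have alg1 : algebraicOver (ratr : rat -> C) g1 by exists p.
  have alg2 : algebraicOver (ratr : rat -> C) g2 by exists q.
  have [P] : algebraicOver (ratr : rat -> C) z.
    rewrite /z -mulr_natr; apply: algebraic_sub => //; apply: algebraic_mul => //.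
    by rewrite -[m%:R](rmorph_nat (ratr : {rmorphism rat -> C})); exact: algebraic_id.
  by exists P.
have [L LE] := simple_numfield P0 rP.
have L1L : L1 `<=` L.
  move=> x /h1 [w ->]; apply/LE; exists (w \Po u).
  by rewrite map_comp_poly horner_comp; congr (_.[_]); exact: esym hu.
have L2L : L2 `<=` L.
  move=> x /h2 [w ->]; apply/LE; exists (w \Po v).
  by rewrite map_comp_poly horner_comp; congr (_.[_]); exact: esym hv.
have hL := nf_subfield L.
have Lz : nf_set L z by apply/LE; exists 'X; rewrite map_polyX hornerX.
have sz s : embedding L s -> s z = s g2 *+ m - s g1.
  move=> es; have L1m := L1L _ Lg1; have L2m := L2L _ Lg2.
  rewrite /z -mulr_natr (embeddingB es) //; last by apply: (subfieldM hL) => //; exact: subfield_nat.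
  by rewrite (embeddingM es) ?(embedding_nat m es) ?mulr_natr //; exact: subfield_nat.
have mapL s : embedding L s -> (forall x, nf_set K x -> s x = x) ->
    forall x, nf_set L x -> nf_set L (s x).
  move=> es sK x /LE [w ->]; rewrite (embedding_ratp w es Lz); apply: ratp_in.
  rewrite (sz _ es) -mulr_natr; apply: (subfieldB hL); last first.
    apply: (L1L); have [_ nor _] := a1; apply: (nor s _ sK); [exact: embedding_restrict L1L es | by exists g1].
  apply: (subfieldM hL); last exact: subfield_nat.
  apply: (L2L); have [_ nor _] := a2; apply: (nor s _ sK); [exact: embedding_restrict L2L es | by exists g2].
exists L; split=> //; split.
- by have [KL1 _ _] := a1; exact: subset_trans L1L.
- by move=> s es sK _ [x Lx <-]; exact: mapL.
move=> s t gs gt x /LE [w ->]; have [es _ sK] := gs; have [et _ tK] := gt.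
rewrite (embedding_ratp w et Lz) (embedding_ratp w es (mapL _ et tK _ Lz)).
rewrite (embedding_ratp w es Lz) (embedding_ratp w et (mapL _ es sK _ Lz)).
congr (_.[_]).
have com L' : L' `<=` L -> abelian_ext K L' -> forall x, nf_set L' x -> s (t x) = t (s x).
  move=> sub ab; have [_ _ c] := ab; exact: (c _ _ (gal_restrict sub ab gs) (gal_restrict sub ab gt)).
have step a b : embedding L a -> embedding L b -> (forall x, nf_set K x -> b x = x) ->
    a (b z) = a (b g2) *+ m - a (b g1).
  move=> ea eb bK; have L1m := L1L _ Lg1; have L2m := L2L _ Lg2.
  have Lb1 := mapL b eb bK _ L1m; have Lb2 := mapL b eb bK _ L2m.
  rewrite (sz _ eb) -mulr_natr (embeddingB ea) //; last by apply: (subfieldM hL) => //; exact: subfield_nat.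
  by rewrite (embeddingM ea) ?(embedding_nat m ea) ?mulr_natr //; exact: subfield_nat.
by rewrite (step s t es et tK) (step t s et es sK) (com _ L1L a1 _ Lg1) (com _ L2L a2 _ Lg2).
Qed.

Lemma abelian_list K (xs : seq C) : (forall x, x \in xs -> max_abelian K x) ->
  exists L, abelian_ext K L /\ forall x, x \in xs -> nf_set L x.
Proof.
elim: xs => [|x xs IH] h.
  exists K; split=> //; split=> //.
    by move=> s _ sK _ [x Kx <-]; rewrite sK.
  by move=> s t [_ _ sK] [_ _ tK] x Kx; rewrite tK // sK // tK.
have [|L1 [a1 h1]] := IH; first by move=> y yx; apply: h; rewrite inE yx orbT.
have [L2 [a2 Lx]] : max_abelian K x by apply: h; rewrite mem_head.
have [L [aL s1 s2]] := compositum a1 a2; exists L; split=> // y.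
by rewrite inE => /orP[/eqP->|/h1]; [exact: s2 | exact: s1].
Qed.

(** A K-embedding s of F sends a primitive element g to a root of its Gal(L/K)-orbit polynomial, so
    s is the restriction of some t in Gal(L/K). If t x left F for some x in F, an automorphism u
    fixing F would move t x, while u t x = t u x = t x. *)
Lemma abelian_subext K F L : nf_set K `<=` F -> F `<=` L -> abelian_ext K L -> abelian_ext K F.
Proof.
move=> KF FL aL; have hL := nf_subfield L; have [KL nor com] := aL.
have [g Fg prim] := primitive_element F; have Lg := FL _ Fg.
have fixed (x : C) : nf_set L x -> (forall s, gal L K s -> s x = x) -> nf_set K x.
  move=> Lx hx; apply: contrapT => Kx.
  have [s [es sK sx]] := separating_embedding (nf_subfield K) KL Lx Kx.
  by apply: sx; apply: hx; exact: abelian_gal.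
have galL s : gal L K s -> embedding L s /\ (forall y, nf_set L y -> nf_set L (s y)).
  by move=> [es sL _]; split=> // y Ly; rewrite -sL; exists y.
have galid : gal L K id by split=> //; rewrite image_id.
have galcomp s t : gal L K s -> gal L K t -> gal L K (s \o t).
  move=> gs gt; have [es sL] := galL s gs; have [et tL] := galL t gt.
  have [_ _ sK] := gs; have [_ _ tK] := gt.
  apply: abelian_gal => //; last by move=> x Kx /=; rewrite tK // sK.
  split=> [|x y Lx Ly|x y Lx Ly] /=; first by rewrite (embedding1 et) (embedding1 es).
    by rewrite (embeddingB et) // (embeddingB es) //; exact: tL.
  by rewrite (embeddingM et) // (embeddingM es) //; exact: tL.
have [P [Pg PL PG Proots]] : exists P : {poly C}, [/\ P.[g] = 0, forall i, nf_set L P`_i,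
    forall s i, gal L K s -> s P`_i = P`_i &
    forall y, P.[y] = 0 -> exists2 s, gal L K s & s g = y].
  apply: orbit_poly => //; first by exists id.
  by move=> s t gs gt; exists (s \o t); [exact: galcomp|].
have PK i : nf_set K P`_i by apply: fixed => // s gs; exact: PG.
have ext s : embedding F s -> (forall x, nf_set K x -> s x = x) ->
    exists2 t, gal L K t & forall x, nf_set F x -> s x = t x.
  move=> es sK; have [|t gt tg] := Proots (s g).
    rewrite -(embedding_fixed_horner es _ Fg) ?Pg ?(embedding0 es) // => i.
    by split; [exact: KF | exact: sK].
  exists t => // x /prim [q ->]; rewrite (embedding_ratp q es Fg) -tg.
  by have [et _] := galL t gt; rewrite (embedding_ratp q et Lg).
have normal s : embedding F s -> (forall x, nf_set K x -> s x = x) -> s @` F `<=` F.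
  move=> es sK _ [x Fx <-]; have [t gt ->] := ext s es sK; last exact: Fx.
  have [et tL] := galL t gt; apply: contrapT => nF.
  have Ltx : nf_set L (t x) by apply/tL/FL.
  have [u [eu uF utx]] := separating_embedding (nf_subfield F) FL Ltx nF.
  have gu : gal L K u by apply: abelian_gal => // y Ky; apply: uF; exact: KF.
  by apply: utx; rewrite (com u t gu gt _ (FL _ Fx)) uF.
split=> // s t [es sF sK] [et tF tK] x Fx.
have [s' gs' sE] := ext s es sK; have [t' gt' tE] := ext t et tK.
have Fsx : nf_set F (s x) by rewrite -sF; exists x.
have Ftx : nf_set F (t x) by rewrite -tF; exists x.
by rewrite sE // tE // tE // sE // (com s' t' gs' gt' _ (FL _ Fx)).
Qed.

Lemma abelian_over K F (xs : seq C) : nf_set F `<=` max_abelian K ->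
  (forall x, x \in xs -> max_abelian K x) ->
  exists L, [/\ abelian_ext K L, F `<=` L & forall x, x \in xs -> nf_set L x].
Proof.
move=> FK h; have [g Fg prim] := primitive_element F.
have [|L [aL hL]] := @abelian_list K (g :: xs).
  by move=> x; rewrite inE => /orP[/eqP->|/h//]; exact: FK.
exists L; split=> // [x /prim [q ->]|x xx]; last by apply: hL; rewrite inE xx orbT.
by apply: ratp_in; apply: hL; rewrite mem_head.
Qed.

End AbelianExtensions.

(** * Completions *)

Section CompletionSequences.
Variable C : numClosedFieldType.
Implicit Types (L : numField C) (v : place).
Local Notation cauchy := Defs.cauchy.

(** Tested on the canonical representative. For an open subgroup S any other Cauchy representative
    gives the same answer, by [eventually_class]. *)
Definition eventually_in L v (S : set C) (x : completion L v) : Prop :=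
  exists N, forall n, (N <= n)%N -> S (rep x n).

Definition open_subgroup L v (S : set C) : Prop :=
  [/\ S 0, forall x y, S x -> S y -> S (x - y) & exists k, nb L v k `<=` S].

Lemma rep_cauchy L v (x : completion L v) : cauchy L v (rep x).
Proof. by have /asboolP := valP (repr (x : {ideal_quot (@null_seq C L v)})). Qed.

Lemma repK L v (x : completion L v) : class_of L v (rep x) = x.
Proof. by rewrite /class_of /rep valKd reprK. Qed.

Lemma rep_class L v u : cauchy L v u ->
  forall k, exists N, forall n, (N <= n)%N -> nb L v k (rep (class_of L v u) n - u n).
Proof.
move=> cu k.
have /eqP := repK (class_of L v u); rewrite {1}/class_of /class_of -Quotient.idealrBE.
move=> /asboolP /(_ k) [N hN]; exists N => n Nn; have := hN n Nn.
by rewrite rmorphB /= !insubd_cauchy //; exact: rep_cauchy.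
Qed.

Lemma class_ofB L v u w : cauchy L v u -> cauchy L v w ->
  class_of L v (u - w) = class_of L v u - class_of L v w.
Proof.
move=> cu cw; rewrite /class_of.
rewrite [RHS](_ : _ = \pi_({ideal_quot (@null_seq C L v)})%qT
   (insubd (0 : cseq L v) u - insubd (0 : cseq L v) w)); last first.
  by rewrite rmorphB.
congr (\pi_(_)%qT _); apply: val_inj; rewrite rmorphB /= !insubd_cauchy //.
exact: cauchyB.
Qed.

Lemma class_of0 L v : class_of L v 0 = 0.
Proof.
have c0 : cauchy L v (0 : nat -> C) by apply: cauchy_cst; exact: (subfield0 (nf_subfield L)).
by rewrite -[X in class_of L v X](subrr 0) class_ofB // subrr.
Qed.

Lemma class_ofD L v u w : cauchy L v u -> cauchy L v w ->
  class_of L v (u + w) = class_of L v u + class_of L v w.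
Proof.
move=> cu cw; have c0 : cauchy L v (0 : nat -> C) by apply: cauchy_cst; exact: (subfield0 (nf_subfield L)).
have -> : u + w = u - (0 - w) by rewrite sub0r opprK.
rewrite class_ofB //; last exact: cauchyB.
by rewrite class_ofB // class_of0 sub0r opprK.
Qed.

Lemma embB L v x y : nf_set L x -> nf_set L y -> emb L v (x - y) = emb L v x - emb L v y.
Proof. by move=> Lx Ly; rewrite /emb -class_ofB //; exact: cauchy_cst. Qed.

Lemma emb1 L v : emb L v 1 = 1. Proof. exact: class_of1. Qed.
Lemma emb0 L v : emb L v 0 = 0. Proof. exact: class_of0. Qed.

Lemma cauchy_shift L v u N : cauchy L v u -> cauchy L v (fun n => u (N + n)%N).
Proof.
move=> [Lu cu]; split=> [n|k]; first exact: Lu.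
have [M hM] := cu k; exists M => m n Mm Mn; apply: hM; apply: leq_trans (leq_addl _ _); done.
Qed.

Lemma class_of_shift L v u N : cauchy L v u -> class_of L v (fun n => u (N + n)%N) = class_of L v u.
Proof.
move=> cu; apply: class_of_eq => //; first exact: cauchy_shift.
move=> k; have [Lu hu] := cu; have [M hM] := hu k; exists M => n Mn.
by apply: hM => //; apply: leq_trans (leq_addl _ _).
Qed.

Lemma clos_eventually L v S (x : completion L v) : eventually_in S x -> clos L v S x.
Proof.
move=> [N hN]; exists (fun n => rep x (N + n)%N); split.
- exact: cauchy_shift (rep_cauchy x).
- by move=> n; apply: hN; exact: leq_addr.
- by rewrite class_of_shift ?repK //; exact: rep_cauchy.
Qed.

Section OpenSubgroup.
Variables (L : numField C) (v : place) (S : set C).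
Hypothesis oS : open_subgroup L v S.

Lemma open_subgroupN x : S x -> S (- x).
Proof. by have [S0 SB _] := oS => Sx; rewrite -sub0r; exact: SB. Qed.

Lemma open_subgroupD x y : S x -> S y -> S (x + y).
Proof. by have [S0 SB _] := oS => Sx /open_subgroupN Sy; rewrite -[y]opprK; exact: SB. Qed.

Lemma eventually_class u : cauchy L v u ->
  (eventually_in S (class_of L v u) <-> exists N, forall n, (N <= n)%N -> S (u n)).
Proof.
move=> cu; have [S0 SB [k kS]] := oS; have [N hN] := rep_class cu k.
split=> -[M hM]; exists (maxn N M) => n; rewrite geq_max => /andP[Nn Mn].
  have -> : u n = rep (class_of L v u) n - (rep (class_of L v u) n - u n) by ring.
  by apply: SB; [exact: hM | apply/kS/hN].
have -> : rep (class_of L v u) n = (rep (class_of L v u) n - u n) + u n by ring.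
by apply: open_subgroupD; [apply/kS/hN | exact: hM].
Qed.

Lemma eventually_emb c : nf_set L c -> (eventually_in S (emb L v c) <-> S c).
Proof.
move=> Lc; rewrite eventually_class; last exact: cauchy_cst.
by split=> [[N /(_ N (leqnn N))]|Sc] //; exists 0%N.
Qed.

Lemma eventuallyB (x y : completion L v) : eventually_in S x -> eventually_in S y -> eventually_in S (x - y).
Proof.
have [S0 SB _] := oS.
move=> [N hN] [M hM]; rewrite -(repK x) -(repK y) -class_ofB; try exact: rep_cauchy.
apply/eventually_class; first by apply: cauchyB; exact: rep_cauchy.
by exists (maxn N M) => n; rewrite geq_max => /andP[Nn Mn]; apply: SB; [exact: hN | exact: hM].
Qed.

Lemma eventually0 : eventually_in S (0 : completion L v).
Proof. by have [S0 _ _] := oS; rewrite -emb0; apply/eventually_emb => //; exact: (subfield0 (nf_subfield L)). Qed.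

Lemma eventuallyN (x : completion L v) : eventually_in S x -> eventually_in S (- x).
Proof. by move=> h; rewrite -sub0r; apply: eventuallyB => //; exact: eventually0. Qed.

Lemma eventuallyD (x y : completion L v) : eventually_in S x -> eventually_in S y -> eventually_in S (x + y).
Proof. by move=> hx /eventuallyN hy; rewrite -[y]opprK; exact: eventuallyB. Qed.

Lemma eventually_sum n (f : 'I_n -> completion L v) : (forall i, eventually_in S (f i)) ->
  eventually_in S (\sum_i f i).
Proof.
elim: n f => [|n IH] f h; first by rewrite big_ord0; exact: eventually0.
by rewrite big_ord_recr /=; apply: eventuallyD => //; exact: IH.
Qed.

Lemma eventuallyM (A B : set C) (x y : completion L v) : eventually_in A x -> eventually_in B y ->
  (forall a b, A a -> B b -> S (a * b)) -> eventually_in S (x * y).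
Proof.
move=> [N hN] [M hM] h; rewrite -(repK x) -(repK y) -class_ofM; try exact: rep_cauchy.
apply/eventually_class; first by apply: cauchyM; exact: rep_cauchy.
by exists (maxn N M) => n; rewrite geq_max => /andP[Nn Mn]; apply: h; [exact: hN | exact: hM].
Qed.

Lemma eventually_embM c (x : completion L v) : nf_set L c ->
  (eventually_in S (emb L v c * x) <-> exists N, forall n, (N <= n)%N -> S (c * rep x n)).
Proof.
move=> Lc; rewrite -{1}(repK x) /emb -class_ofM; [|exact: cauchy_cst|exact: rep_cauchy].
by rewrite eventually_class //; apply: cauchyM; [exact: cauchy_cst | exact: rep_cauchy].
Qed.

Lemma clos_open (x : completion L v) : clos L v S x <-> eventually_in S x.
Proof.
split; last exact: clos_eventually.
by move=> [u [cu Su ->]]; apply/eventually_class => //; exists 0%N => n _.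
Qed.

Lemma eventually_approx (x : completion L v) : exists N, forall n, (N <= n)%N ->
  eventually_in S (x - emb L v (rep x n)).
Proof.
have [S0 SB [k kS]] := oS; have [Lx hx] := rep_cauchy x; have [N hN] := hx k.
exists N => n Nn; rewrite -{1}(repK x) -class_ofB; [|exact: rep_cauchy|exact: cauchy_cst].
apply/eventually_class; first by apply: cauchyB; [exact: rep_cauchy | exact: cauchy_cst].
by exists N => m Nm; apply/kS/hN.
Qed.

End OpenSubgroup.

Lemma eventuallyW L v (A B : set C) (x : completion L v) : A `<=` B -> eventually_in A x -> eventually_in B x.
Proof. by move=> AB [N hN]; exists N => n Nn; apply/AB/hN. Qed.

Lemma eventuallyI L v n (A : 'I_n -> set C) (x : completion L v) : (forall i, eventually_in (A i) x) ->
  eventually_in [set y | forall i, A i y] x.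
Proof.
move=> h; have /choice [N hN] := h; exists (\max_i N i) => m Nm i; apply: hN.
exact: leq_trans (leq_bigmax i) Nm.
Qed.

End CompletionSequences.

(** * Imaginary quadratic fields and lattices *)

Section Quadratic.
Variable C : numClosedFieldType.
Local Notation integral := (integralOver (intr : int -> C)).

(** For a prime p dividing the denominator, q times denominator/p is numerator/p, an integral
    number, so p divides the numerator as well. *)
Lemma rat_integral_int (q : rat) : integral (ratr q) -> exists z : int, ratr q = z%:~R :> C.
Proof.
move=> iq; have [d1|d1] := eqVneq (`|denq q|%N) 1%N.
  exists (numq q); rewrite -[q in LHS]divq_num_den.
  have -> : denq q = 1 by rewrite -(gez0_abs (denq_ge0 q)) d1.
  by rewrite divr1 ratr_int.
have d0 : (0 < `|denq q|)%N by rewrite absz_gt0 denq_neq0.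
pose p := pdiv `|denq q|; have pp : prime p by rewrite pdiv_prime // ltn_neqAle eq_sym d1.
have /dvdnP [e eE] : (p %| `|denq q|)%N by exact: pdiv_dvd.
have dE : (denq q)%:~R = e%:R * p%:R :> C.
  by rewrite -natrM -eE -[in LHS](gez0_abs (denq_ge0 q)).
have pn : p%:R != 0 :> C by rewrite pnatr_eq0 -lt0n prime_gt0.
have en : e%:R != 0 :> C by rewrite pnatr_eq0; move: d0; rewrite eE; case: (e).
have i1 : integral ((numq q)%:~R / p%:R).
  have -> : (numq q)%:~R / p%:R = e%:R * ratr q :> C.
    by rewrite /ratr dE; field; rewrite en pn.
  apply: (@mxpoly.integral_mul _ _ (intr : {rmorphism int -> C})) => //.
  exact: (@mxpoly.integral_id int C (intr : {rmorphism int -> C}) e%:Z).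
have i2 : integral (`|numq q|%N%:R / p%:R).
  have [->//|->] : `|numq q|%N%:R = (numq q)%:~R :> C \/ `|numq q|%N%:R = - (numq q)%:~R :> C.
    by case: (numq q) => n; [left | right; rewrite NegzE rmorphN opprK].
  by rewrite mulNr; exact: (@mxpoly.integral_opp _ _ (intr : {rmorphism int -> C})).
have pn' := integral_frac pp i2.
have : (p %| gcdn `|numq q| `|denq q|)%N by rewrite dvdn_gcd pn' pdiv_dvd.
have := coprime_num_den q; rewrite /coprime => /eqP ->; rewrite dvdn1 => /eqP p1.
by move: pp; rewrite p1.
Qed.

Lemma integral_conj (x : C) : integral x -> integral x^*.
Proof.
move=> [P Pm rP]; exists P => //.
have -> : map_poly intr P = map_poly Num.conj (map_poly intr P : {poly C}).
  by rewrite -map_poly_comp; apply: eq_map_poly => z /=; rewrite rmorph_int.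
by rewrite rootE horner_map (rootP rP) rmorph0.
Qed.

Lemma rat_real (q : rat) : (ratr q : C) \is Num.real.
Proof. by rewrite /ratr rpred_div ?rpred_int. Qed.

Lemma conj_rat (q : rat) : (ratr q : C)^* = ratr q.
Proof. by apply/CrealP; exact: rat_real. Qed.

Lemma conj_linear (a b : rat) (w : C) : (ratr a + ratr b * w)^* = ratr a + ratr b * w^*.
Proof.
transitivity ((ratr a)^* + (ratr b)^* * w^*); last by rewrite !conj_rat.
by move: (ratr a) (ratr b) => x y; rewrite rmorphD rmorphM.
Qed.

Lemma common_denominator n (r : 'I_n -> rat) :
  exists2 D : nat, (0 < D)%N & forall i, exists z : int, D%:R * r i = z%:~R.
Proof.
exists (\prod_i `|denq (r i)|)%N; first by apply: prodn_gt0 => i; rewrite absz_gt0 denq_neq0.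
move=> i; exists ((\prod_(j | j != i) `|denq (r j)|)%N%:Z * numq (r i)).
rewrite (bigD1 i) //= natrM rmorphM /=.
have -> : `|denq (r i)|%N%:R = (denq (r i))%:~R :> rat by rewrite -[in RHS](gez0_abs (denq_ge0 _)).
by rewrite numqE -pmulrn; ring.
Qed.

(** A 3 by 2 rational matrix has a nonzero left kernel. Such relations stand in for the structure
    theory of ideals below. *)
Lemma three_dependent (K : numField C) (x : 'I_3 -> C) :
  (exists b : 'I_2 -> C, basis_over QQ K b) -> (forall i, nf_set K (x i)) ->
  exists c : 'I_3 -> int, (exists i, c i != 0) /\ \sum_i (c i)%:~R * x i = 0.
Proof.
move=> [b [span _]] Kx.
have /choice [r rE] : forall i, exists r : 'I_2 -> rat, x i = \sum_j ratr (r j) * b j.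
  move=> i; have /span [c [cQ ->]] := Kx i.
  have /choice [r rE] : forall i, exists r : rat, ratr r = c i by move=> j; have [r _ <-] := cQ j; exists r.
  by exists r; apply: eq_bigr => j _; rewrite rE.
pose A : 'M[rat]_(3, 2) := \matrix_(i, j) r i j.
have : (0 < \rank (kermx A))%N by rewrite mxrank_ker subn_gt0; apply: leq_ltn_trans (rank_leq_col A) _.
rewrite lt0n mxrank_eq0 => /rowV0Pn [v vA v0].
have vA0 : v *m A = 0 by apply/sub_kermxP.
have [D D0 /choice [z zE]] := common_denominator (v ord0).
exists z; split.
  have /rV0Pn [i vi] : v != 0 by [].
  exists i; rewrite -(intr_eq0 rat) -zE mulf_neq0 // pnatr_eq0 -lt0n //.
have zC i : (z i)%:~R = D%:R * ratr (v ord0 i) :> C by rewrite -ratr_int -zE rmorphM /= ratr_nat.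
have e j : \sum_i ratr (v ord0 i) * ratr (r i j) = 0 :> C.
  have e := congr1 (fun M : 'M[rat]_(1, 2) => M ord0 j) vA0; rewrite /= !mxE in e.
  rewrite -[RHS](rmorph0 (ratr : {rmorphism rat -> C})) -e rmorph_sum; apply: eq_bigr => i _.
  by rewrite mxE rmorphM.
transitivity (\sum_i \sum_j (D%:R * b j) * (ratr (v ord0 i) * ratr (r i j))).
  by apply: eq_bigr => i _; rewrite zC rE mulr_sumr; apply: eq_bigr => j _; move: (ratr _) (ratr (r i j)) (D%:R) => p q d; ring.
rewrite exchange_big /=; apply: big1 => j _.
by rewrite -mulr_sumr e mulr0.
Qed.

(** Descent on the sum of absolute values: while p divides all coefficients, it is divided out. *)
Lemma prime_content (p : nat) n (c : 'I_n -> int) (x : 'I_n -> C) : prime p -> (exists i, c i != 0) ->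
  \sum_i (c i)%:~R * x i = 0 ->
  exists c' : 'I_n -> int, (exists i, ~~ (p %| `|c' i|)%N) /\ \sum_i (c' i)%:~R * x i = 0.
Proof.
move=> pp; move: {2}(\sum_i `|c i|)%N (leqnn (\sum_i `|c i|)%N) => m.
elim: m c => [|m IH] c.
  rewrite leqn0 sum_nat_eq0 => /forallP h [i ci]; have := h i; rewrite implyTb absz_eq0.
  by rewrite (negPf ci).
move=> cm [i0 ci] e.
have [[i hi]|no] := pselect (exists i, ~~ (p %| `|c i|)%N); first by exists c; split=> //; exists i.
have dv i : (p %| `|c i|)%N by apply/negPn/negP => h; apply: no; exists i.
have /choice [c' cE] : forall i, exists z : int, c i = p%:Z * z.
  move=> i; exists (c i %/ p%:Z)%Z; rewrite mulrC divzK // dvdzE; exact: dv.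
have p0 : p%:R != 0 :> C by rewrite pnatr_eq0 -lt0n prime_gt0.
apply: (IH c').
- rewrite -ltnS; apply: leq_trans cm; rewrite (bigD1 i0) //= [X in (_ < X)%N](bigD1 i0) //= -addSn.
  apply: leq_add.
    rewrite cE abszM /=; move: ci; rewrite cE mulf_eq0 negb_or -absz_gt0 => /andP[_ c'0].
    by rewrite -{1}[`|c' i0|%N]mul1n ltn_pmul2r ?absz_gt0 // prime_gt1.
  by apply: leq_sum => i _; rewrite cE abszM /= leq_pmull // prime_gt0.
- by exists i0; move: ci; rewrite cE mulf_eq0 negb_or => /andP[].
- apply: (mulfI p0); rewrite mulr0 -[RHS]e mulr_sumr; apply: eq_bigr => i _.
  by rewrite cE rmorphM /= mulrA.
Qed.

Variable K : numField C.
Hypothesis iqK : imag_quadratic K.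
Let hK := nf_subfield K.

Lemma int_in (L : numField C) (z : int) : nf_set L z%:~R.
Proof. by rewrite -ratr_int; exact: rat_in. Qed.

Lemma quadratic_generator : exists w, [/\ ints K w, w \isn't Num.real &
  forall x, nf_set K x -> exists a b : rat, x = ratr a + ratr b * w].
Proof.
have [bas [w0 Kw0 rw0]] := iqK.
have [d d0 iw] := integral_multiple Kw0.
have dn : d%:R != 0 :> C by rewrite pnatr_eq0 -lt0n.
exists (d%:R * w0).
have nr : d%:R * w0 \isn't Num.real.
  apply: contra rw0 => h; have -> : w0 = d%:R^-1 * (d%:R * w0) by rewrite mulKf.
  by rewrite rpredM // rpredV rpred_nat.
split=> // x Kx.
pose X (i : 'I_3) := nth 0 [:: 1; d%:R * w0; x] i.
have [|c [[i ci] e]] := @three_dependent K X bas.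
  by move=> i; rewrite /X; case: (i : nat) (ltn_ord i) => [|[|[|//]]] _ /=; [exact: (subfield1 hK) | exact: iw.1 | exact: Kx].
move: e; rewrite !big_ord_recl big_ord0 addr0 /X /= mulr1 => e.
set c0 := c ord0 in e; set c1 := c (lift _ _) in e; set c2 := c _ in e.
have [c20|c20] := eqVneq c2 0.
  move: e; rewrite c20 mul0r addr0 => e; exfalso.
  have [c10|c10] := eqVneq c1 0.
    move: e; rewrite c10 mul0r addr0 => /eqP; rewrite intr_eq0 => /eqP c00.
    case/negP: ci; move: i => -[[|[|[|//]]] h].
    - by rewrite (_ : Ordinal h = ord0) -?/c0 ?c00 //; apply: val_inj.
    - by rewrite (_ : Ordinal h = lift ord0 ord0) -?/c1 ?c10 //; apply: val_inj.
    - by rewrite (_ : Ordinal h = lift ord0 (lift ord0 ord0)) -?/c2 ?c20 //; apply: val_inj.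
  have n1 : c1%:~R != 0 :> C by rewrite intr_eq0.
  case/negP: nr; have -> : d%:R * w0 = - c0%:~R / c1%:~R.
    apply: (mulfI n1); rewrite [RHS]mulrC divfK //; apply/eqP; rewrite -addr_eq0 addrC; exact/eqP.
  by rewrite rpred_div ?rpredN ?rpred_int.
have n2 : c2%:~R != 0 :> C by rewrite intr_eq0.
exists (- c0%:~R / c2%:~R), (- c1%:~R / c2%:~R).
rewrite !fmorph_div !rmorphN /= !ratr_int; apply: (mulfI n2).
apply/eqP; rewrite -subr_eq0 -[X in _ == X]e; apply/eqP; field.
by [].
Qed.

(** w and its conjugate are the two roots of the quadratic equation of w over the rationals, so
    complex conjugation acts as the nontrivial automorphism of K. *)
Lemma quadratic_conj w x : (forall x, nf_set K x -> exists a b : rat, x = ratr a + ratr b * w) ->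
  nf_set K w -> w \isn't Num.real -> nf_set K x ->
  exists c d : rat, x + x^* = ratr c /\ x * x^* = ratr d.
Proof.
move=> span Kw nr Kx; have [c [d w2]] := span _ (subfieldM hK Kw Kw).
have w2' : w^* * w^* = ratr c + ratr d * w^*.
  by rewrite -conj_linear -w2 rmorphM.
have nz : w - w^* != 0 by rewrite subr_eq0 eq_sym -CrealE.
have tr : w + w^* = ratr d.
  by apply: (mulIf nz); rewrite mulrC -subr_sqr !expr2 w2 w2'; ring.
have nm : w * w^* = - ratr c by rewrite -(addrK w w^*) [w^* + w]addrC tr mulrBr w2; ring.
have [a [b ->]] := span x Kx; exists (a + a + b * d), (a * a + a * b * d - b * b * c).
have -> : ratr (a + a + b * d) = ratr a + ratr a + ratr b * ratr d :> C by rewrite !(rmorphB, rmorphD, rmorphM).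
have -> : ratr (a * a + a * b * d - b * b * c) = ratr a * ratr a + ratr a * ratr b * ratr d - ratr b * ratr b * ratr c :> C.
  by rewrite !(rmorphB, rmorphD, rmorphM).
rewrite conj_linear; move: (ratr a) (ratr b) (ratr c) (ratr d) tr nm => a' b' c' d' <- nm.
split; first by ring.
have -> : c' = - (w * w^*) by rewrite nm opprK.
ring.
Qed.

Lemma ints_conj w x : (forall x, nf_set K x -> exists a b : rat, x = ratr a + ratr b * w) ->
  nf_set K w -> w \isn't Num.real -> ints K x ->
  exists c d : int, x + x^* = c%:~R /\ x * x^* = d%:~R.
Proof.
move=> span Kw nr [Kx ix]; have [c [d [tr nm]]] := quadratic_conj span Kw nr Kx.
have ic : integral (ratr c).
  by rewrite -tr; apply: (@mxpoly.integral_add _ _ (intr : {rmorphism int -> C})) => //; exact: integral_conj.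
have id : integral (ratr d).
  by rewrite -nm; apply: (@mxpoly.integral_mul _ _ (intr : {rmorphism int -> C})) => //; exact: integral_conj.
have [c' c'E] := rat_integral_int ic; have [d' d'E] := rat_integral_int id.
by exists c', d'; rewrite -c'E -d'E.
Qed.

(** The square of |x| is x times its conjugate, a positive rational integer. Both the discreteness
    of lattices and the triviality of alpha at infinity rest on this bound. *)
Lemma ints_norm_ge1 x : ints K x -> x != 0 -> 1 <= `|x|.
Proof.
move=> ix x0; have [w [iw nr span]] := quadratic_generator.
have [c [d [_ nm]]] := ints_conj span iw.1 nr ix.
have : 1 <= `|x| ^+ 2.
  have : 0 < `|x| ^+ 2 by rewrite exprn_gt0 // normr_gt0.
  by rewrite normCK nm ltr0z => d0; rewrite (ler1z _ d) -gtz0_ge1.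
by rewrite -[X in X <= _ -> _](expr1n _ 2) ler_pXn2r ?nnegrE ?ler01.
Qed.

(** The only embeddings of K are the identity and complex conjugation, so the neighbourhoods at
    infinity are governed by |x| alone. *)
Lemma embedding_norm s x : embedding K s -> nf_set K x -> `|s x| = `|x|.
Proof.
move=> es Kx; have [w [iw nr span]] := quadratic_generator; have Kw := iw.1.
have [c [d [tr nm]]] := ints_conj span Kw nr iw.
have w2 : w * w = c%:~R * w - d%:~R by rewrite -tr -nm; ring.
have Kz (z : int) : nf_set K z%:~R by exact: int_in.
have sz (z : int) : s z%:~R = z%:~R by rewrite -ratr_int (embedding_rat _ es).
have sw : (s w - w) * (s w - w^*) = 0.
  have := congr1 s w2; rewrite (embeddingM es) // (embeddingB es) //; last exact: (subfieldM hK).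
  rewrite (embeddingM es) // !sz -tr -nm => e.
  by transitivity (s w * s w - ((w + w^*) * s w - w * w^*)); [ring | rewrite e subrr].
have [a [b ->]] := span x Kx.
have -> : s (ratr a + ratr b * w) = ratr a + ratr b * s w.
  rewrite (embeddingD es); [|exact: rat_in|by apply: (subfieldM hK) => //; exact: rat_in].
  rewrite [s (ratr b * w)](embeddingM es) //; last exact: rat_in.
  by rewrite [s (ratr a)](embedding_rat _ es) [s (ratr b)](embedding_rat _ es).
move/eqP: sw; rewrite mulf_eq0 !subr_eq0 => /orP[/eqP->//|/eqP->].
by rewrite -[LHS]norm_conjC conj_linear conjCK.
Qed.

Section Lattice.
Variable La : set C.
Hypothesis lLa : is_lattice K La.

Lemma lattice_sub x y : La x -> La y -> La (x - y).
Proof.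
have [_ [b [span _]]] := lLa => /span [c [cZ ->]] /span [c' [c'Z ->]].
apply/span; exists (fun i => c i - c' i); split.
  by move=> i; have [z _ <-] := cZ i; have [z' _ <-] := c'Z i; exists (z - z') => //; rewrite rmorphB.
by rewrite -sumrB; apply: eq_bigr => i _; rewrite mulrBl.
Qed.

Lemma lattice0 : La 0.
Proof.
have [_ [b [span _]]] := lLa; apply/span; exists (fun=> 0); split.
  by move=> i; exists 0.
by rewrite big1 // => i _; rewrite mul0r.
Qed.

Lemma lattice_opp x : La x -> La (- x).
Proof. by move=> Lx; rewrite -sub0r; apply: lattice_sub => //; exact: lattice0. Qed.

Lemma lattice_add x y : La x -> La y -> La (x + y).
Proof. by move=> Lx /lattice_opp Ly; rewrite -[y]opprK; exact: lattice_sub. Qed.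

Lemma lattice_nat n x : La x -> La (n%:R * x).
Proof.
move=> Lx; elim: n => [|n IH]; first by rewrite mul0r; exact: lattice0.
by rewrite -natr1 mulrDl mul1r; exact: lattice_add.
Qed.

Lemma lattice_int (z : int) x : La x -> La (z%:~R * x).
Proof.
move=> Lx; case: z => n; first exact: (lattice_nat n Lx).
by rewrite NegzE rmorphN mulNr; apply: lattice_opp; exact: (lattice_nat n.+1 Lx).
Qed.

Lemma lattice_basis_in (b : 'I_2 -> C) : basis_over ZZ La b -> forall i, La (b i).
Proof.
move=> [span _] i; apply/span; exists (fun j => (i == j)%:R); split=> [j|].
  by exists (i == j)%:R => //; rewrite rmorph_nat.
rewrite (bigD1 i) //= eqxx mul1r big1 ?addr0 // => j ji.
by rewrite eq_sym (negPf ji) mul0r.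
Qed.

Lemma lattice_denominator : exists2 d : nat, (0 < d)%N & forall l, La l -> ints K (d%:R * l).
Proof.
have [LK [b bas]] := lLa; have Lb := lattice_basis_in bas; have [span _] := bas.
have [d0 d0p i0] := integral_multiple (LK _ (Lb ord0)).
have [d1 d1p i1] := integral_multiple (LK _ (Lb (lift ord0 ord0))).
exists (d0 * d1)%N; first by rewrite muln_gt0 d0p.
move=> l /span [c [cZ ->]]; rewrite big_ord_recl big_ord1.
have [z0 _ <-] := cZ ord0; have [z1 _ <-] := cZ (lift ord0 ord0).
have iz (z : int) : ints K z%:~R.
  by case: z => n; [exact: (ints_nat K n) | rewrite NegzE rmorphN; apply: intsN; exact: (ints_nat K n.+1)].
have -> : (d0 * d1)%:R * (z0%:~R * b ord0 + z1%:~R * b (lift ord0 ord0)) =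
   d1%:R * z0%:~R * (d0%:R * b ord0) + d0%:R * z1%:~R * (d1%:R * b (lift ord0 ord0)).
  by rewrite natrM; ring.
by apply: intsD; apply: intsM => //; apply: intsM => //; exact: ints_nat.
Qed.

(** In an integral relation between the two basis vectors and x the coefficient of x is nonzero,
    since the basis is free. *)
Lemma lattice_multiple x : nf_set K x -> exists2 d : nat, (0 < d)%N & La (d%:R * x).
Proof.
move=> Kx; have [LK [b bas]] := lLa; have Lb := lattice_basis_in bas; have [_ free] := bas.
pose X (i : 'I_3) := nth 0 [:: b ord0; b (lift ord0 ord0); x] i.
have [|c [[i ci] e]] := @three_dependent K X iqK.1.
  by move=> i; rewrite /X; case: (i : nat) (ltn_ord i) => [|[|[|//]]] _ /=; [exact: LK | exact: LK | exact: Kx].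
move: e; rewrite !big_ord_recl big_ord0 addr0 /X /= => e.
set c0 := c ord0 in e; set c1 := c (lift _ _) in e; set c2 := c _ in e.
have [c20|c20] := eqVneq c2 0.
  exfalso; pose cc (i : 'I_2) : C := if i == ord0 then c0%:~R else c1%:~R.
  have h : forall i, cc i = 0.
    apply: free => [k|]; first by rewrite /cc; case: eqP => _; eexists.
    by rewrite big_ord_recl big_ord1 -[RHS]e c20 mul0r addr0 /cc /=.
  have /eqP := h ord0; rewrite /cc /= intr_eq0 => /eqP c00.
  have /eqP := h (lift ord0 ord0); rewrite /cc /= intr_eq0 => /eqP c10.
  case/negP: ci; move: i => -[[|[|[|//]]] hh].
  - by rewrite (_ : Ordinal hh = ord0) -?/c0 ?c00 //; apply: val_inj.
  - by rewrite (_ : Ordinal hh = lift ord0 ord0) -?/c1 ?c10 //; apply: val_inj.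
  - by rewrite (_ : Ordinal hh = lift ord0 (lift ord0 ord0)) -?/c2 ?c20 //; apply: val_inj.
exists `|c2|%N; first by rewrite absz_gt0.
have Lc : La (c2%:~R * x).
  have -> : c2%:~R * x = - (c0%:~R * b ord0) - c1%:~R * b (lift ord0 ord0).
    by apply/eqP; rewrite -subr_eq0 -[X in _ == X]e; apply/eqP; ring.
  by apply: lattice_sub; first apply: lattice_opp; exact: lattice_int.
case: (c2) Lc => n //; rewrite NegzE rmorphN mulNr => /lattice_opp.
by rewrite opprK.
Qed.

(** Write x = a + b w, let x' and w' be the conjugates and D = (w - w')^2. Then b D = (x - x')(w -
    w') is rational and integral, hence an integer, and so is a D. Multiples of 1 and w that lie in
    La do the rest. *)
Lemma lattice_ints : exists2 M : nat, (0 < M)%N & forall x, ints K x -> La (M%:R * x).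
Proof.
have [w [iw nr span]] := quadratic_generator; have Kw := iw.1.
have [m1 m1p L1] := lattice_multiple (subfield1 hK).
have [mw mwp Lw] := lattice_multiple Kw.
have [c [d [tr nm]]] := ints_conj span Kw nr iw.
pose De := (w - w^*) ^+ 2.
have nz : w - w^* != 0 by rewrite subr_eq0 eq_sym -CrealE.
pose D : int := c ^+ 2 - 4 * d.
have DE : De = D%:~R.
  by rewrite /D rmorphB rmorphXn rmorphM /= -tr -nm /De; ring.
have D0 : D != 0 by rewrite -(intr_eq0 C) -DE expf_neq0.
exists (`|D| * (m1 * mw))%N; first by rewrite !muln_gt0 m1p mwp absz_gt0 D0.
move=> x ix; have [a [b xE]] := span x ix.1.
have iz (z : int) : integral z%:~R by exact: (@mxpoly.integral_id int C (intr : {rmorphism int -> C}) z).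
have iN y : integral y -> integral (- y) by exact: (@mxpoly.integral_opp _ _ (intr : {rmorphism int -> C})).
have iD y z : integral y -> integral z -> integral (y + z) by exact: (@mxpoly.integral_add _ _ (intr : {rmorphism int -> C})).
have iM y z : integral y -> integral z -> integral (y * z) by exact: (@mxpoly.integral_mul _ _ (intr : {rmorphism int -> C})).
have xc : x^* = ratr a + ratr b * w^* by rewrite xE conj_linear.
have bD : ratr (b * D%:~R) = (x - x^*) * (w - w^*).
  by rewrite rmorphM /= ratr_int -DE xc xE /De; ring.
have ib : integral (ratr (b * D%:~R)).
  rewrite bD; apply: iM; apply: iD; try apply: iN; try apply: integral_conj; [exact: ix.2 | exact: ix.2 | exact: iw.2 | exact: iw.2].
have [bz bzE] := rat_integral_int ib.
have ia : integral (ratr (a * D%:~R)).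
  have -> : ratr (a * D%:~R) = x * D%:~R - bz%:~R * w.
    by rewrite -bzE !rmorphM /= !ratr_int xE; ring.
  apply: iD; first by apply: iM => //; exact: ix.2.
  by apply: iN; apply: iM => //; exact: iw.2.
have [az azE] := rat_integral_int ia.
have LD : La (D%:~R * ((m1 * mw)%:R * x)).
  have -> : D%:~R * ((m1 * mw)%:R * x) = mw%:R * (az%:~R * (m1%:R * 1)) + m1%:R * (bz%:~R * (mw%:R * w)).
    have aE : az%:~R = ratr a * D%:~R :> C by rewrite -azE rmorphM /= ratr_int.
  have bE : bz%:~R = ratr b * D%:~R :> C by rewrite -bzE rmorphM /= ratr_int.
  by rewrite aE bE xE natrM; ring.
  by apply: lattice_add; apply: lattice_nat; exact: lattice_int.
rewrite natrM -mulrA; case: (D) LD => n //; rewrite NegzE rmorphN mulNr => /lattice_opp.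
by rewrite opprK.
Qed.

Lemma lattice_discrete : exists2 r : C, 0 < r & forall l, La l -> l != 0 -> r <= `|l|.
Proof.
have [d d0 hd] := lattice_denominator.
have dp : 0 < d%:R :> C by rewrite ltr0n.
exists d%:R^-1; first by rewrite invr_gt0.
move=> l Ll l0; have := ints_norm_ge1 (hd l Ll) (mulf_neq0 (lt0r_neq0 dp) l0).
by rewrite normrM normr_nat => h; rewrite -(ler_pM2l dp) divff // lt0r_neq0.
Qed.

End Lattice.

(** The matrix of multiplication by x on a Z-basis of O is integral, and x is a root of its
    characteristic polynomial. *)
Lemma order_integral (O : set C) : is_order K O -> O `<=` ints K.
Proof.
move=> [lO O1 OM] x Ox; have [LK [b bas]] := lO; split; first exact: LK.
have Ob := lattice_basis_in bas; have [span _] := bas.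
have /choice [c cE] : forall i, exists c : 'I_2 -> int, x * b i = \sum_j (c j)%:~R * b j.
  move=> i; have /span [c [cZ ->]] := OM _ _ Ox (Ob i).
  have /choice [z zE] : forall j, exists z : int, z%:~R = c j by move=> j; have [z _ <-] := cZ j; exists z.
  by exists z; apply: eq_bigr => j _; rewrite zE.
pose M : 'M[int]_2 := \matrix_(i, j) c j i.
exists (char_poly M); first exact: char_poly_monic.
rewrite map_char_poly -eigenvalue_root_char.
apply/eigenvalueP; exists (\row_j b j).
  apply/rowP => i; rewrite !mxE cE.
  by apply: eq_bigr => j _; rewrite !mxE mulrC.
apply/eqP => /rowP b0; have /span [e [_ e1]] := O1; move/eqP: (oner_neq0 C); apply.
by rewrite e1 big1 // => i _; have := b0 i; rewrite !mxE => ->; rewrite mulr0.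
Qed.

End Quadratic.

(** The localisation at p of a subgroup of C. It describes a completed lattice by conditions on
    elements of K. *)
Definition locp {C : numClosedFieldType} (p : nat) (S : set C) : set C :=
  [set x | exists m, ~~ (p %| m)%N /\ S (m%:R * x)].

Lemma ndvd_gt0 p m : ~~ (p %| m)%N -> (0 < m)%N.
Proof. by case: m => //; rewrite dvdn0. Qed.

(** * Lattices localised and completed at p *)

Section LocalLattices.
Variable C : numClosedFieldType.
Implicit Types (S : set C) (L : numField C) (p : rprime).
Local Notation cauchy := Defs.cauchy.

Definition subgroup S : Prop := S 0 /\ forall x y, S x -> S y -> S (x - y).

Section Subgroup.
Variable S : set C.
Hypothesis gS : subgroup S.

Lemma subgroupN x : S x -> S (- x).
Proof. by move=> Sx; rewrite -sub0r; apply: gS.2 => //; exact: gS.1. Qed.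

Lemma subgroupD x y : S x -> S y -> S (x + y).
Proof. by move=> Sx /subgroupN Sy; rewrite -[y]opprK; exact: gS.2. Qed.

Lemma subgroup_nat n x : S x -> S (n%:R * x).
Proof.
move=> Sx; elim: n => [|n IH]; first by rewrite mul0r; exact: gS.1.
by rewrite -natr1 mulrDl mul1r; exact: subgroupD.
Qed.

Lemma subgroup_int (z : int) x : S x -> S (z%:~R * x).
Proof.
move=> Sx; case: z => n; first exact: (subgroup_nat n Sx).
by rewrite NegzE rmorphN mulNr; apply: subgroupN; exact: (subgroup_nat n.+1 Sx).
Qed.

Lemma subgroup_sum n (f : 'I_n -> C) : (forall i, S (f i)) -> S (\sum_i f i).
Proof.
elim: n f => [|n IH] f h; first by rewrite big_ord0; exact: gS.1.
by rewrite big_ord_recr /=; apply: subgroupD => //; exact: IH.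
Qed.

Lemma locpW p x : S x -> locp (val p) S x.
Proof.
move=> Sx; exists 1%N; rewrite mul1r; split=> //.
by rewrite dvdn1 neq_ltn prime_gt1 ?orbT //; exact: valP p.
Qed.

Lemma ndvdM p m n : ~~ (val p %| m)%N -> ~~ (val p %| n)%N -> ~~ (val p %| m * n)%N.
Proof. by move=> pm pn; rewrite Euclid_dvdM ?negb_or ?pm //; exact: valP p. Qed.

Lemma locp_subgroup p : subgroup (locp (val p) S).
Proof.
split; first by apply: locpW; exact: gS.1.
move=> x y [m [pm Sx]] [n [pn Sy]]; exists (m * n)%N; split; first exact: ndvdM.
have -> : (m * n)%:R * (x - y) = n%:R * (m%:R * x) - m%:R * (n%:R * y) by rewrite natrM; ring.
by apply: gS.2; exact: subgroup_nat.
Qed.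

Lemma locp_unit p n x : ~~ (val p %| n)%N -> locp (val p) S (n%:R * x) -> locp (val p) S x.
Proof.
move=> pn [m [pm Sx]]; exists (m * n)%N; split; first exact: ndvdM.
by rewrite natrM -mulrA.
Qed.

Lemma locp_uniform p n (f : 'I_n -> C) : (forall i, locp (val p) S (f i)) ->
  exists m, ~~ (val p %| m)%N /\ forall i, S (m%:R * f i).
Proof.
move=> h; have /choice [m hm] := h; exists (\prod_i m i)%N; split.
  elim/big_ind: _ => [||i _].
  - by rewrite dvdn1 neq_ltn prime_gt1 ?orbT //; exact: valP p.
  - exact: ndvdM.
  - exact: (hm i).1.
move=> i; rewrite (bigD1 i) //= mulnC natrM -mulrA.
by apply: subgroup_nat; exact: (hm i).2.
Qed.

End Subgroup.

Lemma ints_subgroup L : subgroup (ints L).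
Proof.
by split=> [|x y Ix Iy]; [exact: ints0 | apply: intsD => //; exact: intsN].
Qed.

(** Up to a factor prime to p, M is a power p^e, so the neighbourhood of level e lies in M O_L
    localised at p. *)
Lemma locp_open L p S M : subgroup S -> (0 < M)%N -> (forall x, ints L x -> S (M%:R * x)) ->
  open_subgroup L (Fin p) (locp (val p) S).
Proof.
move=> gS M0 MS; have [S0 SB] := locp_subgroup gS p; split=> //.
have [k pk Mk] := pfactor_coprime (valP p) M0.
exists (logn (val p) M) => x [Lx [m [pm [y Iy e]]]]; exists (m * k)%N; split.
  by apply: ndvdM => //; rewrite -prime_coprime //; exact: valP p.
have -> : (m * k)%:R * x = M%:R * y; last exact: MS.
by rewrite natrM mulrAC e {2}Mk natrM natrX; ring.
Qed.

Lemma ints_open L p : open_subgroup L (Fin p) (locp (val p) (ints L)).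
Proof. by apply: (@locp_open L p _ 1%N) => // [|x]; [exact: ints_subgroup | rewrite mul1r]. Qed.

(** A denominator m prime to p is cleared by the factor m^phi(p^n), with Euler's phi, which is
    congruent to 1 modulo p^n; the n-th term changes by an error tending to zero. *)
Lemma clos_locp L p S (x : completion L (Fin p)) : subgroup S -> S `<=` ints L ->
  eventually_in (locp (val p) S) x -> clos L (Fin p) S x.
Proof.
move=> gS SI [N hN]; have pp := valP p.
have /choice [m hm] : forall n, exists m, ~~ (val p %| m)%N /\ S (m%:R * rep x (N + n)%N).
  by move=> n; have [m hm] := hN (N + n)%N (leq_addr _ _); exists m.
pose u n := (m n ^ totient (val p ^ n))%:R * rep x (N + n)%N.
have cx := cauchy_shift N (rep_cauchy x); have [Lx hx] := cx.
have tp n : (0 < totient (val p ^ n))%N by rewrite totient_gt0 expn_gt0 prime_gt0.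
have Su n : S (u n).
  by rewrite /u -(prednK (tp n)) expnSr natrM -mulrA; apply: subgroup_nat => //; exact: (hm n).2.
have ux k n : (k <= n)%N -> nb L (Fin p) k (u n - rep x (N + n)%N).
  move=> kn; apply: (nb_mono kn); split.
    exact: (subfieldB (nf_subfield L) (SI _ (Su n)).1 (Lx n)).
  exists (m n); split; first exact: (hm n).1.
  have mp := ndvd_gt0 (hm n).1.
  have cop : coprime (m n) (val p ^ n).
    by rewrite coprimeXr // coprime_sym prime_coprime //; exact: (hm n).1.
  have /eqP := cyclic.Euler_exp_totient cop; rewrite eqn_mod_dvd ?expn_gt0 ?mp // => /dvdnP [q qE].
  exists (q%:R * ((m n)%:R * rep x (N + n)%N)).
    by apply: intsM; [exact: ints_nat | apply: SI; exact: (hm n).2].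
  have -> : u n - rep x (N + n)%N = (m n ^ totient (val p ^ n) - 1)%:R * rep x (N + n)%N.
    by rewrite natrB ?expn_gt0 ?mp // mulrBl mul1r.
  by rewrite qE natrM natrX; ring.
have cu : cauchy L (Fin p) u.
  split=> [n|k]; first exact: (SI _ (Su n)).1.
  have [M hM] := hx k; exists (maxn k M) => a b.
  rewrite !geq_max => /andP[ka Ma] /andP[kb Mb].
  have [j jD] : exists j, j = k by exists k.
  have h1 := ux k a ka; have h2 := nbN (ux k b kb); have h3 := hM a b Ma Mb.
  have pD y z : nb L (Fin p) k y -> nb L (Fin p) k z -> nb L (Fin p) k (y + z).
    move=> [Ly [c [pc [y' Iy e]]]] [Lz [d [pd [z' Iz f]]]].
    split; first exact: (subfieldD (nf_subfield L) Ly Lz).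
    exists (c * d)%N; split; first exact: ndvdM.
    exists (d%:R * y' + c%:R * z').
      by apply: intsD; apply: intsM => //; exact: ints_nat.
    by rewrite natrM; transitivity (d%:R * (c%:R * y) + c%:R * (d%:R * z)); [ring | rewrite e f; ring].
  have -> : u a - u b = (u a - rep x (N + a)%N) + (- (u b - rep x (N + b)%N) + (rep x (N + a)%N - rep x (N + b)%N)) by ring.
  by apply: (pD _ _ h1); exact: pD.
exists u; split=> //.
rewrite -[LHS]repK -(class_of_shift N (rep_cauchy x)); apply: class_of_eq => // k.
by exists k => n kn; have /nbN := ux k n kn; rewrite opprB.
Qed.

Lemma clos_intsE L p (x : completion L (Fin p)) :
  clos L (Fin p) (ints L) x <-> eventually_in (locp (val p) (ints L)) x.
Proof.
split; last by apply: clos_locp => //; exact: ints_subgroup.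
move=> [u [cu Iu ->]]; apply/(eventually_class (ints_open L p) cu).
by exists 0%N => n _; apply: locpW.
Qed.

Lemma ints_rat (x : C) : ints rat_field x <-> ZZ x.
Proof.
split=> [[[q _ <-] iq]|[z _ <-]]; first by have [z ->] := rat_integral_int iq; exists z.
split; first by exists z%:~R => //; rewrite ratr_int.
exact: (@mxpoly.integral_id int C (intr : {rmorphism int -> C}) z).
Qed.

Lemma ZZ_subgroup : subgroup (@ZZ C).
Proof.
split; first by exists 0.
by move=> _ _ [x _ <-] [y _ <-]; exists (x - y) => //; rewrite rmorphB.
Qed.

Lemma rat_in_numfield L (x : C) : QQ x -> nf_set L x.
Proof. by move=> [q _ <-]; exact: rat_in. Qed.

Lemma nb_rat L p k (x : C) : nb rat_field (Fin p) k x -> nb L (Fin p) k x.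
Proof.
move=> [Qx [m [pm [y Iy e]]]]; split; first exact: rat_in_numfield.
by exists m; split=> //; exists y => //; split; [exact: (rat_in_numfield L Iy.1) | exact: Iy.2].
Qed.

Lemma cauchy_rat L p u : cauchy (@rat_field C) (Fin p) u -> cauchy L (Fin p) u.
Proof.
move=> [Qu hu]; split=> [n|k]; first exact: (rat_in_numfield L (Qu n)).
by have [N hN] := hu k; exists N => m n Nm Nn; apply: nb_rat; exact: hN.
Qed.

Lemma base_change_class L p u : cauchy (@rat_field C) (Fin p) u ->
  base_change L (class_of rat_field (Fin p) u) = class_of L (Fin p) u.
Proof.
move=> cu; apply: class_of_eq; [exact: cauchy_rat (rep_cauchy _) | exact: cauchy_rat |].
by move=> k; have [N hN] := rep_class cu k; exists N => n Nn; apply: nb_rat; exact: hN.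
Qed.

Section Tensor.
Variables (K : numField C) (iqK : imag_quadratic K).

Lemma lattice_subgroup La : is_lattice K La -> subgroup La.
Proof. by move=> lLa; split; [exact: (lattice0 lLa) | exact: (lattice_sub lLa)]. Qed.

Lemma lattice_open La p : is_lattice K La -> open_subgroup K (Fin p) (locp (val p) La).
Proof.
move=> lLa; have [M M0 hM] := lattice_ints iqK lLa.
by apply: locp_open M0 hM; exact: lattice_subgroup.
Qed.

Lemma tensor_eventually La p (x : completion K (Fin p)) : is_lattice K La ->
  tensorZp K p La x -> eventually_in (locp (val p) La) x.
Proof.
move=> lLa [n [a [l [ha hl ->]]]]; have oLa := lattice_open p lLa.
apply: (eventually_sum oLa) => i; have [b [u [cu Zu ->]] <-] := ha i.
rewrite base_change_class // /emb -class_ofM; [|exact: cauchy_rat|by apply: cauchy_cst; apply: lLa.1].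
apply/(eventually_class oLa).
  by apply: cauchyM; [exact: cauchy_rat | apply: cauchy_cst; exact: lLa.1].
exists 0%N => k _; apply: locpW; rewrite fctE; have [z _ <-] := Zu k.
by apply: subgroup_int => //; exact: lattice_subgroup.
Qed.

(** The coordinates of a representing sequence in a Z-basis of La are rational Cauchy sequences with
    terms integral at p; their limits are the coefficients in Z_p. *)
Lemma eventually_tensor La p (x : completion K (Fin p)) : is_lattice K La ->
  eventually_in (locp (val p) La) x -> tensorZp K p La x.
Proof.
move=> lLa [N hN]; have [M M0 hM] := lattice_ints iqK lLa; have gLa := lattice_subgroup lLa.
have [LK [b bas]] := lLa; have [span free] := bas; have Lb := lattice_basis_in bas.
have /choice [q qE] : forall n, exists q : 'I_2 -> rat, rep x (N + n)%N = \sum_i ratr (q i) * b i.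
  move=> n; have Kx := (rep_cauchy x).1 (N + n)%N.
  have [d d0 /span [c [cZ cE]]] := lattice_multiple iqK lLa Kx.
  have /choice [z zE] : forall i, exists z : int, z%:~R = c i by move=> i; have [z _ <-] := cZ i; exists z.
  have dn : d%:R != 0 :> C by rewrite pnatr_eq0 -lt0n.
  exists (fun i => (z i)%:~R / d%:R); apply: (mulfI dn); rewrite cE mulr_sumr; apply: eq_bigr => i _.
  by rewrite fmorph_div /= ratr_int ratr_nat -zE mulrA [d%:R * _]mulrC divfK.
(* Multiplied by a common denominator of the r i, this becomes an integral relation between basis
   vectors, and freeness identifies the coordinates. *)
have coord (m : nat) (r : 'I_2 -> rat) : La (m%:R * \sum_i ratr (r i) * b i) -> forall i, ZZ (m%:R * ratr (r i) : C).
  move=> /span [c [cZ cE]] i; have [m0|m0] := posnP m; first by rewrite m0 mul0r; exists 0.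
  have /choice [z zE] : forall i, exists z : int, z%:~R = c i by move=> j; have [z _ <-] := cZ j; exists z.
  have [D D0 hD] := common_denominator r.
  have Dn : D%:R != 0 :> C by rewrite pnatr_eq0 -lt0n.
  have DZ j : ZZ (D%:R * ratr (r j) : C).
    by have [w wE] := hD j; exists w => //; rewrite -ratr_int -wE rmorphM /= ratr_nat.
  have h : forall j, D%:R * (m%:R * ratr (r j)) - D%:R * c j = 0.
    apply: free => [j|].
      have [w _ wE] := DZ j; exists (m%:Z * w - D%:Z * z j) => //.
      by rewrite rmorphB !rmorphM /= wE zE; ring.
    rewrite (eq_bigr (fun j => D%:R * (m%:R * (ratr (r j) * b j)) - D%:R * (c j * b j))); last first.
      by move=> j _; ring.
    by rewrite sumrB -!mulr_sumr cE subrr.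
  have /eqP := h i; rewrite -mulrBr mulf_eq0 (negPf Dn) /= subr_eq0 => /eqP ->; exact: cZ.
have Qq n i : QQ (ratr (q n i) : C) by exists (q n i).
have cx := cauchy_shift N (rep_cauchy x); have [_ hx] := cx.
have [k pk Mk] := pfactor_coprime (valP p) M0.
have pk' : ~~ (val p %| k)%N by rewrite -prime_coprime //; exact: valP p.
have cq i : cauchy (@rat_field C) (Fin p) (fun n => ratr (q n i)).
  split=> [n|j]; first exact: Qq.
  have [N' hN'] := hx (j + logn (val p) M)%N; exists N' => m n Nm Nn.
  have [_ [m' [pm' [y Iy e]]]] := hN' m n Nm Nn.
  split; first by apply: (subfieldB QQ_subfield); exact: Qq.
  pose r i := q m i - q n i.
  have rE i' : ratr (r i' / (val p)%:R ^+ j) = (ratr (q m i') - ratr (q n i')) / (val p)%:R ^+ j :> C.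
    by rewrite fmorph_div rmorphXn /= ratr_nat /r rmorphB.
  have La1 : La ((m' * k)%:R * (\sum_i ratr (r i / (val p)%:R ^+ j) * b i)).
    have pn : (val p)%:R ^+ j != 0 :> C by rewrite expf_neq0 // pnatr_eq0 -lt0n prime_gt0 //; exact: valP p.
    have -> : \sum_i ratr (r i / (val p)%:R ^+ j) * b i = (val p)%:R ^- j * (rep x (N + m)%N - rep x (N + n)%N).
      rewrite !qE -sumrB mulr_sumr; apply: eq_bigr => i' _.
      by rewrite rE -mulrBl mulrAC mulrC.
    suff -> : (m' * k)%:R * ((val p)%:R ^- j * (rep x (N + m)%N - rep x (N + n)%N)) = M%:R * y by exact: hM.
    apply: (mulfI pn); rewrite natrM; move: e; rewrite exprD => e.
    rewrite [in M%:R]Mk natrM natrX; set P := _ ^+ logn _ _ in e *; set Q := _ ^+ j in pn e *.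
    transitivity (k%:R * (m'%:R * (rep x (N + m)%N - rep x (N + n)%N))); first by field.
    by rewrite e; ring.
  have [z _ zE] := coord _ _ La1 i.
  exists (m' * k)%N; split; first exact: ndvdM.
  exists z%:~R; first by apply/ints_rat; exists z.
  rewrite zE rE.
  have pn : (val p)%:R ^+ j != 0 :> C by rewrite expf_neq0 // pnatr_eq0 -lt0n prime_gt0 //; exact: valP p.
  by rewrite mulrCA [_ * (_ / _)]mulrC divfK.
pose a i := class_of (@rat_field C) (Fin p) (fun n => ratr (q n i)).
have Za i : Defs.Zp p (a i).
  apply: clos_locp; [exact: ZZ_subgroup | by move=> y /ints_rat |].
  apply/eventually_class; [|exact: cq|].
    by apply: (@locp_open rat_field p _ 1%N) => // [|y /ints_rat]; [exact: ZZ_subgroup | rewrite mul1r].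
  exists 0%N => n _; have [m [pm Lm]] := hN (N + n)%N (leq_addr _ _).
  by exists m; split=> //; move: Lm; rewrite qE => /coord.
exists 2%N, (fun i => base_change K (a i)), b; split=> [i|i|]; [by exists (a i) | exact: Lb |].
have cqK i := cauchy_rat K (cq i).
have cb i : cauchy K (Fin p) (fun=> b i) by apply: cauchy_cst; exact: LK.
rewrite -[LHS]repK -(class_of_shift N (rep_cauchy x)) big_ord_recl big_ord1.
rewrite !base_change_class ?cq // /emb -!class_ofM // -class_ofD; [|exact: cauchyM|exact: cauchyM].
by congr (class_of _ _ _); apply/funext => n; rewrite qE big_ord_recl big_ord1.
Qed.

Lemma tensorE La p (x : completion K (Fin p)) : is_lattice K La ->
  (tensorZp K p La x <-> eventually_in (locp (val p) La) x).
Proof. by move=> lLa; split; [exact: tensor_eventually | exact: eventually_tensor]. Qed.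

Variables (O : set C) (oO : is_order K O).

Lemma ideal_subgroup I : is_ideal O I -> subgroup I.
Proof. by move=> [_ I0 IB _]. Qed.

Lemma order_nat n : O n%:R.
Proof.
by have [lO O1 _] := oO; rewrite -[n%:R]mulr1; apply: subgroup_nat => //; exact: lattice_subgroup.
Qed.

Lemma ideal_natural I : is_ideal O I -> (exists2 x, I x & x != 0) -> exists2 N, (0 < N)%N & I N%:R.
Proof.
move=> [IO I0 IB IM] [x Ix x0]; have [lO O1 OM] := oO; have Kx := lO.1 _ (IO _ Ix).
have [d d0 Od] := lattice_multiple iqK lO (subfieldV (nf_subfield K) Kx).
by exists d => //; rewrite -[d%:R](mulfVK x0); apply: IM.
Qed.

Lemma ideal_open I p : is_ideal O I -> (exists2 x, I x & x != 0) ->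
  open_subgroup K (Fin p) (locp (val p) I).
Proof.
move=> iI nI; have [N N0 IN] := ideal_natural iI nI; have [lO O1 OM] := oO.
have [M M0 hM] := lattice_ints iqK lO; have [_ _ _ IM] := iI.
apply: (@locp_open K p _ (N * M)); [exact: ideal_subgroup | by rewrite muln_gt0 N0 |].
by move=> x ix; rewrite natrM -mulrA mulrC; apply: IM => //; exact: hM.
Qed.

Lemma locp_ideal I p x y : is_ideal O I -> locp (val p) O x -> locp (val p) I y -> locp (val p) I (x * y).
Proof.
move=> [_ _ _ IM] [m [pm Om]] [n [pn Im]]; exists (m * n)%N; split; first exact: ndvdM.
by rewrite natrM mulrACA; exact: IM.
Qed.

(** For the converse, take a positive integer N in I and y in K that approximates x modulo N O_p:
    then x = m^-1 (m y) + N^-1 (x - y) N with m y in I, a sum of two products. *)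
Lemma ideal_spanE I p (x : completion K (Fin p)) : is_ideal O I -> (exists2 y, I y & y != 0) ->
  (span_over (tensorZp K p O) I x <-> eventually_in (locp (val p) I) x).
Proof.
move=> iI nI; have oI := ideal_open p iI nI; have [lO O1 OM] := oO; have [IO I0 IB IM] := iI.
have KI y : I y -> nf_set K y by move=> /IO; exact: lO.1.
split.
  move=> [n [a [l [ha hl ->]]]]; apply: (eventually_sum oI) => i.
  have h : eventually_in (locp (val p) I) (emb K (Fin p) (l i)).
    by apply/(eventually_emb oI (KI _ (hl i))); exact: (locpW p (hl i)).
  apply: (eventuallyM oI (tensor_eventually lO (ha i)) h).
    by move=> y z; exact: locp_ideal.
have [N N0 IN] := ideal_natural iI nI; have Nn : N%:R != 0 :> C by rewrite pnatr_eq0 -lt0n.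
have KN : nf_set K N%:R by exact: (subfield_nat (nf_subfield K)).
have KNV := subfieldV (nf_subfield K) KN.
pose S := [set y : C | locp (val p) O (N%:R^-1 * y)].
have oS : open_subgroup K (Fin p) S.
  have [gO0 gOB] := locp_subgroup (lattice_subgroup lO) p.
  split=> [|y z Sy Sz|]; [by rewrite /S /= mulr0 | by rewrite /S /= mulrBr; exact: gOB |].
  have [_ _ [k kO]] := lattice_open p lO; have [m hm] := nbZ (Fin p) k KNV.
  by exists m => y /hm /kO.
move=> [M1 h1]; have [M2 h2] := eventually_approx oS x.
pose M' := maxn M1 M2; have [m [pm Im]] := h1 M' (leq_maxl _ _).
have hr := h2 M' (leq_maxr _ _); set y := rep x M' in Im hr.
have mn : m%:R != 0 :> C by rewrite pnatr_eq0 -lt0n (ndvd_gt0 pm).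
have Ky : nf_set K y := (rep_cauchy x).1 M'.
have Km : nf_set K m%:R by exact: (subfield_nat (nf_subfield K)).
have KmV := subfieldV (nf_subfield K) Km.
exists 2%N, (fun i => if i == ord0 then emb K (Fin p) m%:R^-1 else emb K (Fin p) N%:R^-1 * (x - emb K (Fin p) y)).
exists (fun i => if i == ord0 then m%:R * y else N%:R).
split.
- move=> i; case: eqP => _; apply: eventually_tensor => //.
    apply/(eventually_emb (lattice_open p lO) KmV); exists m; split=> //.
    by rewrite divff.
  by apply/(eventually_embM (lattice_open p lO)).
- by move=> i; case: eqP.
- rewrite big_ord_recl big_ord1 /= -embM //; last exact: (subfieldM (nf_subfield K)).
  rewrite mulKf // mulrAC -embM // mulVf // emb1 mul1r addrC subrK //.
Qed.

End Tensor.
End LocalLattices.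

(** * Primes of K *)

Section Primes.
Variable C : numClosedFieldType.
Variable K : numField C.
Hypothesis iqK : imag_quadratic K.
Implicit Types (p : rprime) (w I J : set C).
Local Notation ideal := (is_ideal (ints K)).

Lemma ints_int (z : int) : ints K z%:~R.
Proof.
by case: z => n; [exact: (ints_nat K n) | rewrite NegzE rmorphN; apply: intsN; exact: (ints_nat K n.+1)].
Qed.

Lemma ideal_sub I : ideal I -> subgroup I.
Proof. by move=> [_ I0 IB _]. Qed.

Lemma ints_ideal : ideal (ints K).
Proof. by split=> //; [exact: ints0 | move=> x y Ix Iy; apply: intsD => //; exact: intsN | move=> a x; exact: intsM]. Qed.

Lemma mul_ideal_mul I J x y : I x -> J y -> ideal_mul I J (x * y).
Proof.
by move=> Ix Jy; exists 1%N, (fun=> x), (fun=> y); split=> //; rewrite big_ord1.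
Qed.

Lemma ideal_mulP I J : ideal I -> ideal J ->
  [/\ ideal (ideal_mul I J), ideal_mul I J `<=` I & ideal_mul I J `<=` J].
Proof.
move=> iI iJ; have [IO I0 IB IM] := iI; have [JO J0 JB JM] := iJ.
have sI : ideal_mul I J `<=` I.
  move=> _ [n [a [b [ha hb ->]]]]; apply: (subgroup_sum (ideal_sub iI)) => i.
  by rewrite mulrC; apply: IM => //; exact: JO.
have sJ : ideal_mul I J `<=` J.
  move=> _ [n [a [b [ha hb ->]]]]; apply: (subgroup_sum (ideal_sub iJ)) => i.
  by apply: JM => //; exact: IO.
split=> //; split.
- by move=> x /sI /IO.
- by exists 0%N, (fun=> 0), (fun=> 0); split=> //; rewrite big_ord0.
- move=> _ _ [n [a [b [ha hb ->]]]] [m [c [d [hc hd ->]]]].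
  exists (n + m)%N, (fun i => match fintype.split i with inl i => a i | inr j => - c j end),
    (fun i => match fintype.split i with inl i => b i | inr j => d j end); split.
  + by move=> i; case: fintype.split => // j; exact: (subgroupN (ideal_sub iI)).
  + by move=> i; case: fintype.split.
  rewrite big_split_ord /= -sumrN; congr (_ + _); apply: eq_bigr => i _.
    by rewrite -[lshift m i]/(unsplit (inl i)) unsplitK.
  by rewrite -[rshift n i]/(unsplit (inr i)) unsplitK mulNr.
- move=> x _ Ox [n [a [b [ha hb ->]]]]; exists n, (fun i => x * a i), b; split=> //.
    by move=> i; exact: IM.
  by rewrite mulr_sumr; apply: eq_bigr => i _; rewrite mulrA.
Qed.

Lemma ideal_expP I n : ideal I -> ideal (ideal_exp (ints K) I n).
Proof.
by move=> iI; elim: n => [|n IH]; [exact: ints_ideal | have [] := ideal_mulP iI IH].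
Qed.

Lemma ideal_exp_mono I m n : ideal I -> (m <= n)%N ->
  ideal_exp (ints K) I n `<=` ideal_exp (ints K) I m.
Proof.
move=> iI; elim: n => [|n IH]; first by rewrite leqn0 => /eqP ->.
rewrite leq_eqVlt => /orP[/eqP-> //|mn].
apply: subset_trans (IH mn); by have [] := ideal_mulP iI (ideal_expP n iI).
Qed.

Lemma ideal_exp_nat I n (m : nat) : I m%:R -> ideal_exp (ints K) I n (m%:R ^+ n).
Proof.
move=> Im; elim: n => [|n IH]; first by rewrite expr0; exact: (ints_nat K 1).
by rewrite exprS; exact: mul_ideal_mul.
Qed.

Lemma big_ideal_mulP (A : set C -> set C) (ws : seq (set C)) : (forall w, w \in ws -> ideal (A w)) ->
  ideal (\big[ideal_mul/ints K]_(w <- ws) A w) /\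
  forall w, w \in ws -> \big[ideal_mul/ints K]_(w <- ws) A w `<=` A w.
Proof.
elim: ws => [|w ws IH] h; first by rewrite big_nil; split=> //; exact: ints_ideal.
have [iB sB] := IH (fun v vi => h v (mem_behead (s := w :: ws) vi)).
have [im sA sB'] := ideal_mulP (h w (mem_head _ _)) iB.
rewrite big_cons; split=> // v; rewrite inE => /orP[/eqP-> //|vi].
exact: subset_trans sB' (sB v vi).
Qed.

Lemma conductor_sub (phi : idele K -> C) f : is_conductor phi f ->
  exists e : set C -> nat, forall w, nonzero_prime K w ->
    conductor_exp phi w (e w) /\ (e w != 0%N -> f `<=` ideal_exp (ints K) w (e w)).
Proof.
move=> [ws [e [_ pr ce e0 ->]]]; exists e => w pw; split; first exact: ce.
move=> en; have wi : w \in ws by apply/negPn/negP => /(e0 w pw) e0'; rewrite e0' in en.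
have iv v : v \in ws -> ideal (ideal_exp (ints K) v (e v)).
  by move=> vi; apply: ideal_expP; have [] := pr v vi.
exact: ((big_ideal_mulP iv).2 w wi).
Qed.

(** In effect O_K/p has dimension at most 2 over the field with p elements. *)
Lemma prime_dependent p (x : 'I_3 -> C) : (forall i, ints K (x i)) ->
  exists a b c : int, [|| ~~ (val p %| a)%Z, ~~ (val p %| b)%Z | ~~ (val p %| c)%Z] /\
    a%:~R * x ord0 + b%:~R * x (lift ord0 ord0) + c%:~R * x (lift ord0 (lift ord0 ord0)) = 0.
Proof.
move=> ix; have [c [cn e]] := three_dependent iqK.1 (fun i => (ix i).1).
have [c' [[i ci] e']] := prime_content (valP p) cn e.
exists (c' ord0), (c' (lift ord0 ord0)), (c' (lift ord0 (lift ord0 ord0))); split.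
  move: ci; case: (unliftP ord0 i) => [j ->|->]; last by rewrite dvdzE => ->.
  case: (unliftP ord0 j) => [k ->|->]; last by rewrite !dvdzE => ->; rewrite orbT.
  by rewrite (ord1 k) !dvdzE => ->; rewrite !orbT.
by rewrite -[RHS]e' !big_ord_recl big_ord0 addr0 addrA.
Qed.

Lemma inverse_mod p (c : int) : ~~ (val p %| c)%Z -> exists d k : int, d * c = 1 + (val p)%:Z * k.
Proof.
move=> pc; have /coprimezP [[u v] /= e] : coprimez (val p) c.
  by rewrite coprimezE prime_coprime //; exact: valP p.
by exists v, (- u); rewrite -e; ring.
Qed.

Section OverP.
Variable p : rprime.

Lemma ideal_int w (z : int) : ideal w -> w (val p)%:R -> ~ w 1 -> (w z%:~R <-> (val p %| z)%Z).
Proof.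
move=> iw wp w1; have [_ w0 wB wM] := iw; have gw := ideal_sub iw.
split=> [wz|/dvdzP [k ->]]; last by rewrite rmorphM /=; apply: subgroup_int.
apply/negPn/negP => /inverse_mod [d [k e]]; apply: w1.
have -> : 1 = d%:~R * z%:~R - k%:~R * (val p)%:R :> C.
  have -> : d%:~R * z%:~R = (1 + (val p)%:Z * k)%:~R :> C by rewrite -e rmorphM.
  by rewrite rmorphD rmorphM /=; ring.
by apply: gw.2; exact: subgroup_int.
Qed.

Definition pints : set C := [set x | exists2 y, ints K y & x = (val p)%:R * y].

Lemma pints_ideal : ideal pints.
Proof.
split.
- by move=> _ [y Iy ->]; apply: intsM => //; exact: ints_nat.
- by exists 0; [exact: ints0 | rewrite mulr0].
- move=> _ _ [x Ix ->] [y Iy ->]; exists (x - y); last by rewrite mulrBr.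
  by apply: intsD => //; exact: intsN.
- by move=> a _ Ia [y Iy ->]; exists (a * y); [exact: intsM | rewrite mulrCA].
Qed.

Lemma pints_p : pints (val p)%:R.
Proof. by exists 1; [exact: (ints_nat K 1) | rewrite mulr1]. Qed.

Lemma pints1 : ~ pints 1.
Proof.
move=> [y [_ iy] e]; have pp := valP p.
have pn : (val p)%:R != 0 :> C by rewrite pnatr_eq0 -lt0n prime_gt0.
have : integralOver (intr : int -> C) (1%:R / (val p)%:R) 
  by have -> : 1%:R / (val p)%:R = y by rewrite mulr1n [X in X / _]e mulrC mulKf.
by move=> /(integral_frac pp); rewrite dvdn1 => /eqP e1; move: pp; rewrite e1.
Qed.

Lemma pints_sub w : ideal w -> w (val p)%:R -> pints `<=` w.
Proof. by move=> [_ _ _ wM] wp _ [y Iy ->]; rewrite mulrC; exact: wM. Qed.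

(* An ideal strictly between pO and O has residue ring Z/p. *)
Lemma strict_over w y : ideal w -> w (val p)%:R -> ~ w 1 -> w y -> ~ pints y ->
  forall z, ints K z -> exists c d : int, [/\ ~~ (val p %| c)%Z & w (c%:~R * z - d%:~R)] /\
    exists b : int, c%:~R * z - d%:~R = b%:~R * y.
Proof.
move=> iw wp w1 wy py z Iz; have [wO w0 wB wM] := iw; have gw := ideal_sub iw.
pose x (i : 'I_3) := nth 0 [:: 1; y; z] i.
have ix i : ints K (x i).
  rewrite /x; case: (i : nat) (ltn_ord i) => [|[|[|//]]] _ /=; [exact: (ints_nat K 1) | exact: wO | exact: Iz].
have [a [b [c [n e]]]] := prime_dependent p ix; rewrite /x /= mulr1 in e.
have e' : c%:~R * z - (- a)%:~R = (- b)%:~R * y.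
  by rewrite !rmorphN /= mulNr; apply/eqP; rewrite -subr_eq0 -[X in _ == X]e; apply/eqP; ring.
have [pc|pc] := boolP (val p %| c)%Z.
  exfalso; have pcz : pints (c%:~R * z).
    by have /dvdzP [k ->] := pc; exists (k%:~R * z); [apply: intsM => //; exact: ints_int | rewrite rmorphM /=; ring].
  have ab : pints (a%:~R + b%:~R * y).
    have -> : a%:~R + b%:~R * y = - (c%:~R * z) by apply/eqP; rewrite -addr_eq0 e.
    exact: (subgroupN (ideal_sub pints_ideal)).
  have wa : w a%:~R.
    have -> : a%:~R = (a%:~R + b%:~R * y) - b%:~R * y by ring.
    by apply: gw.2; [exact: (pints_sub iw wp) | exact: subgroup_int].
  have /(ideal_int a iw wp w1) pa : w a%:~R := wa.
  have pby : pints (b%:~R * y).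
    have -> : b%:~R * y = (a%:~R + b%:~R * y) - a%:~R by ring.
    apply: (ideal_sub pints_ideal).2 => //.
    by apply/(ideal_int a pints_ideal pints_p pints1).
  have [pb|pb] := boolP (val p %| b)%Z; first by move: n; rewrite pa pb pc.
  have [d [k dk]] := inverse_mod pb; apply: py.
  have -> : y = d%:~R * (b%:~R * y) - (val p)%:R * (k%:~R * y).
    have -> : d%:~R * (b%:~R * y) = (1 + (val p)%:Z * k)%:~R * y by rewrite -dk rmorphM /= mulrA.
    by rewrite rmorphD rmorphM /=; ring.
  apply: (ideal_sub pints_ideal).2.
    by apply: subgroup_int => //; exact: (ideal_sub pints_ideal).
  by exists (k%:~R * y) => //; apply: intsM; [exact: ints_int | exact: wO].
exists c, (- a); split; last by exists (- b).
by split=> //; rewrite e'; exact: subgroup_int.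
Qed.

(** By [strict_over] every x is, up to a factor prime to p, an integer d modulo w. If p divides d
    then x is in w; otherwise x is invertible modulo w, so x z in w forces z in w. *)
Lemma strict_prime w y : ideal w -> w (val p)%:R -> ~ w 1 -> w y -> ~ pints y -> nonzero_prime K w.
Proof.
move=> iw wp w1 wy py; have [wO w0 wB wM] := iw; have gw := ideal_sub iw.
split=> //.
  by exists (val p)%:R => //; rewrite pnatr_eq0 -lt0n prime_gt0 //; exact: valP p.
move=> x z Ix Iz wxz; have [c [d [[pc wc] _]]] := strict_over iw wp w1 wy py Ix.
have [pd|pd] := boolP (val p %| d)%Z.
  left; have [c' [k ck]] := inverse_mod pc.
  have -> : x = c'%:~R * (c%:~R * x - d%:~R) + c'%:~R * d%:~R - (val p)%:R * (k%:~R * x).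
    have := congr1 (fun t : int => t%:~R : C) ck; rewrite rmorphD !rmorphM /= => e.
    transitivity ((c'%:~R * c%:~R - (val p)%:R * k%:~R) * x); last by ring.
    by rewrite e; ring.
  have wd : w d%:~R by apply/(ideal_int d iw wp w1).
  apply: gw.2; last by rewrite mulrC; apply: wM => //; apply: intsM => //; exact: ints_int.
  by apply: subgroupD => //; exact: subgroup_int.
right; have [c' [k ck]] := inverse_mod pd.
have -> : z = c'%:~R * (c%:~R * (x * z)) - c'%:~R * (z * (c%:~R * x - d%:~R)) - (val p)%:R * (k%:~R * z).
  have := congr1 (fun t : int => t%:~R : C) ck; rewrite rmorphD !rmorphM /= => e.
  transitivity ((c'%:~R * d%:~R - (val p)%:R * k%:~R) * z); last by ring.
  by rewrite e; ring.
apply: gw.2; last by rewrite mulrC; apply: wM => //; apply: intsM => //; exact: ints_int.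
by apply: gw.2; apply: subgroup_int => //; [exact: subgroup_int | exact: wM].
Qed.

Definition over w := nonzero_prime K w /\ w (val p)%:R.

(** If pO is not prime, choose x y in pO with x and y outside; the quotient ideal (pO : x) contains
    p and y but not 1, so it lies strictly between pO and O and is prime. *)
Lemma prime_over_exists : exists w, over w.
Proof.
have [pr|npr] := pselect (nonzero_prime K pints).
  by exists pints; split=> //; exact: pints_p.
have : exists x y, [/\ ints K x, ints K y, pints (x * y), ~ pints x & ~ pints y].
  apply: contrapT => no; apply: npr; split; [exact: pints_ideal | | exact: pints1 |].
    by exists (val p)%:R; [exact: pints_p | rewrite pnatr_eq0 -lt0n prime_gt0 //; exact: valP p].
  move=> x y Ix Iy pxy; apply: contrapT => /not_orP [nx ny]; apply: no.
  by exists x, y; split.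
move=> [x [y [Ix Iy pxy nx ny]]]; have [_ _ _ pM] := pints_ideal.
pose w := [set z | ints K z /\ pints (z * x)].
have iw : ideal w.
  split=> [z [] //||z t [Iz pz] [It pt]|a z Ia [Iz pz]].
  - by split; [exact: ints0 | rewrite mul0r; exact: (ideal_sub pints_ideal).1].
  - split; first by apply: intsD => //; exact: intsN.
    by rewrite mulrBl; apply: (ideal_sub pints_ideal).2.
  - by split; [exact: intsM | rewrite -mulrA; exact: pM].
have wp : w (val p)%:R by split; [exact: ints_nat | exists x].
exists w; split=> //; apply: (@strict_prime w y) => //.
  by move=> [_]; rewrite mul1r.
by split; rewrite 1?mulrC.
Qed.

(** Suppose z in w is outside the prime ideal pO, with a + b z + c z^2 = 0. Reading the relation
    modulo w gives p | a; then z (b + c z) is in pO, so b + c z is, which gives p | b and then p |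
    c, against the choice of the relation. *)
Lemma inert_unique w : over w -> nonzero_prime K pints -> w = pints.
Proof.
move=> [[iw _ w1 _] wp] [_ _ _ pP]; have [wO w0 wB wM] := iw; have gw := ideal_sub iw.
apply/seteqP; split; last exact: pints_sub.
move=> z wz; apply: contrapT => pz; have Iz := wO _ wz.
pose x (i : 'I_3) := nth 0 [:: 1; z; z * z] i.
have ix i : ints K (x i).
  rewrite /x; case: (i : nat) (ltn_ord i) => [|[|[|//]]] _ /=; [exact: (ints_nat K 1) | exact: Iz | exact: intsM].
have [a [b [c [n e]]]] := prime_dependent p ix; rewrite /x /= mulr1 in e.
have pa : (val p %| a)%Z.
  apply/(ideal_int a iw wp w1); have -> : a%:~R = - (b%:~R * z) - c%:~R * (z * z).
    by apply/eqP; rewrite -subr_eq0 -[X in _ == X]e; apply/eqP; ring.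
  apply: gw.2; first apply: (subgroupN gw); apply: subgroup_int => //; exact: wM.
have ppa : pints a%:~R by apply/(ideal_int a pints_ideal pints_p pints1).
have : pints (z * (b%:~R + c%:~R * z)).
  have -> : z * (b%:~R + c%:~R * z) = - a%:~R.
    by apply/eqP; rewrite -addr_eq0 -[X in _ == X]e; apply/eqP; ring.
  exact: (subgroupN (ideal_sub pints_ideal)).
case/pP => //; first by apply: intsD; [|apply: intsM => //]; exact: ints_int.
move=> pbc; have pb : (val p %| b)%Z.
  apply/(ideal_int b iw wp w1); have -> : b%:~R = (b%:~R + c%:~R * z) - c%:~R * z by ring.
  by apply: gw.2; [exact: (pints_sub iw wp) | exact: subgroup_int].
have ppb : pints b%:~R by apply/(ideal_int b pints_ideal pints_p pints1).
have : pints (c%:~R * z).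
  have -> : c%:~R * z = (b%:~R + c%:~R * z) - b%:~R by ring.
  exact: (ideal_sub pints_ideal).2.
case/pP => //; first exact: ints_int.
by move/(ideal_int c pints_ideal pints_p pints1) => pc; move: n; rewrite pa pb pc.
Qed.

Lemma over_uniq w (q : rprime) : over w -> w (val q)%:R -> q = p.
Proof.
move=> [[iw _ w1 _] wp] wq; apply: val_inj.
have /(ideal_int (val q) iw wp w1) : w (val q)%:Z%:~R by [].
by rewrite dvdzE /= dvdn_prime2 ?(valP p) ?(valP q) // => /eqP ->.
Qed.

(* Two primes above p which meet outside pO coincide, as y in the intersection
   gives the same reduction map O -> Z/p modulo both. *)
Lemma split_meet w w' : over w -> over w' -> w <> w' -> w `&` w' `<=` pints.
Proof.
move=> [[iw _ w1 _] wp] [[iw' _ w1' _] wp'] ne y [wy wy']; apply: contrapT => py; apply: ne.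
have gw := ideal_sub iw; have gw' := ideal_sub iw'.
suff h v v' : ideal v -> v (val p)%:R -> ~ v 1 -> v y ->
    ideal v' -> v' (val p)%:R -> ~ v' 1 -> v' y -> v `<=` v'.
  by apply/seteqP; split; apply: h.
move=> iv vp v1 vy iv' vp' v1' vy' z vz; have [vO _ _ _] := iv; have [_ _ _ vM'] := iv'.
have [c [d [[pc vc] [b e]]]] := strict_over iv vp v1 vy py (vO _ vz).
have gv := ideal_sub iv; have gv' := ideal_sub iv'.
have pd : (val p %| d)%Z.
  apply/(ideal_int d iv vp v1); have -> : d%:~R = c%:~R * z - (c%:~R * z - d%:~R) by ring.
  by apply: gv.2 => //; exact: subgroup_int.
have vd' : v' d%:~R by apply/(ideal_int d iv' vp' v1').
have vcz : v' (c%:~R * z).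
  have -> : c%:~R * z = (c%:~R * z - d%:~R) + d%:~R by ring.
  by apply: subgroupD => //; rewrite e; exact: subgroup_int.
have [c' [k ck]] := inverse_mod pc.
have -> : z = c'%:~R * (c%:~R * z) - (val p)%:R * (k%:~R * z).
  have := congr1 (fun t : int => t%:~R : C) ck; rewrite rmorphD !rmorphM /= => e'.
  by rewrite mulrA e'; ring.
apply: gv'.2; first exact: subgroup_int.
by rewrite mulrC; apply: vM' => //; apply: intsM; [exact: ints_int | exact: vO].
Qed.

(** If they differed, w would be its own intersection with w', hence pO by [split_meet], and a prime
    pO is the only prime above p. *)
Lemma over_sub w w' : over w -> over w' -> w `<=` w' -> w = w'.
Proof.
move=> ow ow' ww'; apply: contrapT => ne; have mt := split_meet ow ow' ne.
have [[iw _ _ _] wp] := ow; have e : w = pints.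
  by apply/seteqP; split; [move=> x wx; apply: mt; split=> //; exact: ww' | exact: pints_sub].
by apply: ne; rewrite e; apply/esym/inert_unique => //; rewrite -e; exact: ow.1.
Qed.

(** If w is not inside w'', the product of an element of w outside w'' with any element of w' lies
    in pO, hence in w''; so w' is inside w''. *)
Lemma split_third w w' w'' : over w -> over w' -> w <> w' -> over w'' -> w'' = w \/ w'' = w'.
Proof.
move=> ow ow' ne ow''; have mt := split_meet ow ow' ne.
have [[iw _ _ _] wp] := ow; have [[iw' _ _ _] wp'] := ow'; have [[iw'' _ _ prm] wp''] := ow''.
have [wO _ _ wM] := iw; have [wO' _ _ wM'] := iw'.
have [|n] := pselect (w `<=` w''); first by move=> /(over_sub ow ow'') ->; left.
have [x [wx nx]] : exists x, w x /\ ~ w'' x.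
  by apply: contrapT => no; apply: n => x wx; apply: contrapT => nx; apply: no; exists x.
right; apply/esym/(over_sub ow' ow'') => y wy.
have : w'' (x * y).
  apply: (pints_sub iw'' wp''); apply: mt; split; last by apply: wM' => //; exact: wO.
  by rewrite mulrC; apply: wM => //; exact: wO'.
by case/prm => //; [exact: wO | exact: wO'].
Qed.

(** An element of w' outside w is, up to a factor prime to p, congruent modulo w to an integer prime
    to p, hence invertible modulo w. *)
Lemma split_idempotent w w' : over w -> over w' -> w <> w' -> exists2 a, w a & w' (1 - a).
Proof.
move=> ow ow' ne; have mt := split_meet ow ow' ne.
have [[iw _ w1 _] wp] := ow; have [[iw' _ w1' _] wp'] := ow'.
have [wO _ _ wM] := iw; have gw := ideal_sub iw; have gw' := ideal_sub iw'; have [wO' _ _ wM'] := iw'.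
have [x [wx nx]] : exists x, w' x /\ ~ w x.
  by apply: contrapT => no; apply: ne; apply/esym/(over_sub ow' ow) => x wx; apply: contrapT => nx; apply: no; exists x.
have [y [wy ny]] : exists y, w y /\ ~ pints y.
  apply: contrapT => no; have e : w = pints.
    apply/seteqP; split; last exact: pints_sub.
    by move=> y wy; apply: contrapT => ny; apply: no; exists y.
  by apply: ne; rewrite e; apply/esym/inert_unique => //; rewrite -e; exact: ow.1.
have [c [d [[pc wc] _]]] := strict_over iw wp w1 wy ny (wO' _ wx).
have pd : ~~ (val p %| d)%Z.
  apply/negP => /(ideal_int d iw wp w1) wd; apply: nx.
  have [c' [k ck]] := inverse_mod pc.
  have -> : x = c'%:~R * ((c%:~R * x - d%:~R) + d%:~R) - (val p)%:R * (k%:~R * x).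
    have := congr1 (fun t : int => t%:~R : C) ck; rewrite rmorphD !rmorphM /= => e'.
    by rewrite subrK mulrA e'; ring.
  apply: gw.2; first by apply: subgroup_int => //; exact: subgroupD.
  by rewrite mulrC; apply: wM => //; apply: intsM; [exact: ints_int | exact: wO'].
have [d' [k dk]] := inverse_mod pd.
have := congr1 (fun t : int => t%:~R : C) dk; rewrite rmorphD !rmorphM /= => e'.
exists (- (d'%:~R * (c%:~R * x - d%:~R))).
  by apply: (subgroupN gw); exact: subgroup_int.
have -> : 1 - - (d'%:~R * (c%:~R * x - d%:~R)) = d'%:~R * (c%:~R * x) - k%:~R * (val p)%:R.
  rewrite opprK mulrBr e'; ring.
by apply: gw'.2; apply: subgroup_int => //; exact: subgroup_int.
Qed.

End OverP.
End Primes.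

(** * Hecke characters on ray units *)

Section Idempotents.
Variable C : numClosedFieldType.
Variable K : numField C.
Hypothesis iqK : imag_quadratic K.
Implicit Types (p : rprime) (w : set C) (u s t : idele K).
Local Notation cauchy := Defs.cauchy.
Local Notation iinv := Defs.iinv.
Let hK := nf_subfield K.

Lemma loc_unit w p n m x : over K p w -> ~~ (val p %| m)%N -> ideal_exp (ints K) w n (m%:R * x) ->
  loc K w n x.
Proof.
move=> [[iw _ w1 _] wp] pm h; have [EO _ _ _] := ideal_expP n iw.
have m0 : m%:R != 0 :> C by rewrite pnatr_eq0 -lt0n (ndvd_gt0 pm).
split.
  rewrite -[x](mulKf m0); apply: (subfieldM hK _ (EO _ h).1).
  by apply: (subfieldV hK); exact: (subfield_nat hK).
exists m%:R; split=> //; first exact: ints_nat.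
by move/(ideal_int (Posz m) iw wp w1); rewrite dvdzE /=; exact/negP.
Qed.

Lemma locW w p n x : over K p w -> ideal_exp (ints K) w n x -> loc K w n x.
Proof.
move=> ow wx; apply: (@loc_unit w p n 1%N) => //; last by rewrite mul1r.
by rewrite dvdn1 neq_ltn prime_gt1 ?orbT //; exact: valP p.
Qed.

Lemma loc_open w p n : over K p w -> open_subgroup K (Fin p) (loc K w n).
Proof.
move=> ow; have [pw wp] := ow; have [iw _ w1 prm] := pw.
have [EO E0 EB EM] := ideal_expP n iw; split.
- exact: (locW ow).
- move=> x y [Kx [b [Ib wb hb]]] [Ky [c [Ic wc hc]]]; split; first exact: (subfieldB hK).
  exists (b * c); split; first exact: intsM.
    by case/prm.
  have -> : b * c * (x - y) = c * (b * x) - b * (c * y) by ring.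
  by apply: EB; exact: EM.
- exists n => x [Kx [m [pm [y Iy e]]]]; apply: (loc_unit ow pm); rewrite e mulrC.
  by apply: EM => //; exact: ideal_exp_nat.
Qed.

Lemma loc_mul w p n x y : over K p w -> loc K w n x -> locp (val p) (ints K) y -> loc K w n (x * y).
Proof.
move=> ow; have [pw wp] := ow; have [iw _ w1 prm] := pw.
have [EO E0 EB EM] := ideal_expP n iw.
move=> [Kx [b [Ib wb hb]]] [m [pm Iy]]; have m0 : m%:R != 0 :> C by rewrite pnatr_eq0 -lt0n (ndvd_gt0 pm).
split.
  apply: (subfieldM hK Kx); rewrite -[y](mulKf m0); apply: (subfieldM hK _ Iy.1).
  by apply: (subfieldV hK); exact: (subfield_nat hK).
have wm : ~ w m%:R by move/(ideal_int (Posz m) iw wp w1); rewrite dvdzE /=; exact/negP.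
exists (b * m%:R); split; first by apply: intsM => //; exact: ints_nat.
  by case/prm => //; exact: ints_nat.
have -> : b * m%:R * (x * y) = (m%:R * y) * (b * x) by ring.
exact: EM.
Qed.

(** [e] is integral at p and its components at the primes above p other than w are zero: they lie in
    all powers of the maximal ideal. *)
Definition idempotent_at p w (e : completion K (Fin p)) : Prop :=
  [/\ e * e = e, eventually_in (locp (val p) (ints K)) e &
      forall w', over K p w' -> w' <> w -> forall n, eventually_in (loc K w' n) e].

(** If two primes lie above p, start from a in one with 1 - a in the other and iterate x -> x^2 (3 -
    2x), the lifting step for x^2 = x. Both x and 1 - x are squared up to an integral factor, so e n
    and 1 - e n go into growing powers of the two primes. With one prime above p the idempotents are
    1 and 0. *)
Lemma split_idempotents p : exists w w' (e : completion K (Fin p)),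
  [/\ over K p w, over K p w', idempotent_at w e & idempotent_at w' (1 - e)].
Proof.
have [w ow] := prime_over_exists iqK p; have oI := ints_open K p.
have [uni|] := pselect (forall w', over K p w' -> w' = w).
  have o1 : eventually_in (locp (val p) (ints K)) (1 : completion K (Fin p)).
    rewrite -emb1; apply/(eventually_emb oI (subfield1 hK)); apply: locpW; exact: (ints_nat K 1).
  exists w, w, 1; split=> //; split=> //; try (by move=> w' /uni ->); first by rewrite mulr1.
    by rewrite subrr mulr0.
  by rewrite subrr; exact: eventually0.
move=> nuni; have [w' [ow' ne]] : exists w', over K p w' /\ w' <> w.
  by apply: contrapT => no; apply: nuni => w' ow'; apply: contrapT => ne; apply: no; exists w'.
have [a wa wa'] := split_idempotent iqK ow' ow ne.
have [[iw _ w1 _] wp] := ow; have [[iw' _ w1' _] wp'] := ow'.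
have [wO _ _ wM] := iw; have [wO' _ _ wM'] := iw'.
pose e n := iter n (fun x => x * (x * (3%:R - 2%:R * x))) a.
have i3 x : ints K x -> ints K (3%:R - 2%:R * x).
  by move=> Ix; apply: intsD; [exact: ints_nat | apply: intsN; apply: intsM => //; exact: ints_nat].
have Ie n : ints K (e n).
  elim: n => [|n IH]; first exact: wO'.
  by rewrite /e iterS -/(e n); apply: intsM => //; apply: intsM => //; exact: i3.
have eS n : 1 - e n.+1 = (1 - e n) * ((1 + 2%:R * e n) * (1 - e n)).
  by rewrite /e iterS -/(e n); ring.
have we n : w' (e n) /\ w (1 - e n).
  elim: n => [|n [h1 h2]] //; split.
    by rewrite /e iterS -/(e n) mulrC; apply: wM' => //; apply: intsM => //; exact: i3.
  rewrite eS; apply: (wM); last apply: (wM) => //; first by apply: intsD; [exact: (ints_nat K 1) | exact: intsN].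
  by apply: intsD; [exact: (ints_nat K 1) | apply: intsM => //; exact: ints_nat].
have we' n : ideal_exp (ints K) w' n.+1 (e n).
  elim: n => [|n IH].
    by rewrite -[e 0%N]mulr1; apply: mul_ideal_mul; [exact: (we 0%N).1 | exact: (ints_nat K 1)].
  rewrite /e iterS -/(e n); apply: mul_ideal_mul; first exact: (we n).1.
  have [_ _ _ EM] := ideal_expP n.+1 iw'; rewrite mulrC.
  by apply: EM => //; exact: i3.
have we1 n : ideal_exp (ints K) w n.+1 (1 - e n).
  elim: n => [|n IH].
    by rewrite -[1 - _]mulr1; apply: mul_ideal_mul; [exact: (we 0%N).2 | exact: (ints_nat K 1)].
  rewrite eS; apply: mul_ideal_mul; first exact: (we n).2.
  have [_ _ _ EM] := ideal_expP n.+1 iw.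
  by apply: EM => //; apply: intsD; [exact: (ints_nat K 1) | apply: intsM => //; exact: ints_nat].
have ee n : exists2 y, ints K y & e n * e n - e n = (val p)%:R ^+ n.+1 * y.
  elim: n => [|n [y Iy IH]].
    have : pints K p (a * (1 - a)).
      apply: (split_meet iqK ow' ow ne); split.
        by rewrite mulrC; apply: wM' => //; exact: wO.
      by apply: wM => //; exact: wO'.
    move=> [y Iy E]; exists (- y); first exact: intsN.
    by rewrite expr1 /e /= mulrN -E; ring.
  exists (- ((val p)%:R ^+ n * (y * y * (3%:R - 2%:R * e n) * (1 + 2%:R * e n)))).
    apply: intsN; apply: intsM; first by rewrite -natrX; exact: ints_nat.
    apply: intsM; last by apply: intsD; [exact: (ints_nat K 1) | apply: intsM => //; exact: ints_nat].
    by apply: intsM; [exact: intsM | exact: i3].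
  (* For y = x^2 (3 - 2x) one has y^2 - y = -(x^2 - x)^2 (3 - 2x)(1 + 2x). *)
  transitivity (- ((e n * e n - e n) * (e n * e n - e n) * ((3%:R - 2%:R * e n) * (1 + 2%:R * e n)))).
    by rewrite /e iterS -/(e n); ring.
  rewrite IH !exprS; ring.
have step n : exists2 y, ints K y & e n.+1 - e n = (val p)%:R ^+ n.+1 * y.
  have [y Iy E] := ee n; exists (y * (1 - 2%:R * e n)).
    apply: intsM => //; apply: intsD; first exact: (ints_nat K 1).
    by apply: intsN; apply: intsM => //; exact: ints_nat.
  by rewrite mulrA -E /e iterS -/(e n); ring.
have diff k n d : (k <= n)%N -> exists2 y, ints K y & e (n + d)%N - e n = (val p)%:R ^+ k * y.
  move=> kn; elim: d => [|d [y Iy E]]; first by exists 0; [exact: ints0 | rewrite addn0 subrr mulr0].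
  have [z Iz E'] := step (n + d)%N.
  exists ((val p)%:R ^+ ((n + d).+1 - k) * z + y).
    by apply: intsD => //; apply: intsM => //; rewrite -natrX; exact: ints_nat.
  rewrite addnS -[LHS](subrKA (e (n + d)%N)) E E' mulrDr mulrA -exprD subnKC //.
  by apply: leq_trans (leqnSn _); apply: leq_trans kn (leq_addr _ _).
have pn1 : ~~ (val p %| 1)%N by rewrite dvdn1 neq_ltn prime_gt1 ?orbT //; exact: valP p.
have nbe k n m : (k <= n)%N -> (n <= m)%N -> nb K (Fin p) k (e m - e n).
  move=> kn nm; have [y Iy E] := diff k n (m - n)%N kn; rewrite subnKC // in E.
  split; first exact: (subfieldB hK (Ie m).1 (Ie n).1).
  by exists 1%N; split=> //; exists y => //; rewrite mul1r.
have ce : cauchy K (Fin p) e.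
  split=> [n|k]; first exact: (Ie n).1.
  exists k => m n km kn; have [mn|/ltnW nm] := leqP m n; last exact: nbe.
  by rewrite -opprB; apply: nbN; exact: nbe.
have c1 : cauchy K (Fin p) 1 by apply: cauchy_cst; exact: (subfield1 hK).
pose E := class_of K (Fin p) e.
have EE : E * E = E.
  rewrite /E -class_ofM //; apply: class_of_eq => //; first exact: cauchyM.
  move=> k; exists k => n kn; have [y Iy Ey] := ee n.
  split; first by apply: (subfieldB hK _ (Ie n).1); exact: (intsM (Ie n) (Ie n)).1.
  exists 1%N; split=> //; exists ((val p)%:R ^+ (n.+1 - k) * y).
    by apply: intsM => //; rewrite -natrX; exact: ints_nat.
  by rewrite mul1r Ey mulrA -exprD subnKC // leqW.
have E1 : 1 - E = class_of K (Fin p) (1 - e) by rewrite class_ofB // class_of1.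
have c1e : cauchy K (Fin p) (1 - e) by exact: cauchyB.
exists w, w', E; split=> //; split=> //.
- by apply/(eventually_class oI ce); exists 0%N => n _; exact: locpW.
- move=> w'' ow'' nw n; have [//|->] := split_third iqK ow ow' (nesym ne) ow''.
  apply/(eventually_class (loc_open n ow') ce); exists n => m nm; apply: (locW ow').
  exact: (ideal_exp_mono iw' (leqW nm) (we' m)).
- by rewrite mulrBl mul1r mulrBr mulr1 EE subrr subr0.
- rewrite E1; apply/(eventually_class oI c1e); exists 0%N => n _; apply: locpW.
  by apply: intsD; [exact: (ints_nat K 1) | exact: intsN].
- move=> w'' ow'' nw n; have [->|//] := split_third iqK ow ow' (nesym ne) ow''.
  rewrite E1; apply/(eventually_class (loc_open n ow) c1e); exists n => m nm; apply: (locW ow).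
  exact: (ideal_exp_mono iw (leqW nm) (we1 m)).
Qed.

Lemma idele_ext s t : (forall v, s v = t v) -> s = t.
Proof.
case: s t => [a a' aK fa fa'] [b b' bK fb fb'] /= h.
have ab : a = b by apply: functional_extensionality_dep.
subst b; have ab' : a' = b'.
  apply: functional_extensionality_dep => v.
  by rewrite -[LHS]mul1r -(bK v) mulrAC aK mul1r.
subst b'; congr Idele; exact: Prop_irrelevance.
Qed.

(** As e is idempotent, 1 + e (u - 1) is u on the part e K_v and 1 on the complement, and the same
    formula with the inverse of u gives its inverse. *)
Lemma idele_twist (e : forall v, completion K v) u : (forall v, e v * e v = e v) ->
  (forall q, eventually_in (locp (val q) (ints K)) (e (Fin q))) ->
  exists t, forall v, t v = 1 + e v * (u v - 1) /\ iinv t v = 1 + e v * (iinv u v - 1).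
Proof.
move=> ee ie.
have cl q (x : completion K (Fin q)) : clos K (Fin q) (ints K) x ->
    clos K (Fin q) (ints K) (1 + e (Fin q) * (x - 1)).
  move=> /clos_intsE ix; apply/clos_intsE; have oI := ints_open K q.
  have o1 : eventually_in (locp (val q) (ints K)) (1 : completion K (Fin q)).
    by rewrite -emb1; apply/(eventually_emb oI (subfield1 hK)); apply: locpW; exact: (ints_nat K 1).
  apply: (eventuallyD oI o1); apply: (eventuallyM oI (ie q) (eventuallyB oI ix o1)).
  move=> a b [m [pm Ia]] [n [pn Ib]]; exists (m * n)%N; split; first exact: ndvdM.
  by rewrite natrM mulrACA; exact: intsM.
have tK v : (1 + e v * (u v - 1)) * (1 + e v * (iinv u v - 1)) = 1.
  transitivity (1 + e v * ((u v - 1) + (iinv u v - 1)) + (e v * e v) * (u v * iinv u v - u v - iinv u v + 1)).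
    by ring.
  by rewrite ee icompK; ring.
have f1 : finite_set [set p | ~ clos K (Fin p) (ints K) (1 + e (Fin p) * (u (Fin p) - 1))].
  by apply: sub_finite_set (icomp_int u) => q; apply: contra_not; exact: cl.
have f2 : finite_set [set p | ~ clos K (Fin p) (ints K) (1 + e (Fin p) * (iinv u (Fin p) - 1))].
  by apply: sub_finite_set (iinv_int u) => q; apply: contra_not; exact: cl.
by exists (Idele tK f1 f2).
Qed.

Lemma ideleME s t v : ideleM s t v = s v * t v. Proof. by []. Qed.
Lemma ideleVE s v : ideleV s v = iinv s v. Proof. by []. Qed.

(* [idele1] itself is defined by an opaque term, so that its components are out of reach. *)
Definition idele_one : idele K := ideleM (idele1 K) (ideleV (idele1 K)).

Lemma idele_oneE v : idele_one v = 1. Proof. exact: icompK. Qed.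

Section Conductor.
Variables (phi : idele K -> C) (hphi : is_hecke_char phi).

Lemma hecke1 : phi (idele_one) = 1.
Proof.
have e : ideleM (idele_one) (idele_one) = idele_one by apply: idele_ext => v; rewrite ideleME !idele_oneE mulr1.
have := hecke_mul hphi (idele_one) (idele_one); rewrite e => h.
by apply: (mulfI (hecke_neq0 hphi (idele_one))); rewrite -h mulr1.
Qed.

Variables (O f I : set C).
Hypotheses (oO : is_order K O) (iI : is_ideal O I) (nI : exists2 x, I x & x != 0).
Hypotheses (cf : is_conductor phi f) (If : I `<=` f).

Lemma ray_unitsP u : ray_units O I u <-> forall p,
  [/\ eventually_in (locp (val p) O) (u (Fin p)), eventually_in (locp (val p) O) (iinv u (Fin p)) &
      eventually_in (locp (val p) I) (u (Fin p) - 1)].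
Proof.
have [lO _ _] := oO.
by split=> h p; have [h1 h2 h3] := h p; split; [apply/tensorE| apply/tensorE | apply/(ideal_spanE iqK oO)
  | apply/tensorE| apply/tensorE | apply/(ideal_spanE iqK oO)].
Qed.

Let fin_idem (e : forall p, completion K (Fin p)) (P : pred rprime) (v : place) : completion K v :=
  match v with Infty => 0 | Fin q => if P q then e q else 0 end.

(** The twist is 1 away from w. At w it is a unit, which settles exponent 0; for a positive
    exponent, u - 1 lies in I locally, hence in the required power of w because I is inside the
    conductor. *)
Lemma local_units_twist u p w (e : completion K (Fin p)) t : ray_units O I u -> over K p w ->
  idempotent_at w e ->
  t Infty = 1 -> (forall q, q != p -> t (Fin q) = 1) -> t (Fin p) = 1 + e * (u (Fin p) - 1) ->
  iinv t (Fin p) = 1 + e * (iinv u (Fin p) - 1) -> phi t = 1.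
Proof.
move=> /ray_unitsP hu ow [ee ie he] ti tq tp tpv; have [c hc] := conductor_sub cf.
have [pw wp] := ow; apply: (hc w pw).1.1.
have [iw _ w1 _] := pw; have oI := ints_open K p; have [uO uO' uI] := hu p.
have o1 : eventually_in (locp (val p) (ints K)) (1 : completion K (Fin p)).
  by rewrite -emb1; apply/(eventually_emb oI (subfield1 hK)); apply: locpW; exact: (ints_nat K 1).
have Oi : locp (val p) O `<=` locp (val p) (ints K).
  by move=> x [m [pm Om]]; exists m; split=> //; exact: (order_integral oO).
have ui := eventuallyB oI (eventuallyW Oi uO) o1.
have ui' := eventuallyB oI (eventuallyW Oi uO') o1.
split.
  split=> // w' q pw' wq ne n; have ow' : over K q w' by [].
  apply/(clos_open (loc_open n ow')).
  have [E|nq] := eqVneq q p; last by rewrite tq // subrr; exact: (eventually0 (loc_open n ow')).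
  subst q; rewrite tp addrAC subrr add0r.
  apply: (eventuallyM (loc_open n ow') (he w' ow' ne n) ui) => x y; exact: (loc_mul ow').
move=> q wq; have E := over_uniq ow wq; subst q.
have iM x y : locp (val p) (ints K) x -> locp (val p) (ints K) y -> locp (val p) (ints K) (x * y).
  move=> [m [pm Ix]] [n [pn Iy]]; exists (m * n)%N; split; first exact: ndvdM.
  by rewrite natrM mulrACA; exact: intsM.
have l0 : locp (val p) (ints K) `<=` loc K w 0.
  by move=> x [m [pm Ix]]; exact: (loc_unit ow pm).
case: eqP => [cw|/eqP cw].
  split; apply/(clos_open (loc_open 0 ow)); apply: (eventuallyW l0).
    by rewrite tp; apply: (eventuallyD oI o1); exact: (eventuallyM oI ie ui iM).
  by rewrite tpv; apply: (eventuallyD oI o1); exact: (eventuallyM oI ie ui' iM).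
apply/(clos_open (loc_open _ ow)); rewrite tp addrAC subrr add0r mulrC.
have uw : eventually_in (loc K w (c w)) (u (Fin p) - 1).
  apply: eventuallyW uI => x [m [pm Im]]; apply: (loc_unit ow pm).
  by apply: ((hc w pw).2 cw); exact: If.
by apply: (eventuallyM (loc_open _ ow) uw ie) => x y; exact: (loc_mul ow).
Qed.

(* Triviality on local units treats any finite set of primes, and
   continuity does the rest. *)
Lemma hecke_ray_units u : ray_units O I u -> u Infty = 1 -> phi u = 1.
Proof.
move=> ru ui; have hu := (ray_unitsP u).1 ru.
have mk (e : forall p, completion K (Fin p)) (P : pred rprime) :
    (forall p, e p * e p = e p) -> (forall p, eventually_in (locp (val p) (ints K)) (e p)) ->
    exists t : idele K, forall v, t v = 1 + fin_idem e P v * (u v - 1) /\ iinv t v = 1 + fin_idem e P v * (iinv u v - 1).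
  move=> ee ie; apply: idele_twist => [[|q]|q] /=.
  - by rewrite mulr0.
  - by case: (P q); rewrite ?mulr0 ?ee.
  - by case: ifP => _ //; exact: (eventually0 (ints_open K q)).
have o1 p : eventually_in (locp (val p) (ints K)) (1 : completion K (Fin p)).
  by rewrite -emb1; apply/(eventually_emb (ints_open K p) (subfield1 hK)); apply: locpW; exact: (ints_nat K 1).
pose c1 p := cid (split_idempotents p); pose c2 p := cid (projT2 (c1 p)).
pose c3 p := cid (projT2 (c2 p)); pose e p := projT1 (c3 p).
have he p : exists w w', [/\ over K p w, over K p w', idempotent_at w (e p) & idempotent_at w' (1 - e p)].
  by exists (projT1 (c1 p)), (projT1 (c2 p)); exact: (projT2 (c3 p)).
have ee p : e p * e p = e p by have [w [w' [_ _ [] + _ _ _]]] := he p.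
have ie p : eventually_in (locp (val p) (ints K)) (e p) by have [w [w' [_ _ [_ + _] _]]] := he p.
have ee' p : (1 - e p) * (1 - e p) = 1 - e p by rewrite mulrBl mul1r mulrBr mulr1 ee subrr subr0.
have ie' p : eventually_in (locp (val p) (ints K)) (1 - e p) by exact: (eventuallyB (ints_open K p)).
(* The twists by e p and by 1 - e p are each concentrated at one prime of K; their product is u at p
   and 1 elsewhere. *)
have single p : exists t : idele K, phi t = 1 /\ forall v, t v = 1 + fin_idem (fun=> 1) (pred1 p) v * (u v - 1).
  have [w [w' [ow ow' iw iw']]] := he p.
  have [t1 h1] := mk e (pred1 p) ee ie; have [t2 h2] := mk (fun p => 1 - e p) (pred1 p) ee' ie'.
  have p1 : phi t1 = 1.
    apply: (local_units_twist ru ow iw) => [|q qp||]; rewrite ?(h1 _).1 ?(h1 _).2 /= ?mul0r ?addr0 //.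
    - by rewrite (negPf qp) mul0r addr0.
    - by rewrite eqxx.
    - by rewrite eqxx.
  have p2 : phi t2 = 1.
    apply: (local_units_twist ru ow' iw') => [|q qp||]; rewrite ?(h2 _).1 ?(h2 _).2 /= ?mul0r ?addr0 //.
    - by rewrite (negPf qp) mul0r addr0.
    - by rewrite eqxx.
    - by rewrite eqxx.
  exists (ideleM t1 t2); split; first by rewrite (hecke_mul hphi) p1 p2 mulr1.
  case=> [|q] /=; rewrite (h1 _).1 (h2 _).1 /= ?mul0r ?addr0 ?mulr1 //.
  case: (q == p); last by rewrite !mul0r !addr0 mulr1.
  set x := u _ - 1; transitivity (1 + 1 * x + (e q - e q * e q) * (x * x)); first by ring.
  by rewrite ee subrr mul0r addr0.
have multi (s : seq rprime) : exists t : idele K, phi t = 1 /\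
    forall v, t v = 1 + fin_idem (fun=> 1) (fun q => q \in s) v * (u v - 1).
  elim: s => [|p s [t [pt ht]]].
    by exists (idele_one); split; [exact: hecke1 | by case=> [|q]; rewrite idele_oneE /= ?in_nil mul0r addr0].
  have [ps|ps] := boolP (p \in s).
    exists t; split=> // -[|q]; rewrite ht //= inE.
    by case: eqP => [->|]; rewrite ?ps.
  have [t' [pt' ht']] := single p.
  exists (ideleM t' t); split; first by rewrite (hecke_mul hphi) pt pt' mulr1.
  case=> [|q] /=; rewrite ht ht' /= ?mul0r ?addr0 ?mulr1 // inE.
  by have [->|_] := eqVneq q p; rewrite ?(negPf ps) /= ?mul0r ?addr0 ?mulr1 ?mul1r.
apply/eqP; rewrite -subr_eq0 -normr_le0; apply/negPn/negP => n0.
have e0 : 0 < `|1 - phi u|.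
  rewrite normr_gt0; apply: contra n0; rewrite subr_eq0 => /eqP <-.
  by rewrite subrr normr0.
have := @hecke_continuous _ _ _ hphi (idele_one) _ (nbhsx_ballx (phi (idele_one)) `|1 - phi u| e0).
rewrite hecke1 => -[N N0 hN].
(* Only the primes dividing N matter for [idele_ball N]: at the others N is a unit and every
   integral unit satisfies the congruence. *)
have [s ms] : exists s : seq rprime, forall q, (q \in s) = (val q %| N)%N.
  exists [seq q <- pmap insub (iota 0 N.+1) | (val q %| N)%N] => q.
  rewrite mem_filter mem_pmap_sub mem_iota add0n ltnS; case: (boolP (val q %| N)%N) => //= qN.
  exact: dvdn_leq.
have [t [pt ht]] := multi s.
have : ball (1 : C) `|1 - phi u| (phi (ideleM u (ideleV t))).
  apply: hN => /=.
  have -> : ideleM (ideleM u (ideleV t)) (ideleV (idele_one)) = ideleM u (ideleV t).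
    apply: idele_ext => v; have e1 : iinv idele_one v = 1.
      by rewrite -[LHS]mul1r -{1}(idele_oneE v) icompK.
    by rewrite ideleME [X in _ * X]ideleVE e1 mulr1.
  have tv v : t v * iinv t v = 1 := icompK t v.
  split.
    have -> : ideleM u (ideleV t) Infty = 1.
      have t1 : t Infty = 1 by rewrite ht /= mul0r addr0.
      by rewrite /= ui mul1r -[iinv _ _]mul1r -t1 tv.
    rewrite subrr; exists (fun=> 0); split; [|by move=> _; exact: (nb0 K Infty)|by rewrite -emb0].
    by apply: cauchy_cst; exact: (subfield0 hK).
  move=> p; have ci (x : completion K (Fin p)) : eventually_in (locp (val p) (ints K)) x -> clos K (Fin p) (ints K) x.
    by move=> ix; apply/clos_intsE.
  have Oi : locp (val p) O `<=` locp (val p) (ints K).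
    by move=> x [m [pm Om]]; exists m; split=> //; exact: (order_integral oO).
  have [uO uO' _] := hu p.
  have [pN|pN] := boolP (val p %| N)%N.
    have tu : t (Fin p) = u (Fin p).
      by rewrite ht /= ms pN mul1r addrC subrK.
    have tu' : u (Fin p) * iinv t (Fin p) = 1 by rewrite -tu.
    have tu'' : iinv u (Fin p) * t (Fin p) = 1 by rewrite tu mulrC icompK.
    rewrite /= tu' tu'' subrr; split; try exact: clos_ints1.
    exists 0; last by rewrite mulr0.
    by apply: ci; exact: (eventually0 (ints_open K p)).
  have t1 : t (Fin p) = 1 by rewrite ht /= ms (negPf pN) mul0r addr0.
  have t1' : iinv t (Fin p) = 1 by rewrite -[iinv _ _]mul1r -{1}t1 tv.
  rewrite /= t1 t1' !mulr1; split; [by apply/ci/(eventuallyW Oi)|by apply/ci/(eventuallyW Oi)|].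
  have Nn : N%:R != 0 :> C by rewrite pnatr_eq0 -lt0n.
  have KN : nf_set K N%:R by exact: (subfield_nat hK).
  have KNV := subfieldV hK KN.
  exists (emb K (Fin p) N%:R^-1 * (u (Fin p) - 1)); last by rewrite mulrA -embM // divff // emb1 mul1r.
  apply: ci; have oI := ints_open K p.
  apply/(eventually_embM oI _ KNV); have [M hM] := eventuallyB oI (eventuallyW Oi uO) (o1 p).
  exists M => n Mn; have [m [pm Im]] := hM n Mn; exists (N * m)%N; split; first exact: ndvdM.
  by rewrite natrM [N%:R * _]mulrC -mulrA mulVKf.
rewrite (hecke_mul hphi) /ball /=.
have -> : phi (ideleV t) = 1.
  have e1 : ideleM t (ideleV t) = idele_one by apply: idele_ext => v; rewrite [LHS]/= icompK idele_oneE.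
  by have := hecke_mul hphi t (ideleV t); rewrite e1 hecke1 pt mul1r.
by rewrite mulr1 ltxx.
Qed.

End Conductor.
End Idempotents.

(** * The archimedean place *)

Section Roots.
Variable C : numClosedFieldType.

Lemma bernoulli (x : C) n : 0 <= x -> 1 + n%:R * x <= (1 + x) ^+ n.
Proof.
move=> x0; elim: n => [|n IH]; first by rewrite mul0r addr0 expr0.
have x1 : 0 <= 1 + x by rewrite addr_ge0.
apply: le_trans (_ : (1 + x) * (1 + n%:R * x) <= _); last by rewrite exprS ler_wpM2l.
rewrite -subr_ge0 (_ : _ - _ = n%:R * (x * x)); last by rewrite -natr1; ring.
by rewrite mulr_ge0 ?mulr_ge0.
Qed.

(* w + w^* is twice the real part of w. *)
Lemma principal_sqrt (x : C) : exists w, [/\ w ^+ 2 = x, `|w| ^+ 2 = `|x| & 0 <= w + w^*].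
Proof.
have rT (y : C) : y + y^* \is Num.real by apply/CrealP; rewrite rmorphD /= conjCK addrC.
have e : sqrtC x ^+ 2 = x by rewrite sqrtCK.
have [h|h] := real_leP (@real0 C) (rT (sqrtC x)).
  by exists (sqrtC x); split; rewrite // -normrX e.
exists (- sqrtC x); split; first by rewrite sqrrN.
  by rewrite -normrX sqrrN e.
by rewrite rmorphN -opprD oppr_ge0 ltW.
Qed.

(** Factor |x - 1| = |w - 1| |w + 1|. With w' and x' the conjugates, (w + w')^2 = (x + x') + 2 |w|^2
    shows that w + w' is at least m, so |w + 1| is at least 1 + m/2. *)
Lemma sqrt_contraction (m x w : C) : 0 < m -> m <= 1 -> m <= `|x| -> 0 <= x + x^* ->
  w ^+ 2 = x -> `|w| ^+ 2 = `|x| -> 0 <= w + w^* ->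
  m <= `|w| /\ `|w - 1| * (1 + m / 2%:R) <= `|x - 1|.
Proof.
move=> m0 m1 mx x0 wx nw w0; have mr : m \is Num.real by exact: gtr0_real.
have mw : m <= `|w|.
  have [//|wm] := real_leP mr (normr_real w).
  suff : m < m by rewrite ltxx.
  apply: le_lt_trans mx _; rewrite -nw expr2; apply: le_lt_trans (wm).
  by apply: ler_piMr => //; apply: ltW; apply: lt_le_trans wm m1.
split=> //; have T2 : m ^+ 2 <= (w + w^*) ^+ 2.
  have -> : (w + w^*) ^+ 2 = (x + x^*) + `|w| ^+ 2 + `|w| ^+ 2.
    by rewrite normCK -wx rmorphXn /=; ring.
  apply: le_trans (_ : `|w| ^+ 2 <= _); first by rewrite lerXn2r ?nnegrE // ltW.
  by rewrite lerDr addr_ge0 // exprn_ge0.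
have mT : m <= w + w^* by move: T2; rewrite ler_pXn2r ?nnegrE // ltW.
have n2 : 0 < 2%:R :> C by rewrite ltr0n.
have h : 2%:R + m <= 2%:R * `|w + 1|.
  apply: le_trans (_ : `|(w + 1) + (w + 1)^*| <= _).
    have -> : (w + 1) + (w + 1)^* = 2%:R + (w + w^*) by rewrite rmorphD rmorph1; ring.
    by rewrite ger0_norm ?lerD2l // addr_ge0.
  apply: le_trans (ler_normD _ _) _; rewrite norm_conjC.
  by rewrite mulrDl mul1r.
have -> : `|x - 1| = `|w - 1| * `|w + 1|.
  by rewrite -normrM -wx; congr (`| _ |); ring.
apply: ler_wpM2l => //; rewrite -(ler_pM2l n2); apply: le_trans h.
by rewrite mulrDr mulr1 mulrC divfK // lt0r_neq0.
Qed.

(** Repeated square roots with nonnegative real part approach 1 geometrically: each step divides the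
    distance by at least 1 + m/2, where m = min(|z|, 1) stays a lower bound of the absolute
    values. *)
Lemma near_one_root (z e : C) : (forall x : C, exists n, `|x| <= n%:R) -> z != 0 -> 0 < e ->
  exists n w, [/\ (0 < n)%N, w ^+ n = z & `|w - 1| < e].
Proof.
move=> archi z0 e0; have nz : 0 < `|z| by rewrite normr_gt0.
have [m [m0 m1 mz]] : exists m : C, [/\ 0 < m, m <= 1 & m <= `|z|].
  have [h|h] := real_leP (normr_real z) (@real1 C); first by exists `|z|.
  by exists 1; split=> //; exact: ltW.
(* The contraction asks for a nonnegative real part, which z may not have; the first root is taken
   before the iteration, hence the exponent 2^(k+1). *)
have [y0 [yz ny y0p]] := principal_sqrt z.
have my0 : m <= `|y0|.
  have [//|wm] := real_leP (gtr0_real m0) (normr_real y0).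
  suff : m < m by rewrite ltxx.
  apply: le_lt_trans mz _; rewrite -ny expr2; apply: le_lt_trans (wm).
  by apply: ler_piMr => //; apply: ltW; apply: lt_le_trans wm m1.
have n2 : 0 < 2%:R :> C by rewrite ltr0n.
have q0 : 0 < m / 2%:R by rewrite divr_gt0.
have seq k : exists w, [/\ w ^+ (2 ^ k.+1) = z, m <= `|w|, 0 <= w + w^* &
    `|w - 1| * (1 + m / 2%:R) ^+ k <= `|y0 - 1|].
  elim: k => [|k [w [wz mw wp wk]]]; first by exists y0; split=> //; rewrite expr0 mulr1.
  have [v [vw nv vp]] := principal_sqrt w.
  have [mv cv] := sqrt_contraction m0 m1 mw wp vw nv vp.
  exists v; split=> //; first by rewrite expnS exprM vw.
  rewrite exprS mulrA; apply: le_trans wk; apply: ler_wpM2r => //.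
  by rewrite exprn_ge0 // addr_ge0 // ltW.
have [k hk] := archi (`|y0 - 1| / (e * (m / 2%:R))).
have [w [wz _ _ wk]] := seq k; exists (2 ^ k.+1)%N, w; split=> //; first by rewrite expn_gt0.
have em0 : 0 < e * (m / 2%:R) by rewrite mulr_gt0.
have hk' : `|y0 - 1| <= e * (k%:R * (m / 2%:R)).
  rewrite mulrCA -ler_pdivrMr //; apply: le_trans hk.
  by rewrite [leRHS]ger0_norm // divr_ge0 // ltW.
have P0 : 0 < (1 + m / 2%:R) ^+ k by rewrite exprn_gt0 // addr_gt0.
rewrite -(ltr_pM2r P0); apply: le_lt_trans wk _; apply: le_lt_trans hk' _.
rewrite ltr_pM2l //; apply: lt_le_trans (bernoulli k (ltW q0)).
by rewrite ltrDr.
Qed.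

End Roots.

Section Tends.
Variable C : numClosedFieldType.

Definition tends (u : nat -> C) (l : C) : Prop :=
  forall e, 0 < e -> exists N, forall n, (N <= n)%N -> `|u n - l| < e.

Lemma tendsP u l : tends u l <-> u @ \oo --> l.
Proof.
split=> h.
  apply/cvgrPdist_lt => e e0; have [N hN] := h e e0.
  by exists N => // n Nn; rewrite distrC; exact: hN.
move=> e e0; move/cvgrPdist_lt: h => /(_ e e0) [N _ hN].
by exists N => n Nn; rewrite distrC; exact: hN.
Qed.

Lemma tends_uniq u l l' : tends u l -> tends u l' -> l = l'.
Proof. by move=> /tendsP h /tendsP h'; rewrite -(cvg_lim (@norm_hausdorff _ _) h) -(cvg_lim (@norm_hausdorff _ _) h'). Qed.

Lemma tendsM u w l m : tends u l -> tends w m -> tends (u * w) (l * m).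
Proof. by move=> /tendsP h /tendsP h'; apply/tendsP; exact: cvgM. Qed.

Lemma tendsB u w l m : tends u l -> tends w m -> tends (u - w) (l - m).
Proof. by move=> /tendsP h /tendsP h'; apply/tendsP; exact: cvgB. Qed.

Lemma tends_cst l : tends (fun=> l) l.
Proof. by move=> e e0; exists 0%N => n _; rewrite subrr normr0. Qed.

End Tends.

Section Archimedean.
Variable R : realType.
Local Notation C := R[i].
Local Notation cauchy := Defs.cauchy.
Local Notation iinv := Defs.iinv.

Local Notation "x %:C" := (real_complex R x) (format "x %:C").

Lemma complex_archi (x : C) : exists n, `|x| <= n%:R.
Proof.
exists (Num.bound (complex.Re `|x|)); rewrite normc_def /=.
set r := Num.sqrt _; rewrite -(rmorph_nat (real_complex R)) lecR; apply: ltW.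
by apply: archi_boundP; exact: sqrtr_ge0.
Qed.

Lemma small_inverse (e : C) : 0 < e -> exists n : nat, n.+1%:R^-1 < e.
Proof.
move=> e0; have [n hn] := complex_archi e^-1; exists n.
rewrite invf_plt ?posrE ?ltr0n //; apply: le_lt_trans (_ : n%:R < _); last by rewrite ltr_nat.
by move: hn; rewrite ger0_norm // invr_ge0 ltW.
Qed.

Lemma real_complete (u : nat -> R) :
  (forall e, 0 < e -> exists N, forall n m, (N <= n)%N -> (N <= m)%N -> `|u n - u m| < e) ->
  exists l, forall e, 0 < e -> exists N, forall n, (N <= n)%N -> `|u n - l| < e.
Proof.
move=> cu; have /cvg_ex [l hl] : cvg (u @ \oo).
  apply: cauchy_cvg; apply: cauchy_exP => e e0; have [N hN] := cu e e0.
  by exists (u N); exists N => // n Nn /=; exact: hN.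
exists l => e e0; move/cvgrPdist_lt: hl => /(_ e e0) [N _ hN].
by exists N => n Nn; rewrite distrC; exact: hN.
Qed.

Lemma complex_norm_lt (z : C) (e : R) : `|complex.Re z| < e -> `|complex.Im z| < e -> `|z| < (e + e)%:C.
Proof.
move=> hr hi; case: z hr hi => a b /= hr hi; have -> : (a +i* b)%C = a%:C + (0 +i* b)%C.
  by apply/eqP; rewrite eq_complex /= addr0 add0r !eqxx.
apply: le_lt_trans (ler_normD _ _) _; rewrite rmorphD.
by apply: ltrD; rewrite normc_def /= expr0n /= ?addr0 ?add0r sqrtr_sqr ltcR.
Qed.

Lemma complex_complete (u : nat -> C) :
  (forall e, 0 < e -> exists N, forall n m, (N <= n)%N -> (N <= m)%N -> `|u n - u m| < e) ->
  exists l, tends u l.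
Proof.
move=> cu.
have [a ha] : exists l : R, forall e, 0 < e -> exists N, forall n, (N <= n)%N -> `|complex.Re (u n) - l| < e.
  apply: real_complete => e e0; have [|N hN] := cu e%:C; first by rewrite ltcR.
  exists N => n m Nn Nm; rewrite -ltcR; apply: le_lt_trans (hN n m Nn Nm).
  by rewrite -raddfB; exact: normc_ge_Re.
have [b hb] : exists l : R, forall e, 0 < e -> exists N, forall n, (N <= n)%N -> `|complex.Im (u n) - l| < e.
  apply: real_complete => e e0; have [|N hN] := cu e%:C; first by rewrite ltcR.
  exists N => n m Nn Nm; rewrite -ltcR; apply: le_lt_trans (hN n m Nn Nm).
  rewrite -raddfB normc_def lecR -sqrtr_sqr ler_wsqrtr // lerDr sqr_ge0 //.
exists (a +i* b)%C => e e0.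
have [d d0 de] : exists2 d : R, 0 < d & (d + d)%:C <= e.
  have e1 : e = (complex.Re e)%:C by move: e0; rewrite ltcE /= => /andP[/eqP ei _]; case: (e) ei => x y /= ->.
  have er : 0 < complex.Re e by rewrite -ltcR -e1.
  by exists (complex.Re e / 2); [rewrite divr_gt0 | rewrite -splitr -e1].
have [N hN] := ha d d0; have [M hM] := hb d d0; exists (maxn N M) => n.
rewrite geq_max => /andP[Nn Mn]; apply: lt_le_trans de.
by apply: complex_norm_lt; rewrite raddfB; [exact: hN | exact: hM].
Qed.

End Archimedean.

Lemma hecke_near_one (C : numClosedFieldType) (K : numField C) (phi : idele K -> C) e :
  is_hecke_char phi -> 0 < e ->
  exists2 N, (0 < N)%N & forall t, idele_ball N t -> `|phi t - 1| < e.
Proof.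
move=> hphi e0.
have := @hecke_continuous _ _ _ hphi (idele_one K) _ (nbhsx_ballx (phi (idele_one K)) e e0).
rewrite (hecke1 hphi) => -[N N0 hN]; exists N => // t bt.
suff : ball (1 : C) e (phi t) by rewrite /ball /= distrC.
apply: hN => /=; have -> : ideleM t (ideleV (idele_one K)) = t; last by [].
apply: idele_ext => v; rewrite ideleME ideleVE.
have -> : Defs.iinv (idele_one K) v = 1 by rewrite -[LHS]mul1r -{1}(idele_oneE K v) icompK.
by rewrite mulr1.
Qed.

(** * The infinite component, and alpha on infinite ideles *)

Section Infinity.
Variable R : realType.
Local Notation C := R[i].
Variable K : numField C.
Hypothesis iqK : imag_quadratic K.
Local Notation cauchy := Defs.cauchy.
Local Notation iinv := Defs.iinv.
Local Notation "x %:C" := (real_complex R x) (format "x %:C").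
Let hK := nf_subfield K.
Implicit Types (x y : completion K Infty) (s t u : idele K).

(** Identifies the completion at infinity with C: [archM], [arch_inj] and, by density of K in C,
    [arch_surj]. *)
Definition arch x : C := lim (rep x @ \oo).

Lemma nb_infE n (z : C) : nb_inf K n z <-> nf_set K z /\ `|z| < n.+1%:R^-1.
Proof.
split=> -[Kz h]; split=> //; first by apply: h; split.
by move=> s es; rewrite (embedding_norm iqK es Kz).
Qed.

Lemma cauchy_infP (v : nat -> C) : cauchy K Infty v <->
  (forall n, nf_set K (v n)) /\
  (forall e, 0 < e -> exists N, forall n m, (N <= n)%N -> (N <= m)%N -> `|v n - v m| < e).
Proof.
split=> -[Kv h]; split=> // k.
  move=> k0; have [n hn] := small_inverse k0; have [N hN] := h n.
  by exists N => i j Ni Nj; apply: lt_trans hn; apply: ((nb_infE _ _).1 (hN i j Ni Nj)).2.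
have [|N hN] := h k.+1%:R^-1; first by rewrite invr_gt0 ltr0n.
by exists N => i j Ni Nj; apply/nb_infE; split; [exact: (subfieldB hK) | exact: hN].
Qed.

Lemma archP x : tends (rep x) (arch x).
Proof.
have [_ /complex_complete [l hl]] := (cauchy_infP _).1 (rep_cauchy x).
by rewrite /arch; move: (hl) => /tendsP /(cvg_lim (@norm_hausdorff _ _)) ->.
Qed.

Lemma arch_eq x l : tends (rep x) l -> arch x = l.
Proof. exact: tends_uniq (archP x). Qed.

Lemma arch_class v l : cauchy K Infty v -> tends v l -> arch (class_of K Infty v) = l.
Proof.
move=> cv vl; apply: arch_eq; set r := rep _.
have -> : r = v - (v - r) by apply/funext => n; rewrite !fctE; ring.
rewrite -[l]subr0; apply: tendsB => // e e0; have [n hn] := small_inverse e0.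
have [N hN] := rep_class cv n; exists N => m Nm; rewrite subr0 distrC.
by apply: lt_trans hn; apply: ((nb_infE _ _).1 (hN m Nm)).2.
Qed.

Lemma archM x y : arch (x * y) = arch x * arch y.
Proof.
rewrite -{1}(repK x) -{1}(repK y) -class_ofM; [|exact: rep_cauchy|exact: rep_cauchy].
apply: arch_class; first by apply: cauchyM; exact: rep_cauchy.
by apply: tendsM; exact: archP.
Qed.

Lemma arch1 : arch 1 = 1.
Proof.
rewrite -emb1; apply: arch_class; last exact: tends_cst.
by apply: cauchy_cst; exact: (subfield1 hK).
Qed.

Lemma arch_inj x y : arch x = arch y -> x = y.
Proof.
move=> e; rewrite -(repK x) -(repK y); apply: class_of_eq; try exact: rep_cauchy.
move=> k; have := tendsB (archP x) (archP y); rewrite e subrr => h.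
have [|N hN] := h k.+1%:R^-1; first by rewrite invr_gt0 ltr0n.
exists N => n Nn; apply/nb_infE; split; last by have := hN n Nn; rewrite subr0.
by apply: (subfieldB hK); exact: (rep_cauchy _).1.
Qed.

Lemma real_dense (a e : R) : 0 < e -> exists q : rat, `|ratr q - a| < e.
Proof.
move=> e0; have ae : a - e < a + e by rewrite ltrBlDr -addrA ltrDl addr_gt0.
have [q] := rat_in_itvoo ae; rewrite in_itv /= => /andP[h1 h2]; exists q.
by rewrite ltr_norml; apply/andP; split; lra.
Qed.

(** In coordinates with respect to 1 and a nonreal w in K, this is the density of the rationals in
    the reals. *)
Lemma subfield_dense (z e : C) : 0 < e -> exists2 q, nf_set K q & `|q - z| < e.
Proof.
move=> e0; have [w [iw nr _]] := quadratic_generator iqK; have Kw := iw.1.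
have wi : complex.Im w != 0.
  apply: contra nr => /eqP wi; rewrite CrealE; apply/eqP.
  by case: (w) wi => a b /= ->; apply/eqP; rewrite eq_complex /= oppr0 !eqxx.
pose b : R := complex.Im z / complex.Im w; pose a : R := complex.Re z - b * complex.Re w.
have zE : z = a%:C + b%:C * w.
  apply/eqP; rewrite eq_complex {}/a {}/b; case: (w) (z) wi => [w1 w2] [z1 z2] /= wi.
  by rewrite mul0r subr0 mul0r addr0 add0r subrK divfK // !eqxx.
have wn : 0 < 1 + `|w| by rewrite ltr_pwDl.
have [d d0 de] : exists2 d : R, 0 < d & d%:C * (1 + `|w|) <= e.
  have [n hn] := small_inverse (divr_gt0 e0 wn); exists n.+1%:R^-1; first by rewrite invr_gt0 ltr0n.
  by rewrite fmorphV rmorph_nat -ler_pdivlMr // ltW.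
have [p hp] := real_dense a d0; have [q hq] := real_dense b d0.
have cr (r : rat) : (ratr r : C) = (ratr r : R)%:C by rewrite fmorph_rat.
have cn (r : R) : `|r%:C| = `|r|%:C by rewrite normc_def /= expr0n /= addr0 sqrtr_sqr.
exists (ratr p + ratr q * w).
  by apply: (subfieldD hK); [|apply: (subfieldM hK _ Kw)]; exact: rat_in.
have -> : ratr p + ratr q * w - z = (ratr p - a)%:C + (ratr q - b)%:C * w.
  by rewrite zE !cr !rmorphB; ring.
apply: lt_le_trans de; apply: le_lt_trans (ler_normD _ _) _.
rewrite normrM !cn mulrDr mulr1; apply: ltr_leD; first by rewrite ltcR.
by apply: ler_wpM2r => //; rewrite lecR ltW.
Qed.

Lemma arch_surj (z : C) : exists x, arch x = z.
Proof.
have /choice [v hv] : forall n : nat, exists q, nf_set K q /\ `|q - z| < n.+1%:R^-1.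
  by move=> n; have [|q Kq hq] := @subfield_dense z n.+1%:R^-1; [rewrite invr_gt0 ltr0n | exists q].
have vz : tends v z.
  move=> e /small_inverse [N hN]; exists N => n Nn; apply: lt_trans (hv n).2 _.
  by apply: le_lt_trans hN; rewrite lef_pV2 ?posrE ?ltr0n // ler_nat.
exists (class_of K Infty v); apply: arch_class => //.
apply/cauchy_infP; split=> [n|e e0]; first exact: (hv n).1.
have [N hN] := vz (e / 2%:R) (divr_gt0 e0 (ltr0n _ 2)).
exists N => n m Nn Nm; have -> : v n - v m = (v n - z) - (v m - z) by ring.
apply: le_lt_trans (ler_normB _ _) _.
by rewrite [e]splitr; apply: ltrD; exact: hN.
Qed.

Lemma infinite_idele (z : C) : z != 0 -> exists t : idele K, arch_comp t = z /\ forall p, t (Fin p) = 1.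
Proof.
move=> z0; have [x xz] := arch_surj z; have [y yz] := arch_surj z^-1.
have xy : x * y = 1 by apply: arch_inj; rewrite archM xz yz divff // arch1.
pose f (x : completion K Infty) v : completion K v := match v with Infty => x | Fin p => 1 end.
have fxy v : f x v * f y v = 1 by case: v => [|p] //=; rewrite mulr1.
have fin x' : finite_set [set p | ~ clos K (Fin p) (ints K) (f x' (Fin p))].
  by apply: sub_finite_set (@finite_set0 _) => p /=; apply; exact: clos_ints1.
by exists (Idele fxy (fin x) (fin y)); split.
Qed.

Lemma arch_compM s t : arch_comp (ideleM s t) = arch_comp s * arch_comp t.
Proof. exact: archM. Qed.

Lemma arch_comp_neq0 s : arch_comp s != 0.
Proof.
apply/eqP => s0; have := arch_compM s (ideleV s); rewrite s0 mul0r.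
have -> : arch_comp (ideleM s (ideleV s)) = 1 by rewrite /arch_comp -/(arch _) ideleME icompK arch1.
by move/eqP; rewrite oner_eq0.
Qed.

Lemma idele_inf_eq s t : arch_comp s = arch_comp t -> (forall p, s (Fin p) = t (Fin p)) -> s = t.
Proof. by move=> e h; apply: idele_ext => -[|p] //; exact: arch_inj. Qed.

Lemma infinite_ball t N : (forall p, t (Fin p) = 1) -> `|arch_comp t - 1| < N.+1%:R^-1 -> idele_ball N t.
Proof.
move=> tf ta; split.
  have c1 : cauchy K Infty (fun=> 1) by apply: cauchy_cst; exact: (subfield1 hK).
  have e0 : 0 < N.+1%:R^-1 - `|arch_comp t - 1| by rewrite subr_gt0.
  have [M hM] := archP (t Infty) e0.
  have ct := rep_cauchy (t Infty); have cs := cauchy_shift M (cauchyB ct c1).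
  exists (fun n => (rep (t Infty) - (fun=> 1)) (M + n)%N); split=> // [n|].
    apply/nb_infE; split; first exact: cs.1.
    rewrite fctE; set r := rep _ _; have -> : r - 1 = (r - arch (t Infty)) + (arch_comp t - 1) by rewrite /arch_comp -/(arch _); ring.
    apply: le_lt_trans (ler_normD _ _) _; rewrite -ltrBrDr; apply: hM; exact: leq_addr.
  rewrite class_of_shift; last exact: cauchyB.
  by rewrite class_ofB // repK -/(emb K Infty 1) emb1.
move=> p; have ti : iinv t (Fin p) = 1 by rewrite -[LHS]mul1r -{1}(tf p) icompK.
rewrite tf ti subrr; split; try exact: clos_ints1.
exists 0; last by rewrite mulr0.
by apply/clos_intsE; exact: (eventually0 (ints_open K p)).
Qed.

Lemma integral_root (a : C) n : (0 < n)%N -> integralOver (intr : int -> C) (a ^+ n) ->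
  integralOver (intr : int -> C) a.
Proof.
move=> n0 [P Pm rP]; exists (P \Po 'X^n).
  by rewrite monicE lead_coef_comp ?size_polyXn // lead_coefXn expr1n mulr1 -monicE.
by rewrite map_comp_poly map_polyXn rootE horner_comp hornerXn; exact: rP.
Qed.

Variables (alpha : idele K -> C).
Hypothesis alphaK : forall s, nf_set K (alpha s) /\ alpha s != 0.
Hypothesis alphaM : forall s t, alpha (ideleM s t) = alpha s * alpha t.
Hypothesis hphi : is_hecke_char (fun s : idele K => alpha s / arch_comp s).

Lemma alpha1 : alpha (idele_one K) = 1.
Proof.
have e : ideleM (idele_one K) (idele_one K) = idele_one K.
  by apply: idele_ext => v; rewrite ideleME !idele_oneE mulr1.
have := alphaM (idele_one K) (idele_one K); rewrite e => h.
by apply: (mulfI (alphaK (idele_one K)).2); rewrite -h mulr1.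
Qed.

Lemma alpha_near_one e : 0 < e -> exists2 d : C, 0 < d & forall t,
  (forall p, t (Fin p) = 1) -> `|arch_comp t - 1| < d -> `|alpha t - 1| < e.
Proof.
move=> e0; pose phi (s : idele K) : C := alpha s / arch_comp s.
(* With s the infinite component, alpha - 1 = (phi - 1) s + (s - 1) and |s| < 2, so the error is
   below 3 e/4. *)
have e40 : 0 < e / 4%:R by rewrite divr_gt0 // ltr0n.
have [N N0 hN] := hecke_near_one hphi e40.
have [k hk] := small_inverse e40.
pose m := maxn N k; exists m.+1%:R^-1; first by rewrite invr_gt0 ltr0n.
move=> t tf ta.
have inv_mono (i j : nat) : (i <= j)%N -> (j.+1%:R^-1 : C) <= i.+1%:R^-1.
  by move=> ij; rewrite lef_pV2 ?posrE ?ltr0n // ler_nat.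
have taN : `|arch_comp t - 1| < N.+1%:R^-1 by apply: lt_le_trans ta (inv_mono _ _ (leq_maxl _ _)).
have tak : `|arch_comp t - 1| < e / 4%:R.
  by apply: lt_trans hk; apply: lt_le_trans ta (inv_mono _ _ (leq_maxr _ _)).
have ta1 : `|arch_comp t - 1| < 1.
  by apply: lt_le_trans taN _; rewrite invf_le1 ?ltr0n // ler1n.
have hb : `|phi t - 1| < e / 4%:R by apply: hN; exact: infinite_ball.
have aE : alpha t = phi t * arch_comp t by rewrite /phi divfK // arch_comp_neq0.
have an : `|arch_comp t| < 2%:R.
  have -> : arch_comp t = (arch_comp t - 1) + 1 by ring.
  apply: le_lt_trans (ler_normD _ _) _; rewrite normr1 (_ : 2%:R = 1 + 1) // ltrD2r //.
have -> : alpha t - 1 = (phi t - 1) * arch_comp t + (arch_comp t - 1) by rewrite aE; ring.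
apply: le_lt_trans (ler_normD _ _) _; rewrite normrM.
have n4 : 4%:R != 0 :> C by rewrite pnatr_eq0.
have -> : e = e / 4%:R * 2%:R + e / 4%:R + e / 4%:R by field.
rewrite -addrA; apply: ler_ltD; last by apply: lt_trans tak _; rewrite ltrDl.
by apply: ler_pM => //; exact: ltW.
Qed.

Lemma alpha_infinite t : (forall p, t (Fin p) = 1) -> alpha t = 1.
Proof.
move=> tf; have [Ka a0] := alphaK t; have [d d0 ida] := integral_multiple Ka.
have dp : 0 < d%:R :> C by rewrite ltr0n.
have [r r0 hr] := @alpha_near_one d%:R^-1 (ltac:(by rewrite invr_gt0)).
have [n [w [n0 wn wr]]] := near_one_root (@complex_archi R) (arch_comp_neq0 t) r0.
have w0 : w != 0 by apply: contraNneq (arch_comp_neq0 t) => w0; rewrite -wn w0 expr0n gtn_eqF.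
have [u [uw uf]] := infinite_idele w0.
have [Kx x0] := alphaK u; have xr : `|alpha u - 1| < d%:R^-1 by apply: hr => //; rewrite uw.
pose pw k := iter k (ideleM u) (idele_one K).
have pwA k : alpha (pw k) = alpha u ^+ k.
  by elim: k => [|k IH]; rewrite ?alpha1 ?expr0 // /pw iterS -/(pw k) alphaM IH exprS.
have tE : t = pw n.
  apply: idele_inf_eq => [|p]; last first.
    rewrite tf; elim: (n) => [|k IH]; first by rewrite idele_oneE.
    by rewrite /pw iterS -/(pw k) ideleME -IH uf mulr1.
  rewrite -wn -uw; elim: (n) => [|k IH].
    by rewrite expr0 /arch_comp -/(arch _) idele_oneE arch1.
  by rewrite /pw iterS -/(pw k) arch_compM -IH exprS.
(* The same d works for all roots: the n-th power of d alpha(u) is d^(n-1) times d alpha(t), which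
   is integral. Hence r could be fixed before n. *)
have iu : ints K (d%:R * alpha u).
  split; first by apply: (subfieldM hK) => //; exact: (subfield_nat hK).
  apply: (integral_root n0); rewrite exprMn -pwA -tE -(prednK n0) exprSr -mulrA.
  have id : ints K (d%:R ^+ n.-1) by rewrite -natrX; exact: ints_nat.
  exact: (intsM id ida).2.
have i1 : ints K (d%:R * (alpha u - 1)).
  by rewrite mulrBr mulr1; apply: intsD => //; apply: intsN; exact: ints_nat.
have u1 : alpha u = 1.
  apply/eqP; rewrite -subr_eq0; apply/negPn/negP => nz.
  have := ints_norm_ge1 iqK i1 (mulf_neq0 (lt0r_neq0 dp) nz).
  rewrite normrM normr_nat => h.
  suff : d%:R^-1 <= `|alpha u - 1| by move=> /(lt_le_trans xr); rewrite ltxx.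
  by rewrite -(ler_pM2l dp) divff // lt0r_neq0.
by rewrite tE pwA u1 expr1n.
Qed.

(** Splits u into an infinite idele, where alpha is 1, and a ray unit with trivial infinite
    component, where alpha agrees with the Hecke character. *)
Lemma alpha_ray_units (O f I : set C) u : is_order K O -> is_ideal O I -> (exists2 x, I x & x != 0) ->
  is_conductor (fun s : idele K => alpha s / arch_comp s) f -> I `<=` f ->
  ray_units O I u -> alpha u = 1.
Proof.
move=> oO iI nI cf If ru; have [v [va vf]] := infinite_idele (arch_comp_neq0 u).
have vi p : iinv v (Fin p) = 1 by rewrite -[LHS]mul1r -{1}(vf p) icompK.
pose w := ideleM u (ideleV v).
have uE : u = ideleM v w.
  apply: idele_ext => x; rewrite !ideleME ideleVE mulrCA.
  by rewrite icompK mulr1.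
have vu : v Infty = u Infty by apply: arch_inj; exact: va.
have w1 : w Infty = 1 by rewrite ideleME ideleVE -vu icompK.
have wu p : w (Fin p) = u (Fin p) by rewrite ideleME ideleVE vi mulr1.
have wi p : iinv w (Fin p) = iinv u (Fin p).
  by rewrite -[LHS]mul1r -(icompK u (Fin p)) mulrAC -wu icompK mul1r.
have rw : ray_units O I w.
  by move=> p; rewrite wu wi; exact: ru.
have := hecke_ray_units iqK hphi oO iI nI cf If rw w1.
have -> : arch_comp w = 1 by rewrite /arch_comp -/(arch _) w1 arch1.
by rewrite divr1 => aw; rewrite uE alphaM aw alpha_infinite // mulr1.
Qed.

End Infinity.

(** * The action of ideles on torsion *)

Section Normalisation.
Variable C : numClosedFieldType.

Lemma analytic_iso_scale (E : weierstrass C) La xi (b : C) : b != 0 -> analytic_iso E La xi ->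
  analytic_iso E [set x | La (b * x)] (fun z => xi (b * z)).
Proof.
move=> b0 [rg ker add hol]; split.
- rewrite rg; apply/seteqP; split=> [_ [z _ <-]|_ [z _ <-]]; last by exists (b * z).
  by exists (z / b) => //=; rewrite mulrC divfK.
- by move=> z z'; rewrite ker /= mulrBr.
- by move=> z z'; rewrite mulrDr add.
move=> z0; have [X [Y [Z h]]] := hol (b * z0).
exists (fun z => X (b * z)), (fun z => Y (b * z)), (fun z => Z (b * z)).
have ds (G : C -> C) z : derivable (G : C^o -> C^o) (b * z) 1 -> derivable ((fun z => G (b * z)) : C^o -> C^o) z 1.
  move=> /derivable1_diffP dG; apply/derivable1_diffP.
  have dl : derivable ((fun z : C => b * z) : C^o -> C^o) z 1.
    by apply: derivableM; [exact: derivable_cst | exact: derivable_id].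
  by move/derivable1_diffP: dl => dl; exact: differentiable_comp dl dG.
have cb : {for z0, continuous (fun z : C => b * z)}.
  by apply: ctsM; [exact: cts_cst | exact: cts_id].
have := cb _ h; apply: (@filterS _ (nbhs z0)) => z /= [dX dY dZ pz].
exact: (And4 (ds X z dX) (ds Y z dY) (ds Z z dZ) pz).
Qed.

Variable K : numField C.
Hypothesis iqK : imag_quadratic K.
Let hK := nf_subfield K.

Lemma order_nonreal O : is_order K O -> exists2 a, O a & a \isn't Num.real.
Proof.
move=> [lO _ _]; have [w [iw nr _]] := quadratic_generator iqK.
have [d d0 Od] := lattice_multiple iqK lO iw.1; exists (d%:R * w) => //.
apply: contra nr => h; have dn : d%:R != 0 :> C by rewrite pnatr_eq0 -lt0n.
by rewrite -[w](mulKf dn) rpredM // rpredV rpred_nat.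
Qed.

(* The period lattice is homothetic to a lattice in K, because it is stable under a
   nonreal element a of the order: a b0 = m b0 + n b1 with n != 0. *)
Lemma period_lattice O La : is_order K O -> complex_lattice La ->
  (forall a l, O a -> La l -> La (a * l)) ->
  exists b k : C, [/\ b != 0, is_lattice K [set x | La (b * x)], La b &
    forall x, La (b * x) <-> exists m n : int, x = m%:~R + n%:~R * k].
Proof.
move=> oO [c [[span free] _]] stab; have [a Oa na] := order_nonreal oO.
have [[OK _] _ _] := oO; have Ka := OK _ Oa.
pose c0 := c ord0; pose c1 := c (lift ord0 ord0).
have inLa l : La l <-> exists m n : int, l = m%:~R * c0 + n%:~R * c1.
  rewrite span; split=> [[d [dZ ->]]|[m [n ->]]].
    have [m _ mE] := dZ ord0; have [n _ nE] := dZ (lift ord0 ord0).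
    by exists m, n; rewrite big_ord_recl big_ord1 mE nE.
  exists (fun i => if i == ord0 then m%:~R else n%:~R); split; first by move=> i; case: eqP => _; eexists.
  by rewrite big_ord_recl big_ord1.
have indep (m n : int) : m%:~R * c0 + n%:~R * c1 = 0 -> m = 0 /\ n = 0.
  move=> e; have h : forall i : 'I_2, (if i == ord0 then m%:~R else n%:~R) = 0 :> C.
    apply: free => [i|]; first by case: eqP => _; eexists.
    by rewrite big_ord_recl big_ord1.
  have /eqP := h ord0; have /eqP := h (lift ord0 ord0); rewrite /= !intr_eq0.
  by move=> /eqP -> /eqP ->.
have b0 : c0 != 0.
  apply/eqP => c00; have [] := indep 1 0; last by move/eqP; rewrite oner_eq0.
  by rewrite c00 mulr0 mul0r addr0.
have Lb : La c0 by apply/inLa; exists 1, 0; rewrite mul1r mul0r addr0.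
have [m [n e]] := (inLa _).1 (stab _ _ Oa Lb).
have n0 : n%:~R != 0 :> C.
  apply: contra na => /eqP n0; have -> : a = m%:~R.
    by apply: (mulIf b0); rewrite e n0 mul0r addr0.
  exact: rpred_int.
pose k := (a - m%:~R) / n%:~R.
have ck : c1 = c0 * k.
  have kE : k * n%:~R = a - m%:~R by rewrite /k divfK.
  apply: (mulfI n0); rewrite mulrCA [n%:~R * k]mulrC kE mulrBr [c0 * a]mulrC e; ring.
have Kk : nf_set K k.
  apply: (subfieldM hK); last by apply: (subfieldV hK); exact: int_in.
  by apply: (subfieldB hK) => //; exact: int_in.
have inS x : La (c0 * x) <-> exists m n : int, x = m%:~R + n%:~R * k.
  rewrite inLa; split=> -[i [j E]]; exists i, j.
    by apply: (mulfI b0); rewrite E ck; ring.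
  by rewrite E ck; ring.
exists c0, k; split=> //; split.
  move=> x /inS [i [j ->]]; apply: (subfieldD hK); first exact: int_in.
  by apply: (subfieldM hK) => //; exact: int_in.
exists (fun i => if i == ord0 then 1 else k); split.
  move=> x; rewrite [_ x]/= inS; split=> [[i [j ->]]|[d [dZ ->]]].
    exists (fun l => if l == ord0 then i%:~R else j%:~R); split; first by move=> l; case: eqP => _; eexists.
    by rewrite big_ord_recl big_ord1 /= mulr1.
  have [i _ iE] := dZ ord0; have [j _ jE] := dZ (lift ord0 ord0).
  by exists i, j; rewrite big_ord_recl big_ord1 /= iE jE mulr1.
move=> d dZ; rewrite big_ord_recl big_ord1 /= mulr1.
have [i _ iE] := dZ ord0; have [j _ jE] := dZ (lift ord0 ord0); rewrite -iE -jE => E.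
have [i0 j0] : i = 0 /\ j = 0.
  by apply: indep; rewrite ck; transitivity (c0 * (i%:~R + j%:~R * k)); [ring | rewrite E mulr0].
move=> l; case: (unliftP ord0 l) => [l' ->|->]; last by rewrite -iE i0.
by rewrite (ord1 l') -jE j0.
Qed.

End Normalisation.

Section Action.
Variable C : numClosedFieldType.
Variable K : numField C.
Hypothesis iqK : imag_quadratic K.
Variable La : set C.
Hypothesis lLa : is_lattice K La.
Local Notation iinv := Defs.iinv.
Let hK := nf_subfield K.
Let gLa := lattice_subgroup lLa.
Implicit Types (t : idele K) (p : rprime).

Lemma stable_local t p (x : completion K (Fin p)) : idele_lattice t La La ->
  eventually_in (locp (val p) La) x -> eventually_in (locp (val p) La) (t (Fin p) * x).
Proof. by move=> [_ ht] /(tensorE iqK _ lLa) hx; apply/(tensorE iqK _ lLa); rewrite ht; exists x. Qed.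

Lemma stable_localV t p (x : completion K (Fin p)) : idele_lattice t La La ->
  eventually_in (locp (val p) La) x -> eventually_in (locp (val p) La) (iinv t (Fin p) * x).
Proof.
move=> [_ ht] /(tensorE iqK _ lLa); rewrite ht => -[y hy <-].
by rewrite mulrA [iinv _ _ * _]mulrC icompK mul1r; apply/(tensorE iqK _ lLa).
Qed.

Lemma idele_pointP t z z' : idele_lattice t La La -> idele_point t La z z' <->
  forall p, eventually_in (locp (val p) La) (emb K (Fin p) z' - t (Fin p) * emb K (Fin p) z).
Proof. by move=> [_ ht]; split=> h p; [apply/(tensorE iqK _ lLa); rewrite ht | rewrite -ht; apply/(tensorE iqK _ lLa)]. Qed.

Lemma eventually_lattice p z : La z -> eventually_in (locp (val p) La) (emb K (Fin p) z).
Proof. by move=> Lz; apply/(eventually_emb (lattice_open iqK p lLa) (lLa.1 _ Lz)); exact: locpW. Qed.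

(* It suffices to test t on p-primary torsion, where t . z is represented by an
   explicit element of K. *)
Lemma action_local t z p : idele_lattice t La La -> nf_set K z ->
  (forall n z', nf_set K z' -> idele_point t La (n%:R * z) z' -> La (z' - n%:R * z)) ->
  eventually_in (locp (val p) La) ((t (Fin p) - 1) * emb K (Fin p) z).
Proof.
move=> lt Kz ht; have [N N0 LN] := lattice_multiple iqK lLa Kz.
have oL q := lattice_open iqK q lLa.
(* z1 = N' z is p-primary torsion modulo La; N' is a unit at p, so it can be divided out at the
   end. *)
have [N' pN' NE] := pfactor_coprime (valP p) N0; set a := logn _ _ in NE.
have pN : ~~ (val p %| N')%N by rewrite -prime_coprime //; exact: valP p.
pose z1 := N'%:R * z; have Kn n : nf_set K n%:R by exact: (subfield_nat hK).
have Kz1 : nf_set K z1 by exact: (subfieldM hK).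
have Lz1 : La ((val p ^ a)%:R * z1) by rewrite /z1 mulrA -natrM mulnC -NE.
set tp := t (Fin p); pose P := (val p ^ a)%N.
have h1 : eventually_in (locp (val p) La) (tp * emb K (Fin p) (P%:R * z1)).
  by apply: stable_local => //; exact: eventually_lattice.
have KP1 : nf_set K (P%:R * z1) by exact: (subfieldM hK).
have [N1 hN1] : exists N, forall n, (N <= n)%N -> locp (val p) La ((P%:R * z1) * rep tp n).
  by apply/(eventually_embM (oL p) _ KP1); rewrite mulrC.
pose S := [set y | locp (val p) La (z1 * y)].
have oS : open_subgroup K (Fin p) S.
  have [g0 gB] := locp_subgroup gLa p.
  split=> [|y y' Sy Sy'|]; [by rewrite /S /= mulr0 | by rewrite /S /= mulrBr; exact: gB |].
  have [_ _ [k kL]] := oL p; have [m hm] := nbZ (Fin p) k Kz1.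
  by exists m => y /hm /kL.
have [N2 hN2] := eventually_approx oS tp.
pose n := maxn N1 N2; have [m [pm Lm]] := hN1 n (leq_maxl _ _); have hr := hN2 n (leq_maxr _ _).
set tn := rep tp n in Lm hr; have Ktn : nf_set K tn := (rep_cauchy tp).1 n.
have cop : coprime m P by rewrite coprimeXr // coprime_sym prime_coprime //; exact: valP p.
have P0 : (0 < P)%N by rewrite expn_gt0 prime_gt0 //; exact: valP p.
have tot : (0 < totient P)%N by rewrite totient_gt0.
pose r := (m ^ totient P)%N; have r0 : (0 < r)%N by rewrite expn_gt0 (ndvd_gt0 pm).
have /eqP := cyclic.Euler_exp_totient cop; rewrite eqn_mod_dvd // => /dvdnP [q qE].
have rm : r = (m ^ (totient P).-1 * m)%N by rewrite -expnSr prednK.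
(* tn approximates t_p, and r is 1 modulo p^a and a multiple of m. So z' is t_p z1 modulo La at p;
   at the other primes z' and z1, hence also t z1, lie in La. *)
pose z' := r%:R * tn * z1; have Kz' : nf_set K z' by apply: (subfieldM hK) => //; exact: (subfieldM hK).
have pt : idele_point t La z1 z'.
  apply/(idele_pointP _ _ lt) => l; have [E|nl] := eqVneq l p; last first.
    have lP : ~~ (val l %| P)%N.
      apply/negP => h; have := Euclid_dvdX (val p) a (valP l); rewrite h => /esym/andP[].
      by rewrite dvdn_prime2 ?(valP l) ?(valP p) // => /eqP /val_inj E; rewrite E eqxx in nl.
    apply: (eventuallyB (oL l)).
      apply/(eventually_emb (oL l) Kz'); apply: (locp_unit lP); apply: locpW.
      have -> : P%:R * z' = (m ^ (totient P).-1)%:R * (m%:R * (P%:R * z1 * tn)).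
        by rewrite /z' rm natrM; ring.
      exact: subgroup_nat.
    apply: stable_local => //; apply/(eventually_emb (oL l) Kz1).
    by apply: (locp_unit lP); apply: locpW.
  subst l; rewrite -/tp.
  have -> : emb K (Fin p) z' - tp * emb K (Fin p) z1 =
      emb K (Fin p) (z' - tn * z1) - emb K (Fin p) z1 * (tp - emb K (Fin p) tn).
    rewrite (embB _ Kz' (subfieldM hK Ktn Kz1)) (embM _ Ktn Kz1).
    by move: (emb _ _ z') => y; ring.
  apply: (eventuallyB (oL p)).
    apply/(eventually_emb (oL p)); first by apply: (subfieldB hK) => //; exact: (subfieldM hK).
    exists m; split=> //; have -> : z' - tn * z1 = (r - 1)%:R * (tn * z1).
      by rewrite natrB // /z'; ring.
    rewrite qE; have -> : m%:R * ((q * P)%:R * (tn * z1)) = q%:R * (m%:R * (P%:R * z1 * tn)).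
      by rewrite natrM; ring.
    exact: subgroup_nat.
  by apply/(eventually_embM (oL p) _ Kz1).
have Lz' := ht N' z' Kz' pt.
have h2 : eventually_in (locp (val p) La) (emb K (Fin p) N'%:R * ((tp - 1) * emb K (Fin p) z)).
  have -> : emb K (Fin p) N'%:R * ((tp - 1) * emb K (Fin p) z) =
     emb K (Fin p) (z' - z1) - (emb K (Fin p) z' - tp * emb K (Fin p) z1).
    rewrite (embB _ Kz' Kz1) (embM _ (Kn N') Kz).
    by move: (emb _ _ z') => y; ring.
  apply: (eventuallyB (oL p)); first exact: eventually_lattice.
  exact: ((idele_pointP z1 z' lt).1 pt p).
have [M hM] := (eventually_embM (oL p) _ (Kn N')).1 h2.
by exists M => i Mi; apply: (locp_unit pN); exact: hM.
Qed.

End Action.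

(** * The theorem *)

Section AdjoinFacts.
Variable C : numClosedFieldType.
Implicit Types (F S : set C).

Lemma adjoin_subfield F S : is_subfield (adjoin F S).
Proof.
split.
- by move=> M hM _ _; exact: (subfield1 hM).
- by move=> x y hx hy M hM FM SM; apply: (subfieldB hM); [exact: hx | exact: hy].
- by move=> x y hx hy M hM FM SM; apply: (subfieldM hM); [exact: hx | exact: hy].
- by move=> x hx M hM FM SM; apply: (subfieldV hM); exact: hx.
Qed.

Lemma adjoin_base F S : F `<=` adjoin F S.
Proof. by move=> x Fx M _ FM _; exact: FM. Qed.

Lemma adjoin_gen F S : S `<=` adjoin F S.
Proof. by move=> x Sx M _ _ SM; exact: SM. Qed.

Lemma adjoin_sub F S T : S `<=` adjoin F T -> adjoin F S `<=` adjoin F T.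
Proof. by move=> ST x; apply => //; [exact: adjoin_subfield | exact: adjoin_base]. Qed.

Lemma subfieldI (M N : set C) : is_subfield M -> is_subfield N -> is_subfield (M `&` N).
Proof.
move=> hM hN; split.
- by split; [exact: (subfield1 hM) | exact: (subfield1 hN)].
- by move=> x y [? ?] [? ?]; split; [exact: (subfieldB hM) | exact: (subfieldB hN)].
- by move=> x y [? ?] [? ?]; split; [exact: (subfieldM hM) | exact: (subfieldM hN)].
- by move=> x [? ?]; split; [exact: (subfieldV hM) | exact: (subfieldV hN)].
Qed.

End AdjoinFacts.

Section ArtinFacts.
Variable C : numClosedFieldType.
Variables (K : numField C) (art : idele K -> C -> C).
Hypothesis hart : is_artin_map art.

Lemma artin_embedding (L : numField C) s : abelian_ext K L ->
  embedding L (art s) /\ forall x, nf_set L x -> nf_set L (art s x).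
Proof.
move=> abL; have LM x : nf_set L x -> max_abelian K x by exists L.
have [[e1 eB eM] _ fK] := artin_gal hart s; have [KL st _] := abL.
have es : embedding L (art s).
  by split=> // x y Lx Ly; [apply: eB; exact: LM | apply: eM; exact: LM].
by split=> // x Lx; apply: (st _ es) => //; exists x.
Qed.

Lemma artin_one x : max_abelian K x -> art (idele_one K) x = x.
Proof.
move=> [L [abL Lx]]; have [es st] := artin_embedding (idele_one K) abL.
have e : ideleM (idele_one K) (idele_one K) = idele_one K.
  by apply: idele_ext => v; rewrite ideleME !idele_oneE mulr1.
have mx : max_abelian K x by exists L.
have := artin_mul hart (idele_one K) (idele_one K) mx; rewrite e => /esym h.
exact: (embedding_inj es (st _ Lx) Lx h).
Qed.

Lemma artin_gal_over (F : set C) s : (forall x, F x -> art s x = x) -> gal (max_abelian K) F (art s).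
Proof. by move=> h; have [h1 h2 _] := artin_gal hart s. Qed.

End ArtinFacts.

(** * Both inclusions, for a period lattice Z + Z k in K *)

Section Main.
Variable R : realType.
Local Notation C := R[i].
Variables (K F : numField C) (O : set C) (E : weierstrass C).
Variables (theta : C -> ecpoint C -> ecpoint C) (art : idele K -> C -> C) (alpha : idele K -> C) (f : set C).
Hypothesis iqK : imag_quadratic K.
Hypothesis KF : K `<=` F.
Hypothesis oO : is_order K O.
Hypothesis eE : elliptic_curve_over F E.
Hypothesis iso : ring_iso_End F E O theta.
Hypothesis hart : is_artin_map art.
Hypothesis tors : adjoin F (coordinates (torsion E)) `<=` max_abelian K.
Hypothesis alphaK : forall s, nf_set K (alpha s) /\ alpha s != 0.
Hypothesis alphaM : forall s t, alpha (ideleM s t) = alpha s * alpha t.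
Hypothesis hphi : is_hecke_char (fun s : idele K => alpha s / arch_comp s).
Hypothesis main_thm : forall (La : set C) (xi : C -> ecpoint C) (s : idele K),
     is_lattice K La -> analytic_iso E La xi -> norm_group K F s ->
     let t := ideleM (principal K (alpha s)) (ideleV s) in
     idele_lattice t La La /\
     forall tau : C -> C,
       gal (max_abelian K) F tau ->
       (forall x, max_abelian K x -> tau x = art s x) ->
       forall z z', nf_set K z -> nf_set K z' -> idele_point t La z z' ->
         xi z' = map_point tau (xi z).
Hypothesis cf : is_conductor (fun s : idele K => alpha s / arch_comp s) f.
Variable I : set C.
Hypothesis invI : invertible_ideal K O I.
Hypothesis If : I `<=` f `&` O.
Variables (La : set C) (xi : C -> ecpoint C) (k : C).
Hypothesis lLa : is_lattice K La.
Hypothesis ai : analytic_iso E La xi.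
Hypothesis La1 : La 1.
Hypothesis LaE : forall x, La x <-> exists m n : int, x = m%:~R + n%:~R * k.
Hypothesis stab : forall a l, O a -> La l -> La (a * l).
Hypothesis norm : forall a z, O a -> theta a (xi z) = xi (a * z).
Local Notation iinv := Defs.iinv.
Let hK := nf_subfield K.
Let hF := nf_subfield F.
Let gLa := lattice_subgroup lLa.
Let lO : is_lattice K O. Proof. by have [] := oO. Qed.
Let gO : subgroup O := lattice_subgroup lO.
Let O1 : O 1. Proof. by have [] := oO. Qed.

Let Lak : La k. Proof. by apply/LaE; exists 0, 1; rewrite add0r mul1r. Qed.

Lemma ideal_nonzero : exists2 x, I x & x != 0.
Proof.
have [_ [J [_ _ _ IJ]]] := invI; apply: contrapT => no.
have : ideal_mul I J 1 by rewrite IJ.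
move=> [n [a [b [ha _ e]]]]; move/eqP: (oner_neq0 C); apply; rewrite e big1 // => i _.
have [->|ai0] := eqVneq (a i) 0; first by rewrite mul0r.
by exfalso; apply: no; exists (a i).
Qed.

(* This is where End_F(E) = O enters. *)
Lemma multiplier_order a : (forall l, La l -> La (a * l)) -> O a.
Proof.
move=> aL; have Ka : nf_set K a by apply: lLa.1; rewrite -[a]mulr1; exact: aL.
have [a0|a0] := eqVneq a 0; first by rewrite a0; exact: gO.1.
have [m m0 Oma] := lattice_multiple iqK lO Ka.
have Om : O m%:R by exact: (order_nat oO).
have mn : m%:R != 0 :> C by rewrite pnatr_eq0 -lt0n.
have [r r0 hr] := lattice_discrete iqK lLa.
have [th1 th2 _ _ _] := iso.
have [g eg gz] := analytic_endomorphism_over hF eE ai r0 hr aL a0 mn (th1 _ Om)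
  (fun z => norm z Om) (th1 _ Oma) (fun z => norm z Oma).
have [a' Oa' ha'] := th2 _ eg.
have ker z : La ((a - a') * z).
  have [_ h _ _] := ai; rewrite mulrBl; apply/h.
  by rewrite -gz ha' ?norm //; exact: (xi_on ai).
have [->//|ne] := eqVneq a a'; exfalso.
have dn : a - a' != 0 by rewrite subr_eq0.
(* Multiplication by a - a' maps all of C into La, so La would contain r/2, against the
   discreteness. *)
have := ker ((a - a')^-1 * (r / 2%:R)); rewrite mulVKf // => Lr.
have r2 : 0 < r / 2%:R by rewrite divr_gt0 // ltr0n.
have := hr _ Lr (lt0r_neq0 r2); rewrite gtr0_norm // => h.
have : r / 2%:R < r by rewrite ltr_pdivrMr ?ltr0n // ltr_pMr // ltr1n.
by move/lt_le_trans => /(_ _ h); rewrite ltxx.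
Qed.

(** 1 and k generate La, so two conditions with a common denominator reduce the local statement to
    [multiplier_order]. *)
Lemma multiplier_local (p : rprime) y : locp (val p) La (y * 1) -> locp (val p) La (y * k) ->
  locp (val p) O y.
Proof.
move=> h1 h2; pose fb (i : 'I_2) := if i == ord0 then y * 1 else y * k.
have [|m [pm hm]] := @locp_uniform C La gLa p 2 fb; first by rewrite /fb => i; case: eqP.
exists m; split=> //; apply: multiplier_order => l /LaE [a [b ->]].
have La1' := hm ord0; have Lak' := hm (lift ord0 ord0); rewrite /fb /= in La1' Lak'.
have -> : m%:R * y * (a%:~R + b%:~R * k) = a%:~R * (m%:R * (y * 1)) + b%:~R * (m%:R * (y * k)) by ring.
by apply: subgroupD => //; exact: subgroup_int.
Qed.

(** By the normalisation of theta, E[I] is the image of I^-1 La. *)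
Lemma ideal_torsionP P : ideal_torsion E theta I P <-> exists z, P = xi z /\ forall a, I a -> La (a * z).
Proof.
have IO a : I a -> O a by move=> /If [].
split=> [[oP hP]|[z [-> hz]]].
  have [z zP] := xi_surj ai oP; exists z; split=> // a Ia.
  by apply/(xi_Origin ai); rewrite -norm ?zP; [exact: hP | exact: IO].
split=> [|a Ia]; first exact: (xi_on ai).
by rewrite norm; [apply/(xi_Origin ai); exact: hz | exact: IO].
Qed.

Definition coords (P : ecpoint C) : seq C := if P is Affine x y then [:: x; y] else [::].

Lemma torsion_coords z x : nf_set K z -> x \in coords (xi z) -> max_abelian K x.
Proof.
move=> Kz xz; apply: tors; apply: adjoin_gen.
have [N N0 LN] := lattice_multiple iqK lLa Kz.
have it n : iter n (Defs.add E (xi z)) Origin = xi (n%:R * z).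
  elim: n => [|n IH]; first by rewrite mul0r (xi0 ai).
  by have [_ _ ad _] := ai; rewrite iterS IH -ad -natr1 mulrDl mul1r addrC.
have tz : torsion E (xi z).
  split; first exact: (xi_on ai).
  by exists N => //; rewrite it; apply/(xi_Origin ai).
move: xz tz; case: (xi z) => [|a b] //= xab tab; exists a, b; split=> //.
by move: xab; rewrite !inE => /orP[/eqP->|/eqP->]; [left | right].
Qed.

Lemma ideal_torsion_field z : (forall a, I a -> La (a * z)) -> nf_set K z.
Proof.
move=> hz; have [N N0 IN] := ideal_natural iqK oO invI.1 ideal_nonzero.
have n0 : N%:R != 0 :> C by rewrite pnatr_eq0 -lt0n.
rewrite -[z](mulKf n0); apply: (subfieldM hK); last by apply: lLa.1; exact: hz.
by apply: (subfieldV hK); exact: (subfield_nat hK).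
Qed.

Lemma base_abelian : F `<=` max_abelian K.
Proof. by move=> x Fx; apply: tors; exact: adjoin_base. Qed.

(** I contains a positive integer N, so E[I] is inside E[N], whose points are xi((i + j k)/N).
    Finiteness lets a single finite abelian extension contain all coordinates. *)
Lemma ideal_torsion_finite : exists xs : seq C, (forall x, x \in xs -> max_abelian K x) /\
  coordinates (ideal_torsion E theta I) `<=` [set x | x \in xs].
Proof.
have [N N0 IN] := ideal_natural iqK oO invI.1 ideal_nonzero.
have n0 : N%:R != 0 :> C by rewrite pnatr_eq0 -lt0n.
pose pt (ij : 'I_N * 'I_N) : C := (ij.1%:R + ij.2%:R * k) / N%:R.
exists (flatten [seq coords (xi (pt ij)) | ij <- enum {: 'I_N * 'I_N}]); split.
  move=> x /flattenP [s /mapP [ij _ ->]]; apply: torsion_coords.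
  have Kk : nf_set K k by exact: lLa.1.
  have Kn n : nf_set K n%:R by exact: (subfield_nat hK).
  apply: (subfieldM hK); last exact: (subfieldV hK).
  by apply: (subfieldD hK) => //; exact: (subfieldM hK).
move=> c [x [y [/ideal_torsionP [z [exy hz]] cxy]]] /=.
have /LaE [m [n e]] := hz _ IN.
have md (a : int) : exists i : 'I_N, exists q : int, a = (i : nat)%:Z + q * N%:Z.
  have h : (`|(a %% N%:Z)%Z| < N)%N.
    by rewrite -ltz_nat gez0_abs ?modz_ge0 ?ltz_pmod // -lt0n.
  exists (Ordinal h), (a %/ N%:Z)%Z; rewrite /= gez0_abs ?modz_ge0 -?lt0n //.
  by rewrite addrC -divz_eq.
have [i [q mE]] := md m; have [j [q' nE]] := md n.
have xz : xi z = xi (pt (i, j)).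
  have [_ h _ _] := ai; apply/h; apply/LaE; exists q, q'.
  apply: (mulfI n0); rewrite mulrBr e /pt mulrC /= [N%:R * (_ / _)]mulrC divfK //.
  rewrite mE nE !rmorphD !rmorphM /=; ring.
apply/flattenP; exists (coords (xi (pt (i, j)))).
  by apply/mapP; exists (i, j); rewrite ?mem_enum.
by rewrite -xz -exy !inE; case: cxy => ->; rewrite eqxx ?orbT.
Qed.

(** Invertibility writes 1 as a sum of a_i b_i with a_i in I and b_i in J. As I J = O, every b_i l
    with l in La is killed by I modulo La, so (t - 1) b_i maps La into La at p and lies in O_p;
    multiplying by a_i and adding gives t - 1 in I O_p. *)
Lemma trivial_action_ray_unit t : idele_lattice t La La ->
  (forall (z : C) (p : rprime), (forall a, I a -> La (a * z)) ->
     eventually_in (locp (val p) La) ((t (Fin p) - 1) * emb K (Fin p) z)) ->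
  ray_units O I t.
Proof.
move=> lt ht; have [iI [J [JK _ JM IJ]]] := invI; have nI := ideal_nonzero.
have [IO I0 IB IM] := iI; have Kk : nf_set K k by exact: lLa.1.
have : ideal_mul I J 1 by rewrite IJ.
move=> [n [a [b [ha hb e1]]]].
apply/(ray_unitsP iqK oO iI nI) => p; have oL := lattice_open iqK p lLa.
have oOp := lattice_open iqK p lO.
have uI : eventually_in (locp (val p) I) (t (Fin p) - 1).
  have key i : eventually_in [set y | locp (val p) O (y * b i)] (t (Fin p) - 1).
    have Kb := JK _ (hb i).
    have kl l : La l -> exists N, forall m, (N <= m)%N -> locp (val p) La ((b i * l) * rep (t (Fin p) - 1) m).
      move=> Ll; apply/(eventually_embM oL _ (subfieldM hK Kb (lLa.1 _ Ll))); rewrite mulrC.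
      apply: ht => c Ic; rewrite mulrA; apply: stab => //; rewrite -IJ; exact: mul_ideal_mul.
    have [N1 h1] := kl _ La1; have [N2 h2] := kl _ Lak; exists (maxn N1 N2) => m.
    rewrite geq_max => /andP[m1 m2]; apply: multiplier_local.
      by have := h1 m m1; congr (locp _ _ _); ring.
    by have := h2 m m2; congr (locp _ _ _); ring.
  have [N hN] := eventuallyI key; exists N => m Nm.
  have h := hN m Nm; set y := rep _ m in h *.
  have -> : y = \sum_i (y * b i) * a i.
    by rewrite -{1}[y]mulr1 e1 mulr_sumr; apply: eq_bigr => i _; ring.
  apply: (subgroup_sum (locp_subgroup (ideal_subgroup iI) p)) => i.
  by apply: (locp_ideal iI (h i)); exact: (locpW (S := I)).
have IOp : locp (val p) I `<=` locp (val p) O.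
  by move=> x [m [pm Im]]; exists m; split=> //; exact: IO.
split=> //.
  have -> : t (Fin p) = (t (Fin p) - 1) + emb K (Fin p) 1 by rewrite emb1 subrK.
  apply: (eventuallyD oOp); first exact: eventuallyW uI.
  exact: (eventually_lattice iqK lO).
(* The inverse of t preserves La at p as well, hence it is a local multiplier. *)
have kl l : La l -> exists N, forall m, (N <= m)%N -> locp (val p) La (l * rep (iinv t (Fin p)) m).
  move=> Ll; apply/(eventually_embM oL _ (lLa.1 _ Ll)); rewrite mulrC.
  by apply: (stable_localV iqK lLa lt); exact: eventually_lattice.
have [N1 h1] := kl _ La1; have [N2 h2] := kl _ Lak; exists (maxn N1 N2) => m.
rewrite geq_max => /andP[m1 m2]; apply: multiplier_local.
  by have := h1 m m1; congr (locp _ _ _); ring.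
by have := h2 m m2; congr (locp _ _ _); ring.
Qed.

Lemma map_point_fix (s : C -> C) P : (forall x, x \in coords P -> s x = x) -> map_point s P = P.
Proof. by case: P => [|x y] //= h; rewrite !h ?inE ?eqxx ?orbT. Qed.

Lemma ray_class_field_sub : ray_class_field art O I `<=` adjoin F (coordinates (ideal_torsion E theta I)).
Proof.
move=> x [mx hx]; apply: contrapT => nx.
have [xs [mxs cxs]] := ideal_torsion_finite.
have [L [abL FL xsL]] : exists L, [/\ abelian_ext K L, F `<=` L & forall y, y \in x :: xs -> nf_set L y].
  apply: abelian_over; first exact: base_abelian.
  by move=> y; rewrite inE => /orP[/eqP->//|]; exact: mxs.
set M := adjoin F _ in nx; have hM : is_subfield M by exact: adjoin_subfield.
have ML : M `<=` L.
  move=> y; apply => //; first exact: (nf_subfield L).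
  by move=> c /cxs /= cx; apply: xsL; rewrite inE cx orbT.
have Lx : nf_set L x by apply: xsL; rewrite mem_head.
have [g [eg gM gx]] := separating_embedding hM ML Lx nx.
have FM : F `<=` M by exact: adjoin_base.
have gg : gal L K g by apply: abelian_gal => // y Ky; exact: gM (FM _ (KF Ky)).
have [s hs] := artin_surjective hart abL gg.
have abF : abelian_ext K F by exact: abelian_subext abL.
have fF y : nf_set F y -> art s y = y by move=> Fy; rewrite hs; [exact: gM (FM _ Fy) | exact: FL].
(* F is abelian over K as a subextension of L, so fixing F puts s in the norm group, and hypothesis
   (ii) applies. *)
have ns : norm_group K F s by apply/(artin_kernel hart s abF).
have [lt ht] := main_thm lLa ai ns; set t := ideleM _ _ in lt ht.
have rt : ray_units O I t.
  apply: trivial_action_ray_unit => // z p hz; have Kz := ideal_torsion_field hz.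
  apply: (action_local iqK lLa p lt Kz) => n z' Kz' hz'.
  have Knz : nf_set K (n%:R * z) by apply: (subfieldM hK) => //; exact: (subfield_nat hK).
  have e := ht _ (artin_gal_over hart fF) (fun _ _ => erefl) _ _ Knz Kz' hz'.
  have [_ h _ _] := ai; apply/h; rewrite e; apply: map_point_fix => c cz.
  have Mc : M c.
    apply: adjoin_gen; move: cz; case E1 : (xi (n%:R * z)) => [|u v] //= cz.
    exists u, v; split; last by move: cz; rewrite !inE => /orP[/eqP->|/eqP->]; [left | right].
    apply/ideal_torsionP; exists (n%:R * z); split=> // a Ia.
    by rewrite mulrCA; apply: subgroup_nat => //; exact: hz.
  by rewrite hs; [exact: gM | exact: ML].
(* s t is the principal idele of alpha(s), so its Artin symbol is trivial: s can move x only if t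
   does. *)
have := hx _ rt; have st : ideleM s t = principal K (alpha s).
  by apply: idele_ext => v; rewrite !ideleME ideleVE mulrCA icompK mulr1.
have := artin_mul hart s t mx; rewrite st (artin_principal hart (alphaK s).1 (alphaK s).2 mx).
by move=> e1 e2; apply: gx; rewrite -hs // -{1}e2 -e1.
Qed.

Lemma ray_units_mul (u v : idele K) : ray_units O I u -> ray_units O I v -> ray_units O I (ideleM u v).
Proof.
have [iI _] := invI; have nI := ideal_nonzero; have [_ _ OM] := oO.
move=> /(ray_unitsP iqK oO iI nI) hu /(ray_unitsP iqK oO iI nI) hv.
apply/(ray_unitsP iqK oO iI nI) => p; have [u1 u2 u3] := hu p; have [v1 v2 v3] := hv p.
have oOp := lattice_open iqK p lO; have oI := ideal_open iqK oO p iI nI.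
have OOp x y : locp (val p) O x -> locp (val p) O y -> locp (val p) O (x * y).
  move=> [m [pm Om]] [n [pn On]]; exists (m * n)%N; split; first exact: ndvdM.
  by rewrite natrM mulrACA; exact: OM.
split; [exact: (eventuallyM oOp u1 v1 OOp) | exact: (eventuallyM oOp u2 v2 OOp) |].
have -> : ideleM u v (Fin p) - 1 = u (Fin p) * (v (Fin p) - 1) + (u (Fin p) - 1).
  by rewrite ideleME; ring.
by apply: (eventuallyD oI) => //; apply: (eventuallyM oI u1 v3) => x y; exact: locp_ideal.
Qed.

Lemma ray_units_one : ray_units O I (idele_one K).
Proof.
have [iI _] := invI; have nI := ideal_nonzero.
apply/(ray_unitsP iqK oO iI nI) => p.
have i1 : iinv (idele_one K) (Fin p) = 1 by rewrite -[LHS]mul1r -{1}(idele_oneE K (Fin p)) icompK.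
rewrite i1 idele_oneE subrr -emb1; split; try exact: (eventually_lattice iqK lO).
exact: (eventually0 (ideal_open iqK oO p iI nI)).
Qed.

Lemma alpha_one : alpha (idele_one K) = 1.
Proof. exact: (alpha1 alphaK alphaM). Qed.

(* The components of [principal K 1] are not accessible, but hypothesis (ii) for s = 1
   shows that it acts trivially on K / La. *)
Lemma ray_unit_action (u : idele K) (z : C) (p : rprime) : ray_units O I u -> norm_group K F u ->
  (forall a, I a -> La (a * z)) ->
  eventually_in (locp (val p) La)
    (emb K (Fin p) z - ideleM (principal K (alpha u)) (ideleV u) (Fin p) * emb K (Fin p) z).
Proof.
move=> ru nu hz; have [iI _] := invI; have nI := ideal_nonzero; have Kz := ideal_torsion_field hz.
have If' : I `<=` f by move=> a /If [].
have -> : alpha u = 1 by exact: (alpha_ray_units iqK alphaK alphaM hphi oO iI nI cf If' ru).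
have [L0 [abL0 FL0 _]] : exists L, [/\ abelian_ext K L, F `<=` L & forall y, y \in [::] -> nf_set L y].
  by apply: abelian_over => // x; exact: base_abelian.
have abF : abelian_ext K F by exact: abelian_subext abL0.
have f1 x : nf_set F x -> art (idele_one K) x = x by move=> Fx; apply: (artin_one hart); exact: base_abelian.
have n1 : norm_group K F (idele_one K) by apply/(artin_kernel hart _ abF).
have [lt ht] := main_thm lLa ai n1; rewrite alpha_one in lt ht; set t := ideleM _ _ in lt ht.
have t1 : eventually_in (locp (val p) La) ((t (Fin p) - 1) * emb K (Fin p) z).
  apply: (action_local iqK lLa p lt Kz) => n z' Kz' hz'.
  have Knz : nf_set K (n%:R * z) by apply: (subfieldM hK) => //; exact: (subfield_nat hK).
  have e := ht _ (artin_gal_over hart f1) (fun _ _ => erefl) _ _ Knz Kz' hz'.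
  have [_ h _ _] := ai; apply/h; rewrite e; apply: map_point_fix => c cz.
  by apply: (artin_one hart); exact: torsion_coords cz.
have [uO uO' uI] := (ray_unitsP iqK oO iI nI u).1 ru p; have oL := lattice_open iqK p lLa.
have h : eventually_in (locp (val p) La) (iinv u (Fin p) * ((u (Fin p) - 1) * emb K (Fin p) z)).
  apply: (eventuallyM oL uO' _ (B := locp (val p) La)); last first.
    move=> x y [m [pm Om]] [n [pn Ln]]; exists (m * n)%N; split; first exact: ndvdM.
    by rewrite natrM mulrACA; exact: stab.
  rewrite mulrC; apply/(eventually_embM oL _ Kz); have [N hN] := uI; exists N => n Nn.
  have [m [pm Im]] := hN n Nn; exists m; split=> //; rewrite mulrCA mulrC; exact: hz.
have P1 : principal K 1 (Fin p) = t (Fin p).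
  have i1 : iinv (idele_one K) (Fin p) = 1 by rewrite -[LHS]mul1r -{1}(idele_oneE K (Fin p)) icompK.
  by rewrite /t ideleME ideleVE i1 mulr1.
(* z - t u^-1 z = t u^-1 (u - 1) z - (t - 1) z, where t has the p-component of [principal K 1] and
   both terms lie in La at p. *)
have -> : emb K (Fin p) z - ideleM (principal K 1) (ideleV u) (Fin p) * emb K (Fin p) z =
   t (Fin p) * (iinv u (Fin p) * ((u (Fin p) - 1) * emb K (Fin p) z)) - (t (Fin p) - 1) * emb K (Fin p) z.
  have uu := icompK u (Fin p); rewrite ideleME ideleVE P1.
  transitivity (t (Fin p) * (u (Fin p) * iinv u (Fin p)) * emb K (Fin p) z
     - t (Fin p) * iinv u (Fin p) * emb K (Fin p) z - (t (Fin p) - 1) * emb K (Fin p) z); last by ring.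
  by rewrite uu; ring.
by apply: (eventuallyB oL) => //; exact: (stable_local iqK lLa lt).
Qed.

(** If g fixes L intersected with F H_I and moves y, an idele u of U_I with the same effect on L is
    needed. The Artin symbols of U_I permute the orbit of a primitive element w of L; its polynomial
    has coefficients in H_I, fixed by g, so g w is again in the orbit and g = [u, K] on L. As [u, K]
    fixes F, u lies in the norm group, and it acts trivially on E[I]. *)
Lemma coordinates_sub : coordinates (ideal_torsion E theta I) `<=` adjoin F (ray_class_field art O I).
Proof.
move=> y [a [b [/ideal_torsionP [z [exy hz]] yab]]]; apply: contrapT => ny.
have Kz := ideal_torsion_field hz.
have yc : y \in coords (xi z) by rewrite -exy !inE; case: yab => ->; rewrite eqxx ?orbT.
have my : max_abelian K y by exact: torsion_coords yc.
have [L [abL FL yL]] : exists L, [/\ abelian_ext K L, F `<=` L & forall x, x \in [:: y] -> nf_set L x].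
  by apply: abelian_over => [|x]; [exact: base_abelian | rewrite inE => /eqP ->].
have Ly := yL y (mem_head _ _); set A := adjoin F _ in ny.
have hM : is_subfield (A `&` L) by apply: subfieldI; [exact: adjoin_subfield | exact: (nf_subfield L)].
have [|g [eg gM gy]] := separating_embedding hM (@subIsetr _ A L) Ly; first by case.
have FM x : nf_set F x -> (A `&` L) x by move=> Fx; split; [exact: adjoin_base | exact: FL].
have [w Lw pw] := primitive_element L.
pose Gam := [set s : C -> C | exists2 u, ray_units O I u & s = art u].
have LM x : nf_set L x -> max_abelian K x by exists L.
have [|||P [Pw PL PG Pr]] := @orbit_poly C L Gam w Lw.
- by move=> _ [u ru ->]; exact: artin_embedding.
- exists (art (idele_one K)); first by exists (idele_one K) => //; exact: ray_units_one.
  by apply: (artin_one hart); exact: LM.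
- move=> _ _ [u ru ->] [v rv ->]; exists (art (ideleM u v)).
    by exists (ideleM u v) => //; exact: ray_units_mul.
  by apply: (artin_mul hart); exact: LM.
have gP i : nf_set L P`_i /\ g P`_i = P`_i.
  split=> //; apply: gM; split=> //; apply: adjoin_gen; split; first exact: LM.
  by move=> s rs; apply: PG; exists s.
have gw : P.[g w] = 0 by rewrite -(embedding_fixed_horner eg gP Lw) Pw (embedding0 eg).
have [_ [u ru ->] uw] := Pr _ gw.
have [eu _] := artin_embedding hart u abL.
have ug x : nf_set L x -> art u x = g x.
  by move=> /pw [q ->]; rewrite (embedding_ratp q eu Lw) (embedding_ratp q eg Lw) uw.
have abF : abelian_ext K F by exact: abelian_subext abL.
have uF x : nf_set F x -> art u x = x.
  by move=> Fx; rewrite ug; [exact: gM (FM _ Fx) | exact: FL].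
have nu : norm_group K F u by apply/(artin_kernel hart u abF).
have [lt ht] := main_thm lLa ai nu.
have pt : idele_point (ideleM (principal K (alpha u)) (ideleV u)) La z z.
  by apply/(idele_pointP iqK lLa _ _ lt) => p; exact: ray_unit_action.
have := ht _ (artin_gal_over hart uF) (fun _ _ => erefl) _ _ Kz Kz pt.
rewrite -exy /= => -[ea eb]; apply: gy; rewrite -ug //.
by case: yab => ->.
Qed.

Lemma main_equality :
  adjoin F (coordinates (ideal_torsion E theta I)) = adjoin F (ray_class_field art O I).
Proof.
by apply/seteqP; split; apply: adjoin_sub; [exact: coordinates_sub | exact: ray_class_field_sub].
Qed.

End Main.

Theorem theorem5p5 (R : realType) (K F : numField R[i]) (O : set R[i])
    (E : weierstrass R[i]) (theta : R[i] -> ecpoint R[i] -> ecpoint R[i])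
    (art : idele K -> R[i] -> R[i]) (alpha : idele K -> R[i]) (f : set R[i]) :
  imag_quadratic K ->
  K `<=` F ->
  is_order K O ->
  elliptic_curve_over F E ->
  ring_iso_End F E O theta ->
  normalised E O theta ->
  is_artin_map art ->
  adjoin F (coordinates (torsion E)) `<=` max_abelian K ->
  (forall s, nf_set K (alpha s) /\ alpha s != 0) ->
  (forall s t, alpha (ideleM s t) = alpha s * alpha t) ->
  is_hecke_char (fun s : idele K => alpha s / arch_comp s) ->
  (forall (La : set R[i]) (xi : R[i] -> ecpoint R[i]) (s : idele K),
     is_lattice K La -> analytic_iso E La xi -> norm_group K F s ->
     let t := ideleM (principal K (alpha s)) (ideleV s) in
     idele_lattice t La La /\
     forall tau : R[i] -> R[i],
       gal (max_abelian K) F tau ->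
       (forall x, max_abelian K x -> tau x = art s x) ->
       forall z z', nf_set K z -> nf_set K z' -> idele_point t La z z' ->
         xi z' = map_point tau (xi z)) ->
  is_conductor (fun s : idele K => alpha s / arch_comp s) f ->
  forall I : set R[i], invertible_ideal K O I -> I `<=` f `&` O ->
    adjoin F (coordinates (ideal_torsion E theta I)) =
    adjoin F (ray_class_field art O I).
Proof.
move=> iqK KF oO eE iso [La0 [xi0 [cl ai0 norm0]]] hart tors aK aM hphi mt cf I invI If.
(* theta a is a map on points, so multiplication by a preserves the kernel La0 of xi0. *)
have stab0 a l : O a -> La0 l -> La0 (a * l).
  move=> Oa Ll; have [_ ker _ _] := ai0.
  have e : xi0 l = xi0 0 by apply/ker; rewrite subr0.
  by have := congr1 (theta a) e; rewrite !norm0 // => /ker; rewrite mulr0 subr0.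
(* Rescaling by a period b puts the lattice into K and makes 1 a period. *)
have [b [k [b0 lLa Lb LaE]]] := period_lattice iqK oO cl stab0.
apply: (main_equality iqK KF oO eE iso hart tors aK aM hphi mt cf invI If lLa (analytic_iso_scale b0 ai0)
  (k := k)) => //=.
- by rewrite mulr1.
- by move=> a l Oa; rewrite mulrCA; exact: stab0.
- by move=> a z Oa; rewrite norm0 // mulrCA.
Qed.
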